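(* In the flat mid-surface setting of the context, let $(f_w)$ be a sequence of rescaled isometric immersions in $W^{2,2}(S;\mathbb R^3)$ such that $\tilde{\mathcal E}_w(f_w)\to0$ as $w\to0$. Then $\det\mathrm{II}^0\equiv0$ and, modulo a subsequence and translations, $$f_w\to f\ \text{strongly in }W^{2,2},\qquad\nabla_wf_w\to(d_1,d_2)\ \text{strongly in }W^{1,2},\qquad\mathrm{II}^w_{f_w}\to\mathrm{II}^0\ \text{strongly in }L^2,$$ where $f\in W^{2,2}((0,L);\mathbb R^3)$ and $d=(d_1,d_2,d_3)\in L^2((0,L);\mathrm{SO}(3))$ with $d_1=f'$ and $d_1'\cdot d_2=\kappa$.
   Context: **Flat mid-surface data.** $L>0$; $\kappa:[0,L]\to\mathbb R$ is smooth; $\mathrm{II}$ is a smooth field of symmetric $2\times2$ matrices on $[0,L]\times[-w_0/2,w_0/2]$ for some small $w_0>0$ (reference second fundamental form), and the reference metric of the mid-surface is the flat metric $\mathfrak a(z_1,z_2)=\mathrm{diag}((1-\kappa(z_1)z_2)^2,1)$. Put $\mathrm{II}^0(z_1)=\mathrm{II}(z_1,0)$. **Auxiliary immersion.** Let $(e_1,e_2,e_3)$ solve $e_1'=\kappa e_2+\mathrm{II}^0_{11}e_3$, $e_2'=-\kappa e_1+\mathrm{II}^0_{12}e_3$, $e_3'=-\mathrm{II}^0_{11}e_1-\mathrm{II}^0_{12}e_2$ on $[0,L]$ with $(e_1|e_2|e_3)(0)\in \mathrm{SO}(3)$; $\Phi(z_1,z_2)=\int_0^{z_1}e_1\,ds+z_2e_2+\frac12z_2^2\mathrm{II}^0_{22}e_3-\frac16z_2^3\mathrm{II}^0_{22}(\mathrm{II}^0_{12}e_1+\mathrm{II}^0_{22}e_2)$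 ($e_i$, $\mathrm{II}^0$ at $z_1$); $\tilde{\mathfrak n}$ is the unit normal of $\Phi$ with $\tilde{\mathfrak n}(z_1,0)=e_3(z_1)$. **Energy density.** $\mathcal W:\mathbb R^{3\times3}\to[0,\infty]$ is continuous, $\mathcal W(RA)=\mathcal W(A)$ for $R\in \mathrm{SO}(3)$, $\mathcal W(A)=0$ iff $A\in \mathrm{SO}(3)$, $\mathcal W(A)\ge c\,\mathrm{dist}^2(A,\mathrm{SO}(3))$ for some $c>0$, and $\mathcal W$ is $C^2$ near $\mathrm{SO}(3)$. $\mathcal Q_3(B)=\frac12D^2_I\mathcal W(B,B)$; thus $\mathcal Q_3(B)=\mathcal Q_3(\mathrm{sym}\,B)\ge c|\mathrm{sym}\,B|^2$. **Plate energy of width $w$.** $S=(0,L)\times(-1/2,1/2)$, $x'=(x_1,x_2)$, $\nabla_w=(\partial_1\,|\,w^{-1}\partial_2)$. For small $w>0$ set $N_w(x')=(\nabla\Phi\,|\,\tilde{\mathfrak n})|_{(x_1,wx_2)}$, $F_0(x')=N_w^{-T}\,\mathrm{diag}((1-w\kappa(x_1)x_2)^2,1,1)\,N_w^{-1}$, $A_0(x')=F_0^{1/2}N_w$, and $\mathcal Q_w(x',F)=\min\{\mathcal Q_3(A_0^{-T}(x')GA_0^{-1}(x')):G\in\mathbb R^{3\times3},\ G_{2\times2}=F\}$ for $F\in\mathbb R^{2\times2}$, $G_{2\times2}$ being the upper-left $2\times2$ block. A *rescaled isometric immersion* (for $w$) is $f\in W^{2,2}(S;\mathbb R^3)$ with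 $\nabla_wf^T\nabla_wf(x')=\mathfrak a(x_1,wx_2)$ a.e.; $\nu_f$ is its unit normal, $\mathrm{II}^w_f=-\nabla_wf^T\nabla_w\nu_f$, $\mathrm{II}^w(x')=\mathrm{II}(x_1,wx_2)$, and $$\tilde{\mathcal E}_w(f)=\frac1{12}\cdot\frac1{|S|}\int_S\mathcal Q_w(x',\mathrm{II}^w_f-\mathrm{II}^w)\,dx' .$$ Functions on $(0,L)$ are regarded as functions on $S$ independent of $x_2$. *)

(* Defs.v *)
From HB Require Import structures.
From mathcomp Require Import all_boot all_order all_algebra.
From mathcomp Require Import all_classical all_reals all_analysis.

Set Implicit Arguments.
Unset Strict Implicit.
Unset Printing Implicit Defensive.
Import Order.TTheory GRing.Theory Num.Theory.
Import numFieldNormedType.Exports.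
Local Open Scope classical_set_scope.
Local Open Scope ring_scope.

Section Smoothness.
Context {R : realType} {V W : normedModType R}.

(* For finite-dimensional V this is the usual class C^k(U). *)
Fixpoint Ck (k : nat) (U : set V) (f : V -> W) : Prop :=
  match k with
  | 0 => forall x, U x -> {for x, continuous f}
  | k'.+1 => (forall x, U x -> differentiable f x) /\
             (forall v, Ck k' U ('D_v f))
  end.

Definition smooth (U : set V) (f : V -> W) : Prop := forall k, Ck k U f.

(* On a set that is not open, smooth means having a smooth extension to an
   open neighbourhood of the set. *)
Definition smooth_on (A : set V) (f : V -> W) : Prop :=
  exists (U : set V) (g : V -> W),
    [/\ open U, A `<=` U, smooth U g & forall x, A x -> f x = g x].

End Smoothness.

Definition test_fun {R : realType} {V : normedModType R} (Om : set V)
    : set (V -> R) :=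
  [set phi | [/\ smooth setT phi,
                 compact (closure [set x | phi x != 0]) &
                 closure [set x | phi x != 0] `<=` Om]].

(* L^2-based Sobolev spaces on the set Om of the measure space (T, mu). The
   classical partial derivatives D i and the class of test functions are
   parameters, so that the definitions can be instantiated both on an interval
   of R and on a rectangle of R * R. *)
Section Sobolev.
Context {R : realType} {d : measure_display} {T : measurableType d}.
Variables (mu : {measure set T -> \bar R}) (Om : set T).
Variables (m : nat) (D : 'I_m -> (T -> R) -> T -> R) (test : set (T -> R)).
Implicit Types (u v : T -> R).

Definition in_L2 u : Prop := u \_ Om \in Lfun mu 2%:E.

Definition L2norm u : \bar R := ('N[mu]_2%:E[EFin \o (u \_ Om)])%E.

Definition is_weak_deriv (i : 'I_m) u v : Prop :=
  forall phi, test phi ->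
    \int[mu]_(x in Om) (u x * D i phi x) = - \int[mu]_(x in Om) (v x * phi x).

(* The L^2 weak derivative of u, which is unique up to a null set (and is the
   constant 0 if u has none). *)
Definition weak_deriv (i : 'I_m) u : T -> R :=
  xget (fun=> 0) [set v | in_L2 v /\ is_weak_deriv i u v].

(* W^{k,2}(Om) *)
Fixpoint sobolev (k : nat) u : Prop :=
  in_L2 u /\
  match k with
  | 0 => True
  | k'.+1 => forall i, exists v, is_weak_deriv i u v /\ sobolev k' v
  end.

(* The sum of the L^2 norms of all iterated weak derivatives of order at most
   k, which is equivalent to the usual norm of W^{k,2}(Om). *)
Fixpoint sobolev_norm (k : nat) u : \bar R :=
  (L2norm u +
   match k with
   | 0 => 0
   | k'.+1 => \sum_(i < m) sobolev_norm k' (weak_deriv i u)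
   end)%E.

Definition sobolev_cvg (k : nat) (u_ : nat -> T -> R) u : Prop :=
  [/\ forall n, sobolev k (u_ n), sobolev k u &
      (fun n => sobolev_norm k (u_ n \- u)) @ \oo --> 0%E].

End Sobolev.

Section SobolevInterval.
Context {R : realType}.
Variable L : R.

Definition open_itv_D (i : 'I_1) (u : measurableTypeR R -> R)
    : measurableTypeR R -> R := fun t => 'D_(1 : R) (u : R -> R) t.

Definition open_itv : set (measurableTypeR R) := `]0, L[.

Definition sobolev1 (k : nat) (f : R -> 'cV[R]_3) : Prop :=
  forall j, sobolev lebesgue_measure open_itv open_itv_D
    (test_fun (`]0, L[ : set R)) k (fun t => f t j 0).

Definition weak_deriv1 (f : R -> 'cV[R]_3) (t : R) : 'cV[R]_3 :=
  \col_j weak_deriv lebesgue_measure open_itv open_itv_D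
    (test_fun (`]0, L[ : set R)) 0 (fun s => f s j 0) t.

End SobolevInterval.

Section SobolevStrip.
Context {R : realType}.
Variable L : R.

Definition lebesgue2 := (@lebesgue_measure R \x @lebesgue_measure R)%E.

Definition strip : set (R * R) := `]0, L[ `*` `]- 2^-1, 2^-1[.

Definition dir (i : 'I_2) : R * R := if i == 0 then (1, 0) else (0, 1).

Definition strip_D (i : 'I_2) (u : measurableTypeR R * measurableTypeR R -> R)
    : measurableTypeR R * measurableTypeR R -> R :=
  fun x => 'D_(dir i) (u : R * R -> R) x.

Definition weak_partial_scal (i : 'I_2) (u : R * R -> R) : R * R -> R :=
  weak_deriv lebesgue2 strip strip_D (test_fun strip) i u.

Definition weak_partial (i : 'I_2) (f : R * R -> 'cV[R]_3) (x : R * R)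
    : 'cV[R]_3 :=
  \col_j weak_partial_scal i (fun y => f y j 0) x.

Definition sobolev2 (k p q : nat) (f : R * R -> 'M[R]_(p, q)) : Prop :=
  forall i j, sobolev lebesgue2 strip strip_D (test_fun strip) k
    (fun x => f x i j).

(* Strong convergence in W^{k,2}(S) of matrix-valued maps; k = 0 is L^2(S). *)
Definition sobolev2_cvg (k p q : nat) (f_ : nat -> R * R -> 'M[R]_(p, q))
    (f : R * R -> 'M[R]_(p, q)) : Prop :=
  forall i j, sobolev_cvg lebesgue2 strip strip_D (test_fun strip) k
    (fun n x => f_ n x i j) (fun x => f x i j).

End SobolevStrip.

Section LinearAlgebra.
Context {R : realType}.

Definition dot (u v : 'cV[R]_3) : R := (u^T *m v) 0 0.

(* Frobenius norm, that is the Euclidean norm on columns; the library's norm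
   on matrices is the sup norm. *)
Definition frob (p q : nat) (A : 'M[R]_(p, q)) : R :=
  Num.sqrt (\tr (A^T *m A)).

(* Index arithmetic is modulo 3. *)
Definition cross (u v : 'cV[R]_3) : 'cV[R]_3 :=
  \col_(i < 3) (u (i + 1) 0 * v (i + 2) 0 - u (i + 2) 0 * v (i + 1) 0).

Definition unit_normal (u v : 'cV[R]_3) : 'cV[R]_3 :=
  (frob (cross u v))^-1 *: cross u v.

Definition mx3 (a b c : 'cV[R]_3) : 'M[R]_3 := row_mx a (row_mx b c).

Definition SO3 : set 'M[R]_3 := [set A | A^T *m A = 1%:M /\ \det A = 1].

Definition dist_SO3 (A : 'M[R]_3) : R := inf [set frob (A - Q) | Q in SO3].

(* The symmetric positive semidefinite square root, which is unique. *)
Definition sqrtmx (F : 'M[R]_3) : 'M[R]_3 :=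
  xget 0 [set B | [/\ B^T = B, forall v : 'cV[R]_3, 0 <= dot v (B *m v) &
                      B *m B = F]].

End LinearAlgebra.

Section EnergyDensity.
Context {R : realType}.
Variable W : 'M[R]_3 -> \bar R.

Record energy_density : Prop := EnergyDensity {
  density_ge0 : forall A, (0 <= W A)%E ;
  density_continuous : continuous W ;
  density_frame : forall Q A, SO3 Q -> W (Q *m A) = W A ;
  density_eq0 : forall A, W A = 0%E <-> SO3 A ;
  density_coercive : exists2 c : R, 0 < c &
    forall A, ((c * dist_SO3 A ^+ 2)%:E <= W A)%E ;
  density_C2 : exists U : set 'M[R]_3,
    [/\ open U, SO3 `<=` U, forall A, U A -> W A \is a fin_num &
        Ck 2 U (fine \o W)]
}.

Definition Q3 (B : 'M[R]_3) : R :=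
  2^-1 * 'D_B ('D_B (fine \o W : 'M[R]_3 -> R)) 1%:M.

End EnergyDensity.

Section PlateEnergy.
Context {R : realType}.
Variables (L : R) (kappa : R -> R) (II : R * R -> 'M[R]_2).
Variables (e1 e2 e3 : R -> 'cV[R]_3) (W : 'M[R]_3 -> \bar R).

Definition II_mid (t : R) : 'M[R]_2 := II (t, 0).

(* Indices start at 0: II_mid t 0 1 is the entry II^0_{12}. *)
Definition frame : Prop :=
  [/\ SO3 (mx3 (e1 0) (e2 0) (e3 0)),
      [/\ {within `[0, L], continuous e1}, {within `[0, L], continuous e2} &
          {within `[0, L], continuous e3}] &
      forall t : R, 0 < t < L ->
      [/\ is_derive t 1 e1 (kappa t *: e2 t + II_mid t 0 0 *: e3 t),
          is_derive t 1 e2 (- kappa t *: e1 t + II_mid t 0 1 *: e3 t) &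
          is_derive t 1 e3 (- II_mid t 0 0 *: e1 t - II_mid t 0 1 *: e2 t)]].

Definition Phi (z : R * R) : 'cV[R]_3 :=
  let A := II_mid z.1 in
  (\col_i \int[lebesgue_measure]_(s in `[0, z.1]) e1 s i 0)
  + z.2 *: e2 z.1
  + (2^-1 * z.2 ^+ 2 * A 1 1) *: e3 z.1
  - (6^-1 * z.2 ^+ 3 * A 1 1) *: (A 0 1 *: e1 z.1 + A 1 1 *: e2 z.1).

(* On z.2 = 0 the partial derivatives of Phi are e1 and e2, so this is the unit
   normal which equals e3 there. *)
Definition Phi_normal (z : R * R) : 'cV[R]_3 :=
  unit_normal ('D_(dir 0) Phi z) ('D_(dir 1) Phi z).

Definition metric (z : R * R) : 'M[R]_2 :=
  diag_mx (\row_j if j == 0 then (1 - kappa z.1 * z.2) ^+ 2 else 1).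

Definition metric3 (z : R * R) : 'M[R]_3 :=
  diag_mx (\row_j if j == 0 then (1 - kappa z.1 * z.2) ^+ 2 else 1).

Section Width.
Variable w : R.

Definition rescale (x : R * R) : R * R := (x.1, w * x.2).

Definition N_w (x : R * R) : 'M[R]_3 :=
  let z := rescale x in
  mx3 ('D_(dir 0) Phi z) ('D_(dir 1) Phi z) (Phi_normal z).

Definition F_0 (x : R * R) : 'M[R]_3 :=
  (invmx (N_w x))^T *m metric3 (rescale x) *m invmx (N_w x).

Definition A_0 (x : R * R) : 'M[R]_3 := sqrtmx (F_0 x) *m N_w x.

(* The infimum is a minimum, since Q3 is a nonnegative quadratic form. *)
Definition Q_w (x : R * R) (F : 'M[R]_2) : R :=
  inf [set Q3 W ((invmx (A_0 x))^T *m G *m invmx (A_0 x)) |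
       G in [set G : 'M[R]_(2 + 1) | ulsubmx G = F]].

Definition grad_w (f : R * R -> 'cV[R]_3) (x : R * R) : 'M[R]_(3, 2) :=
  row_mx (weak_partial L 0 f x) (w^-1 *: weak_partial L 1 f x).

Definition isometric_immersion (f : R * R -> 'cV[R]_3) : Prop :=
  sobolev2 L 2 f /\
  {ae lebesgue2, forall x, strip L x ->
     (grad_w f x)^T *m grad_w f x = metric (rescale x)}.

Definition normal_w (f : R * R -> 'cV[R]_3) (x : R * R) : 'cV[R]_3 :=
  unit_normal (col 0 (grad_w f x)) (col 1 (grad_w f x)).

Definition II_w (f : R * R -> 'cV[R]_3) (x : R * R) : 'M[R]_2 :=
  - ((grad_w f x)^T *m grad_w (normal_w f) x).

Definition energy_w (f : R * R -> 'cV[R]_3) : \bar R :=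
  ((12^-1 * (fine (lebesgue2 (strip L)))^-1)%:E *
   \int[lebesgue2]_(x in strip L) (Q_w x (II_w f x - II (rescale x)))%:E)%E.

End Width.
End PlateEnergy.

(* Main.v *)
Require Import Defs.
From HB Require Import structures.
From mathcomp Require Import all_boot all_order all_algebra.
From mathcomp Require Import all_classical all_reals all_analysis.
From mathcomp Require Import measurable_realfun.
From mathcomp Require Import ring lra.

Set Implicit Arguments.
Unset Strict Implicit.
Unset Printing Implicit Defensive.
Import Order.TTheory GRing.Theory Num.Theory.
Import numFieldNormedType.Exports.
Local Open Scope classical_set_scope.
Local Open Scope ring_scope.

(** The tangent vectors of a rescaled isometric immersion, normalized, together with
    its normal form a moving frame [A_w = (a, c, n)] in [SO(3)], and the structure
    equations read [d_1 A_w = A_w Om(kappa, lambda^-1 H_11, H_21)],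
    [d_2 A_w = O(w H)] with [H = II^w_f].  Coercivity of [Q_w] turns the
    vanishing of the energy into [H -> II^0] in [L^2].  With [E = (e1, e2, e3)] the
    limit frame, the gradient of the rotation [A_w E^T] therefore tends to [0], and by
    the Poincare inequality [A_w E^T] converges, along a subsequence, to a constant
    [C] in [SO(3)]; so [A_w -> C E], and the structure equations upgrade this to
    convergence of all derivatives.

    For [det II^0 = 0], let [a^, c^] be the averages of [a, c] in [x_2].  By the
    Poincare inequality on vertical segments, [(a - a^) / w -> x_2 II^0_12 d_3] and
    [(c - c^) / w -> x_2 II^0_22 d_3].  Integrating [c^ . (a - a^) / w] against
    [x_2 eta'(x_1)], integrating by parts and using that [c . d_1 a = kappa] does not
    depend on [f], one gets in the limit
    [int x_2^2 eta (II^0_12 ^2 - II^0_11 II^0_22) = 0]. *)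

(** * Square-integrable functions *)

(** No weak compactness enters: the gradient of [A_w E^T] is small in norm, so only its nine bounded
    means have to converge, and Bolzano-Weierstrass suffices. The constant [C] is unavoidable,
    because the energy sees second fundamental forms but not the position of the surface. Products
    of weak derivatives occur everywhere. They are handled by functions that are absolutely
    continuous on almost every line, where the product rule is one-dimensional; a countable family
    of test functions links this notion to distributional derivatives. [Q_w] conjugates [Q3] by
    [A_0]. The point is that [A_0^T A_0 = diag(lambda^2, 1, 1)], so [A_0] is bounded whatever [Phi]
    is, as soon as [Phi] is an immersion, which holds for thin strips. Coercivity bounds only the
    symmetric part of [H - II]; the symmetry of [H] and of [II] supplies the rest. In the
    determinant argument the weight [x_2] kills each term that depends on [x_1] alone, even with the
    factor [1/w] in front, while the quotients that remain converge strongly, so that their products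
    pass to the limit. *)

Lemma aeS d (T : measurableType d) (R : realType) (m : {measure set T -> \bar R})
    (P Q : T -> Prop) : (forall x, P x -> Q x) ->
  {ae m, forall x, P x} -> {ae m, forall x, Q x}.
Proof. exact: filterS. Qed.

Lemma aeS2 d (T : measurableType d) (R : realType) (m : {measure set T -> \bar R})
    (P P' Q : T -> Prop) : (forall x, P x -> P' x -> Q x) ->
  {ae m, forall x, P x} -> {ae m, forall x, P' x} -> {ae m, forall x, Q x}.
Proof. exact: filterS2. Qed.

Lemma aeS3 d (T : measurableType d) (R : realType) (m : {measure set T -> \bar R})
    (P P' P'' Q : T -> Prop) : (forall x, P x -> P' x -> P'' x -> Q x) ->
  {ae m, forall x, P x} -> {ae m, forall x, P' x} -> {ae m, forall x, P'' x} ->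
  {ae m, forall x, Q x}.
Proof. exact: filterS3. Qed.

Lemma aeW d (T : measurableType d) (R : realType) (m : {measure set T -> \bar R})
    (P : T -> Prop) : (forall x, P x) -> {ae m, forall x, P x}.
Proof. exact: nearW. Qed.

Section L2.
Context d (T : measurableType d) (R : realType) (mu : {measure set T -> \bar R}).
Variable D : set T.
Hypothesis mD : measurable D.
Implicit Types u v : T -> R.

(** Nothing is required outside [D], and no quotient by null sets is taken; [in_L2E] identifies this
    with membership of the zero extension in [Lfun]. *)
Definition L2 u : Prop :=
  measurable_fun D u /\ mu.-integrable D (EFin \o (fun x => u x ^+ 2)).

Definition ip u v : R := \int[mu]_(x in D) (u x * v x).

Definition aebd (K : R) u : Prop := {ae mu, forall x, D x -> `|u x| <= K}.

Lemma aebdM K K' u v : aebd K u -> aebd K' v -> aebd (K * K') (fun x => u x * v x).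
Proof. by move=> hu hv; apply: aeS2 hu hv => x h1 h2 Dx; rewrite normrM ler_pM// ?h1 ?h2. Qed.

Lemma aebdD K K' u v : aebd K u -> aebd K' v -> aebd (K + K') (fun x => u x + v x).
Proof. by move=> hu hv; apply: aeS2 hu hv => x h1 h2 Dx; rewrite (le_trans (ler_normD _ _))// lerD ?h1 ?h2. Qed.

Lemma L2_meas u : L2 u -> measurable_fun D u. Proof. by case. Qed.

Lemma integrable_dom u v : measurable_fun D u ->
  mu.-integrable D (EFin \o v) -> (forall x, D x -> `|u x| <= v x) ->
  mu.-integrable D (EFin \o u).
Proof.
move=> mu_ iv uv; apply: le_integrable iv => //; first exact/measurable_EFinP.
move=> x Dx /=; rewrite lee_fin (le_trans (uv _ Dx))// ler_norm //.
Qed.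

Lemma integrable_ae_dom u v : measurable_fun D u ->
  mu.-integrable D (EFin \o v) ->
  {ae mu, forall x, D x -> `|u x| <= v x} ->
  mu.-integrable D (EFin \o u).
Proof.
move=> mu_ iv uv.
apply/integrableP; split; first exact/measurable_EFinP.
have /integrableP[mv vlt] := iv.
apply: le_lt_trans vlt; apply: ae_ge0_le_integral => //.
- exact/measurableT_comp/measurable_EFinP.
- exact/measurableT_comp.
- apply: aeS uv => x /[apply] h /=; rewrite lee_fin.
  by rewrite (le_trans h)// ler_norm.
Qed.

Lemma L2M_integrable u v : L2 u -> L2 v ->
  mu.-integrable D (EFin \o (fun x => u x * v x)).
Proof.
move=> [mu_ iu] [mv iv].
apply: (@integrable_dom _ (fun x => u x ^+ 2 + v x ^+ 2)).
- exact: measurable_funM.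
- by have := integrableD mD iu iv; exact: eq_integrable.
- move=> x _; rewrite ler_norml; apply/andP; split; nra.
Qed.

Lemma L2_ae_le K u v : measurable_fun D u -> L2 v ->
  {ae mu, forall x, D x -> `|u x| <= K * `|v x| } -> L2 u.
Proof.
move=> mu_ [mv iv] h; split => //.
apply: (@integrable_ae_dom _ (fun x => K ^+ 2 * v x ^+ 2)).
- exact: measurable_funX.
- have := @integrableZl _ _ _ mu D mD (K ^+ 2) _ iv.
  by apply: eq_integrable.
- apply: aeS h => x /[apply] h.
  rewrite normrX -[v x ^+ 2]real_normK ?num_real// -exprMn.
  by rewrite lerXn2r ?nnegrE// (le_trans _ h).
Qed.

Lemma L2Z k u : L2 u -> L2 (fun x => k * u x).
Proof.
move=> [mu_ iu]; apply: (@L2_ae_le `|k| _ u) => //.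
- by apply: measurable_funM => //; exact: measurable_cst.
- by apply: nearW => x _; rewrite normrM.
Qed.

Lemma L2D u v : L2 u -> L2 v -> L2 (fun x => u x + v x).
Proof.
move=> [mu_ iu] [mv iv]; split; first exact: measurable_funD.
apply: (@integrable_dom _ (fun x => 2 * (u x ^+ 2) + 2 * (v x ^+ 2))).
- by apply: measurable_funX; exact: measurable_funD.
- have h1 := @integrableZl _ _ _ mu D mD 2 _ iu.
  have h2 := @integrableZl _ _ _ mu D mD 2 _ iv.
  have := integrableD mD h1 h2; apply: eq_integrable => // x _.
- move=> x _; rewrite ger0_norm ?sqr_ge0//; have := sqr_ge0 (u x - v x); nra.
Qed.

Lemma L2N u : L2 u -> L2 (fun x => - u x).
Proof.
by move=> /(@L2Z (-1)); under eq_fun do rewrite mulN1r.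
Qed.

Lemma L2B u v : L2 u -> L2 v -> L2 (fun x => u x - v x).
Proof. by move=> hu /L2N; exact: L2D. Qed.

Lemma L2M_bd K u v : measurable_fun D u -> aebd K u -> L2 v ->
  L2 (fun x => u x * v x).
Proof.
move=> mu_ bu lv; apply: (@L2_ae_le K _ v) => //.
  by apply: measurable_funM => //; case: lv.
apply: aeS bu => x /[apply] h.
by rewrite normrM ler_wpM2r.
Qed.

Lemma ipC u v : ip u v = ip v u.
Proof. by rewrite /ip; under eq_Rintegral do rewrite mulrC. Qed.

Lemma ipDl u v z : L2 u -> L2 v -> L2 z ->
  ip (fun x => u x + v x) z = ip u z + ip v z.
Proof.
move=> hu hv hz; rewrite /ip.
under eq_Rintegral do rewrite mulrDl.
by rewrite RintegralD//; exact: L2M_integrable.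
Qed.

Lemma ipZl k u z : L2 u -> L2 z -> ip (fun x => k * u x) z = k * ip u z.
Proof.
move=> hu hz; rewrite /ip.
under eq_Rintegral do rewrite -mulrA.
by rewrite RintegralZl//; exact: L2M_integrable.
Qed.

Lemma ipBl u v z : L2 u -> L2 v -> L2 z ->
  ip (fun x => u x - v x) z = ip u z - ip v z.
Proof.
move=> hu hv hz; rewrite ipDl//; last exact: L2N.
by congr +%R; rewrite -mulN1r -ipZl//; congr ip; apply/funext => x; rewrite mulN1r.
Qed.

Lemma ipDr z u v : L2 u -> L2 v -> L2 z ->
  ip z (fun x => u x + v x) = ip z u + ip z v.
Proof. by move=> hu hv hz; rewrite ipC ipDl// ![ip z _]ipC. Qed.

Lemma ipZr k z u : L2 u -> L2 z -> ip z (fun x => k * u x) = k * ip z u.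
Proof. by move=> hu hz; rewrite ipC ipZl// [ip z _]ipC. Qed.

Lemma ipBr z u v : L2 u -> L2 v -> L2 z ->
  ip z (fun x => u x - v x) = ip z u - ip z v.
Proof. by move=> hu hv hz; rewrite ipC ipBl// ![ip z _]ipC. Qed.

Lemma ip_ge0 u : 0 <= ip u u.
Proof. by apply: Rintegral_ge0 => x _; rewrite -expr2 sqr_ge0. Qed.

(** The discriminant of the nonnegative polynomial [t |-> ip (u + t v) (u + t v)]. *)
Lemma cauchy_schwarz u v : L2 u -> L2 v ->
  ip u v ^+ 2 <= ip u u * ip v v.
Proof.
move=> hu hv.
have key t : 0 <= ip u u + 2 * t * ip u v + t ^+ 2 * ip v v.
  have := ip_ge0 (fun x => u x + t * v x).
  have htv := L2Z t hv.
  have huv := L2D hu htv.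
  rewrite ipDl// !ipDr// ipZl// ipZr// ipZl// ipZr// (ipC v u).
  by congr (_ <= _); ring.
have [v0|v0] := eqVneq (ip v v) 0.
  rewrite v0 mulr0.
  (* With [ip v v = 0] the polynomial is affine; at this [t] its value would be [-1] if [ip u v]
     were nonzero. *)
  have := key (- (ip u u + 1) / (2 * ip u v)).
  have [->|p0] := eqVneq (ip u v) 0; first by rewrite expr0n.
  rewrite v0 mulr0 addr0 => h; exfalso; move: h.
  suff -> : ip u u + 2 * (- (ip u u + 1) / (2 * ip u v)) * ip u v = -1 by lra.
  by field.
have vgt : 0 < ip v v by rewrite lt_neqAle eq_sym v0 ip_ge0.
have := key (- ip u v / ip v v).
have -> : ip u u + 2 * (- ip u v / ip v v) * ip u v +
   (- ip u v / ip v v) ^+ 2 * ip v v = (ip u u * ip v v - ip u v ^+ 2) / ip v v.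
  by field.
by rewrite pmulr_lge0 ?invr_gt0// subr_ge0.
Qed.

Lemma Rint_ae_eq u v : measurable_fun D u -> measurable_fun D v ->
  {ae mu, forall x, D x -> u x = v x} ->
  \int[mu]_(x in D) u x = \int[mu]_(x in D) v x.
Proof.
move=> hu hv h; rewrite /Rintegral; congr fine.
apply: ae_eq_integral => //; try exact/measurable_EFinP.
by apply: aeS h => x /[apply] ->.
Qed.

Lemma Rint_ae_le u v : mu.-integrable D (EFin \o u) ->
  mu.-integrable D (EFin \o v) -> {ae mu, forall x, D x -> u x <= v x} ->
  \int[mu]_(x in D) u x <= \int[mu]_(x in D) v x.
Proof.
move=> iu iv h.
have mu_ : measurable_fun D u by apply/measurable_EFinP; exact: measurable_int iu.
have mv : measurable_fun D v by apply/measurable_EFinP; exact: measurable_int iv.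
(* Replacing [v] by the maximum changes it on a null set only and makes the inequality hold
   everywhere on [D]. *)
pose v' x := Order.max (u x) (v x).
have mv' : measurable_fun D v' by exact: measurable_maxr.
rewrite (@Rint_ae_eq v v')//; last first.
  by apply: aeS h => x /[apply] h; rewrite /v' max_r.
apply: le_Rintegral => //; last by move=> x _; rewrite /v' le_max lexx.
apply: (@integrable_dom _ (fun x => `|u x| + `|v x|)) => //.
  by have := integrableD mD (integrable_norm iu) (integrable_norm iv); exact: eq_integrable.
move=> x _; rewrite /v'; case: (leP (u x) (v x)) => _.
  by rewrite lerDr.
by rewrite lerDl.
Qed.

Lemma ip_ae_le K u v : L2 u -> L2 v ->
  {ae mu, forall x, D x -> u x ^+ 2 <= K * v x ^+ 2} ->
  ip u u <= K * ip v v.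
Proof.
move=> hu hv h.
have iu := L2M_integrable hu hu; have iv := L2M_integrable hv hv.
rewrite /ip -RintegralZl//; apply: Rint_ae_le => //.
  by have := integrableZl mD K iv; exact: eq_integrable.
Qed.

Lemma ip_ae_eq u u' v v' : L2 u -> L2 v -> L2 u' -> L2 v' ->
  {ae mu, forall x, D x -> u x = u' x} ->
  {ae mu, forall x, D x -> v x = v' x} -> ip u v = ip u' v'.
Proof.
move=> hu hv hu' hv' eu ev; apply: Rint_ae_eq; try exact: measurable_funM (L2_meas _) (L2_meas _).
by apply: aeS2 eu ev => x a b Dx; rewrite a// b.
Qed.

Lemma ip_sqD u v : L2 u -> L2 v ->
  ip (fun x => u x + v x) (fun x => u x + v x) <= 2 * ip u u + 2 * ip v v.
Proof.
move=> hu hv; have huv := L2D hu hv.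
rewrite ipDl// !ipDr// (ipC v u).
have h := ip_ge0 (fun x => u x - v x); have huB := L2B hu hv.
move: h; rewrite ipBl// !ipBr// (ipC v u); lra.
Qed.

Lemma ip_sqZ k u : L2 u ->
  ip (fun x => k * u x) (fun x => k * u x) = k ^+ 2 * ip u u.
Proof. by move=> hu; have hk := L2Z k hu; rewrite ipZl// ipZr//; ring. Qed.

(** Strong [L^2] convergence through the squared norm, so that estimates remain polynomial in [ip];
    the square root returns in [cv2_L2norm]. *)
Definition cv2 (u_ : nat -> T -> R) u : Prop :=
  [/\ forall n, L2 (u_ n), L2 u &
    (fun n => ip (fun x => u_ n x - u x) (fun x => u_ n x - u x)) @ \oo --> (0 : R)].

Lemma cvg0_squeeze (a b : nat -> R) K : (forall n, 0 <= a n) ->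
  (forall n, a n <= K * b n) -> b @ \oo --> (0 : R) -> a @ \oo --> (0 : R).
Proof.
move=> a0 ab b0; apply: (@squeeze_cvgr _ _ _ _ (cst 0) (fun n => K * b n)).
- by apply: nearW => n; rewrite a0 ab.
- exact: cvg_cst.
- by rewrite -[0](mulr0 K); exact: cvgM (cvg_cst _) b0.
Qed.

Lemma cv2D (u_ : nat -> T -> R) u (v_ : nat -> T -> R) v : cv2 u_ u -> cv2 v_ v ->
  cv2 (fun n x => u_ n x + v_ n x) (fun x => u x + v x).
Proof.
move=> [hu_ hu cu] [hv_ hv cv]; split; [by move=> n; exact: L2D|exact: L2D|].
pose a n := ip (fun x => u_ n x - u x) (fun x => u_ n x - u x).
pose b n := ip (fun x => v_ n x - v x) (fun x => v_ n x - v x).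
have h : (fun n => a n + b n) @ \oo --> (0 : R).
  by rewrite -[0]addr0; apply: cvgD.
apply: (cvg0_squeeze _ _ h (K := 2)).
- by move=> n; exact: ip_ge0.
- move=> n; rewrite mulrDr.
  have -> : (fun x => u_ n x + v_ n x - (u x + v x)) =
     (fun x => (u_ n x - u x) + (v_ n x - v x)) by apply/funext => x; ring.
  by apply: ip_sqD; exact: L2B.
Qed.

Lemma cv2Z k (u_ : nat -> T -> R) u : cv2 u_ u -> cv2 (fun n x => k * u_ n x) (fun x => k * u x).
Proof.
move=> [hu_ hu cu]; split; [by move=> n; exact: L2Z|exact: L2Z|].
apply: (@cvg0_squeeze _ _ (k ^+ 2) _ _ cu) => n; first exact: ip_ge0.
rewrite -ip_sqZ; last exact: L2B.
by rewrite (_ : (fun x => _) = (fun x => k * (u_ n x - u x)))//; apply/funext => x; ring.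
Qed.

Lemma cv2N (u_ : nat -> T -> R) u : cv2 u_ u -> cv2 (fun n x => - u_ n x) (fun x => - u x).
Proof.
move/(cv2Z (-1)); under eq_fun do under eq_fun do rewrite mulN1r.
by under [X in cv2 _ X]eq_fun do rewrite mulN1r.
Qed.

Lemma cv2B (u_ : nat -> T -> R) u (v_ : nat -> T -> R) v : cv2 u_ u -> cv2 v_ v ->
  cv2 (fun n x => u_ n x - v_ n x) (fun x => u x - v x).
Proof. by move=> hu /cv2N; exact: cv2D. Qed.

Lemma cv2_cst u : L2 u -> cv2 (fun _ => u) u.
Proof.
move=> hu; split => //.
rewrite (_ : (fun _ => _) = cst 0); first exact: cvg_cst.
apply/funext => n; rewrite /ip.
under eq_Rintegral do rewrite subrr mulr0.
by rewrite Rintegral_cst// mul0r.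
Qed.

(** The splitting [u_n v_n - u v = u_n (v_n - v) + v (u_n - u)] decides where the bounds sit: on the
    sequence for one factor and on the limit for the other. Bounded frame vectors thus multiply
    coefficients that converge in [L^2] only. *)
Lemma cv2M_bd K K' (u_ : nat -> T -> R) u (v_ : nat -> T -> R) v : cv2 u_ u -> cv2 v_ v ->
  (forall n, aebd K (u_ n)) -> aebd K' v ->
  cv2 (fun n x => u_ n x * v_ n x) (fun x => u x * v x).
Proof.
move=> [hu_ hu cu] [hv_ hv cv] bu bv.
have H1 n : L2 (fun x => u_ n x * v_ n x) by apply: (L2M_bd _ (bu n)) => //; case: (hu_ n).
have H2 : L2 (fun x => u x * v x).
  by under eq_fun do rewrite mulrC; apply: (L2M_bd _ bv) => //; case: hv.
have H3 n : L2 (fun x => u_ n x * (v_ n x - v x)).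
  by apply: (L2M_bd _ (bu n)); [case: (hu_ n)|exact: L2B].
have H4 n : L2 (fun x => v x * (u_ n x - u x)).
  by apply: (L2M_bd _ bv); [case: hv|exact: L2B].
split => //.
apply: (@cvg0_squeeze _ (fun n => 2 * K ^+ 2 * ip (fun x => v_ n x - v x) (fun x => v_ n x - v x)
    + 2 * K' ^+ 2 * ip (fun x => u_ n x - u x) (fun x => u_ n x - u x)) 1).
- by move=> n; exact: ip_ge0.
- move=> n; rewrite mul1r.
  have -> : (fun x => u_ n x * v_ n x - u x * v x) =
    (fun x => u_ n x * (v_ n x - v x) + v x * (u_ n x - u x)) by apply/funext => x; ring.
  apply: (le_trans (ip_sqD _ _)) => //.
  rewrite -!(mulrA 2); apply: lerD;
    rewrite ler_pM2l//; apply: ip_ae_le => //; try exact: L2B.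
  + apply: aeS (bu n) => x /[apply] h; rewrite exprMn ler_wpM2r ?sqr_ge0//.
    by rewrite -[u_ n x ^+ 2]real_normK ?num_real// lerXn2r ?nnegrE// (le_trans _ h).
  + apply: aeS bv => x /[apply] h; rewrite exprMn ler_wpM2r ?sqr_ge0//.
    by rewrite -[v x ^+ 2]real_normK ?num_real// lerXn2r ?nnegrE// (le_trans _ h).
- rewrite -[X in _ --> X]addr0; apply: cvgD.
  + by rewrite -[X in _ --> X](mulr0 (2 * K ^+ 2)); apply: cvgM => //; exact: cvg_cst.
  + by rewrite -[X in _ --> X](mulr0 (2 * K' ^+ 2)); apply: cvgM => //; exact: cvg_cst.
Qed.

Lemma cv2_ae (u_ : nat -> T -> R) u (u_' : nat -> T -> R) u' : cv2 u_ u -> (forall n, L2 (u_' n)) -> L2 u' ->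
  (forall n, {ae mu, forall x, D x -> u_' n x = u_ n x}) ->
  {ae mu, forall x, D x -> u' x = u x} -> cv2 u_' u'.
Proof.
move=> [hu_ hu cu] hu_' hu' e_ e; split => //.
rewrite (_ : (fun n => _) = (fun n => ip (fun x => u_ n x - u x) (fun x => u_ n x - u x)))//.
apply/funext => n; apply: ip_ae_eq; try exact: L2B.
- by apply: aeS2 (e_ n) e => x a b Dx; rewrite a// b.
- by apply: aeS2 (e_ n) e => x a b Dx; rewrite a// b.
Qed.

Lemma cv2_ip (u_ : nat -> T -> R) u (v_ : nat -> T -> R) v : cv2 u_ u -> cv2 v_ v ->
  (fun n => ip (u_ n) (v_ n)) @ \oo --> ip u v.
Proof.
move=> [hu_ hu cu] [hv_ hv cv].
pose a n := ip (fun x => u_ n x - u x) (fun x => u_ n x - u x).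
pose b n := ip (fun x => v_ n x - v x) (fun x => v_ n x - v x).
apply/cvgrPdist_lt => e e0.
(* Three error terms, each estimated by Cauchy-Schwarz; the 3 comes from
   [(p + q + r)^2 <= 3 (p^2 + q^2 + r^2)]. *)
have CS n : (ip (u_ n) (v_ n) - ip u v) ^+ 2 <=
   3 * (a n * b n + ip u u * b n + a n * ip v v).
  have hB := L2B (hu_ n) hu; have hB' := L2B (hv_ n) hv.
  have -> : ip (u_ n) (v_ n) - ip u v =
     ip (fun x => u_ n x - u x) (fun x => v_ n x - v x) + ip u (fun x => v_ n x - v x)
     + ip (fun x => u_ n x - u x) v.
    rewrite !ipBl// !ipBr//; ring.
  have h1 := cauchy_schwarz hB hB'; have h2 := cauchy_schwarz hu hB'.
  have h3 := cauchy_schwarz hB hv.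
  rewrite -/(a n) -/(b n) in h1 h2 h3 *.
  set p := ip _ _ in h1 *; set q := ip _ _ in h2 *; set r := ip _ _ in h3 *.
  apply: (@le_trans _ _ (3 * (p ^+ 2 + q ^+ 2 + r ^+ 2))); last by rewrite ler_pM2l// !lerD.
  have := sqr_ge0 (p - q); have := sqr_ge0 (p - r); have := sqr_ge0 (q - r); nra.
have : (fun n => 3 * (a n * b n + ip u u * b n + a n * ip v v)) @ \oo --> (0 : R).
  have -> : (0 : R) = 3 * (0 * 0 + ip u u * 0 + 0 * ip v v) by ring.
  apply: cvgM; first exact: cvg_cst.
  by apply: cvgD; [apply: cvgD|]; apply: cvgM => //; exact: cvg_cst.
move/cvgrPdist_lt => /(_ (e ^+ 2)) []; first by rewrite exprn_gt0.
move=> N _ hN; exists N => // n Nn; have := hN n Nn.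
rewrite sub0r normrN => h.
rewrite distrC -(@ltr_pXn2r _ 2)// ?nnegrE ?ltW// -normrX ger0_norm ?sqr_ge0//.
by apply: le_lt_trans h; rewrite ler_normr CS.
Qed.

Lemma cv2_shift (u_ : nat -> T -> R) u s : {homo s : m n / (m < n)%N} -> cv2 u_ u ->
  cv2 (fun n => u_ (s n)) u.
Proof.
move=> hs [hu_ hu cu]; split => //.
have hsn n : (n <= s n)%N.
  by elim: n => // n IH; rewrite (leq_ltn_trans IH)// hs.
apply/cvgrPdist_lt => e e0; move/cvgrPdist_lt : cu => /(_ e e0)[N _ hN].
by exists N => // n Nn; apply: hN => /=; rewrite (leq_trans Nn).
Qed.

Hypothesis fD : (mu D < +oo)%E.

Lemma integrable_bd K u : measurable_fun D u -> aebd K u ->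
  mu.-integrable D (EFin \o u).
Proof.
move=> mu_ bu; apply: (@integrable_ae_dom _ (cst K)) => //.
apply/integrableP; split; first by apply/measurable_EFinP.
rewrite (eq_integral (cst `|K|%:E))// integral_cst//.
by rewrite lte_mul_pinfty// lee_fin.
Qed.

Lemma L2_bd K u : measurable_fun D u -> aebd K u -> L2 u.
Proof.
move=> mu_ bu; split => //; apply: (@integrable_bd (K ^+ 2)).
  exact: measurable_funX.
apply: aeS bu => x /[apply] h; rewrite normrX lerXn2r ?nnegrE//.
by rewrite (le_trans _ h).
Qed.

Lemma L2_cst k : L2 (cst k).
Proof. by apply: (@L2_bd `|k|) => //; exact: nearW. Qed.

Lemma L2_integrable u : L2 u -> mu.-integrable D (EFin \o u).
Proof.
move=> hu; have := L2M_integrable hu (L2_cst 1).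
by apply: eq_integrable => // x _ /=; rewrite mulr1.
Qed.

Lemma cv2_unif (u_ : nat -> T -> R) u (e_ : nat -> R) : (forall n, L2 (u_ n)) -> L2 u ->
  e_ @ \oo --> (0 : R) -> (forall n x, D x -> `|u_ n x - u x| <= e_ n) -> cv2 u_ u.
Proof.
move=> hu_ hu e0 h; split => //.
apply: (@cvg0_squeeze _ (fun n => e_ n ^+ 2) (ip (cst 1) (cst 1))).
- by move=> n; exact: ip_ge0.
- move=> n; rewrite mulrC; apply: ip_ae_le.
  + exact: L2B.
  + exact: L2_cst.
  + apply: nearW => x Dx; rewrite expr1n mulr1 -[_ ^+ 2]real_normK ?num_real//.
    by rewrite lerXn2r ?nnegrE// ?(le_trans _ (h n x Dx))// h.
- by rewrite -[X in _ --> X](mulr0 (0 : R)); apply: cvgM.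
Qed.
End L2.
Arguments L2 {d T R}.
Arguments ip {d T R}.
Arguments cv2 {d T R}.
Arguments aebd {d T R}.

(** * Slicing and Fubini *)

(** The inner integrals in Fubini's theorem are extended reals, finite only almost everywhere; this
    converts them to real functions with the same integral. *)
Lemma integrable_fine d (T : measurableType d) (R : realType)
    (mu : {measure set T -> \bar R}) (D : set T) (G : T -> \bar R) :
  measurable D -> mu.-integrable D G ->
  mu.-integrable D (EFin \o (fine \o G)) /\
  \int[mu]_(x in D) fine (G x) = fine (\int[mu]_(x in D) G x)%E.
Proof.
move=> mD iG.
have mG := measurable_int _ iG.
have mfG : measurable_fun D (EFin \o (fine \o G)).
  by apply/measurable_EFinP; apply: measurableT_comp.
have ae : {ae mu, forall x, D x -> (EFin \o (fine \o G)) x = G x}.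
  by apply: aeS (integrable_ae mD iG) => x /[apply] h /=; rewrite fineK.
split; last by rewrite /Rintegral; congr fine; exact: ae_eq_integral.
apply/integrableP; split => //.
have /integrableP[_] := iG; apply: le_lt_trans.
apply: ae_ge0_le_integral => //; try exact: measurableT_comp.
by apply: aeS ae => x /[apply] ->.
Qed.

Section Fubini.
Context d1 d2 (T1 : measurableType d1) (T2 : measurableType d2) (R : realType).
Variables (m1 : {sigma_finite_measure set T1 -> \bar R})
  (m2 : {sigma_finite_measure set T2 -> \bar R}).
Variables (A : set T1) (B : set T2).
Hypotheses (mA : measurable A) (mB : measurable B).
Implicit Type f : T1 * T2 -> R.
Local Notation pm := (m1 \x m2)%E.

Let mAB : measurable (A `*` B). Proof. exact: measurableX. Qed.

(** Slices of a zero extension are zero extensions of slices, so Fubini on the whole product space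
    gives Fubini on [A] times [B]. *)
Lemma restrict_prod1 f x : (fun y => ((EFin \o f) \_ (A `*` B)) (x, y)) =
  if x \in A then (EFin \o (fun y => f (x, y))) \_ B else cst 0%E.
Proof.
apply/funext => y; rewrite !patchE.
case: (boolP (x \in A)) => xA /=.
  rewrite /patch; congr (if _ then _ else _).
  by rewrite in_setX/= xA.
by case: ifPn => //; rewrite inE => -[/= Ax _]; rewrite notin_setE in xA.
Qed.

Lemma restrict_prod2 f y : (fun x => ((EFin \o f) \_ (A `*` B)) (x, y)) =
  if y \in B then (EFin \o (fun x => f (x, y))) \_ A else cst 0%E.
Proof.
apply/funext => x; rewrite !patchE.
case: (boolP (y \in B)) => yB /=.
  rewrite /patch; congr (if _ then _ else _).
  by rewrite in_setX/= yB andbT.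
by case: ifPn => //; rewrite inE => -[/= _ By]; rewrite notin_setE in yB.
Qed.

Let F_E f : fubini_F m2 ((EFin \o f) \_ (A `*` B)) =
  (fun x => \int[m2]_(y in B) (f (x, y))%:E)%E \_ A.
Proof.
apply/funext => x; rewrite /fubini_F patchE; rewrite restrict_prod1.
by case: ifPn => xA; [rewrite -integral_mkcond|exact: integral0].
Qed.

Let G_E f : fubini_G m1 ((EFin \o f) \_ (A `*` B)) =
  (fun y => \int[m1]_(x in A) (f (x, y))%:E)%E \_ B.
Proof.
apply/funext => y; rewrite /fubini_G patchE; rewrite restrict_prod2.
by case: ifPn => yB; [rewrite -integral_mkcond|exact: integral0].
Qed.

Section integrable.
Variable f : T1 * T2 -> R.
Hypothesis hf : pm.-integrable (A `*` B) (EFin \o f).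

Let hF : pm.-integrable setT ((EFin \o f) \_ (A `*` B)).
Proof. by rewrite -integrable_mkcond. Qed.

Lemma fub_slice1 :
  {ae m1, forall x, A x -> m2.-integrable B (EFin \o (fun y => f (x, y)))}.
Proof.
apply: aeS (ae_integrable1 hF) => x + Ax.
by rewrite restrict_prod1 mem_set// -integrable_mkcond.
Qed.

Lemma fub_slice2 :
  {ae m2, forall y, B y -> m1.-integrable A (EFin \o (fun x => f (x, y)))}.
Proof.
apply: aeS (ae_integrable2 hF) => y + By.
by rewrite restrict_prod2 mem_set// -integrable_mkcond.
Qed.

Let iF : m1.-integrable A (fun x => \int[m2]_(y in B) (f (x, y))%:E)%E.
Proof. by rewrite integrable_mkcond// -F_E; exact: integrable_fubini_F. Qed.

Let iG : m2.-integrable B (fun y => \int[m1]_(x in A) (f (x, y))%:E)%E.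
Proof.
rewrite integrable_mkcond// -G_E.
have mF := measurable_int _ hF.
apply/integrableP; split; first exact: measurable_fubini_G hF.
(* By Tonelli the iterated integral of the absolute value is finite, and it dominates the absolute
   value of the inner integral. *)
have := (integrable21ltyP m1 m2 mF).1 hF.
apply: le_lt_trans.
apply: ge0_le_integral => //.
- by apply: measurableT_comp => //; exact: measurable_fubini_G hF.
- apply: (measurable_fun_fubini_tonelli_G (abse \o ((EFin \o f) \_ (A `*` B)))).
    exact: measurableT_comp.
  by move=> z; exact: abse_ge0.
- by move=> y _; apply: le_abse_integral => //; exact: measurableT_comp.
Qed.

Lemma fub_outer1 :
  m1.-integrable A (EFin \o (fun x => \int[m2]_(y in B) f (x, y))).
Proof. exact: (integrable_fine mA iF).1. Qed.

Lemma fub_outer2 :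
  m2.-integrable B (EFin \o (fun y => \int[m1]_(x in A) f (x, y))).
Proof. exact: (integrable_fine mB iG).1. Qed.

Lemma fub1 : \int[m1]_(x in A) (\int[m2]_(y in B) f (x, y)) =
  \int[pm]_(z in A `*` B) f z.
Proof.
rewrite [LHS](integrable_fine mA iF).2; congr fine.
by rewrite integral_mkcond -F_E integral12_prod_meas1// -integral_mkcond.
Qed.

Lemma fub2 : \int[m2]_(y in B) (\int[m1]_(x in A) f (x, y)) =
  \int[pm]_(z in A `*` B) f z.
Proof.
rewrite [LHS](integrable_fine mB iG).2; congr fine.
by rewrite integral_mkcond -G_E integral21_prod_meas1// -integral_mkcond.
Qed.

End integrable.

Lemma integrable_tensor (u : T1 -> R) (v : T2 -> R) :
  m1.-integrable A (EFin \o u) -> m2.-integrable B (EFin \o v) ->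
  pm.-integrable (A `*` B) (EFin \o (fun z => u z.1 * v z.2)).
Proof.
move=> iu iv.
have mu : measurable_fun A u by apply/measurable_EFinP; exact: measurable_int iu.
have mv : measurable_fun B v by apply/measurable_EFinP; exact: measurable_int iv.
have muv : measurable_fun (A `*` B) (fun z => u z.1 * v z.2).
  apply: measurable_funM.
  - apply: (@measurable_comp _ _ _ _ _ _ A) => //.
    + by move=> _ [z [? _] <-].
    + exact: measurable_funTS measurable_fst.
  - apply: (@measurable_comp _ _ _ _ _ _ B) => //.
    + by move=> _ [z [_ ?] <-].
    + exact: measurable_funTS measurable_snd.
rewrite integrable_mkcond//; apply/integrable12ltyP.
  by apply/(measurable_restrictT _ _).1 => //; apply/measurable_EFinP; exact: muv.
rewrite (_ : (fun x => _) = (fun x => `|u x|%:E * \int[m2]_(y in B) `|(v y)%:E|)%E \_ A); last first.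
  apply/funext => x; rewrite patchE.
  under eq_integral do rewrite [((_ \o _) \_ _) _](congr1 (@^~ _) (restrict_prod1 _ _)).
  case: ifPn => xA; last first.
    by apply: integral0_eq => y _; exact: abse0.
  rewrite -ge0_integralZl//; last first.
    by apply: measurableT_comp => //; exact/measurable_EFinP.
  rewrite [RHS]integral_mkcond; apply: eq_integral => y _.
  by rewrite !patchE; case: ifPn => // _; rewrite ?abse0//= normrM EFinM.
rewrite -integral_mkcond ge0_integralZr//; last 2 first.
- by apply/measurable_EFinP; exact: measurableT_comp.
- by apply: integral_ge0.
have /integrableP[_ hu] := iu; have /integrableP[_ hv] := iv.
apply: lte_mul_pinfty => //; first exact: integral_ge0.
by rewrite ge0_fin_numE//; exact: integral_ge0.
Qed.

(** The measures of the sections of a null set integrate to 0, so almost all of them vanish. *)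
Lemma ae_slice1 (P : T1 * T2 -> Prop) :
  {ae pm, forall z, (A `*` B) z -> P z} ->
  {ae m1, forall x, A x -> {ae m2, forall y, B y -> P (x, y)}}.
Proof.
move=> [N [mN N0 hN]].
have := indic_fubini_tonelli1 m1 m2 mN.
have -> : (\int[m1 \x m2]_z (\1_N z)%:E = 0)%E by rewrite integral_indic// setIT; exact: N0.
rewrite indic_fubini_tonelli_FE// => /esym h.
have mx := measurable_fun_xsection m2 mN.
have : (\int[m1]_x `|(m2 \o xsection N) x| = 0)%E.
  by rewrite -h; apply: eq_integral => x _; rewrite gee0_abs.
move/(ae_eq_integral_abs m1 measurableT) => /(_ mx).
apply: aeS => x /(_ I) /= h0 Ax.
exists (xsection N x); split => //; first exact: measurable_xsection.
by move=> y /= hy; rewrite /xsection/= inE; apply: hN => /= hh; apply: hy => By; exact: hh.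
Qed.

Lemma ae_slice2 (P : T1 * T2 -> Prop) :
  {ae pm, forall z, (A `*` B) z -> P z} ->
  {ae m2, forall y, B y -> {ae m1, forall x, A x -> P (x, y)}}.
Proof.
move=> [N [mN N0 hN]].
have := indic_fubini_tonelli m1 m2 mN.
have := indic_fubini_tonelli1 m1 m2 mN.
have -> : (\int[m1 \x m2]_z (\1_N z)%:E = 0)%E by rewrite integral_indic// setIT; exact: N0.
move=> <-.
rewrite indic_fubini_tonelli_GE// => h.
have mx := measurable_fun_ysection m1 mN.
have : (\int[m2]_x `|(m1 \o ysection N) x| = 0)%E.
  by rewrite h; apply: eq_integral => x _; rewrite gee0_abs.
move/(ae_eq_integral_abs m2 measurableT) => /(_ mx).
apply: aeS => y /(_ I) /= h0 By.
exists (ysection N y); split => //; first exact: measurable_ysection.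
by move=> x /= hx; rewrite /ysection/= inE; apply: hN => /= hh; apply: hx => Ax; exact: hh.
Qed.

(** Tonelli can only be applied to a measurable exceptional set. This is why, in contrast to
    [ae_slice1], the property is an equation between measurable functions. *)
Lemma ae_unslice1 f g : measurable_fun (A `*` B) f -> measurable_fun (A `*` B) g ->
  {ae m1, forall x, A x -> {ae m2, forall y, B y -> f (x, y) = g (x, y)}} ->
  {ae pm, forall z, (A `*` B) z -> f z = g z}.
Proof.
move=> mf mg h.
pose N := (A `*` B) `&` [set z | f z != g z].
have mN : measurable N.
  have mfg := (measurable_EFinP _ _).2 (measurable_funB mf mg).
  rewrite (_ : N = (A `*` B) `&` [set z | (EFin \o (f \- g)) z != 0%E]).
    exact: emeasurable_neq.
  apply/seteqP; split => z /= [h1]; rewrite /= eqe subr_eq0 => h2; split => //.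
exists N; split => //; last first.
  by move=> z /= /not_implyP[? /eqP ?]; split.
have := indic_fubini_tonelli1 m1 m2 mN.
rewrite integral_indic// setIT => ->.
rewrite indic_fubini_tonelli_FE//.
rewrite (ae_eq_integral (cst 0%E))//; first exact: integral0.
  exact: measurable_fun_xsection.
apply: aeS h => x h _ /=.
case: (pselect (A x)) => [/h [M [mM M0 hM]]|nA].
  apply/eqP; rewrite eq_le measure_ge0 andbT -M0 le_measure ?inE//.
    exact: measurable_xsection.
  move=> y; rewrite /xsection/= inE => -[[_ By]] /= /eqP fg.
  by apply: hM => /= /(_ By).
rewrite (_ : xsection N x = set0) ?measure0//.
by apply/seteqP; split => // y; rewrite /xsection/= inE => -[[]].
Qed.

Lemma ae_unslice2 f g : measurable_fun (A `*` B) f -> measurable_fun (A `*` B) g ->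
  {ae m2, forall y, B y -> {ae m1, forall x, A x -> f (x, y) = g (x, y)}} ->
  {ae pm, forall z, (A `*` B) z -> f z = g z}.
Proof.
move=> mf mg h.
pose N := (A `*` B) `&` [set z | f z != g z].
have mN : measurable N.
  have mfg := (measurable_EFinP _ _).2 (measurable_funB mf mg).
  rewrite (_ : N = (A `*` B) `&` [set z | (EFin \o (f \- g)) z != 0%E]).
    exact: emeasurable_neq.
  apply/seteqP; split => z /= [h1]; rewrite /= eqe subr_eq0 => h2; split => //.
exists N; split => //; last first.
  by move=> z /= /not_implyP[? /eqP ?]; split.
have := indic_fubini_tonelli1 m1 m2 mN.
rewrite integral_indic// setIT => ->.
rewrite indic_fubini_tonelli//.
rewrite indic_fubini_tonelli_GE//.
rewrite (ae_eq_integral (cst 0%E))//; first exact: integral0.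
  exact: measurable_fun_ysection.
apply: aeS h => y h _ /=.
case: (pselect (B y)) => [/h [M [mM M0 hM]]|nB].
  apply/eqP; rewrite eq_le measure_ge0 andbT -M0 le_measure ?inE//.
    exact: measurable_ysection.
  move=> x; rewrite /ysection/= inE => -[[Ax _]] /= /eqP fg.
  by apply: hM => /= /(_ Ax).
rewrite (_ : ysection N y = set0) ?measure0//.
by apply/seteqP; split => // x; rewrite /ysection/= inE => -[[]].
Qed.
End Fubini.

(** * Primitives on an interval *)

Section primitive.
Context {R : realType}.
Local Notation mu := (@lebesgue_measure R).
Implicit Types (a b x y : R) (u v z : R -> R).

Definition itvoo a b : set (measurableTypeR R) := `]a, b[.

Lemma measurable_itvoo a b : measurable (itvoo a b).
Proof. exact: measurable_itv. Qed.
Hint Resolve measurable_itvoo : core.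

Lemma itvooE a b x : itvoo a b x = (a < x < b) :> Prop.
Proof. by rewrite /itvoo/= in_itv. Qed.

Lemma itvoo_fin a b : (mu (itvoo a b) < +oo)%E.
Proof. by rewrite /itvoo lebesgue_measure_itv/=; case: ifP => _; rewrite ?ltry. Qed.

Lemma integrable_meas1 (D : set (measurableTypeR R)) v : mu.-integrable D (EFin \o v) -> measurable_fun D v.
Proof. by move=> iv; apply/measurable_EFinP; exact: measurable_int iv. Qed.

Lemma integrable_oo_cc a b v : mu.-integrable (itvoo a b) (EFin \o v) ->
  mu.-integrable `[a, b] (EFin \o v).
Proof.
move=> /integrableP[mv iv]; apply/integrableP.
have mv' : measurable_fun `[a, b] v.
  by apply: (measurable_fun_itv_cc (b0 := false) (b1 := true)); exact/measurable_EFinP.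
split; first exact/measurable_EFinP.
by rewrite integral_itv_bndoo//; exact: measurableT_comp.
Qed.

Lemma integrable_sub a b x y v : mu.-integrable (itvoo a b) (EFin \o v) ->
  a <= x -> y <= b -> mu.-integrable (itvoo x y) (EFin \o v).
Proof.
move=> iv ax yb; apply: integrableS iv => // t; rewrite !itvooE => /andP[h1 h2].
by rewrite (le_lt_trans ax h1) (lt_le_trans h2 yb).
Qed.

Definition Prim a v x := \int[mu]_(s in itvoo a x) v s.

Lemma Prim0 a v : Prim a v a = 0.
Proof.
by rewrite /Prim (_ : itvoo a a = set0) ?Rintegral_set0// -subset0 => t; rewrite itvooE; lra.
Qed.

Lemma Prim_cc a b x v : mu.-integrable (itvoo a b) (EFin \o v) -> x <= b ->
  Prim a v x = parameterized_integral mu a x v.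
Proof.
move=> iv xb; rewrite /Prim /parameterized_integral /Rintegral; congr fine.
rewrite [RHS]integral_itv_bndoo//.
have i := integrable_sub iv (lexx a) xb; exact: measurable_int i.
Qed.

Lemma Prim_cont a b v : a <= b -> mu.-integrable (itvoo a b) (EFin \o v) ->
  {within `[a, b], continuous (Prim a v)}.
Proof.
move=> ab iv.
have := parameterized_integral_continuous ab (integrable_oo_cc iv).
apply: subspace_eq_continuous => x; rewrite inE/= in_itv/= => /andP[_ xb].
exact/esym/(Prim_cc iv xb).
Qed.

Lemma Prim_meas a b v : a <= b -> mu.-integrable (itvoo a b) (EFin \o v) ->
  measurable_fun (itvoo a b) (Prim a v).
Proof.
move=> ab iv; apply: (@measurable_funS _ _ _ _ `[a, b]) => //.
  by apply: subset_itvScc; rewrite bnd_simp.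
by apply: subspace_continuous_measurable_fun => //; exact: Prim_cont.
Qed.

Lemma Prim_split a b x y v : mu.-integrable (itvoo a b) (EFin \o v) ->
  a <= x -> x <= y -> y <= b -> Prim a v y - Prim a v x = Prim x v y.
Proof.
move=> iv ax xy yb.
have ix := integrable_oo_cc (integrable_sub iv (lexx a) (le_trans xy yb)).
have iy := integrable_oo_cc (integrable_sub iv (lexx a) yb).
rewrite (Prim_cc iv)// (Prim_cc iv (le_trans xy yb)) /parameterized_integral.
rewrite Rintegral_itvB// ?bnd_simp// /Prim.
have ixy := integrable_oo_cc (integrable_sub iv ax yb).
rewrite /Rintegral; congr fine; rewrite integral_itv_bndoo//.
have i := integrable_sub iv ax yb; exact: measurable_int i.
Qed.

Lemma Prim_bd a b x v : mu.-integrable (itvoo a b) (EFin \o v) -> x <= b ->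
  `|Prim a v x| <= Prim a (fun s => `|v s|) b.
Proof.
move=> iv xb.
have ix := integrable_sub iv (lexx a) xb.
apply: (le_trans (le_normr_Rintegral _ ix)) => //.
rewrite /Prim /Rintegral fine_le//.
- by apply: integrable_fin_num => //; exact: integrable_norm.
- by apply: integrable_fin_num => //; exact: integrable_norm.
apply: ge0_subset_integral => //.
- by apply: measurable_int; exact: integrable_norm iv.
- by move=> t; rewrite !itvooE => /andP[-> /= h]; exact: lt_le_trans h xb.
Qed.

Lemma Prim_eq a b x u v : mu.-integrable (itvoo a b) (EFin \o u) ->
  mu.-integrable (itvoo a b) (EFin \o v) ->
  {ae mu, forall x, itvoo a b x -> u x = v x} -> x <= b -> Prim a u x = Prim a v x.
Proof.
move=> iu iv uv xb; apply: Rint_ae_eq => //.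
- by apply/measurable_EFinP; apply: measurable_int; exact: integrable_sub iu _ _.
- by apply/measurable_EFinP; apply: measurable_int; exact: integrable_sub iv _ _.
- apply: aeS uv => t h; rewrite itvooE => /andP[at_ tx]; apply: h.
  by rewrite itvooE at_ (lt_le_trans tx).
Qed.

Lemma PrimZ a k v x : mu.-integrable (itvoo a x) (EFin \o v) ->
  Prim a (fun s => k * v s) x = k * Prim a v x.
Proof. by move=> iv; rewrite /Prim RintegralZl. Qed.

Lemma PrimD a u v x : mu.-integrable (itvoo a x) (EFin \o u) ->
  mu.-integrable (itvoo a x) (EFin \o v) ->
  Prim a (fun s => u s + v s) x = Prim a u x + Prim a v x.
Proof. by move=> iu iv; rewrite /Prim RintegralD. Qed.

Lemma integrableM_cont a b u v : a <= b ->
  mu.-integrable (itvoo a b) (EFin \o v) -> {within `[a, b], continuous u} ->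
  mu.-integrable (itvoo a b) (EFin \o (fun x => u x * v x)).
Proof.
move=> ab iv cu.
have [M hM] : exists M, forall x, itvoo a b x -> `|u x| <= M.
  have cn : {within `[a, b], continuous (fun x => `|u x|)}.
    by move=> x; apply: continuous_comp; [exact: cu|exact: norm_continuous].
  have [c _ hc] := EVT_max ab cn.
  exists (`|u c|) => x; rewrite itvooE => /andP[ax xb]; apply: hc.
  by rewrite in_itv/= !ltW.
have mv : measurable_fun (itvoo a b) v by apply/measurable_EFinP; exact: measurable_int iv.
have mu_ : measurable_fun (itvoo a b) u.
  apply: (@measurable_funS _ _ _ _ `[a, b]) => //.
    by apply: subset_itvScc; rewrite bnd_simp.
  exact: subspace_continuous_measurable_fun.
apply: (@integrable_dom _ _ _ mu _ _ _ (fun x => M * `|v x|)) => //.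
- exact: measurable_funM.
- by have := integrableZl (measurable_itvoo a b) M (integrable_norm iv); exact: eq_integrable.
- by move=> x xab; rewrite normrM ler_wpM2r// hM.
Qed.

Lemma Rint_lt_left a b x (f : R -> R) : x <= b ->
  \int[mu]_(t in itvoo a b) (f t * (t < x :> R)%R%:R) = \int[mu]_(t in itvoo a x) f t.
Proof.
move=> xb; rewrite [RHS]Rintegral_mkcond [LHS]Rintegral_mkcond.
congr Rintegral; apply/funext => t; rewrite !patchE !mem_setE /= !in_itv/=.
case: (ltP t x) => tx; rewrite ?andbF ?mulr0; last by case: ifP.
by rewrite andbT (lt_le_trans tx xb) andbT mulr1.
Qed.

Lemma Rint_lt_right a b x (f : R -> R) : a <= x ->
  \int[mu]_(t in itvoo a b) (f t * (x < t :> R)%R%:R) = \int[mu]_(t in itvoo x b) f t.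
Proof.
move=> ax; rewrite [RHS]Rintegral_mkcond [LHS]Rintegral_mkcond.
congr Rintegral; apply/funext => t; rewrite !patchE !mem_setE /= !in_itv/=.
case: (ltP x t) => tx; rewrite ?mulr0 /=; last by case: ifP.
by rewrite (le_lt_trans ax tx) mulr1.
Qed.

(** The tensor product restricted to the triangle below the diagonal, the integrand to which [PrimM]
    applies Fubini. *)
Lemma integrable_triangle a b v z : mu.-integrable (itvoo a b) (EFin \o v) ->
  mu.-integrable (itvoo a b) (EFin \o z) ->
  (mu \x mu)%E.-integrable (itvoo a b `*` itvoo a b)
    (EFin \o (fun p : measurableTypeR R * measurableTypeR R =>
      v p.1 * z p.2 * (p.2 < p.1 :> R)%R%:R)).
Proof.
move=> iv iz.
pose T := [set p : measurableTypeR R * measurableTypeR R | p.2 < p.1].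
have mT : measurable T.
  rewrite -[T]setTI; apply: (measurable_fun_ltr (D := setT) _ _ _ (Y := [set true])) => //.
have mX : measurable (itvoo a b `*` itvoo a b) by exact: measurableX.
have iT := integrable_tensor (measurable_itvoo a b) (measurable_itvoo a b) iv iz.
apply: (@integrable_dom _ _ _ _ _ mX _ (fun p => `|v p.1 * z p.2|)).
- apply: measurable_funM.
    by apply/measurable_EFinP; exact: measurable_int iT.
  rewrite (_ : (fun _ => _) = (\1_T : _ -> R)); first exact: measurable_indic.
  apply/funext => p; rewrite indicE; congr (_%:R); congr nat_of_bool.
  by apply/idP/idP; rewrite inE.
- exact: integrable_norm iT.
- move=> p _; rewrite normrM ler_piMr// .
  by case: (_ < _)%R; rewrite ?normr1 ?normr0.
Qed.

(** Integration by parts for densities that are merely integrable: the integral of [v(s) z(t)] over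
    the square is the sum of those over the two triangles cut off by the diagonal. *)
Lemma PrimM a b v z : a <= b -> mu.-integrable (itvoo a b) (EFin \o v) ->
  mu.-integrable (itvoo a b) (EFin \o z) ->
  Prim a v b * Prim a z b = Prim a (fun s => v s * Prim a z s + Prim a v s * z s) b.
Proof.
move=> ab iv iz.
have ivz : mu.-integrable (itvoo a b) (EFin \o (fun s => v s * Prim a z s)).
  by under eq_fun do rewrite mulrC; apply: integrableM_cont => //; exact: Prim_cont.
have izv : mu.-integrable (itvoo a b) (EFin \o (fun s => Prim a v s * z s)).
  by apply: integrableM_cont => //; exact: Prim_cont.
(* Both sides integrate [v(s) z(t)] over the triangle [t < s], in the two possible orders. *)
have Fub : \int[mu]_(s in itvoo a b) (v s * Prim a z s) =
   \int[mu]_(t in itvoo a b) (z t * (Prim a v b - Prim a v t)).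
  have ih := integrable_triangle iv iz.
  have := fub1 (measurable_itvoo a b) (measurable_itvoo a b) ih.
  rewrite -(fub2 (measurable_itvoo a b) (measurable_itvoo a b) ih) => Fub.
  rewrite (_ : Rintegral _ _ _ = \int[mu]_(s in itvoo a b) \int[mu]_(t in itvoo a b)
      (v s * z t * (t < s :> R)%R%:R)); last first.
    apply: eq_Rintegral => s; rewrite inE itvooE => /andP[as_ sb].
    rewrite (Rint_lt_left a (fun t => v s * z t) (ltW sb)) -/(Prim a _ s) PrimZ//.
    exact: (integrable_sub iz (lexx a) (ltW sb)).
  rewrite [RHS](_ : _ = \int[mu]_(t in itvoo a b) \int[mu]_(s in itvoo a b)
      (v s * z t * (t < s :> R)%R%:R)); first exact: Fub.
  apply: eq_Rintegral => t; rewrite inE itvooE => /andP[at_ tb].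
  rewrite (Rint_lt_right b (fun s => v s * z t) (ltW at_)).
  rewrite (Prim_split iv (ltW at_) (ltW tb) (lexx b)) -PrimZ; last first.
    exact: (integrable_sub iv (ltW at_) (lexx b)).
  by apply: eq_Rintegral => s _; rewrite mulrC.
rewrite PrimD// [X in _ = X + _]Fub /Prim -/(Prim a v b) -/(Prim a z b).
have -> : \int[mu]_(t in itvoo a b) (z t * (Prim a v b - Prim a v t)) =
   Prim a v b * Prim a z b - \int[mu]_(t in itvoo a b) (Prim a v t * z t).
  rewrite -PrimZ// -RintegralB//; last first.
    by have := integrableZl (measurable_itvoo a b) (Prim a v b) iz; exact: eq_integrable.
  by apply: eq_Rintegral => t _; ring.
by rewrite subrK.
Qed.

(* [u] agrees almost everywhere with an absolutely continuous function of derivative [v]. *)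
Definition prim a b u v : Prop := mu.-integrable (itvoo a b) (EFin \o v) /\
  exists c, {ae mu, forall x, itvoo a b x -> u x = c + Prim a v x}.

Lemma prim_ae a b u u' v v' : prim a b u v ->
  mu.-integrable (itvoo a b) (EFin \o v') ->
  {ae mu, forall x, itvoo a b x -> u x = u' x} ->
  {ae mu, forall x, itvoo a b x -> v x = v' x} -> prim a b u' v'.
Proof.
move=> [iv [c hc]] iv' uu vv; split => //; exists c.
apply: aeS2 hc uu => x h1 h2 abx; rewrite -h2// h1//; congr +%R.
by apply: Prim_eq iv iv' vv _; move: abx; rewrite itvooE => /andP[_ /ltW].
Qed.

Lemma primD a b u v u' v' : prim a b u v -> prim a b u' v' ->
  prim a b (fun x => u x + u' x) (fun x => v x + v' x).
Proof.
move=> [iv [c hc]] [iv' [c' hc']].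
split; first by have := integrableD (measurable_itvoo a b) iv iv'; exact: eq_integrable.
exists (c + c'); apply: aeS2 hc hc' => x h h' xab; rewrite h// h'//.
have xb : x <= b by move: xab; rewrite itvooE => /andP[_ /ltW].
by rewrite PrimD; [ring|exact: integrable_sub iv _ _|exact: integrable_sub iv' _ _].
Qed.

Lemma primZ a b k u v : prim a b u v -> prim a b (fun x => k * u x) (fun x => k * v x).
Proof.
move=> [iv [c hc]].
split; first by have := integrableZl (measurable_itvoo a b) k iv; exact: eq_integrable.
exists (k * c); apply: aeS hc => x h xab; rewrite h//.
have xb : x <= b by move: xab; rewrite itvooE => /andP[_ /ltW].
by rewrite PrimZ; [ring|exact: integrable_sub iv _ _].
Qed.

Lemma prim_cst a b k : prim a b (cst k) (cst 0).
Proof.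
split; first exact: integrable0.
by exists k; apply: nearW => x _; rewrite /Prim Rintegral_cst// mul0r addr0.
Qed.

Lemma Prim_prim a b v : mu.-integrable (itvoo a b) (EFin \o v) ->
  prim a b (Prim a v) v.
Proof. by move=> iv; split => //; exists 0; apply: nearW => x _; rewrite add0r. Qed.

(** The product rule holds for the continuous representatives by [PrimM] and is carried over by
    [prim_ae]. Measurability of [u] and [u'] is assumed because agreement almost everywhere with a
    continuous function does not give it. *)
Lemma primM a b u v u' v' : a <= b -> prim a b u v -> prim a b u' v' ->
  measurable_fun (itvoo a b) u -> measurable_fun (itvoo a b) u' ->
  prim a b (fun x => u x * u' x) (fun x => v x * u' x + u x * v' x).
Proof.
move=> ab [iv [c hc]] [iv' [c' hc']] mu_ mu'.
have cP : {within `[a, b], continuous (fun x => c + Prim a v x)}.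
  by move=> x; apply: cvgD; [exact: cvg_cst|exact: Prim_cont].
have cP' : {within `[a, b], continuous (fun x => c' + Prim a v' x)}.
  by move=> x; apply: cvgD; [exact: cvg_cst|exact: Prim_cont].
have mv : measurable_fun (itvoo a b) v by apply/measurable_EFinP; exact: measurable_int iv.
have mv' : measurable_fun (itvoo a b) v' by apply/measurable_EFinP; exact: measurable_int iv'.
pose w x := v x * (c' + Prim a v' x) + (c + Prim a v x) * v' x.
have i1 : mu.-integrable (itvoo a b) (EFin \o (fun x => v x * (c' + Prim a v' x))).
  by under eq_fun do rewrite mulrC; exact: integrableM_cont.
have i2 : mu.-integrable (itvoo a b) (EFin \o (fun x => (c + Prim a v x) * v' x)).
  exact: integrableM_cont.
have iw : mu.-integrable (itvoo a b) (EFin \o w).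
  by have := integrableD (measurable_itvoo a b) i1 i2; exact: eq_integrable.
have iw' : mu.-integrable (itvoo a b) (EFin \o (fun x => v x * u' x + u x * v' x)).
  apply: (integrable_ae_dom (measurable_itvoo a b) _ (integrable_norm iw)).
    by apply: measurable_funD; exact: measurable_funM.
  by apply: aeS2 hc hc' => x h h' xab; rewrite h// h'.
apply: (@prim_ae a b (fun x => (c + Prim a v x) * (c' + Prim a v' x)) _ w) => //.
- split => //; exists (c * c'); apply: nearW => x; rewrite itvooE => /andP[ax xb].
  have [ax' xb'] := (ltW ax, ltW xb).
  have ivx := integrable_sub iv (lexx a) xb'; have ivx' := integrable_sub iv' (lexx a) xb'.
  have j1 : mu.-integrable (itvoo a x) (EFin \o (fun x => v x * Prim a v' x)).
    by under eq_fun do rewrite mulrC; apply: integrableM_cont => //; exact: Prim_cont.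
  have j2 : mu.-integrable (itvoo a x) (EFin \o (fun x => Prim a v x * v' x)).
    by apply: integrableM_cont => //; exact: Prim_cont.
  have j3 := integrableZl (measurable_itvoo a x) c' ivx.
  have j4 := integrableZl (measurable_itvoo a x) c ivx'.
  have -> : Prim a w x = c' * Prim a v x + c * Prim a v' x +
     Prim a (fun s => v s * Prim a v' s + Prim a v s * v' s) x.
    rewrite -PrimZ// -PrimZ// -PrimD// -PrimD//.
    + by congr (Prim a _ x); apply/funext => s; rewrite /w; ring.
    + by have := integrableD (measurable_itvoo a x) j3 j4; exact: eq_integrable.
    + by have := integrableD (measurable_itvoo a x) j1 j2; exact: eq_integrable.
  by rewrite -PrimM//; ring.
- by apply: aeS2 hc hc' => x h h' xab; rewrite h// h'.
- by apply: aeS2 hc hc' => x h h' xab; rewrite /w h// h'.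
Qed.

Lemma prim_C1 a b F f : a < b -> {within `[a, b], continuous F} ->
  {within `[a, b], continuous f} ->
  (forall x, a < x < b -> is_derive x 1 F (f x)) ->
  mu.-integrable (itvoo a b) (EFin \o f) /\
  forall x, a <= x <= b -> F x = F a + Prim a f x.
Proof.
move=> ab cF cf dF.
have icc : mu.-integrable `[a, b] (EFin \o f).
  by apply: continuous_compact_integrable => //; exact: segment_compact.
have ioo : mu.-integrable (itvoo a b) (EFin \o f).
  by apply: integrableS icc => //; apply: subset_itvScc; rewrite bnd_simp.
split => // x /andP[]; rewrite le_eqVlt => /orP[/eqP <- _|ax xb].
  by rewrite Prim0 addr0.
have sub : `[a, x] `<=` `[a, b].
  by apply: subset_itvl; rewrite bnd_simp.
have cFx := continuous_subspaceW sub cF.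
have := @continuous_FTC2 _ f F a x ax (continuous_subspaceW sub cf).
have [_ h1 h2] := (continuous_within_itvP F ax).1 cFx.
have dLR : derivable_oo_LRcontinuous F a x.
  split => // y; rewrite in_itv/= => /andP[ay yx].
  by have [] := dF y; rewrite ?ay ?(lt_le_trans yx).
move=> /(_ dLR) h3.
rewrite (Prim_cc ioo)// /parameterized_integral /Rintegral h3 -?EFinB /=; first by rewrite subrKC.
move=> y; rewrite in_itv/= => /andP[ay yx].
by rewrite derive1E; apply: derive_val; apply: dF; rewrite ay (lt_le_trans yx).
Qed.

Lemma prim_parts a b u v phi dphi : a < b -> prim a b u v ->
  measurable_fun (itvoo a b) u ->
  mu.-integrable (itvoo a b) (EFin \o dphi) ->
  (forall x, a < x < b -> phi x = Prim a dphi x) -> Prim a dphi b = 0 ->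
  (exists M, forall x, itvoo a b x -> `|dphi x| <= M) ->
  \int[mu]_(x in itvoo a b) (u x * dphi x) = - \int[mu]_(x in itvoo a b) (v x * phi x).
Proof.
move=> /ltW ab [iv [c hc]] mu_ id ph ph0 [M hM].
have md : measurable_fun (itvoo a b) dphi by apply/measurable_EFinP; exact: measurable_int id.
have mP := Prim_meas ab iv.
have i1 : mu.-integrable (itvoo a b) (EFin \o (fun x => v x * Prim a dphi x)).
  by under eq_fun do rewrite mulrC; apply: integrableM_cont => //; exact: Prim_cont.
have i2 : mu.-integrable (itvoo a b) (EFin \o (fun x => Prim a v x * dphi x)).
  by apply: integrableM_cont => //; exact: Prim_cont.
have i3 := integrableZl (measurable_itvoo a b) c id.
rewrite (@Rint_ae_eq _ _ _ _ _ (measurable_itvoo a b) _ (fun x => c * dphi x + Prim a v x * dphi x))//.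
- rewrite RintegralD// RintegralZl// -/(Prim a dphi b) ph0 mulr0 add0r.
  have -> : \int[mu]_(x in itvoo a b) (v x * phi x) =
      \int[mu]_(x in itvoo a b) (v x * Prim a dphi x).
    by apply: eq_Rintegral => x; rewrite inE itvooE => /ph ->.
  have := PrimM ab iv id; rewrite ph0 mulr0 {1}/Prim RintegralD// => /esym/eqP.
  by rewrite addrC addr_eq0 => /eqP.
- exact: measurable_funM.
- by apply: measurable_funD; apply: measurable_funM.
- by apply: aeS hc => x h xab; rewrite h// mulrDl.
Qed.

End primitive.
#[global] Hint Resolve measurable_itvoo : core.

(** * Smooth bump functions *)

Section Ck.
Context {R : realType}.
Implicit Types V W : normedModType R.

Lemma CkW V W k (f : V -> W) : Ck k.+1 setT f -> Ck k setT f.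
Proof.
elim: k f => [|k IH] f /=.
  by move=> [h _] x _; exact/differentiable_continuous/h.
by move=> [h1 h2]; split => // v; apply: IH; exact: h2.
Qed.

Lemma CkD V W k (f g : V -> W) : Ck k setT f -> Ck k setT g ->
  Ck k setT (fun x => f x + g x).
Proof.
elim: k f g => [|k IH] f g /=.
  by move=> hf hg x _; apply: cvgD; [exact: hf|exact: hg].
move=> [f1 f2] [g1 g2]; split.
  by move=> x _; apply: differentiableD; [exact: f1|exact: g1].
move=> v; rewrite (_ : 'D_v _ = fun x => 'D_v f x + 'D_v g x); first exact: IH.
apply/funext => x.
by rewrite -[LHS]/('D_v (f + g) x) deriveD//; apply: diff_derivable; [exact: f1|exact: g1].
Qed.

Lemma CkM V k (f g : V -> R) : Ck k setT f -> Ck k setT g ->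
  Ck k setT (fun x => f x * g x).
Proof.
elim: k f g => [|k IH] f g.
  by move=> hf hg x _; apply: cvgM; [exact: hf|exact: hg].
move=> hf hg; have [f1 f2] := hf; have [g1 g2] := hg; split.
  by move=> x _; apply: differentiableM; [exact: f1|exact: g1].
move=> v; rewrite (_ : 'D_v _ = fun x => f x * 'D_v g x + g x * 'D_v f x).
  by apply: CkD; apply: IH; first [exact: f2|exact: g2|exact: CkW].
apply/funext => x.
by rewrite -[LHS]/('D_v (f * g) x) deriveM//; apply: diff_derivable; [exact: f1|exact: g1].
Qed.

Lemma Ck_cst V W k (c : W) : Ck k setT (cst c : V -> W).
Proof.
elim: k c => [|k IH] c; first by move=> x _; exact: cvg_cst.
split; first by move=> x _; exact: differentiable_cst.
move=> v; rewrite (_ : 'D_v _ = cst 0)//; apply/funext => x; exact: derive_cst.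
Qed.

(** The differential of [l] is the same map [A] at every point, so each derivative of [f \o l] is
    again a derivative of [f] composed with [l], and the induction closes without a product rule. *)
Lemma Ck_comp V V' W k (l : V -> V') (A : V -> V') (f : V' -> W) :
  (forall x, differentiable l x) -> (forall x v, 'd l x v = A v) ->
  Ck k setT f -> Ck k setT (f \o l).
Proof.
move=> dl lA; elim: k f => [|k IH] f.
  move=> hf x _; apply: continuous_comp; last exact: hf.
  exact/differentiable_continuous/dl.
move=> [f1 f2]; split.
  by move=> x _; apply: differentiable_comp; [exact: dl|exact: f1].
move=> v; rewrite (_ : 'D_v _ = 'D_(A v) f \o l); first by apply: IH; exact: f2.
apply/funext => x.
rewrite deriveE; last by apply: differentiable_comp; [exact: dl|exact: f1].
rewrite diff_comp; [|exact: dl|exact: f1].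
by rewrite /= lA -deriveE//; exact: f1.
Qed.

Lemma derive_scaleR (f : R -> R) v x : differentiable f x -> 'D_v f x = v * f^`()%classic x.
Proof.
by move=> df; rewrite deriveE// (diff1E df) /= .
Qed.

Lemma Ck_R k (f g : R -> R) : (forall x : R, is_derive x 1 f (g x)) ->
  Ck k setT g -> Ck k.+1 setT f.
Proof.
move=> fg hg; have df x : differentiable f x by apply/derivable1_diffP; case: (fg x).
split => // v; rewrite (_ : 'D_v f = fun x => v * g x).
  by apply: CkM => //; exact: Ck_cst.
by apply/funext => x; rewrite derive_scaleR// derive1E; have [_ ->] := fg x.
Qed.

(* The factor [p] makes the class closed under differentiation. *)
Definition expm (p : {poly R}) (x : R) : R :=
  if 0 < x then p.[x^-1] * expR (- x^-1) else 0.

Lemma pow_expR_le n (y : R) : 0 <= y -> y ^+ n * expR (- y) <= n`!%:R.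
Proof.
move=> y0; rewrite expRN ler_pdivrMr ?expR_gt0//.
case: n => [|n]; first by rewrite expr0 fact0 mul1r -expR0 ler_expR.
have := expR_ge1Dxn n y0.
have f0 : 0 < (n.+1)`!%:R :> R by rewrite ltr0n fact_gt0.
move=> h; rewrite mulrC -ler_pdivrMr//; apply: le_trans h.
by rewrite lerDr.
Qed.

Lemma poly_expR_bd (p : {poly R}) : exists K, forall y, 0 <= y ->
  `|p.[y] * expR (- y)| <= K.
Proof.
exists (\sum_(i < size p) `|p`_i| * i`!%:R) => y y0.
rewrite horner_coef mulr_suml; apply: (le_trans (ler_norm_sum _ _ _)).
apply: ler_sum => i _; rewrite -mulrA normrM ler_wpM2l//.
by rewrite ger0_norm ?pow_expR_le// mulr_ge0 ?exprn_ge0 ?expR_ge0.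
Qed.

Lemma is_derive_expm (p : {poly R}) (x : R) :
  is_derive x 1 (expm p) (expm ('X^2 * (p - p^`())) x).
Proof.
have [x0|x0|->] := ltrgtP x 0.
- rewrite {2}/expm ltNge (ltW x0)/=.
  have h0 : is_derive x 1 (cst (0 : R) : R -> R) 0 by exact: is_derive_cst.
  apply: near_eq_is_derive h0.
  near=> y; have y0 : y < 0 by near: y; exact: lt_nbhsl.
  by rewrite /expm ltNge (ltW y0).
- rewrite {2}/expm x0.
  apply: (@near_eq_is_derive R R R (fun y => p.[y^-1] * expR (- y^-1))).
    near=> y; rewrite /expm (_ : 0 < y)//.
    by near: y; exact: lt_nbhsr.
  have xn0 : x != 0 by rewrite gt_eqF.
  have dV : is_derive x 1 (fun y : R => y^-1) (- x ^- 2 *: 1) by apply: is_deriveV.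
  have dp : is_derive x^-1 1 (horner p) p^`().[x^-1].
    by rewrite derivE; apply: DeriveDef; [exact: derivable_horner|rewrite derive1E].
  have d1 := is_derive1_comp dp dV.
  have d2 := @is_derive1_comp _ expR (fun y => - y^-1) x _ _ (is_derive_expR (- x^-1)) (is_deriveN dV).
  have d3 := is_deriveM d1 d2.
  apply: (is_derive_eq d3).
  rewrite !hornerE /= /GRing.scale /=; field.
  exact: xn0.
- rewrite {2}/expm ltxx.
  (* For [h > 0] the difference quotient at 0 is [h] times [y^2 p(y) exp(-y)] at [y = 1/h], and that
     factor is bounded. *)
  have [K hK] := poly_expR_bd ('X^2 * p).
  have lim0 : h^-1 *: ((expm p \o shift 0) (h *: 1) - expm p 0) @[h --> 0^'] --> (0 : R).
    apply/cvgr0Pnorm_lt => e e0.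
    have K1 : 0 < `|K| + 1 by rewrite ltr_wpDl.
    near=> h.
    rewrite /= addr0 /expm ltxx subr0 /GRing.scale/= mulr1.
    case: ifPn => h0; last by rewrite mulr0 normr0.
    have hV : 0 <= h^-1 by rewrite invr_ge0 ltW.
    have := hK _ hV; rewrite !hornerE /= => hh.
    have -> : h^-1 * p.[h^-1] * expR (- h^-1) =
       h * (h^-1 ^+ 2 * p.[h^-1] * expR (- h^-1)) by field; rewrite gt_eqF.
    rewrite normrM (le_lt_trans (ler_wpM2l _ hh))//.
    rewrite (le_lt_trans (ler_wpM2l _ (ler_norm _)))//.
    apply: (@le_lt_trans _ _ (`|h| * (`|K| + 1))); first by rewrite ler_wpM2l// lerDl.
    rewrite -ltr_pdivlMr//.
    by near: h; apply: dnbhs0_lt; rewrite divr_gt0.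
  apply: DeriveDef; first by apply/cvg_ex; exists 0.
  exact/cvg_lim.
Unshelve. all: by end_near. Qed.

Lemma expm_smooth p : smooth setT (expm p).
Proof.
move=> k; elim: k p => [|k IH] p.
  have := @Ck_R 0 _ _ (is_derive_expm p).
  move=> _ x _; apply/differentiable_continuous/derivable1_diffP.
  by case: (is_derive_expm p x).
by apply: Ck_R; [exact: is_derive_expm|exact: IH].
Qed.

Lemma affine_diff (m a x : R) : is_derive x 1 (fun y : R => m * y + a) m.
Proof.
have -> : (fun y : R => m * y + a) = (m *: (id : R -> R)) + cst a by apply/funext.
apply: is_derive_eq; rewrite /GRing.scale/= ; ring.
Qed.

Lemma smooth_affine (f : R -> R) (m a : R) : smooth setT f ->
  smooth setT (fun x : R => f (m * x + a)).
Proof.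
move=> hf k; have dx x := affine_diff m a x.
have da x : differentiable (fun y : R => m * y + a) x.
  by apply/derivable1_diffP; case: (dx x).
apply: (@Ck_comp _ _ _ k (fun y : R => m * y + a) (fun v => m * v)) => // x v.
by rewrite -deriveE// derive_scaleR// derive1E; have [_ ->] := dx x; rewrite mulrC.
Qed.

(* Vanishes outside [a, b] and tends to the indicator of ]a, b[ as [m] grows. *)
Definition sbump (m a b x : R) : R :=
  expm 1 (m * x + (- (m * a))) * expm 1 (- m * x + m * b).

Lemma sbump_smooth m a b : smooth setT (sbump m a b).
Proof. by move=> k; apply: CkM; apply: smooth_affine; exact: expm_smooth. Qed.

Lemma sbumpE m a b x : 0 < m -> sbump m a b x = if a < x < b then
  expR (- (m * (x - a))^-1) * expR (- (m * (b - x))^-1) else 0.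
Proof.
move=> m0; rewrite /sbump /expm.
have -> : m * x + - (m * a) = m * (x - a) by ring.
have -> : - m * x + m * b = m * (b - x) by ring.
rewrite !pmulr_rgt0// !subr_gt0 !hornerE.
by case: (a < x); case: (x < b); rewrite ?mulr0 ?mul0r.
Qed.

Lemma sbump_ge0 m a b x : 0 < m -> 0 <= sbump m a b x.
Proof. by move=> m0; rewrite sbumpE//; case: ifP => // _; rewrite mulr_ge0 ?expR_ge0. Qed.

Lemma sbump_le1 m a b x : 0 < m -> sbump m a b x <= 1.
Proof.
move=> m0; rewrite sbumpE//; case: ifP => [/andP[ax xb]|_]; last exact: ler01.
by rewrite mulr_ile1 ?expR_ge0// -expR0 ler_expR oppr_le0 invr_ge0 mulr_ge0 ?subr_ge0 ?ltW.
Qed.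

Lemma sbump_cvg a b x :
  sbump n.+1%:R a b x @[n --> \oo] --> ((a < x :> R)%:R * (x < b :> R)%:R : R).
Proof.
have key (t : R) : 0 < t -> expR (- (n.+1%:R * t)^-1) @[n --> \oo] --> (1 : R).
  move=> t0; suff : expR (- (n.+1%:R * t)^-1) @[n --> \oo] --> (expR (- (0 * t^-1)) : R).
    by rewrite mul0r oppr0 expR0.
  apply: (cvg_comp (fun n : nat => - (n.+1%:R * t)^-1) expR); last exact: continuous_expR.
  apply: cvgN.
  under eq_fun do rewrite invfM.
  apply: cvgM; last exact: cvg_cst.
  exact: cvg_harmonic.
have nE n : sbump n.+1%:R a b x = if a < x < b then
  expR (- (n.+1%:R * (x - a))^-1) * expR (- (n.+1%:R * (b - x))^-1) else 0.
  by apply: sbumpE; rewrite ltr0n.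
under eq_fun do rewrite nE.
have [/andP[ax xb]|nab] := boolP (a < x < b).
  rewrite ax xb mulr1.
  have := cvgM (key _ (_ : 0 < x - a)) (key _ (_ : 0 < b - x)).
  by rewrite mulr1; apply; rewrite subr_gt0.
by move: nab; case: (a < x); case: (x < b) => //= _; rewrite ?mulr0 ?mul0r; exact: cvg_cst.
Qed.

Lemma sbump_gt0 m a b x : 0 < m -> a < x < b -> 0 < sbump m a b x.
Proof. by move=> m0 h; rewrite sbumpE// h mulr_gt0 ?expR_gt0. Qed.

Lemma sbump_eq0 m a b x : 0 < m -> ~~ (a < x < b) -> sbump m a b x = 0.
Proof. by move=> m0 /negbTE h; rewrite sbumpE// h. Qed.

Lemma supp_test (A B a b : R) (f : R -> R) : A < a -> b < B -> smooth setT f ->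
  (forall x, ~~ (a <= x <= b) -> f x = 0) -> test_fun (`]A, B[ : set R) f.
Proof.
move=> Aa bB sf f0.
have sub : closure [set x | f x != 0] `<=` `[a, b].
  have cab : closed (`[a, b] : set R) by exact: itv_closed.
  rewrite ((closure_id `[a, b]).1 cab).
  apply: closureS => x /=; rewrite in_itv/=.
  by case: (boolP (a <= x <= b)) => // /f0 ->; rewrite eqxx.
split => //.
- apply: (subclosed_compact _ (@segment_compact _ a b)) => //; exact: closed_closure.
- move=> x /sub /=; rewrite !in_itv/= => /andP[h1 h2].
  by rewrite (lt_le_trans Aa h1) (le_lt_trans h2 bB).
Qed.

Lemma sbump_supp m a b x : 0 < m -> ~~ (a <= x <= b) -> sbump m a b x = 0.
Proof.
by move=> m0 h; apply: sbump_eq0 => //; apply: contra h => /andP[h1 h2]; rewrite !ltW.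
Qed.

End Ck.

(** * Weak derivatives on an interval *)

Lemma Rint_dct d (T : measurableType d) (R : realType)
    (mu : {measure set T -> \bar R}) (D : set T) (f_ : nat -> T -> R) (f h : T -> R) :
  measurable D -> (forall n, measurable_fun D (f_ n)) ->
  mu.-integrable D (EFin \o h) ->
  (forall x, D x -> f_ ^~ x @ \oo --> f x) ->
  (forall n x, D x -> `|f_ n x| <= h x) ->
  (fun n => \int[mu]_(x in D) f_ n x) @ \oo --> \int[mu]_(x in D) f x.
Proof.
move=> mD mf ih cf fh.
have mf' : measurable_fun D f by apply: measurable_fun_cvg cf.
have nf x : D x -> `|f x| <= h x.
  move=> Dx; have cn := @cvg_norm _ _ _ _ _ _ _ (cf x Dx).
  have -> : `|f x| = limn (fun n => `|f_ n x|) by apply/esym/cvg_lim => //; exact: cn.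
  apply: limr_le; first by apply/cvg_ex; exists `|f x|; exact: cn.
  by apply: nearW => n; exact: fh.
have i_f : mu.-integrable D (EFin \o f) by apply: (integrable_dom mD _ ih).
have H := @dominated_cvg _ _ _ mu _ mD (fun n => EFin \o f_ n) (EFin \o f) (EFin \o h)
  (fun n => (measurable_EFinP _ _).2 (mf n)).
have {}H : (\int[mu]_(x in D) (EFin \o f_ n) x)%E @[n --> \oo] --> (\int[mu]_(x in D) (EFin \o f) x)%E.
  apply: H => //.
  - move=> x Dx; apply: cvg_EFin; first exact: nearW.
    exact: cf.
apply: fine_cvg; rewrite fineK//; exact: integrable_fin_num.
Qed.

Lemma Rint_ge0_eq0 d (T : measurableType d) (R : realType)
    (mu : {measure set T -> \bar R}) (D : set T) (f : T -> R) :
  measurable D -> mu.-integrable D (EFin \o f) -> (forall x, D x -> 0 <= f x) ->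
  \int[mu]_(x in D) f x = 0 -> {ae mu, forall x, D x -> f x = 0}.
Proof.
move=> mD i_f f0 e0.
have : (\int[mu]_(x in D) `|(f x)%:E| = 0)%E.
  rewrite (eq_integral (fun x => (f x)%:E)); last first.
    by move=> x; rewrite inE => Dx; rewrite gee0_abs// lee_fin f0.
  move/(integrable_fin_num mD)/fineK : (i_f) => /= <-.
  by rewrite -[fine _]/(\int[mu]_(x in D) f x) e0.
move/ae_eq_integral_abs => -[]//; first exact: measurable_int i_f.
move=> N [mN N0 hN]; exists N; split => //; apply: subset_trans hN.
by move=> x /= h1 h2; apply: h1 => Dx; have [] := h2 Dx.
Qed.

(** The middle third of []A, B[] carries the reference bump that corrects the mean in
    [test_family]. *)
Definition third_lo {R : realType} (A B : R) := (2 * A + B) / 3.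
Definition third_hi {R : realType} (A B : R) := (A + 2 * B) / 3.

Lemma third_lt {R : realType} (A B : R) : A < B ->
  [/\ A < third_lo A B, third_lo A B < third_hi A B & third_hi A B < B].
Proof. by rewrite /third_lo /third_hi => AB; split; lra. Qed.

Section fundamental.
Context {R : realType}.
Local Notation mu := (@lebesgue_measure R).
Implicit Types (A B : R).

(** The bumps increase in steepness to the indicator of []p, q[], so by dominated convergence the
    integral of [g] over []p, q[] vanishes. *)
Lemma Prim_pq A B p q (g : R -> R) : mu.-integrable (itvoo A B) (EFin \o g) ->
  A < p -> p <= q -> q < B ->
  (forall n, \int[mu]_(t in itvoo A B) (g t * sbump n.+1%:R p q t) = 0) ->
  Prim A g p = Prim A g q.
Proof.
move=> ig Ap pq qB h.
have mg : measurable_fun (itvoo A B) g by apply/measurable_EFinP; exact: measurable_int ig.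
have mb n : measurable_fun (itvoo A B) (sbump n.+1%:R p q).
  apply: measurable_funTS; apply: continuous_measurable_fun => x.
  exact: (@sbump_smooth R n.+1%:R p q 0%N x I).
have n0 n : 0 < n.+1%:R :> R by rewrite ltr0n.
have := @Rint_dct _ _ _ mu (itvoo A B) (fun n t => g t * sbump n.+1%:R p q t)
   (fun t => g t * ((p < t :> R)%:R * (t < q :> R)%:R)) (fun t => `|g t|)
   (measurable_itvoo A B) (fun n => measurable_funM mg (mb n)) (integrable_norm ig).
have E : (fun n => \int[mu]_(t in itvoo A B) (g t * sbump n.+1%:R p q t)) = cst 0.
  by apply/funext => n; rewrite h.
rewrite E => /(_ _ _)/cvg_lim H.
have : \int[mu]_(t in itvoo A B) (g t * ((p < t :> R)%:R * (t < q :> R)%:R)) = 0.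
  rewrite -[LHS]H//; first by rewrite lim_cst.
  - by move=> x _; apply: cvgM; [exact: cvg_cst|exact: sbump_cvg].
  - by move=> n x _; rewrite normrM ler_piMr// ger0_norm ?sbump_ge0 ?sbump_le1.
under eq_Rintegral do rewrite mulrA.
rewrite (Rint_lt_left A (fun t => g t * (p < t :> R)%:R) (ltW qB)).
rewrite (Rint_lt_right q g (ltW Ap)) => h0.
have := Prim_split ig (ltW Ap) pq (ltW qB).
by rewrite /Prim h0 => /subr0_eq ->.
Qed.

(** Rational endpoints keep the set of test functions countable; density of the rationals and
    continuity of the primitive recover all points of the interval. *)
Lemma Prim_rat_const A B (g : R -> R) : A < B -> mu.-integrable (itvoo A B) (EFin \o g) ->
  (forall (n : nat) (p q : rat), A < ratr p -> ratr q < B ->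
    \int[mu]_(t in itvoo A B) (g t * sbump n.+1%:R (ratr p) (ratr q) t) = 0) ->
  forall x, A <= x <= B -> Prim A g x = 0.
Proof.
move=> AB ig h.
have hrat (p q : rat) : A < ratr p :> R -> ratr p < B :> R -> A < ratr q :> R -> ratr q < B :> R ->
    Prim A g (ratr p) = Prim A g (ratr q).
  move=> h1 h2 h3 h4; have [pq|/ltW qp] := leP (ratr p) (ratr q : R).
    by apply: Prim_pq ig _ _ _ _ => // n; exact: h.
  by apply/esym; apply: Prim_pq ig _ _ _ _ => // n; exact: h.
have [q0 /[!in_itv]/= /andP[q1 q2]] := rat_in_itvoo AB.
have cP := Prim_cont (ltW AB) ig.
have hk x : A <= x <= B -> Prim A g x = Prim A g (ratr q0).
  move=> xAB; apply/eqP/negPn/negP => ne.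
  have e0 : 0 < `|Prim A g x - Prim A g (ratr q0)| by rewrite normr_gt0 subr_eq0.
  move/subspace_continuousP : cP => /(_ x); rewrite /= in_itv/= => /(_ xAB).
  move/cvgrPdist_lt => /(_ _ e0); rewrite near_withinE => /nbhs_ballP[d /= d0 hd].
  have lt1 : Num.max A (x - d) < Num.min B (x + d).
    rewrite lt_min !gt_max AB /=; move: xAB => /andP[h1 h2].
    by apply/and3P; split; lra.
  have [q /[!in_itv]/= /andP[]] := rat_in_itvoo lt1.
  rewrite gt_max lt_min => /andP[h1 h2] /andP[h3 h4].
  have bq : ball x d (ratr q : R) by rewrite /ball/= ltr_norml; apply/andP; split; lra.
  have qAB : (ratr q : R) \in `[A, B] by rewrite in_itv/= !ltW.
  have := hd _ bq qAB.
  have -> : from_subspace `[A, B] (Prim A g) (ratr q) = Prim A g (ratr q0) by exact: hrat.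
  by rewrite ltxx.
by move=> x /hk ->; rewrite -(hk A) ?lexx ?ltW// Prim0.
Qed.

(** Lebesgue differentiation of the primitive of the zero extension of [g]. *)
Lemma Prim_eq0_ae A B (g : R -> R) : mu.-integrable (itvoo A B) (EFin \o g) ->
  (forall x, A <= x <= B -> Prim A g x = 0) ->
  {ae mu, forall x, itvoo A B x -> g x = 0}.
Proof.
move=> ig h0.
pose f := g \_ (itvoo A B).
have i_f : mu.-integrable setT (EFin \o f).
  have := (integrable_mkcond _ (measurable_itvoo A B)).1 ig.
  by apply: eq_integrable => // x _; rewrite /f /= !patchE; case: ifP.
have lf : locally_integrable [set: R] f by exact: (integrable_locally (measurable_itvoo A B) ig).
have iy y : mu.-integrable `]-oo, y] (EFin \o f) by apply: integrableS i_f.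
have := FTC1Ny iy lf; apply: aeS => x [df d1] /[dup] xAB; rewrite itvooE => /andP[Ax xB].
have fx : f x = g x by rewrite /f patchE mem_set.
rewrite -fx -d1.
have F0 y : A <= y <= B -> \int[mu]_(t in `]-oo, y]) f t = 0.
  move=> /andP[Ay yB]; rewrite -(Rintegral_itv_bndo_bndc (a := -oo%O)); last first.
    by apply: integrableS i_f.
  rewrite -[RHS](h0 y) ?Ay// /Prim /f.
  rewrite [RHS]Rintegral_mkcond [LHS]Rintegral_mkcond.
  congr Rintegral; apply/funext => t; rewrite !patchE !mem_setE /= !in_itv/=.
  case: (ltP A t) => At /=; last by case: ifP.
  by case: (ltP t y) => //= ty; rewrite (lt_le_trans ty yB).
rewrite derive1E.
rewrite -(@near_eq_derive _ _ _ (cst 0)) ?derive_cst//.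
near=> y; rewrite F0//; apply/andP; split; apply: ltW; near: y.
- exact: lt_nbhsr.
- exact: lt_nbhsl.
Unshelve. all: by end_near. Qed.

Lemma fundamental_lemma A B (g : R -> R) : A < B -> mu.-integrable (itvoo A B) (EFin \o g) ->
  (forall (n : nat) (p q : rat), A < ratr p -> ratr q < B ->
    \int[mu]_(t in itvoo A B) (g t * sbump n.+1%:R (ratr p) (ratr q) t) = 0) ->
  {ae mu, forall x, itvoo A B x -> g x = 0}.
Proof. by move=> AB ig h; apply: Prim_eq0_ae => //; exact: Prim_rat_const. Qed.

(** Integrating from minus infinity makes the antiderivative smooth on the whole line, as a test
    function has to be; on [[A, B]] it is [Prim A z] when the support of [z] lies inside. *)
Definition antider (z : R -> R) (x : R) : R := \int[mu]_(t in `]-oo, x]) z t.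

Section antider.
Variables (a b A B : R) (z : R -> R).
Hypotheses (Aa : A < a) (bB : b < B) (sz : smooth setT z).
Hypothesis z0 : forall x, ~~ (a <= x <= b) -> z x = 0.

Lemma supp_integrable : mu.-integrable setT (EFin \o z).
Proof.
have cz : continuous z by move=> x; exact: (sz 0%N x I).
have icc : mu.-integrable `[a, b] (EFin \o z).
  apply: continuous_compact_integrable; first exact: segment_compact.
  exact: continuous_subspaceT.
have mab : measurable (`[a, b] : set (measurableTypeR R)) by exact: measurable_itv.
have := (integrable_mkcond (mu := mu) _ mab).1 icc.
apply: eq_integrable => // x _; rewrite /= patchE mem_setE in_itv/=.
by case: ifPn => // /z0 ->.
Qed.

Lemma antider_derive (x : R) : is_derive x 1 (antider z) (z x).
Proof.
have x1 : x < x + 1 by rewrite ltrDl.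
have i1 : mu.-integrable `]-oo, (x + 1)] (EFin \o z) by apply: integrableS supp_integrable.
have cz : {for x, continuous z} by exact: (sz 0%N x I).
have [h1 h2] := @continuous_FTC1 _ z -oo%O x (x + 1) x1 i1 (ltNyr _) cz.
exact: (DeriveDef h1 (etrans (esym (derive1E _ _)) h2)).
Qed.

Lemma antider_smooth : smooth setT (antider z).
Proof.
move=> [|k]; last by apply: Ck_R; [exact: antider_derive|exact: sz].
move=> x _; apply/differentiable_continuous/derivable1_diffP.
by case: (antider_derive x).
Qed.

Lemma antider_Prim x : A <= x -> antider z x = Prim A z x.
Proof.
move=> Ax; rewrite /antider -(Rintegral_itv_bndo_bndc (a := -oo%O)); last first.
  by apply: integrableS supp_integrable.
rewrite /Prim.
rewrite [RHS]Rintegral_mkcond [LHS]Rintegral_mkcond.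
congr Rintegral; apply/funext => t; rewrite !patchE !mem_setE /= !in_itv/=.
case: (ltP A t) => At /=; first by [].
by rewrite z0 ?if_same// negb_and -ltNge (le_lt_trans At Aa).
Qed.

Lemma antider_left x : x < a -> antider z x = 0.
Proof.
move=> xa; rewrite /antider.
under eq_Rintegral => t.
  rewrite inE/= in_itv/= => tx.
  rewrite z0; last by rewrite negb_and -ltNge (le_lt_trans tx xa).
  over.
by rewrite Rintegral_cst// mul0r.
Qed.

Lemma antider_right x : b < x -> antider z x = Prim A z B.
Proof.
move=> bx.
have [ab|ba] := leP a b; last first.
  have zz t : z t = 0 by apply: z0; apply/negP => /andP[h1 h2]; move: (le_trans h1 h2); rewrite leNgt ba.
  rewrite /antider /Prim; under eq_Rintegral do rewrite zz.
  by under [RHS]eq_Rintegral do rewrite zz; rewrite !Rintegral_cst// !mul0r.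
rewrite antider_Prim; last by rewrite ltW// (lt_trans Aa)// (le_lt_trans ab).
rewrite /Prim [RHS]Rintegral_mkcond [LHS]Rintegral_mkcond.
congr Rintegral; apply/funext => t; rewrite !patchE !mem_setE /= !in_itv/=.
have [tb|bt] := leP t b; first by rewrite (le_lt_trans tb bx) (le_lt_trans tb bB).
by rewrite z0 ?if_same// negb_and -!ltNge bt orbT.
Qed.

Lemma antider_test : Prim A z B = 0 -> test_fun (`]A, B[ : set R) (antider z).
Proof.
move=> P0; apply: (@supp_test _ A B a b) => //; first exact: antider_smooth.
move=> x; rewrite negb_and -!ltNge => /orP[/antider_left//|/antider_right ->//].
Qed.
End antider.

(** * Du Bois-Reymond's lemma: weak derivatives and absolute continuity on an interval *)

Section weak1.
Variables (A B : R).
Hypothesis AB : A < B.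

Local Notation a0 := (third_lo A B).
Local Notation b0 := (third_hi A B).

(* Countably many test functions determine weak derivatives; countability lets the
   exceptional null sets of the slices below be united. *)
Definition test_family (i : nat * rat * rat) (x : R) : R :=
  sbump i.1.1.+1%:R (ratr i.1.2) (ratr i.2) x +
  - (Prim A (sbump i.1.1.+1%:R (ratr i.1.2) (ratr i.2)) B / Prim A (sbump 1 a0 b0) B)
    * sbump 1 a0 b0 x.

Let bump_int m p q : 0 < m -> mu.-integrable setT (EFin \o sbump m p q).
Proof.
move=> m0; apply: (@supp_integrable p q _ (sbump_smooth m p q)) => x; exact: sbump_supp.
Qed.

Let bump_int' m p q : 0 < m -> mu.-integrable (itvoo A B) (EFin \o sbump m p q).
Proof. by move=> m0; apply: integrableS (bump_int p q m0). Qed.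

Let Aa0 : A < a0. Proof. by case: (third_lt AB). Qed.
Let b0B : b0 < B. Proof. by case: (third_lt AB). Qed.
Let ab0 : a0 < b0. Proof. by case: (third_lt AB). Qed.

Let mass0 : Prim A (sbump 1 a0 b0) B != 0.
Proof.
apply/negP => /eqP P0.
have i1 := bump_int' a0 b0 ltr01.
have := Rint_ge0_eq0 (measurable_itvoo A B) i1 (fun x _ => sbump_ge0 a0 b0 x ltr01) P0.
move=> [N [mN N0 hN]].
have : (mu (itvoo a0 b0) <= 0)%E.
  rewrite -N0 le_measure ?inE// => x; rewrite itvooE => xab; apply: hN => /= h.
  have : itvoo A B x.
    by rewrite itvooE; move: xab => /andP[h1 h2]; rewrite (lt_trans Aa0 h1) (lt_trans h2 b0B).
  by move=> /h /eqP; rewrite gt_eqF// sbump_gt0.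
by rewrite /itvoo lebesgue_measure_itv/= lte_fin ab0 -EFinD lee_fin leNgt subr_gt0 ab0.
Qed.

Lemma test_family_smooth i : smooth setT (test_family i).
Proof.
move=> k; apply: CkD; first exact: sbump_smooth.
by apply: CkM; [exact: Ck_cst|exact: sbump_smooth].
Qed.

Lemma test_family_supp i x : ~~ (Num.min a0 (ratr i.1.2) <= x <= Num.max b0 (ratr i.2)) ->
  test_family i x = 0.
Proof.
move=> h; rewrite /test_family.
have -> : sbump 1 a0 b0 x = 0.
  by apply: sbump_supp => //; apply: contra h => /andP[h1 h2]; rewrite ge_min le_max h1 h2.
rewrite mulr0 addr0; apply: sbump_supp; first by rewrite ltr0n.
by apply: contra h => /andP[h1 h2]; rewrite ge_min le_max h1 h2 !orbT.
Qed.

Lemma test_family_int i : mu.-integrable (itvoo A B) (EFin \o test_family i).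
Proof.
by apply: integrableS (supp_integrable (test_family_smooth i) (@test_family_supp i)).
Qed.

(** The multiple of the reference bump is subtracted to reach mean zero, the condition under which
    the antiderivative has compact support in []A, B[]. *)
Lemma test_family_Prim i : Prim A (test_family i) B = 0.
Proof.
rewrite /test_family PrimD.
- rewrite PrimZ; last exact: bump_int'.
  by rewrite mulNr divfK// subrr.
- by apply: bump_int'; rewrite ltr0n.
- have := integrableZl (measurable_itvoo A B)
    (- (Prim A (sbump i.1.1.+1%:R (ratr i.1.2) (ratr i.2)) B / Prim A (sbump 1 a0 b0) B)) (bump_int' a0 b0 ltr01).
  exact: eq_integrable.
Qed.

Lemma test_family_test i : A < ratr i.1.2 -> ratr i.2 < B ->
  test_fun (`]A, B[ : set R) (antider (test_family i)).
Proof.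
move=> h1 h2; apply: (@antider_test (Num.min a0 (ratr i.1.2)) (Num.max b0 (ratr i.2))).
- by rewrite lt_min Aa0.
- by rewrite gt_max b0B.
- exact: test_family_smooth.
- exact: test_family_supp.
- exact: test_family_Prim.
Qed.

Lemma cont_bounded (f : R -> R) : {within `[A, B], continuous f} ->
  exists M, forall x, itvoo A B x -> `|f x| <= M.
Proof.
move=> cf; have cn : {within `[A, B], continuous (fun x => `|f x|)}.
  by move=> x; apply: continuous_comp; [exact: cf|exact: norm_continuous].
have [c _ hc] := EVT_max (ltW AB) cn.
exists (`|f c|) => x; rewrite itvooE => /andP[ax xb]; apply: hc.
by rewrite in_itv/= !ltW.
Qed.

(** By parts, [u - Prim A v] is orthogonal to each member of the family. As the members are bumps
    corrected by the reference bump, [u - Prim A v - k] is orthogonal to the bumps themselves for a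
    suitable constant [k]. *)
Lemma weak_prim u v : mu.-integrable (itvoo A B) (EFin \o u) ->
  mu.-integrable (itvoo A B) (EFin \o v) ->
  (forall i, A < ratr i.1.2 -> ratr i.2 < B ->
    \int[mu]_(x in itvoo A B) (u x * test_family i x) =
    - \int[mu]_(x in itvoo A B) (v x * antider (test_family i) x)) ->
  prim A B u v.
Proof.
move=> iu iv h.
have cfam i : {within `[A, B], continuous (test_family i)}.
  by apply: continuous_subspaceT => x; exact: (test_family_smooth i 0%N x I).
have iV : mu.-integrable (itvoo A B) (EFin \o Prim A v).
  apply: (integrable_bd (measurable_itvoo A B) (itvoo_fin A B) (K := Prim A (fun s => `|v s|) B)).
    exact: Prim_meas (ltW AB) iv.
  by apply: aeW => x; rewrite itvooE => /andP[_ /ltW xB]; exact: Prim_bd iv xB.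
have e1 i : A < ratr i.1.2 -> ratr i.2 < B ->
    \int[mu]_(x in itvoo A B) ((u x - Prim A v x) * test_family i x) = 0.
  move=> h1 h2.
  have aP x : A < x < B -> antider (test_family i) x = Prim A (test_family i) x.
    move=> /andP[/ltW Ax _].
    apply: (@antider_Prim (Num.min a0 (ratr i.1.2)) (Num.max b0 (ratr i.2)) A) => //.
    - by rewrite lt_min Aa0.
    - exact: test_family_smooth.
    - exact: test_family_supp.
  have := prim_parts AB (Prim_prim iv) (Prim_meas (ltW AB) iv) (test_family_int i)
    aP (test_family_Prim i) (cont_bounded (cfam i)).
  rewrite -h// => e.
  under eq_Rintegral do rewrite mulrBl.
  rewrite RintegralB//; first by rewrite e subrr.
  - by under eq_fun do rewrite mulrC; apply: integrableM_cont => //; exact: ltW.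
  - by under eq_fun do rewrite mulrC; apply: integrableM_cont => //; exact: ltW.
(* The mean of [u - Prim A v] weighted by the reference bump, which is the value that the correction
   term of [test_family] produces. *)
pose k := \int[mu]_(x in itvoo A B) ((u x - Prim A v x) * sbump 1 a0 b0 x) / Prim A (sbump 1 a0 b0) B.
have ih : mu.-integrable (itvoo A B) (EFin \o (fun x => u x - Prim A v x)).
  by have := integrableB (measurable_itvoo A B) iu iV; exact: eq_integrable.
have ihk : mu.-integrable (itvoo A B) (EFin \o (fun x => u x - Prim A v x - k)).
  have ik : mu.-integrable (itvoo A B) (EFin \o cst k).
    by apply: (@integrable_bd _ _ _ mu _ (measurable_itvoo A B) (itvoo_fin A B) `|k|) => //; exact: aeW.
  by have := integrableB (measurable_itvoo A B) ih ik; exact: eq_integrable.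
have cb m p q : {within `[A, B], continuous (sbump m p q)}.
  by apply: continuous_subspaceT => x; exact: (sbump_smooth m p q 0%N x I).
split => //; exists k.
have := @fundamental_lemma A B (fun x => u x - Prim A v x - k) AB ihk.
have key : (forall (n : nat) (p q : rat), A < ratr p -> ratr q < B ->
    \int[mu]_(t in itvoo A B) ((u t - Prim A v t - k) * sbump n.+1%:R (ratr p) (ratr q) t) = 0).
  move=> n p q h1 h2; have := e1 (n, p, q) h1 h2; rewrite /test_family /=.
  set bb := sbump n.+1%:R _ _; set K := Prim A bb B => E.
  have i1 : mu.-integrable (itvoo A B) (EFin \o (fun x => (u x - Prim A v x) * bb x)).
    under eq_fun do rewrite mulrC.
    by apply: integrableM_cont (ltW AB) ih _; exact: cb.
  have i2 : mu.-integrable (itvoo A B) (EFin \o (fun x => (u x - Prim A v x) * sbump 1 a0 b0 x)).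
    under eq_fun do rewrite mulrC.
    by apply: integrableM_cont (ltW AB) ih _; exact: cb.
  have ib : mu.-integrable (itvoo A B) (EFin \o bb) by apply: bump_int'; rewrite ltr0n.
  under eq_Rintegral do rewrite mulrBl.
  have ikb : mu.-integrable (itvoo A B) (EFin \o (fun x => k * bb x)).
    by have := integrableZl (measurable_itvoo A B) k ib; exact: eq_integrable.
  rewrite (RintegralB (measurable_itvoo A B) i1 ikb) -/(Prim A (fun x => k * bb x) B).
  rewrite PrimZ// -/K /k.
  have : \int[mu]_(x in itvoo A B) ((u x - Prim A v x) * bb x) +
     (- (K / Prim A (sbump 1 a0 b0) B)) * \int[mu]_(x in itvoo A B) ((u x - Prim A v x) * sbump 1 a0 b0 x) = 0.
    rewrite -RintegralZl// -RintegralD//; last first.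
      by have := integrableZl (measurable_itvoo A B) (- (K / Prim A (sbump 1 a0 b0) B)) i2; exact: eq_integrable.
    by rewrite -[RHS]E; apply: eq_Rintegral => x _; ring.
  by move=> <-; rewrite mulNr; congr (_ - _); field; exact: mass0.
by move=> /(_ key); apply: aeS => x /[apply] /eqP; rewrite subr_eq0 => /eqP <-; rewrite subrK.
Qed.

Lemma prim_test u v phi dphi : prim A B u v -> measurable_fun (itvoo A B) u ->
  (forall x : R, is_derive x 1 phi (dphi x)) -> continuous dphi ->
  phi A = 0 -> phi B = 0 ->
  \int[mu]_(x in itvoo A B) (u x * dphi x) = - \int[mu]_(x in itvoo A B) (v x * phi x).
Proof.
move=> puv mu_ dp cd pA pB.
have cp : continuous phi.
  by move=> x; apply/differentiable_continuous/derivable1_diffP; case: (dp x).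
have [i1 h1] := prim_C1 AB (continuous_subspaceT cp) (continuous_subspaceT cd) (fun x _ => dp x).
apply: prim_parts => //.
- by move=> x /andP[h2 h3]; rewrite h1 ?pA ?add0r// !ltW.
- by have := h1 B; rewrite pA pB add0r lexx ltW// => /(_ isT).
- by apply: cont_bounded; exact: continuous_subspaceT.
Qed.

(** Two densities of one function make [v - v'] a density of a constant, which also has density 0;
    testing both against bumps gives orthogonality of [v - v'] to every bump. *)
Lemma prim_uniq u v v' : prim A B u v -> prim A B u v' ->
  {ae mu, forall x, itvoo A B x -> v x = v' x}.
Proof.
move=> [iv [c hc]] [iv' [c' hc']].
have ivv : mu.-integrable (itvoo A B) (EFin \o (fun x => v x - v' x)).
  by have := integrableB (measurable_itvoo A B) iv iv'; exact: eq_integrable.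
have iN : mu.-integrable (itvoo A B) (EFin \o (fun x => (-1) * v' x)).
  by have := integrableZl (measurable_itvoo A B) (-1) iv'; exact: eq_integrable.
have pc : prim A B (cst (c' - c)) (fun x => v x - v' x).
  split => //; exists 0; apply: aeS2 hc hc' => x h h' xAB.
  have xB : x <= B by move: xAB; rewrite itvooE => /andP[_ /ltW].
  have -> : Prim A (fun x => v x - v' x) x = Prim A v x - Prim A v' x.
    have -> : (fun x => v x - v' x) = (fun x => v x + (-1) * v' x) by apply/funext => t; ring.
    rewrite PrimD; [|exact: (integrable_sub iv)|exact: (integrable_sub iN)].
    by rewrite PrimZ; [ring|exact: (integrable_sub iv')].
  by have := h xAB; rewrite h'// => e; rewrite add0r /=; lra.
have := @fundamental_lemma A B _ AB ivv.
have key : forall (n : nat) (p q : rat), A < ratr p -> ratr q < B ->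
    \int[mu]_(t in itvoo A B) ((v t - v' t) * sbump n.+1%:R (ratr p) (ratr q) t) = 0.
  move=> n p q h1 h2.
  have bs := sbump_smooth n.+1%:R (ratr p : R) (ratr q).
  have db (x : R) : is_derive x 1 (sbump n.+1%:R (ratr p : R) (ratr q)) ((sbump n.+1%:R (ratr p : R) (ratr q))^`()%classic x).
    have [d1 _] := bs 1%N.
    by apply: DeriveDef; [exact/derivable1_diffP/d1|rewrite derive1E].
  have cd : continuous (sbump n.+1%:R (ratr p : R) (ratr q))^`()%classic.
    have [_ d2] := bs 1%N; move=> x.
    rewrite (_ : _^`()%classic = 'D_1 (sbump n.+1%:R (ratr p : R) (ratr q))).
      exact: (d2 1 x I).
    by apply/funext => y; rewrite derive1E.
  have := prim_test pc _ db cd.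
  have nA : ~~ (ratr p < A < ratr q) by rewrite negb_and -!leNgt (ltW h1).
  have nB : ~~ (ratr p < B < ratr q) by rewrite negb_and -!leNgt (ltW h2) orbT.
  have n0 : 0 < n.+1%:R :> R by rewrite ltr0n.
  move=> /(_ (measurable_cst _) (sbump_eq0 n0 nA) (sbump_eq0 n0 nB)).
  have := prim_test (prim_cst A B (c' - c)) (measurable_cst _) db cd (sbump_eq0 n0 nA) (sbump_eq0 n0 nB).
  move=> -> /oppr_inj <-; apply/eqP.
  by under eq_Rintegral do rewrite mul0r; rewrite Rintegral_cst// mul0r.
by move=> /(_ key); apply: aeS => x /[apply] /eqP; rewrite subr_eq0 => /eqP.
Qed.

Lemma test_C1 (phi : R -> R) : test_fun (`]A, B[ : set R) phi ->
  [/\ forall x : R, is_derive x 1 phi ('D_1 phi x), continuous ('D_1 phi : R -> R),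
     phi A = 0 & phi B = 0].
Proof.
move=> [sp _ cl].
have out x : ~~ (A < x < B) -> phi x = 0.
  move=> nx; apply/eqP/negPn/negP => h; move/negP : nx; apply.
  have : closure [set x | phi x != 0] x by apply: subset_closure.
  by move=> /cl /=; rewrite in_itv.
split.
- move=> x; have [d1 _] := sp 1%N.
  by apply: DeriveDef => //; exact/derivable1_diffP/d1.
- by have [_ d2] := sp 1%N; move=> x; exact: (d2 1 x I).
- by apply: out; rewrite ltxx.
- by apply: out; rewrite ltxx andbF.
Qed.

Lemma prim_weak u v phi : prim A B u v -> measurable_fun (itvoo A B) u ->
  test_fun (`]A, B[ : set R) phi ->
  \int[mu]_(x in itvoo A B) (u x * 'D_1 phi x) = - \int[mu]_(x in itvoo A B) (v x * phi x).
Proof. by move=> puv mu_ /test_C1[h1 h2 h3 h4]; exact: prim_test puv mu_ h1 h2 h3 h4. Qed.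

Lemma weak_prim_test u v : mu.-integrable (itvoo A B) (EFin \o u) ->
  mu.-integrable (itvoo A B) (EFin \o v) ->
  (forall phi, test_fun (`]A, B[ : set R) phi ->
    \int[mu]_(x in itvoo A B) (u x * 'D_1 phi x) =
    - \int[mu]_(x in itvoo A B) (v x * phi x)) ->
  prim A B u v.
Proof.
move=> iu iv h; apply: weak_prim => // i h1 h2.
rewrite -h; last exact: test_family_test.
apply: eq_Rintegral => x _; congr (_ * _).
by have [_ ->] := antider_derive (test_family_smooth i) (@test_family_supp i) x.
Qed.

End weak1.
End fundamental.

(** * Slices of the strip *)

Section strip.
Context {R : realType}.
Variable L : R.
Hypothesis hL : 0 < L.
Local Notation mu := (@lebesgue_measure R).
Local Notation mu2 := (@lebesgue2 R).
Local Notation S := (strip L).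
Implicit Types (b : bool) (s t : R) (g h u v : R * R -> R).

(* The boolean selects the direction: [true] is [x_1] and [false] is [x_2]. *)
Definition dlo b : R := if b then 0 else - 2^-1.
Definition dhi b : R := if b then L else 2^-1.
Definition pt b s t : R * R := if b then (s, t) else (t, s).
Definition along b (z : R * R) : R := if b then z.1 else z.2.
Definition dom b := itvoo (dlo b) (dhi b).

Lemma dlohi b : dlo b < dhi b.
Proof. by case: b => //=; rewrite /dlo /dhi; have : (0 : R) < 2^-1 by []; lra. Qed.

Lemma stripE : S = (itvoo 0 L `*` itvoo (- 2^-1) 2^-1). Proof. by []. Qed.

Lemma measurable_strip : measurable (S : set (measurableTypeR R * measurableTypeR R)).
Proof. by rewrite stripE; apply: measurableX. Qed.
Hint Resolve measurable_strip : core.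

Lemma lebesgue2_strip : mu2 S = L%:E.
Proof.
rewrite /lebesgue2 stripE product_measure1E//.
have e1 : mu (itvoo 0 L) = L%:E by rewrite /itvoo lebesgue_measure_itv/= lte_fin hL oppr0 adde0.
have e2 : mu (itvoo (- 2^-1) 2^-1) = 1%:E :> \bar R.
  rewrite /itvoo lebesgue_measure_itv/= lte_fin.
  rewrite ifT; last by have : (0 : R) < 2^-1 by []; lra.
  by rewrite -EFinD; congr EFin; rewrite opprK; lra.
transitivity (L%:E * 1%:E)%E; last by rewrite mule1.
by congr (_ * _)%E.
Qed.

Lemma strip_fin : (mu2 S < +oo)%E.
Proof. by rewrite lebesgue2_strip ltry. Qed.

Lemma strip_pt b s t : dom b s -> dom (~~ b) t -> S (pt b s t).
Proof. by case: b. Qed.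

Lemma pt_strip b s t : S (pt b s t) -> dom b s /\ dom (~~ b) t.
Proof. by case: b => -[]. Qed.

Lemma pt_along b z : pt b (along b z) (along (~~ b) z) = z.
Proof. by case: b; case: z. Qed.

Lemma along_pt b s t : along b (pt b s t) = s. Proof. by case: b. Qed.
Lemma alongN_pt b s t : along (~~ b) (pt b s t) = t. Proof. by case: b. Qed.

Lemma slice_integrable b u : mu2.-integrable S (EFin \o u) ->
  {ae mu, forall t, dom (~~ b) t ->
    mu.-integrable (dom b) (EFin \o (fun s => u (pt b s t)))}.
Proof.
case: b => iu; first exact: (fub_slice2 (measurable_itvoo _ _) (measurable_itvoo _ _) iu).
exact: (fub_slice1 (measurable_itvoo _ _) (measurable_itvoo _ _) iu).
Qed.

Lemma outer_integrable b u : mu2.-integrable S (EFin \o u) ->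
  mu.-integrable (dom (~~ b)) (EFin \o (fun t => \int[mu]_(s in dom b) u (pt b s t))).
Proof.
case: b => iu; first exact: (fub_outer2 (measurable_itvoo _ _) (measurable_itvoo _ _) iu).
exact: (fub_outer1 (measurable_itvoo _ _) (measurable_itvoo _ _) iu).
Qed.

Lemma fubini_strip b u : mu2.-integrable S (EFin \o u) ->
  \int[mu]_(t in dom (~~ b)) \int[mu]_(s in dom b) u (pt b s t) =
  \int[mu2]_(z in S) u z.
Proof.
case: b => iu; first exact: (fub2 (measurable_itvoo _ _) (measurable_itvoo _ _) iu).
exact: (fub1 (measurable_itvoo _ _) (measurable_itvoo _ _) iu).
Qed.

Lemma ae_slice b (P : R * R -> Prop) : {ae mu2, forall z, S z -> P z} ->
  {ae mu, forall t, dom (~~ b) t -> {ae mu, forall s, dom b s -> P (pt b s t)}}.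
Proof. by case: b; [exact: ae_slice2|exact: ae_slice1]. Qed.

Lemma ae_unslice b u v : measurable_fun S (u : measurableTypeR R * measurableTypeR R -> R) ->
  measurable_fun S (v : measurableTypeR R * measurableTypeR R -> R) ->
  {ae mu, forall t, dom (~~ b) t -> {ae mu, forall s, dom b s -> u (pt b s t) = v (pt b s t)}} ->
  {ae mu2, forall z, S z -> u z = v z}.
Proof.
case: b => mu_ mv h.
  exact: (ae_unslice2 (measurable_itvoo _ _) (measurable_itvoo _ _) mu_ mv h).
exact: (ae_unslice1 (measurable_itvoo _ _) (measurable_itvoo _ _) mu_ mv h).
Qed.

Lemma ae_dom b (P : R -> Prop) : {ae mu, forall s, dom b s -> P s} ->
  {ae mu2, forall z, S z -> P (along b z)}.
Proof.
move=> [N [mN N0 hN]].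
exists (along b @^-1` N); split.
- rewrite -[X in measurable X]setTI; case: b hN => hN.
    exact: (@measurable_fst _ _ (measurableTypeR R) (measurableTypeR R) measurableT N mN).
  exact: (@measurable_snd _ _ (measurableTypeR R) (measurableTypeR R) measurableT N mN).
- have -> : along b @^-1` N = if b then N `*` setT else setT `*` N.
    by case: (b); apply/seteqP; split => z //=; [move=> [] | move=> []].
  have N0' : mu (N : set (measurableTypeR R)) = 0%E by exact: N0.
  case: (b); rewrite /lebesgue2 product_measure1E//.
    by rewrite [X in (X * _)%E]N0' mul0e.
  by rewrite [X in (_ * X)%E]N0' mule0.
- move=> z /= hz; apply: hN => /= h; apply: hz => Sz; apply: h.
  by move: Sz; rewrite -{1}(pt_along b z) => /pt_strip[].
Qed.

(** Measurability refers to the product sigma-algebra. Rounding the first variable down to a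
    multiple of [1/(n+1)] gives functions whose preimages are countable unions of rectangles, and
    these functions converge to [f] pointwise. *)
Lemma continuous_measurable2 (f : R * R -> R) : continuous f ->
  measurable_fun setT (f : measurableTypeR R * measurableTypeR R -> R).
Proof.
move=> cf.
pose rd (n : nat) (x : R) : R := (Num.floor (n.+1%:R * x))%:~R / n.+1%:R.
have cvr x : (fun n => rd n x) @ \oo --> x.
  apply/cvgrPdist_le => e e0.
  have := @cvg_harmonic R => /cvgrPdist_le/(_ _ e0)[N _ hN].
  exists N => // n Nn; have := hN n Nn; rewrite sub0r normrN /harmonic.
  rewrite ger0_norm ?invr_ge0// => h.
  have n0 : 0 < n.+1%:R :> R by rewrite ltr0n.
  have /andP[h1 h2] := floor_itv (n.+1%:R * x).
  have -> : x - rd n x = (n.+1%:R * x - (Num.floor (n.+1%:R * x))%:~R) / n.+1%:R.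
    by rewrite /rd mulrBl mulrAC divff ?mul1r// gt_eqF.
  rewrite ger0_norm; last by rewrite divr_ge0 ?subr_ge0// ltW.
  apply: le_trans h; rewrite -[leRHS]mul1r ler_pM2r ?invr_gt0// lerBlDr addrC.
  by apply: ltW; rewrite intrD1 in h2 *.
apply: (@measurable_fun_cvg _ (measurableTypeR R * measurableTypeR R)%type R setT
   (fun n z => f (rd n z.1, z.2))).
- move=> n _ Y mY; rewrite setTI.
  have -> : (fun z : R * R => f (rd n z.1, z.2)) @^-1` Y =
    \bigcup_(k in [set: int]) (((fun x => Num.floor (n.+1%:R * x)) @^-1` [set k]) `*`
       ((fun y => f (k%:~R / n.+1%:R, y)) @^-1` Y)).
    apply/seteqP; split => z /=.
      by move=> Yz; exists (Num.floor (n.+1%:R * z.1)).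
    by move=> [k _ [/= hk hy]]; rewrite /rd hk.
  apply: countable_bigcupT_measurable => //.
  move=> k; apply: measurableX.
    have n0 : 0 < n.+1%:R :> R by rewrite ltr0n.
    have -> : (fun x : R => Num.floor (n.+1%:R * x)) @^-1` [set k] =
       `[k%:~R / n.+1%:R, (k + 1)%:~R / n.+1%:R[%classic.
      apply/seteqP; split => x /=; rewrite in_itv/= ler_pdivrMr// ltr_pdivlMr// [x * _]mulrC.
        by move=> <-; exact: floor_itv.
      by move=> h; exact: floor_def.
    exact: measurable_itv.
  rewrite -[X in measurable X]setTI.
  have cfy : continuous (fun y => f (k%:~R / n.+1%:R, y)).
    move=> y; apply: continuous_comp; last exact: cf.
    exact: (cvg_pair (cvg_cst _) cvg_id).
  exact: (continuous_measurable_fun cfy measurableT).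
- move=> [z1 z2] _; apply: (cvg_comp (fun n => (rd n z1, z2)) f); last exact: cf.
  exact: (cvg_pair (cvr _) (cvg_cst _)).
Qed.

Lemma continuous_bounded_strip (f : R * R -> R) : continuous f ->
  exists M, forall z, S z -> `|f z| <= M.
Proof.
move=> cf.
have cK : compact (`[0, L] `*` `[- 2^-1, 2^-1] : set (R * R)).
  by apply: compact_setX; exact: segment_compact.
have ne : (`[0, L] `*` `[- 2^-1, 2^-1] : set (R * R)) !=set0.
  have h2 : (0 : R) < 2^-1 by [].
  by exists (0, 0); split => /=; rewrite in_itv/= ?lexx /= ?oppr_le0 !ltW.
have cn : {within (`[0, L] `*` `[- 2^-1, 2^-1] : set (R * R)), continuous (fun z => `|f z|)}.
  apply: continuous_subspaceT => z; apply: continuous_comp; [exact: cf|exact: norm_continuous].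
have [c _ hc] := compact_EVT_max ne cK cn.
exists `|f c| => z; rewrite stripE => -[]; rewrite !itvooE => /andP[h1 h2] /andP[h3 h4].
by apply: hc; rewrite inE; split => /=; rewrite in_itv/= !ltW.
Qed.

Lemma pt_continuous b t : continuous (fun s => pt b s t).
Proof.
move=> s; case: b; first exact: (cvg_pair cvg_id (cvg_cst _)).
exact: (cvg_pair (cvg_cst _) cvg_id).
Qed.

Definition wdir b : R * R := if b then (1, 0) else (0, 1).

Lemma pt_shift b s t (h : R) : h *: wdir b + pt b s t = pt b (h *: (1 : R) + s) t.
Proof.
by case: b; rewrite /pt /wdir; congr (_, _); rewrite /= /GRing.scale /= ?mulr0 ?add0r.
Qed.

Lemma quot_slice b s t (f : R * R -> R) :
  (fun h : R => h^-1 *: ((f \o shift (pt b s t)) (h *: wdir b) - f (pt b s t))) =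
  (fun h : R => h^-1 *: (((fun s => f (pt b s t)) \o shift s) (h *: (1 : R)) - f (pt b s t))).
Proof. by apply/funext => h /=; rewrite pt_shift. Qed.

Lemma derive_slice b s t (f : R * R -> R) :
  'D_1 (fun s => f (pt b s t)) s = 'D_(wdir b) f (pt b s t).
Proof. by rewrite /derive quot_slice. Qed.

Lemma derivable_slice b s t (f : R * R -> R) :
  derivable f (pt b s t) (wdir b) -> derivable (fun s => f (pt b s t)) s 1.
Proof. by rewrite /derivable quot_slice. Qed.

Lemma is_derive_slice b s t (f : R * R -> R) : differentiable f (pt b s t) ->
  is_derive s (1 : R) (fun s => f (pt b s t)) ('D_(wdir b) f (pt b s t)).
Proof.
move=> df; apply: DeriveDef; last exact: derive_slice.
by apply: derivable_slice; exact: diff_derivable.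
Qed.

Section test2.
Variables (f : R * R -> R).
Hypothesis tf : test_fun S f.

Lemma test2_diff z : differentiable f z.
Proof. by have [sf _ _] := tf; have [d _] := sf 1%N; exact: d. Qed.

Lemma test2_cont : continuous f.
Proof. by move=> z; exact/differentiable_continuous/test2_diff. Qed.

Lemma test2_Dcont b : continuous ('D_(wdir b) f : R * R -> R).
Proof. by have [sf _ _] := tf; have [_ d] := sf 1%N; move=> z; exact: (d (wdir b) z I). Qed.

Lemma test2_out z : ~ S z -> f z = 0.
Proof.
move=> nS; apply/eqP/negPn/negP => h; apply: nS.
have [_ _ cl] := tf; apply: cl; exact: subset_closure.
Qed.
End test2.

Lemma slice_weak b t (u v f : R * R -> R) : test_fun S f -> dom (~~ b) t ->
  prim (dlo b) (dhi b) (fun s => u (pt b s t)) (fun s => v (pt b s t)) ->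
  measurable_fun (dom b) (fun s => u (pt b s t)) ->
  \int[mu]_(s in dom b) (u (pt b s t) * 'D_(wdir b) f (pt b s t)) =
  - \int[mu]_(s in dom b) (v (pt b s t) * f (pt b s t)).
Proof.
move=> tf dt pv mu_.
apply: (prim_test (dlohi b) pv mu_ (phi := fun s => f (pt b s t))
   (dphi := fun s => 'D_(wdir b) f (pt b s t))).
- by move=> s; apply: is_derive_slice; exact: test2_diff.
- move=> s; apply: (@continuous_comp _ _ _ (fun s => pt b s t) ('D_(wdir b) f)).
    exact: pt_continuous.
  exact: test2_Dcont.
- apply: test2_out => // /pt_strip[]; rewrite /dom itvooE ltxx //.
- apply: test2_out => // /pt_strip[]; rewrite /dom itvooE ltxx andbF//.
Qed.

Lemma bd_integrable u (f : R * R -> R) : mu2.-integrable S (EFin \o u) -> continuous f ->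
  mu2.-integrable S (EFin \o (fun z => u z * f z)).
Proof.
move=> iu cf; have [M hM] := continuous_bounded_strip cf.
have mu_ : measurable_fun S (u : measurableTypeR R * measurableTypeR R -> R).
  by apply/measurable_EFinP; exact: measurable_int iu.
apply: (@integrable_dom _ _ _ mu2 _ measurable_strip _ (fun z => M * `|u z|)).
- by apply: measurable_funM => //; apply: measurable_funTS; exact: continuous_measurable2.
- by have := integrableZl measurable_strip M (integrable_norm iu); exact: eq_integrable.
- by move=> z Sz; rewrite normrM mulrC ler_wpM2r// hM.
Qed.

Definition pd b u v : Prop := {ae mu, forall t, dom (~~ b) t ->
  prim (dlo b) (dhi b) (fun s => u (pt b s t)) (fun s => v (pt b s t))}.

Lemma integrable_meas (u : R * R -> R) : mu2.-integrable S (EFin \o u) ->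
  measurable_fun S (u : measurableTypeR R * measurableTypeR R -> R).
Proof. by move=> iu; apply/measurable_EFinP; exact: measurable_int iu. Qed.

(** Integration by parts on each line, then Fubini; the slices of a test function vanish at the ends
    of the line. *)
Lemma pd_weak b u v f : mu2.-integrable S (EFin \o u) -> mu2.-integrable S (EFin \o v) ->
  pd b u v -> test_fun S f ->
  \int[mu2]_(z in S) (u z * 'D_(wdir b) f z) = - \int[mu2]_(z in S) (v z * f z).
Proof.
move=> iu iv puv tf.
have cf := test2_cont tf; have cDf := @test2_Dcont _ tf b.
have iuD := bd_integrable iu cDf; have ivf := bd_integrable iv cf.
rewrite -(fubini_strip b iuD) -(fubini_strip b ivf).
rewrite -mulN1r -RintegralZl//; last exact: (outer_integrable b ivf).
apply: (Rint_ae_eq (measurable_itvoo _ _)).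
- by apply/measurable_EFinP; exact: measurable_int (outer_integrable b iuD).
- apply: measurable_funM => //.
  by apply/measurable_EFinP; exact: measurable_int (outer_integrable b ivf).
- apply: aeS2 puv (slice_integrable b iu) => t h1 h2 dt.
  rewrite mulN1r; apply: slice_weak => //; first exact: h1.
  by apply/measurable_EFinP; exact: measurable_int (h2 dt).
- exact: measurable_itvoo.
Qed.

Lemma along_comp b (f : R -> R) : smooth setT f -> smooth setT (fun z : R * R => f (along b z)).
Proof.
move=> sf k.
have da z : differentiable (along b : R * R -> R) z /\ forall v : R * R, 'd (along b : R * R -> R) z v = along b v.
  have c1 : continuous (fst : R * R -> R) by move=> ?; exact: cvg_fst.
  have c2 : continuous (snd : R * R -> R) by move=> ?; exact: cvg_snd.
  case: b; split.
  - have E : along true = (fst : R * R -> R) by [].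
    rewrite E.
    exact: (linear_differentiable (f := fst : {linear (R * R)%type -> R}) z c1).
  - by move=> v; rewrite (diff_lin (f := fst : {linear (R * R)%type -> R}) z c1).
  - exact: (linear_differentiable (f := snd : {linear (R * R)%type -> R}) z c2).
  - by move=> v; rewrite (diff_lin (f := snd : {linear (R * R)%type -> R}) z c2).
apply: (@Ck_comp R _ _ _ k (along b) (along b)) => //.
- by move=> z; case: (da z).
- by move=> z; case: (da z).
Qed.

Lemma tensor_test b (f g : R -> R) :
  test_fun (`]dlo b, dhi b[ : set R) f -> test_fun (`]dlo (~~ b), dhi (~~ b)[ : set R) g ->
  test_fun S (fun z => f (along b z) * g (along (~~ b) z)).
Proof.
move=> [sf kf clf] [sg kg clg].
pose K : set (R * R) := [set z | closure [set x | f x != 0] (along b z) /\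
    closure [set x | g x != 0] (along (~~ b) z)].
have KE : K = if b then closure [set x | f x != 0] `*` closure [set x | g x != 0]
   else closure [set x | g x != 0] `*` closure [set x | f x != 0].
  by rewrite /K; case: (b); apply/seteqP; split => z /= [].
have cK : compact K by rewrite KE; case: (b); exact: compact_setX.
have clK : closed K.
  by apply: compact_closed => //; exact: norm_hausdorff.
have sub : closure [set z : R * R | f (along b z) * g (along (~~ b) z) != 0] `<=` K.
  rewrite ((closure_id K).1 clK); apply: closureS => z /=.
  by rewrite mulf_eq0 negb_or => /andP[h1 h2]; split; apply: subset_closure.
split.
- by move=> k; apply: CkM; exact: along_comp.
- by apply: (subclosed_compact _ cK) => //; exact: closed_closure.
- move=> z /sub [/clf h1 /clg h2]; rewrite -(pt_along b z).
  exact: strip_pt.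
Qed.

Lemma derive_tensor b (f g : R -> R) s t : differentiable f s ->
  smooth setT f -> smooth setT g ->
  'D_(wdir b) (fun z => f (along b z) * g (along (~~ b) z)) (pt b s t) = 'D_1 f s * g t.
Proof.
move=> df sf sg.
rewrite -(derive_slice b s t (fun z => f (along b z) * g (along (~~ b) z))).
under eq_fun do rewrite along_pt alongN_pt mulrC.
rewrite -[LHS]/('D_1 (g t *: f) s) deriveZ; first by rewrite mulrC.
exact: diff_derivable.
Qed.

End strip.
#[global] Hint Resolve measurable_strip : core.

(** * Weak derivatives on the strip *)

Lemma ae_count d (T : measurableType d) (R : realType) (m : {measure set T -> \bar R})
    (C : countType) (P : C -> T -> Prop) :
  (forall c, {ae m, forall x, P c x}) -> {ae m, forall x, forall c, P c x}.
Proof.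
move=> h.
have : {ae m, forall x, forall n : nat, if unpickle n is Some c then P c x else True}.
  by apply/ae_foralln => n; case: unpickle => [c|]; [exact: h|exact: aeW].
by apply: aeS => x hx c; have := hx (pickle c); rewrite pickleK.
Qed.

Lemma aeI d (T : measurableType d) (R : realType) (m : {measure set T -> \bar R})
    (P Q : T -> Prop) :
  {ae m, forall x, P x} -> {ae m, forall x, Q x} -> {ae m, forall x, P x /\ Q x}.
Proof. exact: aeS2. Qed.

Lemma RintZ d (T : measurableType d) (R : realType) (m : {measure set T -> \bar R})
    (D : set T) k (f : T -> R) : measurable D -> m.-integrable D (EFin \o f) ->
  \int[m]_(x in D) (k * f x) = k * \int[m]_(x in D) f x.
Proof. by move=> mD i_f; rewrite RintegralZl. Qed.

Section wd.
Context {R : realType}.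
Variable L : R.
Hypothesis hL : 0 < L.
Local Notation mu := (@lebesgue_measure R).
Local Notation mu2 := (@lebesgue2 R).
Local Notation S := (strip L).
Local Notation L2S := (L2 mu2 S).
Implicit Types (b : bool) (s t : R) (u v g h : R * R -> R).

Let mS := @measurable_strip R L.
Let fS := strip_fin hL.

(** Testing with a product of the antiderivative of a family member and a transversal bump, the
    transversal fundamental lemma yields the one-dimensional identity on almost every line. The
    exceptional set depends on the family member, and countability merges these sets before
    [weak_prim] is applied line by line. *)
Lemma weak_pd b u v : mu2.-integrable S (EFin \o u) -> mu2.-integrable S (EFin \o v) ->
  (forall f, test_fun S f ->
    \int[mu2]_(z in S) (u z * 'D_(wdir b) f z) = - \int[mu2]_(z in S) (v z * f z)) ->
  pd L b u v.
Proof.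
move=> iu iv h.
pose F i := test_family (dlo b) (dhi L b) i.
(* The one-dimensional weak identity on a line says exactly that the integral of [w i] along it
   vanishes. *)
pose w i z := u z * F i (along b z) + v z * antider (F i) (along b z).
have sF i : smooth setT (F i) by exact: test_family_smooth.
have sA i : smooth setT (antider (F i)).
  exact: (antider_smooth (test_family_smooth _ _ i) (@test_family_supp _ _ _ i)).
have ca (f : R -> R) b' : smooth setT f -> continuous (fun z : R * R => f (along b' z)).
  by move=> sf z; exact: (along_comp b' sf 0%N z I).
have i1 i := bd_integrable hL iu (ca _ b (sF i)).
have i2 i := bd_integrable hL iv (ca _ b (sA i)).
have iw i : mu2.-integrable S (EFin \o w i).
  by have := integrableD mS (i1 i) (i2 i); exact: eq_integrable.
have H0 i : {ae mu, forall t, dom L (~~ b) t -> (dlo b : R) < ratr i.1.2 -> ratr i.2 < dhi L b ->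
    \int[mu]_(s in dom L b) w i (pt b s t) = 0}.
  case: (pselect ((dlo b : R) < ratr i.1.2 /\ ratr i.2 < dhi L b)) => [[a1 a2]|na]; last first.
    by apply: aeW => t _ a1 a2; exfalso; apply: na.
  have := fundamental_lemma (dlohi hL (~~ b)) (outer_integrable b (iw i)).
  have key : forall (n : nat) (p q : rat), (dlo (~~ b) : R) < ratr p -> ratr q < dhi L (~~ b) ->
     \int[mu]_(t in dom L (~~ b)) ((\int[mu]_(s in dom L b) w i (pt b s t)) * sbump n.+1%:R (ratr p) (ratr q) t) = 0.
    move=> n p q c1 c2.
    have : test_fun (`]dlo (~~ b), dhi L (~~ b)[ : set R) (sbump n.+1%:R (ratr p) (ratr q)).
      apply: (@supp_test _ _ _ (ratr p) (ratr q)) => //; first exact: sbump_smooth.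
      by move=> x; apply: sbump_supp; rewrite ltr0n.
    move: (sbump n.+1%:R (ratr p) (ratr q)) => B tB.
    have sB : smooth setT B by case: tB.
    have iwB := bd_integrable hL (iw i) (ca _ (~~ b) sB).
    have -> : \int[mu]_(t in dom L (~~ b)) ((\int[mu]_(s in dom L b) w i (pt b s t)) * B t) =
       \int[mu]_(t in dom L (~~ b)) (\int[mu]_(s in dom L b) (w i (pt b s t) * B (along (~~ b) (pt b s t)))).
      apply: (Rint_ae_eq (measurable_itvoo _ _)).
      - apply: measurable_funM; first exact: integrable_meas1 (outer_integrable b (iw i)).
        apply: measurable_funTS; apply: continuous_measurable_fun => x; exact: (sB 0%N x I).
      - exact: integrable_meas1 (outer_integrable b iwB).
      - apply: aeS (slice_integrable b (iw i)) => t /[apply] it.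
        under [RHS]eq_Rintegral do rewrite alongN_pt mulrC.
        exact: (etrans (mulrC _ _) (esym (RintZ (B t) (measurable_itvoo _ _) it))).
    rewrite (fubini_strip b iwB).
    have tt : test_fun S (fun z => antider (F i) (along b z) * B (along (~~ b) z)).
      by apply: tensor_test => //; exact: (test_family_test (dlohi hL b) a1 a2).
    have := h _ tt.
    have E (z : R * R) : 'D_(wdir b) (fun z => antider (F i) (along b z) * B (along (~~ b) z)) z =
       F i (along b z) * B (along (~~ b) z).
      rewrite -[in LHS](pt_along b z) derive_tensor//; last first.
        by have [d _] := sA i 1%N; exact: d.
      by have [_ ->] := antider_derive (sF i) (@test_family_supp _ _ _ i) (along b z).
    under eq_Rintegral do rewrite E.
    move=> /eqP; rewrite -addr_eq0 => /eqP e0; rewrite -[RHS]e0.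
    have j1 : mu2.-integrable S (EFin \o (fun z => u z * (F i (along b z) * B (along (~~ b) z)))).
      apply: (bd_integrable hL iu) => z.
      by apply: cvgM; [exact: (ca _ b (sF i))|exact: (ca _ (~~ b) sB)].
    have j2 : mu2.-integrable S (EFin \o (fun z => v z * (antider (F i) (along b z) * B (along (~~ b) z)))).
      apply: (bd_integrable hL iv) => z.
      by apply: cvgM; [exact: (ca _ b (sA i))|exact: (ca _ (~~ b) sB)].
    rewrite -RintegralD//; apply: eq_Rintegral => z _; rewrite /w; ring.
  by move=> /(_ key); apply: aeS => t /[apply].
have := ae_count H0; apply: aeS3 (slice_integrable b iu) (slice_integrable b iv) => t h1 h2 h3 dt.
apply: (weak_prim (dlohi hL b) (h1 dt) (h2 dt)) => i a1 a2.
have := h3 i dt a1 a2; rewrite /w.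
under eq_Rintegral do rewrite along_pt.
have cs (f : R -> R) : smooth setT f -> {within `[dlo b, dhi L b], continuous f}.
  by move=> sf; apply: continuous_subspaceT => x; exact: (sf 0%N x I).
rewrite RintegralD//.
- by move/eqP; rewrite addr_eq0 => /eqP.
- exact: measurable_itvoo.
- under eq_fun do rewrite mulrC.
  by apply: integrableM_cont (h1 dt) _; [exact/ltW/dlohi|exact: cs].
- under eq_fun do rewrite mulrC.
  by apply: integrableM_cont (h2 dt) _; [exact/ltW/dlohi|exact: cs].
Qed.

(* By [pd_weak] and [weak_pd] this is the distributional derivative: a function has a
   weak derivative iff it is absolutely continuous on almost every line. *)
Definition wd b u v : Prop := [/\ L2S u, L2S v & pd L b u v].

Lemma L2S_int u : L2S u -> mu2.-integrable S (EFin \o u).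
Proof. exact: L2_integrable. Qed.

Lemma slice_L2 b u : L2S u -> {ae mu, forall t, dom L (~~ b) t ->
  L2 mu (dom L b) (fun s => u (pt b s t))}.
Proof.
move=> hu; have [_ hu2] := hu.
apply: aeS2 (slice_integrable b (L2S_int hu)) (slice_integrable b hu2) => t h1 h2 dt.
split; last exact: (h2 dt).
by apply/measurable_EFinP; exact: measurable_int (h1 dt).
Qed.

Lemma pd_ae b u v u' v' : pd L b u v -> L2S v' ->
  {ae mu2, forall z, S z -> u z = u' z} -> {ae mu2, forall z, S z -> v z = v' z} ->
  pd L b u' v'.
Proof.
move=> p hv' eu ev.
rewrite /pd in p; have h1 := aeI p (slice_integrable b (L2S_int hv')).
apply: aeS3 h1 (ae_slice b eu) (ae_slice b ev) => t [pp iv] h2 h3 dt.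
exact: prim_ae (pp dt) (iv dt) (h2 dt) (h3 dt).
Qed.

Lemma wd_ae b u v u' v' : wd b u v -> L2S u' -> L2S v' ->
  {ae mu2, forall z, S z -> u z = u' z} -> {ae mu2, forall z, S z -> v z = v' z} ->
  wd b u' v'.
Proof. by move=> [hu hv p] hu' hv' eu ev; split => //; exact: pd_ae p hv' eu ev. Qed.

Lemma wd_uniq b u v v' : wd b u v -> wd b u v' -> {ae mu2, forall z, S z -> v z = v' z}.
Proof.
move=> [hu hv p] [_ hv' p'].
apply: (ae_unslice (b := b)); [exact: (L2_meas hv)|exact: (L2_meas hv')|].
apply: aeS2 p p' => t h1 h2 dt.
exact: (prim_uniq (dlohi hL b) (h1 dt) (h2 dt)).
Qed.

Lemma wdD b u v u' v' : wd b u v -> wd b u' v' ->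
  wd b (fun z => u z + u' z) (fun z => v z + v' z).
Proof.
move=> [hu hv p] [hu' hv' p']; split; [exact: L2D|exact: L2D|].
by apply: aeS2 p p' => t h1 h2 dt; exact: primD (h1 dt) (h2 dt).
Qed.

Lemma wdZ b k u v : wd b u v -> wd b (fun z => k * u z) (fun z => k * v z).
Proof.
move=> [hu hv p]; split; [exact: L2Z|exact: L2Z|].
by apply: aeS p => t h1 dt; exact: primZ (h1 dt).
Qed.

Lemma wdB b u v u' v' : wd b u v -> wd b u' v' ->
  wd b (fun z => u z - u' z) (fun z => v z - v' z).
Proof.
move=> h /(wdZ (-1)) /(wdD h); congr wd; apply/funext => z; ring.
Qed.

Lemma wd_cst b k : wd b (cst k) (cst 0).
Proof.
split; [exact: L2_cst|exact: L2_cst|].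
by apply: aeW => t dt; exact: prim_cst.
Qed.

Lemma pdM b u v u' v' : L2S u -> L2S u' -> pd L b u v -> pd L b u' v' ->
  pd L b (fun z => u z * u' z) (fun z => v z * u' z + u z * v' z).
Proof.
move=> hu hu' p p'.
rewrite /pd in p p'; have h1 := aeI p p'.
apply: aeS3 h1 (slice_L2 b hu) (slice_L2 b hu') => t [q q'] h2 h3 dt.
move: (q dt) (q' dt) => {}q {}q'.
by apply: primM => //; [exact/ltW/dlohi|exact: L2_meas (h2 dt)|exact: L2_meas (h3 dt)].
Qed.

(** The bounds keep the product and its derivative in [L^2]; orthonormal frames provide them. *)
Lemma wdM b K K' u v u' v' : wd b u v -> wd b u' v' -> aebd mu2 S K u -> aebd mu2 S K' u' ->
  wd b (fun z => u z * u' z) (fun z => v z * u' z + u z * v' z).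
Proof.
move=> [hu hv p] [hu' hv' p'] bu bu'; split.
- by apply: (L2M_bd mS _ bu) => //; exact: L2_meas hu.
- apply: L2D => //; last by apply: (L2M_bd mS _ bu) => //; exact: L2_meas hu.
  under eq_fun do rewrite mulrC.
  by apply: (L2M_bd mS _ bu') => //; exact: L2_meas hu'.
- exact: pdM.
Qed.

Lemma wd_along b (f df : R -> R) :
  {within `[dlo b, dhi L b], continuous f} -> {within `[dlo b, dhi L b], continuous df} ->
  (forall s, dlo b < s < dhi L b -> is_derive s (1 : R) f (df s)) ->
  L2S (fun z => f (along b z)) -> L2S (fun z => df (along b z)) ->
  wd b (fun z => f (along b z)) (fun z => df (along b z)).
Proof.
move=> cf cdf d h1 h2; split => //; apply: aeW => t dt.
have [i1 e] := prim_C1 (dlohi hL b) cf cdf d.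
split; first by under eq_fun do rewrite along_pt.
exists (f (dlo b)); apply: aeW => s; rewrite itvooE => /andP[a1 a2].
rewrite along_pt e ?ltW//; congr (_ + _).
by congr (Prim _ _ _); apply/funext => x; rewrite along_pt.
Qed.

Lemma wd_transv b (f : R -> R) : L2S (fun z => f (along (~~ b) z)) ->
  wd b (fun z => f (along (~~ b) z)) (cst 0).
Proof.
move=> h; split => //; first exact: L2_cst.
apply: aeW => t dt; under eq_fun do rewrite alongN_pt.
exact: prim_cst.
Qed.

(** With [M] the [L^1] norm of [v], both the primitive and its mean are at most [M], so their
    difference is at most [2 M], and [M^2 <= (B - A) |v|^2] by Cauchy-Schwarz. This explains the
    factor [4 (B - A)^2]. *)
Lemma poincare1 (A B : R) (u v : R -> R) : A < B -> prim A B u v ->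
  L2 mu (itvoo A B) u -> L2 mu (itvoo A B) v ->
  forall m, m = (\int[mu]_(s in itvoo A B) u s) / (B - A) ->
  ip mu (itvoo A B) (fun s => u s - m) (fun s => u s - m) <= 4 * (B - A) ^+ 2 * ip mu (itvoo A B) v v.
Proof.
move=> AB [iv [c hc]] hu hv m m_def.
have mI := measurable_itvoo A B; have fI := itvoo_fin A B.
have BA : 0 < B - A by rewrite subr_gt0.
have muI : mu (itvoo A B) = (B - A)%:E.
  by rewrite /itvoo lebesgue_measure_itv/= lte_fin AB -EFinD.
have Rc k : \int[mu]_(s in itvoo A B) (cst k s) = k * (B - A).
  transitivity (k * fine (mu (itvoo A B))); last by rewrite muI.
  by rewrite Rintegral_cst.
pose M := Prim A (fun s => `|v s|) B.
have M2 : M ^+ 2 <= (B - A) * ip mu (itvoo A B) v v.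
  have hnv : L2 mu (itvoo A B) (fun s => `|v s|).
    apply: (L2_ae_le mI (K := 1) _ hv); first by apply: measurableT_comp => //; exact: L2_meas hv.
    by apply: aeW => s _; rewrite normr_id mul1r.
  have := cauchy_schwarz mI (L2_cst mI fI 1) hnv.
  rewrite /ip; under [X in _ <= X * _ -> _]eq_Rintegral do rewrite mulr1.
  rewrite (Rc 1) mul1r /M /Prim.
  under [X in X ^+ 2 <= _ -> _]eq_Rintegral do rewrite mul1r.
  under [X in _ <= _ * X -> _]eq_Rintegral do rewrite -expr2 real_normK ?num_real// expr2.
  by [].
have M0 : 0 <= M by apply: Rintegral_ge0.
have hV : L2 mu (itvoo A B) (Prim A v).
  apply: (L2_bd mI fI (K := M)); first exact: Prim_meas (ltW AB) iv.
  by apply: aeW => s; rewrite itvooE => /andP[_ /ltW sB]; exact: Prim_bd.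
have mE : m = c + (\int[mu]_(s in itvoo A B) Prim A v s) / (B - A).
  rewrite m_def (@Rint_ae_eq _ _ _ mu _ mI u (fun s => cst c s + Prim A v s)) //.
  - rewrite RintegralD//; last 2 first.
    + exact: L2_integrable (L2_cst mI fI c).
    + exact: L2_integrable hV.
    by rewrite Rc mulrDl mulfK// gt_eqF.
  - exact: L2_meas hu.
  - apply: measurable_funD => //; exact: L2_meas hV.
pose m' := (\int[mu]_(s in itvoo A B) Prim A v s) / (B - A).
have m'M : `|m'| <= M.
  rewrite /m' normrM [`|_^-1|]gtr0_norm ?invr_gt0// ler_pdivrMr//.
  apply: (le_trans (le_normr_Rintegral mI _)); first exact: L2_integrable hV.
  rewrite -(Rc M); apply: le_Rintegral => //.
  - exact: integrable_norm (L2_integrable mI fI hV).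
  - exact: L2_integrable (L2_cst mI fI M).
  - by move=> s; rewrite itvooE => /andP[_ /ltW sB]; exact: Prim_bd.
have hum : L2 mu (itvoo A B) (fun s => u s - m) by apply: L2B => //; exact: L2_cst.
apply: (@le_trans _ _ (4 * M ^+ 2 * ip mu (itvoo A B) (cst 1) (cst 1))).
  apply: ip_ae_le => //; first exact: L2_cst.
  apply: aeS hc => s h sAB; rewrite h// mE -/m' expr1n mulr1.
  have : `|Prim A v s - m'| <= 2 * M.
    rewrite (le_trans (ler_normB _ _))// mulr_natl mulr2n lerD//.
    by move: sAB; rewrite itvooE => /andP[_ /ltW sB]; exact: Prim_bd.
  have -> : c + Prim A v s - (c + m') = Prim A v s - m' by ring.
  move=> hh; rewrite -[leLHS]real_normK ?num_real//.
  have -> : 4 * M ^+ 2 = (2 * M) ^+ 2 by ring.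
  by rewrite lerXn2r ?nnegrE// mulr_ge0.
have -> : ip mu (itvoo A B) (cst 1) (cst 1) = B - A.
  by rewrite -[RHS]mul1r -Rc /ip; apply: eq_Rintegral => s _; rewrite /= mulr1.
have h4 : 0 <= 4 * (B - A) by rewrite mulr_ge0// ltW.
have := ler_wpM2l h4 M2; congr (_ <= _); ring.
Qed.

End wd.

(** * Averages and Poincare inequalities *)

Section avg.
Context {R : realType}.
Variable L : R.
Hypothesis hL : 0 < L.
Local Notation mu := (@lebesgue_measure R).
Local Notation mu2 := (@lebesgue2 R).
Local Notation S := (strip L).
Local Notation L2S := (L2 mu2 S).
Local Notation nsq u := (ip mu2 S u u).
Local Notation dom := (dom L).
Implicit Types (b : bool) (s t : R) (u v g h : R * R -> R).

Let mS := @measurable_strip R L.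
Let fS := strip_fin hL.

Definition len b : R := dhi L b - dlo b.

Lemma len_gt0 b : 0 < len b. Proof. by rewrite subr_gt0; exact: dlohi. Qed.

Lemma len_false : len false = 1.
Proof. by rewrite /len /= opprK [RHS](splitr 1) !mul1r. Qed.

Lemma Rint_dom_cst b (k : R) : \int[mu]_(s in dom b) k = k * len b.
Proof.
transitivity (k * fine (mu (dom b))).
  by rewrite Rintegral_cst//; exact: measurable_itvoo.
rewrite /dom /itvoo lebesgue_measure_itv/= lte_fin (dlohi hL).
by rewrite -EFinD.
Qed.

Lemma dom_cst_integrable b (k : R) : mu.-integrable (dom b) (EFin \o cst k).
Proof.
apply: L2_integrable; [exact: measurable_itvoo|exact: itvoo_fin|].
by apply: L2_cst; [exact: measurable_itvoo|exact: itvoo_fin].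
Qed.

Lemma along_integrable b (g : R -> R) : mu.-integrable (dom b) (EFin \o g) ->
  mu2.-integrable S (EFin \o (fun z => g (along b z))) /\
  \int[mu2]_(z in S) g (along b z) = len (~~ b) * \int[mu]_(t in dom b) g t.
Proof.
move=> ig.
have i2 : mu2.-integrable S (EFin \o (fun z => g (along b z))).
  rewrite /lebesgue2 stripE; case: b ig => ig.
    have := @integrable_tensor _ _ _ _ _ mu mu _ _ (measurable_itvoo _ _) (measurable_itvoo _ _) _ _ ig (dom_cst_integrable false 1).
    by congr (integrable _ _ _); apply/funext => z /=; rewrite mulr1.
  have := @integrable_tensor _ _ _ _ _ mu mu _ _ (measurable_itvoo _ _) (measurable_itvoo _ _) _ _ (dom_cst_integrable true 1) ig.
  by congr (integrable _ _ _); apply/funext => z /=; rewrite mul1r.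
split => //; rewrite -(fubini_strip (~~ b) i2).
have E s t : along b (pt (~~ b) s t) = t by case: (b).
under eq_Rintegral.
  move=> t _; under eq_Rintegral do rewrite E.
  rewrite Rint_dom_cst; over.
rewrite negbK.
under eq_Rintegral do rewrite mulrC.
exact: (RintZ _ (measurable_itvoo _ _) ig).
Qed.

(** The mean along direction [b] is kept as a function on the plane, so that it can be subtracted
    from [u] and differentiated in the other direction. *)
Definition avg b u (z : R * R) : R :=
  (len b)^-1 * \int[mu]_(s in dom b) u (pt b s (along (~~ b) z)).

Lemma avg_int b u : mu2.-integrable S (EFin \o u) ->
  mu2.-integrable S (EFin \o avg b u) /\
  \int[mu2]_(z in S) avg b u z = \int[mu2]_(z in S) u z.
Proof.
move=> iu; have iO := outer_integrable b iu.
have iZ : mu.-integrable (dom (~~ b)) (EFin \o (fun t => (len b)^-1 * \int[mu]_(s in dom b) u (pt b s t))).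
  by have := integrableZl (measurable_itvoo _ _) (len b)^-1 iO; exact: eq_integrable.
have [h1 h2] := along_integrable iZ; split; first exact: h1.
rewrite -[LHS]/(\int[mu2]_(z in S) (fun t => (len b)^-1 * \int[mu]_(s in dom b) u (pt b s t)) (along (~~ b) z)) h2 negbK RintZ//; last exact: measurable_itvoo.
by rewrite mulrA mulfV ?gt_eqF ?len_gt0// mul1r fubini_strip.
Qed.

Lemma avg_L2 b u : L2S u -> L2S (avg b u) /\ nsq (avg b u) <= nsq u.
Proof.
move=> hu; have [mu_ iu2] := hu.
have [ia _] := avg_int b (L2S_int hL hu).
have [ia2 e2] := avg_int b iu2.
have ma : measurable_fun S (avg b u : measurableTypeR R * measurableTypeR R -> R).
  exact: integrable_meas ia.
have key : {ae mu2, forall z, S z -> avg b u z ^+ 2 <= avg b (fun z => u z ^+ 2) z}.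
  have h := slice_L2 hL b hu.
  have := ae_dom h; apply: aeS => z hz Sz.
  move: (hz Sz) => {}hz.
  rewrite /avg; move: (along (~~ b) z) hz => t hz.
  have := cauchy_schwarz (measurable_itvoo _ _) (L2_cst (measurable_itvoo _ _) (itvoo_fin _ _) 1) hz.
  rewrite /ip.
  under eq_Rintegral do rewrite mul1r.
  under [X in _ <= X * _ -> _]eq_Rintegral do rewrite mulr1.
  rewrite Rint_dom_cst mul1r exprMn => H.
  under [in leRHS]eq_Rintegral do rewrite expr2.
  rewrite exprVn expr2 invfM -mulrA ler_wpM2l ?invr_ge0 ?(ltW (len_gt0 b))//.
  by rewrite mulrC ler_pdivrMr ?len_gt0// mulrC.
have iA2 : mu2.-integrable S (EFin \o (fun z => avg b u z ^+ 2)).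
  apply: (integrable_ae_dom mS _ ia2); first exact: measurable_funX.
  by apply: aeS key => z /[apply]; rewrite ger0_norm// sqr_ge0.
split; first by [].
rewrite /ip; under eq_Rintegral do rewrite -expr2.
under [leRHS]eq_Rintegral do rewrite -expr2.
by rewrite -e2; exact: (Rint_ae_le mS iA2 ia2).
Qed.

Lemma avgB b u v : L2S u -> L2S v ->
  {ae mu2, forall z, S z -> avg b (fun z => u z - v z) z = avg b u z - avg b v z}.
Proof.
move=> hu hv.
have h := aeI (slice_integrable b (L2S_int hL hu)) (slice_integrable b (L2S_int hL hv)).
have h' : {ae mu, forall t, dom (~~ b) t ->
  \int[mu]_(s in dom b) (u (pt b s t) - v (pt b s t)) = \int[mu]_(s in dom b) (u (pt b s t)) - \int[mu]_(s in dom b) v (pt b s t)}.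
  by apply: aeS h => t [h1 h2] dt; rewrite RintegralB//; [exact: measurable_itvoo|exact: h1|exact: h2].
apply: aeS (ae_dom h') => z hz Sz.
by rewrite /avg hz// mulrBr.
Qed.

Lemma avg_avg b u : mu2.-integrable S (EFin \o u) ->
  avg b (avg (~~ b) u) = cst (L^-1 * \int[mu2]_(z in S) u z).
Proof.
move=> iu; apply/funext => z; rewrite /avg negbK /cst.
have iO := outer_integrable (~~ b) iu; rewrite negbK in iO.
under eq_Rintegral do rewrite along_pt.
rewrite RintZ//; last exact: measurable_itvoo.
have := fubini_strip (~~ b) iu; rewrite negbK => ->.
rewrite mulrA -invfM; congr (_^-1 * _).
have -> : len b * len (~~ b) = len true * len false by case: (b); rewrite // mulrC.
by rewrite len_false mulr1 /len /= subr0.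
Qed.

Lemma poincare_slice b u v : wd L b u v ->
  nsq (fun z => u z - avg b u z) <= 4 * len b ^+ 2 * nsq v.
Proof.
move=> [hu hv p].
have hd : L2S (fun z => u z - avg b u z) by apply: L2B => //; have [] := avg_L2 b hu.
have i1 := hd.2; have i2 := hv.2.
rewrite /ip; under eq_Rintegral do rewrite -expr2.
under [in leRHS]eq_Rintegral do rewrite -expr2.
rewrite -(fubini_strip b i1) -(fubini_strip b i2).
rewrite -RintZ; [|exact: measurable_itvoo|exact: (outer_integrable b i2)].
apply: Rint_ae_le; first exact: measurable_itvoo.
- exact: (outer_integrable b i1).
- have := integrableZl (measurable_itvoo _ _) (4 * len b ^+ 2) (outer_integrable b i2).
  exact: eq_integrable.
rewrite /pd in p; have h := aeI (slice_L2 hL b hu) (slice_L2 hL b hv).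
apply: aeS2 p h => t pt_ [h1 h2] dt.
have := poincare1 (dlohi hL b) (pt_ dt) (h1 dt) (h2 dt) erefl.
rewrite /ip; under eq_Rintegral do rewrite -expr2.
under [in leRHS]eq_Rintegral do rewrite -expr2.
congr (_ <= _); apply: eq_Rintegral => s _; congr (_ ^+ 2); congr (_ - _).
rewrite /avg mulrC; congr (_ * _).
by apply: eq_Rintegral => r _; rewrite alongN_pt.
Qed.

(** The deviation from the mean is [(u - avg_2 u) + avg_2 (u - avg_1 u)], where [avg_i] averages in
    [x_i]. Each summand is controlled by one slice inequality, since averaging contracts the norm;
    the constants are twice [4 len^2] for the lengths 1 and [L]. *)
Lemma poincare2 u u1 u2 : wd L true u u1 -> wd L false u u2 ->
  nsq (fun z => u z - L^-1 * \int[mu2]_(z in S) u z) <= 8 * nsq u2 + 8 * L ^+ 2 * nsq u1.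
Proof.
move=> w1 w2; have [hu h1 _] := w1; have [_ h2 _] := w2.
have [ht _] := avg_L2 true hu; have [hf _] := avg_L2 false hu.
have hB : L2S (fun z => u z - avg true u z) by exact: L2B.
have [hB1 hB2] := avg_L2 false hB.
have hB3 : L2S (fun z => u z - avg false u z) by exact: L2B.
pose v z := (u z - avg false u z) + avg false (fun z => u z - avg true u z) z.
have hv : L2S v by exact: L2D.
have hm : L2S (fun z => u z - L^-1 * \int[mu2]_(z in S) u z) by apply: L2B => //; exact: L2_cst.
have -> : nsq (fun z => u z - L^-1 * \int[mu2]_(z in S) u z) = nsq v.
  have h : {ae mu2, forall z, S z -> u z - L^-1 * \int[mu2]_(z in S) u z = v z}.
    apply: aeS (avgB false hu ht) => z hz Sz; rewrite /v hz//.
    by rewrite (avg_avg false (L2S_int hL hu)) /=; ring.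
  exact: ip_ae_eq.
apply: (le_trans (ip_sqD mS hB3 hB1)).
have p1 := poincare_slice w1; have p2 := poincare_slice w2.
have l1 : len true = L by rewrite /len /= subr0.
have l2 : len false = 1 by exact: len_false.
rewrite l1 in p1; rewrite l2 in p2.
move: p1 p2 hB2; move: (nsq _) (nsq _) (nsq _) (nsq _) (nsq _) => a b c d e; lra.
Qed.

Lemma fubini_along b u (g : R -> R) : mu2.-integrable S (EFin \o u) -> smooth setT g ->
  \int[mu]_(s in dom b) ((\int[mu]_(t in dom (~~ b)) u (pt (~~ b) t s)) * g s) =
  \int[mu2]_(z in S) (u z * g (along b z)).
Proof.
move=> iu sg.
have i1 := bd_integrable hL iu (fun z => along_comp b sg 0%N z I).
have ou := outer_integrable (~~ b) iu; have o1 := outer_integrable (~~ b) i1.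
rewrite negbK in ou o1.
have := fubini_strip (~~ b) i1; rewrite negbK => <-.
apply: (Rint_ae_eq (measurable_itvoo _ _)).
- apply: measurable_funM; first exact: integrable_meas1 ou.
  by apply: measurable_funTS; apply: continuous_measurable_fun => x; exact: (sg 0%N x I).
- exact: integrable_meas1 o1.
have := slice_integrable (~~ b) iu; rewrite negbK.
apply: aeS => t /[apply] it.
have E s : along b (pt (~~ b) s t) = t by case: (b).
under [RHS]eq_Rintegral do rewrite E mulrC.
exact: (etrans (mulrC _ _) (esym (RintZ (g t) (measurable_itvoo _ _) it))).
Qed.

(** Differentiation under the integral sign, obtained weakly: a test function of the remaining
    variable is moved inside by Fubini, and the integration by parts is done on the slices. *)
Lemma wd_avg b u v : wd L b u v -> wd L b (avg (~~ b) u) (avg (~~ b) v).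
Proof.
move=> [hu hv p].
have [hau _] := avg_L2 (~~ b) hu; have [hav _] := avg_L2 (~~ b) hv.
split => //.
have iu := L2S_int hL hu; have iv := L2S_int hL hv.
have ou := outer_integrable (~~ b) iu; have ov := outer_integrable (~~ b) iv.
rewrite negbK in ou ov.
suff P : prim (dlo b) (dhi L b) (fun s => \int[mu]_(t in dom (~~ b)) u (pt (~~ b) t s))
    (fun s => \int[mu]_(t in dom (~~ b)) v (pt (~~ b) t s)).
  apply: aeW => t dt; rewrite /avg negbK.
  under eq_fun do rewrite along_pt; under [X in prim _ _ _ X]eq_fun do rewrite along_pt.
  exact: primZ.
apply: (weak_prim_test (dlohi hL b) ou ov) => f [sf kf clf].
have sDf : smooth setT ('D_1 f) by move=> k; have [_] := sf k.+1; exact.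
rewrite (fubini_along b iu sDf) (fubini_along b iv sf).
have i1 := bd_integrable hL iu (fun z => along_comp b sDf 0%N z I).
have i2 := bd_integrable hL iv (fun z => along_comp b sf 0%N z I).
rewrite -(fubini_strip b i1) -(fubini_strip b i2) -mulN1r -RintZ; last 2 first.
- exact: measurable_itvoo.
- exact: (outer_integrable b i2).
have i3 := integrableZl (measurable_itvoo _ _) (-1) (outer_integrable b i2).
apply: (Rint_ae_eq (measurable_itvoo _ _)).
- exact: integrable_meas1 (outer_integrable b i1).
- exact: integrable_meas1 i3.
rewrite /pd in p; apply: aeS2 p (slice_L2 hL b hu) => t h2 h1 dt.
move: (h2 dt) (h1 dt) => {}h2 {}h1.
rewrite mulN1r; under eq_Rintegral do rewrite along_pt.
under [in RHS]eq_Rintegral do rewrite along_pt.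
have z0 x : ~ (dlo b < x < dhi L b) -> f x = 0.
  move=> nx; apply/eqP/negPn/negP => h; apply: nx.
  by have := clf x (@subset_closure _ [set x | f x != 0] x h); rewrite /= in_itv.
apply: (prim_test (dlohi hL b) h2 (L2_meas h1) (phi := f) (dphi := 'D_1 f)).
- move=> x; apply: DeriveDef => //; apply: diff_derivable.
  by have [d _] := sf 1%N; exact: d.
- by move=> x; exact: (sDf 0%N x I).
- by apply: z0; rewrite ltxx.
- by apply: z0; rewrite ltxx andbF.
Qed.

End avg.

(** * Convergence in Sobolev spaces *)

Section sobolev_L2.
Context {R : realType} {d : measure_display} {T : measurableType d}.
Variables (mu : {measure set T -> \bar R}) (Om : set T).
Hypothesis mO : measurable Om.
Implicit Types u v : T -> R.

Lemma restrict_sq u : (EFin \o (fun x => u x ^+ 2)) \_ Om =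
  EFin \o (fun x => ((u \_ Om) x) ^+ 2).
Proof.
apply/funext => x /=; rewrite /patch; case: ifP => //= _.
by rewrite expr0n.
Qed.

Lemma sq_int u : L2 mu Om u -> (\int[mu]_x (`|((u \_ Om) x)%:E| `^ 2) = (ip mu Om u u)%:E)%E.
Proof.
move=> [mu_ iu].
rewrite /ip /Rintegral; under eq_integral do rewrite poweR_EFin powR_mulrn// real_normK ?num_real//.
rewrite -[X in integral mu setT X]/(EFin \o (fun x => ((u \_ Om) x) ^+ 2)) -restrict_sq -integral_mkcond.
rewrite fineK; last exact: (integrable_fin_num mO iu).
by apply: eq_integral.
Qed.

Lemma in_L2E u : in_L2 mu Om u <-> L2 mu Om u.
Proof.
rewrite /in_L2; split => [h|[h1 h2]].
  have h2 := Lfun2_integrable_sqr h.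
  move: h; rewrite inE => /andP[/[!inE]/= mf _]; split.
    exact/(measurable_restrictT _ mO).
  by apply/integrable_mkcond => //; rewrite restrict_sq.
rewrite inE; apply/andP; split; rewrite inE/=.
  by apply/(measurable_restrictT _ mO).
rewrite /finite_norm unlock /Lnorm; apply: poweR_lty.
by rewrite /= (sq_int (conj h1 h2)) ltry.
Qed.

Lemma L2normE u : L2 mu Om u -> L2norm mu Om u = (Num.sqrt (ip mu Om u u))%:E.
Proof.
move=> h; rewrite /L2norm unlock /Lnorm /= (sq_int h) poweR_EFin.
by rewrite powR12_sqrt// ip_ge0.
Qed.

Lemma cv2_L2norm (u_ : nat -> T -> R) u : cv2 mu Om u_ u ->
  (fun n => L2norm mu Om (u_ n \- u)) @ \oo --> 0%E.
Proof.
move=> [h1 h2 h3].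
have E n : L2norm mu Om (u_ n \- u) = (Num.sqrt (ip mu Om (fun x => u_ n x - u x) (fun x => u_ n x - u x)))%:E.
  by apply: L2normE; exact: L2B.
under eq_fun do rewrite E.
apply: cvg_EFin; first exact: nearW.
rewrite -sqrtr0.
exact: (continuous_cvg _ (@sqrt_continuous R 0) h3).
Qed.

Lemma cv2_L2norm_ae (u_ : nat -> T -> R) u (f_ : nat -> T -> R) : cv2 mu Om u_ u ->
  (forall n, L2 mu Om (f_ n)) ->
  (forall n, {ae mu, forall x, Om x -> f_ n x = u_ n x - u x}) ->
  (fun n => L2norm mu Om (f_ n)) @ \oo --> 0%E.
Proof.
move=> cu hf e; have [h1 h2 h3] := cu.
have E n : L2norm mu Om (f_ n) = L2norm mu Om (u_ n \- u).
  have hB : L2 mu Om (u_ n \- u) by exact: L2B.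
  by rewrite !L2normE//; congr (Num.sqrt _)%:E; exact: ip_ae_eq.
by under eq_fun do rewrite E; exact: cv2_L2norm.
Qed.

Section weak.
Variables (m : nat) (D : 'I_m -> (T -> R) -> T -> R) (test : set (T -> R)).
(* [wdi] stands for any characterization of weak derivatives in L^2 that makes
   them unique up to a null set. *)
Variable wdi : 'I_m -> (T -> R) -> (T -> R) -> Prop.
Hypothesis wdi_L2 : forall i u v, wdi i u v -> L2 mu Om u /\ L2 mu Om v.
Hypothesis wdiE : forall i u v, L2 mu Om u -> L2 mu Om v ->
  is_weak_deriv mu Om D test i u v <-> wdi i u v.
Hypothesis wdi_uniq : forall i u v v', wdi i u v -> wdi i u v' ->
  {ae mu, forall x, Om x -> v x = v' x}.
Hypothesis wdi_ae : forall i u v u' v', wdi i u v -> L2 mu Om u' -> L2 mu Om v' ->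
  {ae mu, forall x, Om x -> u x = u' x} -> {ae mu, forall x, Om x -> v x = v' x} ->
  wdi i u' v'.
Hypothesis wdi_B : forall i u v u' v', wdi i u v -> wdi i u' v' -> wdi i (u \- u') (v \- v').
Local Notation wkd := (weak_deriv mu Om D test).
Local Notation sob := (sobolev mu Om D test).
Local Notation sobn := (sobolev_norm mu Om D test).

(** [weak_deriv] is a choice among all admissible derivatives, so its value is tied to an explicit
    derivative only almost everywhere. *)
Lemma weak_derivP i u v : wdi i u v ->
  wdi i u (wkd i u) /\ {ae mu, forall x, Om x -> wkd i u x = v x}.
Proof.
move=> w; have [hu hv] := wdi_L2 w.
have [h1 h2] : [set v | in_L2 mu Om v /\ is_weak_deriv mu Om D test i u v] (wkd i u).
  rewrite /weak_deriv; apply: (@xgetPex _ (fun=> 0)); exists v; split; first exact/in_L2E.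
  exact/wdiE.
move/in_L2E : h1 => h1; have /(wdiE _ hu h1) w' := h2.
by split => //; exact: wdi_uniq w' w.
Qed.

Lemma sobolev_wkd k i u : sob k.+1 u -> wdi i u (wkd i u).
Proof.
move=> [/in_L2E hu /(_ i)[v [wv sv]]].
have hv : L2 mu Om v by apply/in_L2E; case: k sv => [|k] [].
by move/(wdiE _ hu hv) : wv => /weak_derivP[].
Qed.

Lemma sobolev_wkd2 i j u : sob 2 u -> wdi j (wkd i u) (wkd j (wkd i u)).
Proof.
move=> [/in_L2E hu /(_ i)[v [wv sv]]].
have hv : L2 mu Om v by apply/in_L2E; case: sv.
move/(wdiE _ hu hv) : wv => /weak_derivP[w1 e].
have [_ h1] := wdi_L2 w1.
have w2 := @sobolev_wkd 0 j v sv; have [_ h2] := wdi_L2 w2.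
have /weak_derivP[] // : wdi j (wkd i u) (wkd j v).
apply: (wdi_ae w2) => //; last exact: aeW.
by apply: aeS e => x /[apply].
Qed.

Lemma sobolev1I u (v : 'I_m -> T -> R) : L2 mu Om u -> (forall i, wdi i u (v i)) -> sob 1 u.
Proof.
move=> hu w; split; first exact/in_L2E.
move=> i; have [_ hv] := wdi_L2 (w i).
by exists (v i); split; [exact/wdiE|split => //; exact/in_L2E].
Qed.

Lemma sobolev2I u (v : 'I_m -> T -> R) (v2 : 'I_m -> 'I_m -> T -> R) : L2 mu Om u -> (forall i, wdi i u (v i)) ->
  (forall i j, wdi j (v i) (v2 i j)) -> sob 2 u.
Proof.
move=> hu w w2; split; first exact/in_L2E.
move=> i; have [_ hv] := wdi_L2 (w i).
by exists (v i); split; [exact/wdiE|exact: (sobolev1I hv (w2 i))].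
Qed.

Lemma esum_cvg0 (I : Type) (r : seq I) (a : nat -> I -> \bar R) :
  (forall n i, (0 <= a n i)%E) -> (forall i, a n i @[n --> \oo] --> 0%E) ->
  (\sum_(i <- r) a n i)%E @[n --> \oo] --> 0%E.
Proof.
move=> a0 ca; elim: r => [|i r IH].
  by under eq_fun do rewrite big_nil; exact: cvg_cst.
under eq_fun do rewrite big_cons.
have H := cvgeD (isT : adde_def (0%E : \bar R) 0%E) (ca i) IH.
rewrite adde0 in H; exact: H.
Qed.

Lemma L2norm_ge0 u : (0 <= L2norm mu Om u)%E. Proof. exact: Lnorm_ge0. Qed.

Lemma sobolev_cvg0 (u_ : nat -> T -> R) u : cv2 mu Om u_ u ->
  sobolev_cvg mu Om D test 0 u_ u.
Proof.
move=> cu; have [hu_ hu _] := cu; split.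
- by move=> n; split => //; exact/in_L2E.
- by split => //; exact/in_L2E.
- by under eq_fun do rewrite /= adde0; exact: cv2_L2norm.
Qed.

(** The functions [f_ n] agree with [u_n - u] almost everywhere only: in the norm of order 2 this
    lemma is applied to chosen representatives of first derivatives. *)
Lemma sobolev_norm1_cvg (u_ : nat -> T -> R) u (v_ : nat -> 'I_m -> T -> R) (v : 'I_m -> T -> R)
    (f_ : nat -> T -> R) :
  cv2 mu Om u_ u -> (forall i, cv2 mu Om (fun n => v_ n i) (v i)) ->
  (forall n i, wdi i (u_ n) (v_ n i)) -> (forall i, wdi i u (v i)) ->
  (forall n, L2 mu Om (f_ n)) ->
  (forall n, {ae mu, forall x, Om x -> f_ n x = u_ n x - u x}) ->
  sobn 1 (f_ n) @[n --> \oo] --> 0%E.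
Proof.
move=> cu cv w_ w hf ef; have [hu_ hu _] := cu.
rewrite -[X in _ --> X]adde0; apply: cvgeD => //; first exact: cv2_L2norm_ae cu hf ef.
apply: esum_cvg0 => [n i|i]; first by rewrite adde_ge0 ?L2norm_ge0.
under eq_fun do rewrite /= adde0.
have wB n : wdi i (f_ n) (v_ n i \- v i).
  have w1 := wdi_B (w_ n i) (w i); apply: (wdi_ae w1) => //.
  - by have [] := wdi_L2 w1.
  - by apply: aeS (ef n) => x /[apply].
  - exact: aeW.
apply: (cv2_L2norm_ae (cv i)) => n; have [w1 e1] := weak_derivP (wB n) => //.
by have [] := wdi_L2 w1.
Qed.

Lemma sobolev_cvg1 (u_ : nat -> T -> R) u (v_ : nat -> 'I_m -> T -> R) (v : 'I_m -> T -> R) :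
  cv2 mu Om u_ u -> (forall i, cv2 mu Om (fun n => v_ n i) (v i)) ->
  (forall n i, wdi i (u_ n) (v_ n i)) -> (forall i, wdi i u (v i)) ->
  sobolev_cvg mu Om D test 1 u_ u.
Proof.
move=> cu cv w_ w; have [hu_ hu _] := cu; split.
- by move=> n; exact: (sobolev1I (hu_ n) (w_ n)).
- exact: sobolev1I hu w.
- apply: (sobolev_norm1_cvg cu cv w_ w) => n; first exact: L2B.
  exact: aeW.
Qed.

Lemma sobolev_cvg2 (u_ : nat -> T -> R) u (v_ : nat -> 'I_m -> T -> R) (v : 'I_m -> T -> R)
    (v2_ : nat -> 'I_m -> 'I_m -> T -> R) (v2 : 'I_m -> 'I_m -> T -> R) :
  cv2 mu Om u_ u -> (forall i, cv2 mu Om (fun n => v_ n i) (v i)) ->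
  (forall i j, cv2 mu Om (fun n => v2_ n i j) (v2 i j)) ->
  (forall n i, wdi i (u_ n) (v_ n i)) -> (forall i, wdi i u (v i)) ->
  (forall n i j, wdi j (v_ n i) (v2_ n i j)) -> (forall i j, wdi j (v i) (v2 i j)) ->
  sobolev_cvg mu Om D test 2 u_ u.
Proof.
move=> cu cv cv2' w_ w w2_ w2; have [hu_ hu _] := cu; split.
- by move=> n; exact: (sobolev2I (hu_ n) (w_ n) (w2_ n)).
- exact: sobolev2I hu w w2.
rewrite -[X in _ --> X]adde0; apply: cvgeD => //; first exact: cv2_L2norm.
apply: esum_cvg0 => [n i|i].
  by rewrite /= adde_ge0 ?L2norm_ge0// sume_ge0// => j _; rewrite adde_ge0 ?L2norm_ge0.
have wB n := weak_derivP (wdi_B (w_ n i) (w i)).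
apply: (sobolev_norm1_cvg (cv i) (cv2' i) (fun n j => w2_ n i j) (w2 i)) => n.
  by have [/wdi_L2[]] := wB n.
by have [] := wB n.
Qed.

End weak.
End sobolev_L2.

Section strip_sobolev.
Context {R : realType}.
Variable L : R.
Hypothesis hL : 0 < L.
Local Notation mu2 := (@lebesgue2 R).
Local Notation S := (strip L).
Local Notation L2S := (L2 mu2 S).

Let mS := @measurable_strip R L.

Definition wds (i : 'I_2) := wd L (i == 0).

Lemma wds_L2 i u v : wds i u v -> L2S u /\ L2S v. Proof. by case. Qed.

Lemma dir_wdir (i : 'I_2) : dir i = wdir (i == 0) :> R * R.
Proof. by rewrite /dir /wdir; case: eqP. Qed.

Lemma wdsE (i : 'I_2) u v : L2S u -> L2S v ->
  is_weak_deriv mu2 S (@strip_D R) (test_fun S) i u v <-> wds i u v.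
Proof.
move=> hu hv; split => [h|[_ _ p]].
  split => //; apply: (weak_pd hL (L2S_int hL hu) (L2S_int hL hv)) => f tf.
  have := h f tf; rewrite /strip_D; under eq_Rintegral do rewrite dir_wdir.
  exact.
move=> f tf; rewrite /strip_D; under eq_Rintegral do rewrite dir_wdir.
exact: (pd_weak hL (L2S_int hL hu) (L2S_int hL hv) p tf).
Qed.

Lemma wds_uniq (i : 'I_2) u v v' : wds i u v -> wds i u v' ->
  {ae mu2, forall x, S x -> v x = v' x}.
Proof. exact: wd_uniq. Qed.

Lemma wds_ae (i : 'I_2) u v u' v' : wds i u v -> L2S u' -> L2S v' ->
  {ae mu2, forall x, S x -> u x = u' x} -> {ae mu2, forall x, S x -> v x = v' x} ->
  wds i u' v'.
Proof. exact: wd_ae. Qed.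

Lemma wds_B (i : 'I_2) u v u' v' : wds i u v -> wds i u' v' -> wds i (u \- u') (v \- v').
Proof. exact: wdB. Qed.

Lemma weak_partialP i u v : wds i u v -> wds i u (weak_partial_scal L i u) /\
  {ae mu2, forall x, S x -> weak_partial_scal L i u x = v x}.
Proof. exact: (weak_derivP mS wds_L2 wdsE wds_uniq). Qed.

Lemma sobolev2_wds i u : sobolev mu2 S (@strip_D R) (test_fun S) 2 u ->
  wds i u (weak_partial_scal L i u) /\
  forall j, wds j (weak_partial_scal L i u) (weak_partial_scal L j (weak_partial_scal L i u)).
Proof.
move=> h; split; first exact: (sobolev_wkd mS wds_L2 wdsE wds_uniq i h).
by move=> j; exact: (sobolev_wkd2 mS wds_L2 wdsE wds_uniq wds_ae i j h).
Qed.

End strip_sobolev.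

Section itv_sobolev.
Context {R : realType}.
Variable L : R.
Hypothesis hL : 0 < L.
Local Notation mu := (@lebesgue_measure R).
Local Notation I := (itvoo 0 L).

(** The one-dimensional instance of the relation [wdi], hence indexed by ['I_1]. *)
Definition wd1 (i : 'I_1) (u v : R -> R) := [/\ L2 mu I u, L2 mu I v & prim 0 L u v].

Let mI : measurable (I : set (measurableTypeR R)) := measurable_itvoo 0 L.

Lemma wd1_L2 i u v : wd1 i u v -> L2 mu I u /\ L2 mu I v. Proof. by case. Qed.

Lemma L2I_int u : L2 mu I u -> mu.-integrable I (EFin \o u).
Proof. by apply: L2_integrable => //; exact: itvoo_fin. Qed.

Lemma wd1E (i : 'I_1) u v : L2 mu I u -> L2 mu I v ->
  is_weak_deriv mu I (@open_itv_D R) (test_fun (`]0, L[ : set R)) i u v <-> wd1 i u v.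
Proof.
move=> hu hv; split => [h|[_ _ p]].
  split => //; exact: (weak_prim_test hL (L2I_int hu) (L2I_int hv) h).
move=> f tf; rewrite /open_itv_D.
exact: (prim_weak hL p (L2_meas hu) tf).
Qed.

Lemma wd1_uniq (i : 'I_1) u v v' : wd1 i u v -> wd1 i u v' ->
  {ae mu, forall x, I x -> v x = v' x}.
Proof. move=> [_ _ h] [_ _ h']; exact: (prim_uniq hL h h'). Qed.

Lemma weak_deriv1P i (u v : R -> R) : wd1 i u v ->
  {ae mu, forall x, I x -> weak_deriv mu I (@open_itv_D R) (test_fun (`]0, L[ : set R)) i u x = v x}.
Proof. by move=> /(weak_derivP mI wd1_L2 wd1E wd1_uniq)[]. Qed.

Lemma sobolev_I0 (u : R -> R) : L2 mu I u ->
  sobolev mu I (@open_itv_D R) (test_fun (`]0, L[ : set R)) 0 u.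
Proof. by move=> h; split => //; exact/in_L2E. Qed.

Lemma sobolev_I2 (u v v2 : R -> R) : wd1 0 u v -> wd1 0 v v2 ->
  sobolev mu I (@open_itv_D R) (test_fun (`]0, L[ : set R)) 2 u.
Proof.
move=> w w2; have [hu _ _] := w.
apply: (@sobolev2I _ _ _ _ _ mI _ _ _ _ wd1_L2 wd1E u (fun=> v) (fun _ _ => v2)) => //.
Qed.

End itv_sobolev.

(** * Coercivity of the plate energy *)

Section linalg.
Context {R : realType}.
Implicit Types (A B Q : 'M[R]_3) (u v : 'cV[R]_3).

Lemma dotE u v : dot u v = \sum_i u i 0 * v i 0.
Proof. by rewrite /dot mxE; apply: eq_bigr => i _; rewrite mxE. Qed.

Lemma frob_entry (p q : nat) (A : 'M[R]_(p, q)) i j : `|A i j| <= frob A.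
Proof.
rewrite /frob -sqrtr_sqr ler_wsqrtr// /mxtrace (bigD1 j)//= mxE (bigD1 i)//= !mxE -expr2.
rewrite -addrA lerDl addr_ge0// sumr_ge0// => k _.
  by rewrite mxE -expr2 sqr_ge0.
by rewrite mxE sumr_ge0// => l _; rewrite mxE -expr2 sqr_ge0.
Qed.

Lemma orth_entry A i j d : (A^T *m A) j j <= d ^+ 2 -> 0 <= d -> `|A i j| <= d.
Proof.
move=> h d0; rewrite -(@ler_pXn2r _ 2)// ?nnegrE// real_normK ?num_real//.
apply: le_trans h; rewrite mxE (bigD1 i)//= !mxE -expr2 lerDl sumr_ge0// => k _.
by rewrite mxE -expr2 sqr_ge0.
Qed.

Lemma SO3_entry Q i j : SO3 Q -> `|Q i j| <= 1.
Proof.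
by move=> [QQ _]; apply: orth_entry => //; rewrite QQ mxE eqxx expr1n.
Qed.

Lemma SO3_1 : SO3 (1%:M : 'M[R]_3).
Proof. by split; rewrite ?trmx1 ?mulmx1// det1. Qed.

(** For each rotation [Q], [A^T A - 1 = A^T (A - Q) + (A - Q)^T Q]. An entry of either product has
    three terms, with entries of [A] at most [M] and those of [Q] at most 1. *)
Lemma dist_SO3_entry A M i j : (forall k l, `|A k l| <= M) ->
  `|(A^T *m A - 1%:M) i j| <= 3 * (M + 1) * dist_SO3 A.
Proof.
move=> hM; have M0 : 0 <= M by apply: le_trans (hM 0 0).
have M1 : 0 < 3 * (M + 1) by rewrite mulr_gt0// ltr_wpDl.
rewrite -ler_pdivrMl// mulrC; apply: lb_le_inf.
  by exists (frob (A - 1%:M)), 1%:M => //; exact: SO3_1.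
move=> _ [Q hQ <-]; rewrite ler_pdivrMr// mulrC.
have [QQ _] := hQ.
have -> : A^T *m A - 1%:M = A^T *m (A - Q) + (A - Q)^T *m Q.
  rewrite -QQ mulmxBr (_ : (A - Q)^T = A^T - Q^T); last by apply/matrixP => k l; rewrite !mxE.
  by rewrite mulmxBl addrA subrK.
rewrite mxE (le_trans (ler_normD _ _))//.
have -> : 3 * (M + 1) * frob (A - Q) = \sum_(k < 3) (M * frob (A - Q)) + \sum_(k < 3) (frob (A - Q) * 1).
  by rewrite !sumr_const card_ord; move: (frob _) => F; ring.
by apply: lerD; rewrite mxE (le_trans (ler_norm_sum _ _ _))//; apply: ler_sum => k _;
  rewrite normrM mxE ler_pM// ?frob_entry//; exact: SO3_entry.
Qed.

End linalg.

(** * Second-order expansion of the energy density at the identity *)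

Section taylor.
Context {R : realType}.

Lemma is_derive_line (V : normedModType R) (f : V -> R) x v (t : R) :
  differentiable f (x + t *: v) ->
  is_derive t (1 : R) (fun s : R => f (x + s *: v)) ('D_v f (x + t *: v)).
Proof.
move=> df.
have E : (fun h : R => h^-1 *: (((fun s : R => f (x + s *: v)) \o shift t) (h *: (1 : R)) - f (x + t *: v))) =
  (fun h : R => h^-1 *: ((f \o shift (x + t *: v)) (h *: v) - f (x + t *: v))).
  apply/funext => h /=; congr (_ *: (f _ - _)).
  by rewrite /shift /= scaler1 scalerDl addrCA.
have d : derivable f (x + t *: v) v by exact: diff_derivable.
by apply: DeriveDef; rewrite /derivable /derive E.
Qed.

(** A minimum at 0 forces [g' 0 = 0], differentiability of [g'] at the single point 0 gives
    [g' s <= (q + e) s], and the mean value theorem finishes. The factor 1/2 of Taylor's formula is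
    given up; it would only improve a constant. *)
Lemma second_order_bound (g g' : R -> R) (q r : R) : 0 < r ->
  (forall t : R, `|t| < r -> is_derive t (1 : R) g (g' t)) ->
  is_derive (0 : R) (1 : R) g' q -> (forall t, `|t| < r -> 0 <= g t) -> g 0 = 0 ->
  forall e, 0 < e -> exists2 d, 0 < d & forall t, 0 < t < d -> g t <= (q + e) * t ^+ 2.
Proof.
move=> r0 dg dg' g0 g00 e e0.
have rI t : t \in `]- r, r[%R -> `|t| < r by rewrite in_itv /= ltr_norml.
have g'0 : g' 0 = 0.
  have h : is_derive (0 : R) (1 : R) g 0.
    apply: (@derive1_at_min R g (- r) r).
    - by rewrite -subr_ge0 opprK addr_ge0 ?ltW.
    - by move=> t /rI /dg[].
    - by rewrite in_itv/= oppr_lt0 r0.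
    - by move=> t /rI tr; rewrite g00 g0.
  have h2 := dg 0; rewrite normr0 in h2; have := h2 r0.
  by move=> [_ <-]; case: h.
have cq : (h^-1 * g' h) @[h --> (0 : R)^'] --> q.
  have [d1 d2] := dg'; rewrite -d2; move: d1; rewrite /derivable.
  have -> : (fun h : R => h^-1 *: ((g' \o shift 0) (h *: (1 : R)) - g' 0)) = (fun h => h^-1 * g' h).
    by apply/funext => h; rewrite /= addr0 scaler1 g'0 subr0.
  move=> c; rewrite /derive.
  have -> : (fun h : R => h^-1 *: ((g' \o shift 0) (h *: (1 : R)) - g' 0)) = (fun h => h^-1 * g' h).
    by apply/funext => h; rewrite /= addr0 scaler1 g'0 subr0.
  exact: c.
move/cvgrPdist_le/(_ _ e0) : cq => [d /= d0 hd].
exists (Num.min d r); first by rewrite lt_min d0 r0.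
move=> t /andP[t0]; rewrite lt_min => /andP[td tr].
have key s : 0 < s -> s < d -> g' s <= (q + e) * s.
  move=> s0 sd; have := hd s; rewrite /ball_/= sub0r normrN gtr0_norm// => /(_ sd).
  rewrite gt_eqF// => /(_ isT); rewrite ler_distl => /andP[].
  by rewrite lerBlDr mulrC ler_pdivrMr// => ->.
have [||c] := @MVT R g g' 0 t t0.
- move=> x; rewrite in_itv/= => /andP[x0 xt]; apply: dg.
  by rewrite gtr0_norm// (lt_trans xt).
- apply: derivable_within_continuous => x; rewrite in_itv/= => /andP[x0 xt].
  by have [] := dg x; rewrite // ger0_norm// (le_lt_trans xt).
rewrite in_itv/= => /andP[c0 ct]; rewrite g00 !subr0 => gt.
have gc := key _ c0 (lt_trans ct td).
have gt0 : 0 <= g t by rewrite g0// gtr0_norm.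
have gtc : g t <= (q + e) * c * t by rewrite gt ler_wpM2r// ltW.
have qe : 0 <= q + e.
  by have := le_trans gt0 gtc; rewrite -mulrA pmulr_lge0// mulr_gt0.
by rewrite (le_trans gtc)// -mulrA ler_wpM2l// expr2 ler_wpM2r// ltW.
Qed.

End taylor.

Section coercive.
Context {R : realType}.
Variable W : 'M[R]_3 -> \bar R.
Hypothesis hW : energy_density W.

(** Along [1 + t B] the density is at most about [2 Q3(B) t^2] and at least [c dist^2]. The distance
    in turn bounds [(1 + t B)^T (1 + t B) - 1 = t (B + B^T) + t^2 B^T B]; dividing by [t^2] and
    letting [t] tend to 0 leaves the symmetric part of [B]. *)
Lemma Q3_coercive : exists2 C : R, 0 < C &
  forall (B : 'M[R]_3) i j, (B i j + B j i) ^+ 2 <= C * Q3 W B.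
Proof.
have [c c0 hc] := density_coercive hW.
have [U [oU SU fU [dh dDh]]] := density_C2 hW.
(* [162 = 2 * 81]: the 2 undoes the factor 1/2 in [Q3], and 81 is the square of [3 (2 + 1)], the
   constant of [dist_SO3_entry] for entries bounded by 2. *)
exists (162 / c); first by rewrite divr_gt0.
move=> B i j; set h := (fine \o W : 'M[R]_3 -> R).
pose q := 'D_B ('D_B h) 1%:M.
pose g (t : R) := h (1%:M + t *: B); pose g' (t : R) := 'D_B h (1%:M + t *: B).
have U1 : nbhs (1%:M : 'M[R]_3) U by apply: open_nbhs_nbhs; split => //; exact/SU/SO3_1.
have cl : (1%:M + t *: B) @[t --> (0 : R)] --> (1%:M : 'M[R]_3).
  have : (1%:M + t *: B) @[t --> (0 : R)] --> (1%:M + 0 *: B : 'M[R]_3).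
    by apply: cvgD; [exact: cvg_cst|apply: cvgZr_tmp; exact: cvg_id].
  by rewrite scale0r addr0.
have /nbhs_ballP[r /= r0 hr] := cl _ U1.
have hU t : `|t| < r -> U (1%:M + t *: B).
  by move=> tr; apply: hr; rewrite /ball /= sub0r normrN.
have lb t : `|t| < r -> c * dist_SO3 (1%:M + t *: B) ^+ 2 <= g t.
  move=> tr; have := hc (1%:M + t *: B); rewrite -lee_fin /g /h /= fineK//.
  exact: fU (hU _ tr).
have g0 t : `|t| < r -> 0 <= g t.
  by move=> tr; apply: le_trans (lb _ tr); rewrite mulr_ge0 ?sqr_ge0// ltW.
have g00 : g 0 = 0.
  by rewrite /g scale0r addr0 /h /= (_ : W _ = 0%E)//; apply/(density_eq0 hW); exact: SO3_1.
have sb := @second_order_bound R g g' q r r0.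
have key : forall e, 0 < e -> exists2 d, 0 < d & forall t, 0 < t < d -> g t <= (q + e) * t ^+ 2.
  apply: sb.
  - by move=> t tr; apply: is_derive_line; exact/dh/hU.
  - rewrite /q; have E : 1%:M + (0 : R) *: B = 1%:M by rewrite scale0r addr0.
    rewrite -[in 'D_B _ _]E.
    apply: is_derive_line; rewrite E.
    have [d1 _] := dDh B; apply: d1; exact/SU/SO3_1.
  - exact: g0.
  - exact: g00.
rewrite /Q3 -/h -/q.
have -> : 162 / c * (2^-1 * q) = 81 * q / c by field; rewrite gt_eqF.
pose x := B i j + B j i; pose y := (B^T *m B) i j; pose b := frob B.
have b0 : 0 <= b by exact: sqrtr_ge0.
apply/ler_addgt0Pr => n n0.
(* This tolerance contributes [81 (n c / 162) / c = n / 2]; the other half of [n] is reserved for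
   the cross term in [t]. *)
have [d d0 hd] := key (n * c / 162) (divr_gt0 (mulr_gt0 n0 c0) (ltr0Sn _ _)).
have p1 : 0 < b + 1 by rewrite ltr_wpDl.
have p2 : 0 < 4 * `|x * y| + 1 by rewrite ltr_wpDl// mulr_ge0.
(* The first two bounds keep [t] in the range of the expansion and of the neighbourhood [U], the
   third keeps the entries of [1 + t B] below 2, and the last makes [2 t |x y|] at most [n / 2]. *)
pose t := Num.min (Num.min (d / 2) (r / 2)) (Num.min (b + 1)^-1 (n / (4 * `|x * y| + 1))).
have t0 : 0 < t by rewrite !lt_min invr_gt0 p1 (divr_gt0 n0 p2) (divr_gt0 d0)// (divr_gt0 r0).
have [t1 t2 t3 t4] : [/\ t <= d / 2, t <= r / 2, t <= (b + 1)^-1 & t <= n / (4 * `|x * y| + 1)].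
  by rewrite !ge_min !lexx !orbT.
have td : t < d by apply: le_lt_trans t1 _; rewrite ltr_pdivrMr// ltr_pMr// ltr1n.
have tr : t < r by apply: le_lt_trans t2 _; rewrite ltr_pdivrMr// ltr_pMr// ltr1n.
have ent k l : `|(1%:M + t *: B) k l| <= 2.
  rewrite !mxE (le_trans (ler_normD _ _))// (_ : 2 = 1 + 1)//; apply: lerD.
    by case: (k == l); rewrite ?normr1// normr0.
  rewrite normrM gtr0_norm//.
  have : t * (b + 1) <= 1 by rewrite -ler_pdivlMr// mul1r.
  apply: le_trans; rewrite ler_wpM2l ?(ltW t0)//.
  by rewrite (le_trans (frob_entry _ _ _))// lerDl.
have := dist_SO3_entry i j ent.
have -> : ((1%:M + t *: B)^T *m (1%:M + t *: B) - 1%:M) i j = t * (x + t * y).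
  have -> : (1%:M + t *: B)^T = 1%:M + t *: B^T by rewrite linearD/= linearZ/= trmx1.
  rewrite mulmxDr mulmx1 mulmxDl mul1mx -scalemxAl -scalemxAr.
  rewrite /y /x; move: (B^T *m B) (t) => P tt; rewrite !mxE; move: (_ == _)%:R => o; ring.
have lbt := lb t; rewrite gtr0_norm// in lbt; have {}lbt := lbt tr.
have {}hd := hd t; rewrite t0 td in hd; have {}hd := hd isT.
move: lbt hd t4; rewrite ler_pdivlMr// -/x.
have D0 : 0 <= dist_SO3 (1%:M + t *: B).
  apply: lb_le_inf; first by exists (frob (1%:M + t *: B - 1%:M)), 1%:M => //; exact: SO3_1.
  by move=> _ [Q _ <-]; exact: sqrtr_ge0.
move: D0; move: (dist_SO3 _) (g t) => D G D0 h1 h2 h3 h4.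
have {}h4 : t ^+ 2 * (x + t * y) ^+ 2 <= 81 * D ^+ 2.
  have -> : 81 * D ^+ 2 = (3 * (2 + 1) * D) ^+ 2 by ring.
  rewrite -exprMn -[leLHS]real_normK ?num_real// lerXn2r ?nnegrE//.
  by rewrite !mulr_ge0.
have h5 : c * (t ^+ 2 * (x + t * y) ^+ 2) <= 81 * ((q + n * c / 162) * t ^+ 2).
  apply: (@le_trans _ _ (81 * (c * D ^+ 2))); last by rewrite ler_pM2l// (le_trans h1).
  by rewrite [leRHS]mulrCA ler_pM2l.
have h6 : c * (x + t * y) ^+ 2 <= 81 * (q + n * c / 162).
  rewrite -(ler_pM2r (exprn_gt0 2 t0)); move: h5; congr (_ <= _); last by rewrite mulrA.
  by rewrite mulrA mulrAC.
have h7 : (x + t * y) ^+ 2 <= 81 * q / c + n / 2.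
  rewrite -(ler_pM2l c0) (le_trans h6)// le_eqVlt; apply/orP; left; apply/eqP.
  by field; rewrite gt_eqF.
have h8 : x ^+ 2 - 2 * t * `|x * y| <= (x + t * y) ^+ 2.
  have : - (x * y) <= `|x * y| by rewrite -normrN ler_norm.
  have := sqr_ge0 (t * y); move: `|x * y| => z h9 h10.
  have -> : (x + t * y) ^+ 2 = x ^+ 2 + 2 * t * (x * y) + (t * y) ^+ 2 by ring.
  have := ler_wpM2l (ltW t0) h10; move: h9; clear; nra.
move: h3 h7 h8 t0; rewrite -/x; move: `|x * y| => z; clear; nra.
Qed.

End coercive.

(** * Cross products, determinants and square roots in dimension three *)

Section cross.
Context {R : realType}.
Implicit Types (A B Q : 'M[R]_3) (u v p q : 'cV[R]_3).

Lemma sum3 (V : nmodType) (F : 'I_3 -> V) : \sum_i F i = F 0 + F 1 + F 2.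
Proof.
rewrite !big_ord_recl big_ord0 addr0 addrA; congr (_ + F _ + F _); exact/val_inj.
Qed.

Lemma ord3_ind (P : 'I_3 -> Prop) : P 0 -> P 1 -> P 2 -> forall i, P i.
Proof.
move=> p0 p1 p2 [[|[|[|//]]] hi].
- by rewrite (_ : Ordinal hi = 0)//; exact/val_inj.
- by rewrite (_ : Ordinal hi = 1)//; exact/val_inj.
- by rewrite (_ : Ordinal hi = 2)//; exact/val_inj.
Qed.

Lemma crossE u v : [/\ cross u v 0 0 = u 1 0 * v 2 0 - u 2 0 * v 1 0,
  cross u v 1 0 = u 2 0 * v 0 0 - u 0 0 * v 2 0 &
  cross u v 2 0 = u 0 0 * v 1 0 - u 1 0 * v 0 0].
Proof.
have e12 : (1 + 2 = 0 :> 'I_3) by exact/val_inj.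
have e22 : (2 + 2 = 1 :> 'I_3) by exact/val_inj.
have e21 : (2 + 1 = 0 :> 'I_3) by exact/val_inj.
have e11 : (1 + 1 = 2 :> 'I_3) by exact/val_inj.
by split; rewrite mxE ?add0r ?e12 ?e22 ?e21 ?e11.
Qed.

Lemma mx3E (a b c : 'cV[R]_3) i : [/\ mx3 a b c i 0 = a i 0, mx3 a b c i 1 = b i 0 & mx3 a b c i 2 = c i 0].
Proof.
have e0 : (0 : 'I_3) = lshift 2 (0 : 'I_1) by exact/val_inj.
have e1 : (1 : 'I_3) = rshift 1 (lshift 1 (0 : 'I_1)) by exact/val_inj.
have e2 : (2 : 'I_3) = rshift 1 (rshift 1 (0 : 'I_1)) by exact/val_inj.
split.
- by rewrite e0; exact: row_mxEl.
- by rewrite e1; exact: (etrans (row_mxEr _ _ _ _) (row_mxEl _ _ _ _)).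
- by rewrite e2; exact: (etrans (row_mxEr _ _ _ _) (row_mxEr _ _ _ _)).
Qed.

Lemma dot3 u v : dot u v = u 0 0 * v 0 0 + u 1 0 * v 1 0 + u 2 0 * v 2 0.
Proof. by rewrite dotE sum3. Qed.

Lemma lagrange_identity u v u' v' :
  dot (cross u v) (cross u' v') = dot u u' * dot v v' - dot u v' * dot v u'.
Proof.
rewrite !dot3; have [-> -> ->] := crossE u v; have [-> -> ->] := crossE u' v'; ring.
Qed.

Lemma dot_crossl u v : dot u (cross u v) = 0.
Proof. by rewrite dot3; have [-> -> ->] := crossE u v; ring. Qed.

Lemma dot_crossr u v : dot v (cross u v) = 0.
Proof. by rewrite dot3; have [-> -> ->] := crossE u v; ring. Qed.

Lemma dotC u v : dot u v = dot v u.
Proof. by rewrite !dot3; ring. Qed.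

Lemma dotZl k u v : dot (k *: u) v = k * dot u v.
Proof. by rewrite !dot3 !mxE; ring. Qed.

Lemma dotZr k u v : dot u (k *: v) = k * dot u v.
Proof. by rewrite !dot3 !mxE; ring. Qed.

Lemma dotDl u v p : dot (u + v) p = dot u p + dot v p.
Proof. by rewrite !dot3 !mxE; ring. Qed.

Lemma dotDr u v p : dot p (u + v) = dot p u + dot p v.
Proof. by rewrite !dot3 !mxE; ring. Qed.

Lemma dot_ge0 u : 0 <= dot u u.
Proof. by rewrite dot3 !addr_ge0// -expr2 sqr_ge0. Qed.

Lemma dot_gt0 u : u != 0 -> 0 < dot u u.
Proof.
move=> u0; rewrite lt_neqAle dot_ge0 andbT eq_sym; apply: contra u0.
rewrite dot3 !paddr_eq0 ?addr_ge0// -?expr2 ?sqr_ge0// !sqrf_eq0.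
move=> /andP[/andP[/eqP h0 /eqP h1] /eqP h2]; apply/eqP/matrixP => i j.
by rewrite ord1 mxE; elim/ord3_ind: i.
Qed.

Lemma frob_dot u : frob u = Num.sqrt (dot u u).
Proof. by rewrite /frob /mxtrace big_ord1. Qed.

Lemma unit_normalE u v : dot (cross u v) (cross u v) != 0 ->
  [/\ dot (unit_normal u v) (unit_normal u v) = 1, dot u (unit_normal u v) = 0 &
      dot v (unit_normal u v) = 0].
Proof.
move=> h; rewrite /unit_normal !dotZl !dotZr dot_crossl dot_crossr !mulr0; split => //.
rewrite frob_dot mulrA -invfM -expr2 sqr_sqrtr ?dot_ge0// mulVf//.
Qed.

Lemma mulmx_col (M : 'M[R]_3) (v : 'cV[R]_3) i : (M *m v) i 0 = M i 0 * v 0 0 + M i 1 * v 1 0 + M i 2 * v 2 0.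
Proof. by rewrite mxE sum3. Qed.

Lemma gram_mx3 (a b c : 'cV[R]_3) (G : 'M[R]_3) : G^T = G ->
  G 0 0 = dot a a -> G 1 1 = dot b b -> G 2 2 = dot c c ->
  G 0 1 = dot a b -> G 0 2 = dot a c -> G 1 2 = dot b c ->
  (mx3 a b c)^T *m mx3 a b c = G.
Proof.
move=> GT g00 g11 g22 g01 g02 g12.
have GS i j : G i j = G j i by rewrite -{1}GT mxE.
have E i j : ((mx3 a b c)^T *m mx3 a b c) i j =
   mx3 a b c 0 i * mx3 a b c 0 j + mx3 a b c 1 i * mx3 a b c 1 j + mx3 a b c 2 i * mx3 a b c 2 j.
  by rewrite mxE sum3 !mxE.
have [h1 h2 h3] := mx3E a b c 0; have [k1 k2 k3] := mx3E a b c 1; have [l1 l2 l3] := mx3E a b c 2.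
apply/matrixP => i j; rewrite E.
elim/ord3_ind: i; elim/ord3_ind: j; rewrite ?[G 1 0]GS ?[G 2 0]GS ?[G 2 1]GS
  ?(g00, g11, g22, g01, g02, g12) dot3 ?(h1, h2, h3, k1, k2, k3, l1, l2, l3); ring.
Qed.

Lemma trmx_mx3_mul (a b c v : 'cV[R]_3) : dot a v = 0 -> dot b v = 0 -> dot c v = 1 ->
  (mx3 a b c)^T *m v = delta_mx 2 0.
Proof.
have [h1 h2 h3] := mx3E a b c 0; have [k1 k2 k3] := mx3E a b c 1; have [l1 l2 l3] := mx3E a b c 2.
rewrite !dot3 => av bv cv; apply/matrixP => i j; rewrite ord1 [RHS]mxE mulmx_col.
rewrite [_^T i 0]mxE [_^T i 1]mxE [_^T i 2]mxE.
by elim/ord3_ind: i; rewrite ?(h1, h2, h3, k1, k2, k3, l1, l2, l3) ?av ?bv ?cv.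
Qed.

Lemma det2 (N : 'M[R]_2) : \det N = N 0 0 * N 1 1 - N 0 1 * N 1 0.
Proof.
rewrite (expand_det_row _ 0) !big_ord_recl big_ord0 addr0 /cofactor !det_mx11 !mxE.
have l00 : lift (0 : 'I_2) (0 : 'I_1) = 1 by exact/val_inj.
have l10 : lift (1 : 'I_2) (0 : 'I_1) = 0 by exact/val_inj.
rewrite !l00 !l10 /= expr0 expr1; ring.
Qed.

Lemma det3 (M : 'M[R]_3) : \det M =
  M 0 0 * (M 1 1 * M 2 2 - M 1 2 * M 2 1) - M 0 1 * (M 1 0 * M 2 2 - M 1 2 * M 2 0)
  + M 0 2 * (M 1 0 * M 2 1 - M 1 1 * M 2 0).
Proof.
rewrite (expand_det_row _ 0) sum3 /cofactor.
have d2 (N : 'M[R]_2) : \det N = N 0 0 * N 1 1 - N 0 1 * N 1 0 by exact: det2.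
have l00 : lift (0 : 'I_3) (0 : 'I_2) = 1 by exact/val_inj.
have l01 : lift (0 : 'I_3) (1 : 'I_2) = 2 by exact/val_inj.
have l10 : lift (1 : 'I_3) (0 : 'I_2) = 0 by exact/val_inj.
have l11 : lift (1 : 'I_3) (1 : 'I_2) = 2 by exact/val_inj.
have l20 : lift (2 : 'I_3) (0 : 'I_2) = 0 by exact/val_inj.
have l21 : lift (2 : 'I_3) (1 : 'I_2) = 1 by exact/val_inj.
rewrite !d2 !mxE l00 l01 l10 l11 l20 l21 /= expr0 expr1 sqrrN expr1n; ring.
Qed.

Lemma det_mx3 (a b c : 'cV[R]_3) : \det (mx3 a b c) = dot (cross a b) c.
Proof.
rewrite det3 dot3; have [-> -> ->] := crossE a b.
have [-> -> ->] := mx3E a b c 0; have [-> -> ->] := mx3E a b c 1; have [-> -> ->] := mx3E a b c 2.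
ring.
Qed.

(* Square root of a positive semidefinite [2 x 2] block: by Cayley-Hamilton
   [(M + s)^2 = (tr M + 2 s) M] when [s^2 = det M]. *)
Lemma psd_root22 (a b d : R) : 0 <= a -> 0 < d -> b ^+ 2 <= a * d ->
  exists x y z, [/\ x ^+ 2 + y ^+ 2 = a, y * (x + z) = b & y ^+ 2 + z ^+ 2 = d] /\
    forall p q : R, 0 <= x * p ^+ 2 + 2 * y * p * q + z * q ^+ 2.
Proof.
move=> a0 d0 h; pose s := Num.sqrt (a * d - b ^+ 2); pose t := Num.sqrt (a + d + 2 * s).
have s0 : 0 <= s by exact: sqrtr_ge0.
have s2 : s ^+ 2 = a * d - b ^+ 2 by rewrite sqr_sqrtr// subr_ge0.
have t0 : 0 < t by rewrite sqrtr_gt0 ltr_wpDr ?mulr_ge0// ltr_wpDl.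
have t2 : t ^+ 2 = a + d + 2 * s by rewrite sqr_sqrtr// !addr_ge0 ?mulr_ge0// ltW.
exists ((a + s) / t), (b / t), ((d + s) / t); split.
  have tn : t != 0 by rewrite gt_eqF.
  have t2n : t ^+ 2 != 0 by rewrite expf_neq0.
  split; apply: (mulIf t2n); rewrite [in RHS]t2.
  - have -> : (((a + s) / t) ^+ 2 + (b / t) ^+ 2) * t ^+ 2 = (a + s) ^+ 2 + b ^+ 2 by field.
    by rewrite sqrrD s2; ring.
  - have -> : b / t * ((a + s) / t + (d + s) / t) * t ^+ 2 = b * (a + d + 2 * s) by field.
    by [].
  - have -> : ((b / t) ^+ 2 + ((d + s) / t) ^+ 2) * t ^+ 2 = b ^+ 2 + (d + s) ^+ 2 by field.
    by rewrite sqrrD s2; ring.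
move=> p q.
have -> : (a + s) / t * p ^+ 2 + 2 * (b / t) * p * q + (d + s) / t * q ^+ 2 =
   (a * p ^+ 2 + 2 * b * p * q + d * q ^+ 2 + s * (p ^+ 2 + q ^+ 2)) / t by ring.
rewrite divr_ge0 ?(ltW t0)// addr_ge0//; last by rewrite mulr_ge0// addr_ge0 ?sqr_ge0.
rewrite -(pmulr_rge0 _ d0).
have -> : d * (a * p ^+ 2 + 2 * b * p * q + d * q ^+ 2) = (d * q + b * p) ^+ 2 + (a * d - b ^+ 2) * p ^+ 2 by ring.
by rewrite addr_ge0 ?sqr_ge0// mulr_ge0 ?sqr_ge0// subr_ge0.
Qed.

Lemma dot_mul (C : 'M[R]_3) u v : dot (C *m u) (C *m v) = dot u (C^T *m C *m v).
Proof. by rewrite /dot trmx_mul !mulmxA. Qed.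

Lemma mul_mx3 (C : 'M[R]_3) a b c : C *m mx3 a b c = mx3 (C *m a) (C *m b) (C *m c).
Proof. by rewrite /mx3 -!mul_mx_row. Qed.

Lemma orth_mulC (Q : 'M[R]_3) : Q^T *m Q = 1%:M -> Q *m Q^T = 1%:M.
Proof. exact: mulmx1C. Qed.

(** [n] is an eigenvector of [C^T C] with eigenvalue 1, so in an orthonormal basis containing [n] a
    two-dimensional block remains and [psd_root22] replaces the spectral theorem. Existence of one
    root is enough to know that the choice in [sqrtmx] is a root. *)
Lemma sqrtmxP (C : 'M[R]_3) n q : C \in unitmx -> C^T *m C *m n = n ->
  dot n n = 1 -> dot q q = 1 -> dot q n = 0 ->
  (sqrtmx (C^T *m C))^T = sqrtmx (C^T *m C) /\
  sqrtmx (C^T *m C) *m sqrtmx (C^T *m C) = C^T *m C.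
Proof.
move=> uC Fn nn qq qn.
suff [B hB] : exists B, [/\ B^T = B, forall v : 'cV[R]_3, 0 <= dot v (B *m v) &
    B *m B = C^T *m C].
  by have [] : [set B | [/\ B^T = B, forall v : 'cV[R]_3, 0 <= dot v (B *m v) &
    B *m B = C^T *m C]] (sqrtmx (C^T *m C)) by apply: (@xgetPex _ 0); exists B.
pose q2 := cross n q.
have q22 : dot q2 q2 = 1 by rewrite lagrange_identity nn qq (dotC n q) qn; ring.
have q2n : dot q2 n = 0 by rewrite dotC dot_crossl.
have qq2 : dot q q2 = 0 by rewrite dot_crossr.
pose Q := mx3 q q2 n.
have QQ : Q^T *m Q = 1%:M.
  by apply: gram_mx3; rewrite ?trmx1// !mxE ?qq ?q22 ?nn ?qq2 ?qn ?q2n.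
(* By the Lagrange identity the defect is the squared norm of a cross product. *)
have CS : dot (C *m q) (C *m q2) ^+ 2 <= dot (C *m q) (C *m q) * dot (C *m q2) (C *m q2).
  rewrite -subr_ge0 expr2 {2}[dot (C *m q) (C *m q2)]dotC -lagrange_identity; exact: dot_ge0.
have d0 : 0 < dot (C *m q2) (C *m q2).
  apply: dot_gt0; apply/eqP => h.
  have : q2 = 0 by rewrite -(mulKmx uC q2) h mulmx0.
  by move=> q20; move: q22; rewrite q20 dot3 !mxE; lra.
have [x [y [z [[h1 h2 h3] h4]]]] := psd_root22 (dot_ge0 (C *m q)) d0 CS.
(* The root in the basis [(q, q2, n)]: the block from [psd_root22] and the eigenvalue 1. *)
pose r : seq (seq R) := [:: [:: x; y; 0]; [:: y; z; 0]; [:: 0; 0; 1]].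
pose S : 'M[R]_3 := \matrix_(i, j) nth 0 (nth [::] r i) j.
have S00 : S 0 0 = x by rewrite mxE.
have S01 : S 0 1 = y by rewrite mxE.
have S02 : S 0 2 = 0 by rewrite mxE.
have S10 : S 1 0 = y by rewrite mxE.
have S11 : S 1 1 = z by rewrite mxE.
have S12 : S 1 2 = 0 by rewrite mxE.
have S20 : S 2 0 = 0 by rewrite mxE.
have S21 : S 2 1 = 0 by rewrite mxE.
have S22 : S 2 2 = 1 by rewrite mxE.
have ST : S^T = S.
  by apply/matrixP => i j; rewrite mxE; elim/ord3_ind: i; elim/ord3_ind: j;
    rewrite ?(S00, S01, S02, S10, S11, S12, S20, S21, S22).
have SS : S *m S = (C *m Q)^T *m (C *m Q).
  apply/esym; rewrite mul_mx3; apply: gram_mx3.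
  - by rewrite trmx_mul ST.
  - by rewrite mxE sum3 S00 S01 S02 S10 S20 -h1; ring.
  - by rewrite mxE sum3 S11 S01 S12 S10 S21 -h3; ring.
  - by rewrite dot_mul Fn nn mxE sum3 S20 S21 S22 S02 S12; ring.
  - by rewrite mxE sum3 S00 S01 S02 S11 S21 -h2; ring.
  - by rewrite dot_mul Fn qn mxE sum3 S00 S01 S02 S12 S22; ring.
  - by rewrite dot_mul Fn q2n mxE sum3 S10 S02 S11 S12 S22; ring.
exists (Q *m S *m Q^T); split.
- by rewrite !trmx_mul trmxK ST mulmxA.
- move=> v; have -> : dot v (Q *m S *m Q^T *m v) = dot (Q^T *m v) (S *m (Q^T *m v)).
    by rewrite /dot trmx_mul trmxK !mulmxA.
  move: (Q^T *m v) => u; rewrite dot3 !mulmx_col S00 S01 S02 S10 S11 S12 S20 S21 S22.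
  rewrite (_ : _ + _ = (x * u 0 0 ^+ 2 + 2 * y * u 0 0 * u 1 0 + z * u 1 0 ^+ 2) + u 2 0 ^+ 2); last by ring.
  by rewrite addr_ge0// sqr_ge0.
- rewrite !mulmxA -[_ *m Q^T *m Q]mulmxA QQ mulmx1 -[Q *m S *m S]mulmxA SS trmx_mul.
  by rewrite !mulmxA (orth_mulC QQ) mul1mx -mulmxA (orth_mulC QQ) mulmx1.
Qed.

End cross.

(** * Pointwise lower bound for the plate density *)

Section Qw.
Context {R : realType}.
Variables (kappa : R -> R) (II : R * R -> 'M[R]_2).
Variables (e1 e2 e3 : R -> 'cV[R]_3) (W : 'M[R]_3 -> \bar R).
Variable (w : R) (x : R * R).
Local Notation z := (rescale w x).
Local Notation p := ('D_(dir 0) (Phi II e1 e2 e3) z).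
Local Notation q := ('D_(dir 1) (Phi II e1 e2 e3) z).
Local Notation n := (Phi_normal II e1 e2 e3 z).
Local Notation N := (N_w II e1 e2 e3 w x).
Local Notation l := (1 - kappa z.1 * z.2).
Local Notation A := (A_0 kappa II e1 e2 e3 w x).
Hypothesis pq0 : dot (cross p q) (cross p q) != 0.
Hypothesis l0 : 0 < l.

Let r : seq R := [:: l; 1; 1].
Let D1 : 'M[R]_3 := diag_mx (\row_j nth 0 r j).
Let e : 'cV[R]_3 := delta_mx 2 0.

Let D1E : D1^T *m D1 = metric3 kappa z.
Proof.
rewrite tr_diag_mx mulmx_diag; congr diag_mx; apply/rowP => i; rewrite !mxE.
by elim/ord3_ind: i => /=; rewrite ?mulr1// -expr2.
Qed.

Let uN : N \in unitmx.
Proof.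
rewrite unitmxE unitfE /N_w det_mx3 /Phi_normal /unit_normal dotZr mulf_neq0// invr_neq0//.
by rewrite frob_dot sqrtr_eq0 -ltNge lt_neqAle eq_sym pq0 dot_ge0.
Qed.

Let Ne : N *m e = n.
Proof.
rewrite -colE; apply/matrixP => i j; rewrite ord1 mxE.
by have [_ _ ->] := mx3E p q n i.
Qed.

Let NTn : N^T *m n = e.
Proof.
have [nn pn qn] : [/\ dot n n = 1, dot p n = 0 & dot q n = 0] := unit_normalE pq0.
by rewrite /N_w /= (trmx_mx3_mul pn qn nn).
Qed.

Let D1e : D1 *m e = e.
Proof.
rewrite -colE; apply/matrixP => i j; rewrite ord1 !mxE.
by elim/ord3_ind: i.
Qed.

(** [D1 = diag(l, 1, 1)] is a root of the metric, which turns [F_0] into the Gram matrix of [C]. The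
    normal is fixed by it because [N] maps the third basis vector to [n] and [N^T] maps [n] back. *)
Let C := D1 *m invmx N.

Let F0E : F_0 kappa II e1 e2 e3 w x = C^T *m C.
Proof. by rewrite /F_0 -D1E /C trmx_mul !mulmxA. Qed.

Let uC : C \in unitmx.
Proof.
rewrite unitmx_mul unitmx_inv uN andbT unitmxE unitfE det_diag.
by rewrite !big_ord_recl big_ord0 !mxE /= !mulr1 gt_eqF.
Qed.

Let Cn : C^T *m C *m n = n.
Proof.
rewrite -mulmxA /C -[D1 *m _ *m n]mulmxA -{1}Ne mulKmx// D1e trmx_mul -mulmxA tr_diag_mx -/D1 D1e.
by rewrite -NTn trmx_inv mulKmx// unitmx_tr.
Qed.

(** The square root enters squared, so [A_0^T A_0 = N^T F_0 N] and all dependence on [Phi] cancels.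
    The columns of [A_0] therefore have lengths [l], 1 and 1. *)
Lemma A0_gram : A^T *m A = metric3 kappa z.
Proof.
have [nn pn qn] : [/\ dot n n = 1, dot p n = 0 & dot q n = 0] := unit_normalE pq0.
have p0 : p != 0.
  apply: contraNneq pq0 => p0; rewrite lagrange_identity p0 !dot3 !mxE; apply/eqP; ring.
have pp := dot_gt0 p0.
have [sT ss] : (sqrtmx (C^T *m C))^T = sqrtmx (C^T *m C) /\
  sqrtmx (C^T *m C) *m sqrtmx (C^T *m C) = C^T *m C.
  apply: (@sqrtmxP _ C n ((Num.sqrt (dot p p))^-1 *: p)) => //.
    by rewrite dotZl dotZr mulrA -invfM -expr2 sqr_sqrtr ?dot_ge0// mulVf// gt_eqF.
  by rewrite dotZl pn mulr0.
rewrite /A_0 F0E trmx_mul sT mulmxA -[_ *m sqrtmx _ *m sqrtmx _]mulmxA ss /C trmx_mul.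
rewrite !mulmxA -trmx_mul mulVmx// trmx1 mul1mx -!mulmxA mulVmx// mulmx1.
exact: D1E.
Qed.

Lemma A0_unit : A \in unitmx.
Proof.
have : metric3 kappa z \in unitmx.
  rewrite unitmxE unitfE det_diag !big_ord_recl big_ord0 !mxE /= !mulr1.
  by rewrite expf_neq0// gt_eqF.
by rewrite -A0_gram unitmx_mul => /andP[].
Qed.

(** A competitor [G] equals [A^T B A], and symmetrizing [G] symmetrizes [B], the only part of [B]
    that [Q3] controls. An entry is a sum of 9 terms with two factors at most 2 from [A], whence
    [36 = 9 * 4]. *)
Lemma Qw_lower K : 0 < K -> l <= 2 ->
  (forall (B : 'M[R]_3) i j, (B i j + B j i) ^+ 2 <= K * Q3 W B) ->
  forall (F : 'M[R]_2) i j, (F i j + F j i) ^+ 2 <= 36 ^+ 2 * K * Q_w kappa II e1 e2 e3 W w x F.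
Proof.
move=> K0 l2 hK F i j.
have K1 : 0 < 36 ^+ 2 * K := mulr_gt0 (exprn_gt0 2 (ltr0Sn _ _)) K0.
rewrite -ler_pdivrMl// mulrC; apply: lb_le_inf.
  exists (Q3 W ((invmx A)^T *m block_mx F 0 0 (0 : 'M[R]_1) *m invmx A)).
  by exists (block_mx F 0 0 0) => //; exact: block_mxKul.
move=> _ [G /= GF <-]; rewrite ler_pdivrMr// mulrC.
set B := (invmx A)^T *m (G : 'M[R]_3) *m invmx A.
have GE : (G : 'M[R]_3) = A^T *m B *m A.
  have h : A^T *m (invmx A)^T = 1%:M by rewrite -trmx_mul mulVmx ?trmx1// A0_unit.
  rewrite /B -!mulmxA mulVmx ?A0_unit// mulmx1 mulmxA h mul1mx.
  by [].
have FE k m : F k m = G (lshift 1 k) (lshift 1 m) by rewrite -GF !mxE.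
have aA k m : `|A k m| <= 2.
  apply: orth_entry => //; rewrite A0_gram mxE eqxx mxE mulr1n.
  case: ifP => _; last by rewrite -[leLHS](expr1n _ 2) lerXn2r ?nnegrE// ler1n.
  by rewrite lerXn2r ?nnegrE// ltW.
have Q0 : 0 <= K * Q3 W B by rewrite (le_trans _ (hK B 0 0))// sqr_ge0.
have bB k m : `|B k m + B m k| <= Num.sqrt (K * Q3 W B).
  by rewrite -sqrtr_sqr ler_wsqrtr.
rewrite !FE; move: (lshift 1 i) (lshift 1 j) => a b.
have -> : G a b + G b a = \sum_k \sum_m A k a * (B k m + B m k) * A m b.
  rewrite GE mxE [X in _ + X]mxE.
  under eq_bigr do rewrite mxE mulr_suml.
  under [X in _ + X]eq_bigr do rewrite mxE mulr_suml.
  rewrite exchange_big/= -big_split/=; apply: eq_bigr => k _.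
  rewrite -big_split/=; apply: eq_bigr => m _; rewrite !mxE; ring.
have : `|\sum_k \sum_m A k a * (B k m + B m k) * A m b| <= 36 * Num.sqrt (K * Q3 W B).
  have -> : 36 * Num.sqrt (K * Q3 W B) = \sum_(k < 3) \sum_(m < 3) (2 * Num.sqrt (K * Q3 W B) * 2).
    by rewrite !sumr_const !card_ord; move: (Num.sqrt _) => s; ring.
  rewrite (le_trans (ler_norm_sum _ _ _))//; apply: ler_sum => k _.
  rewrite (le_trans (ler_norm_sum _ _ _))//; apply: ler_sum => m _.
  by rewrite !normrM !ler_pM// mulr_ge0.
move=> h; rewrite -[leLHS]real_normK ?num_real//.
apply: (@le_trans _ _ ((36 * Num.sqrt (K * Q3 W B)) ^+ 2)).
  by rewrite lerXn2r ?nnegrE// mulr_ge0.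
by rewrite exprMn sqr_sqrtr// mulrA.
Qed.

End Qw.

(** * The frame along the midline *)

Section frame.
Context {R : realType}.
Variables (L w0 : R) (kappa : R -> R) (II : R * R -> 'M[R]_2) (e1 e2 e3 : R -> 'cV[R]_3).
Hypotheses (hL : 0 < L) (hw0 : 0 < w0).
Hypothesis hkappa : smooth_on `[0, L] kappa.
Hypothesis hII : smooth_on (`[0, L] `*` `[- (w0 / 2), w0 / 2]) II.
Hypothesis hframe : frame L kappa II e1 e2 e3.
Implicit Types (f g : R -> R) (s t : R).
Local Notation mu := (@lebesgue_measure R).

Lemma is_derive_entry (m n : nat) (f : R -> 'M[R]_(m, n)) t df i j :
  is_derive t (1 : R) f df -> is_derive t (1 : R) (fun s => f s i j) (df i j).
Proof.
move=> [d <-]; apply: DeriveDef; first by have /derivable_mxP := d; exact.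
by rewrite (derive_mx d) mxE.
Qed.

Lemma derivable_sliceP b s t (f : R * R -> R) :
  derivable f (pt b s t) (wdir b) <-> derivable (fun s => f (pt b s t)) s (1 : R).
Proof. by rewrite /derivable quot_slice. Qed.

Lemma within_entry (m n : nat) (f : R -> 'M[R]_(m, n)) (A : set R) i j :
  {within A, continuous f} -> {within A, continuous (fun s => f s i j)}.
Proof.
move=> cf x.
apply: (@continuous_comp (subspace A) _ _ f (fun M : 'M[R]_(m, n) => M i j) x (cf x)).
exact: coord_continuous.
Qed.

Lemma kappa_cont : {within `[0, L], continuous kappa}.
Proof.
have [U [g [oU AU sg eg]]] := hkappa.
have cg : {within `[0, L], continuous g}.
  apply: continuous_in_subspaceT => x /[!inE] xA; exact: (sg 0%N x (AU _ xA)).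
by apply: subspace_eq_continuous cg => x /[!inE] /eg.
Qed.

Lemma midpt_in t : 0 <= t <= L -> (`[0, L] `*` `[- (w0 / 2), w0 / 2]) (t, 0 : R).
Proof.
move=> h; have h2 : 0 <= w0 / 2 by rewrite divr_ge0 ?ltW.
by split; rewrite /= in_itv/= ?h ?oppr_le0 ?h2.
Qed.

(** [II] is smooth only on a closed rectangle, so its derivative is read off a smooth extension;
    that extension supplies a derivative that stays continuous up to the ends of the interval. *)
Lemma II_mid_C1 i j : exists f f', [/\ {within `[0, L], continuous f},
  {within `[0, L], continuous f'}, forall t, 0 <= t <= L -> II_mid II t i j = f t &
  forall t, 0 < t < L -> is_derive t (1 : R) f (f' t)].
Proof.
have [U [G [oU AU sG eG]]] := hII.
have ct t : {for t, continuous (fun t : R => (t, 0 : R))}.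
  exact: (cvg_pair cvg_id (cvg_cst _)).
have sub (h : R * R -> 'M[R]_2) : Ck 0 U h -> {within `[0, L], continuous (fun t => h (t, 0) i j)}.
  move=> ch; apply: continuous_in_subspaceT => t /[!inE]; rewrite /= in_itv/= => tL.
  apply: (@continuous_comp _ _ _ (fun t => h (t, 0 : R)) (fun M : 'M[R]_2 => M i j)); last exact: coord_continuous.
  by apply: (continuous_comp (ct t)); apply: ch; apply: AU; exact: midpt_in.
exists (fun t => G (t, 0) i j), (fun t => ('D_(wdir true) G (t, 0)) i j); split.
- apply: sub; exact: (sG 0%N).
- by apply: (sub ('D_(wdir true) G)); have [_ h] := sG 1%N; exact: h.
- by move=> t tL; rewrite /II_mid eG//; exact: midpt_in.
- move=> t /andP[t0 tL].
  have [dG _] := sG 1%N.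
  have d : derivable G (t, 0) (wdir true).
    by apply: diff_derivable; apply: dG; apply: AU; apply: midpt_in; rewrite !ltW.
  rewrite (derive_mx d) mxE; apply: DeriveDef.
    apply: (derivable_slice (b := true) (t := 0) (f := fun z => G z i j)).
    by have /derivable_mxP := d; exact.
  exact: (derive_slice true t 0 (fun z => G z i j)).
Qed.

Lemma II_mid_cont i j : {within `[0, L], continuous (fun t => II_mid II t i j)}.
Proof.
have [f [_ [cf _ e _]]] := II_mid_C1 i j.
by apply: subspace_eq_continuous cf => x /[!inE]/=; rewrite in_itv/= => /e.
Qed.

Lemma is_deriveDf f g t df dg : is_derive t (1 : R) f df -> is_derive t (1 : R) g dg ->
  is_derive t (1 : R) (fun s => f s + g s) (df + dg).
Proof. exact: is_deriveD. Qed.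

Lemma is_deriveMf f g t df dg : is_derive t (1 : R) f df -> is_derive t (1 : R) g dg ->
  is_derive t (1 : R) (fun s => f s * g s) (f t * dg + g t * df).
Proof. exact: is_deriveM. Qed.

Lemma is_deriveNf f t df : is_derive t (1 : R) f df ->
  is_derive t (1 : R) (fun s => - f s) (- df).
Proof. exact: is_deriveN. Qed.

(** The coefficients of [Phi], seen as a polynomial in [z.2], form a class closed under sums and
    products whose derivatives are uniformly bounded. *)
Definition C1b f := exists f' M, 0 <= M /\
  forall s, 0 < s < L -> [/\ is_derive s (1 : R) f (f' s), `|f s| <= M & `|f' s| <= M].

Lemma C1bD f g : C1b f -> C1b g -> C1b (fun s => f s + g s).
Proof.
move=> [f' [M [M0 hf]]] [g' [N [N0 hg]]].
exists (fun s => f' s + g' s), (M + N); split; first exact: addr_ge0.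
move=> s hs; have [h1 h2 h3] := hf s hs; have [k1 k2 k3] := hg s hs; split.
- exact: is_deriveD.
- by rewrite (le_trans (ler_normD _ _))// lerD.
- by rewrite (le_trans (ler_normD _ _))// lerD.
Qed.

Lemma C1bM f g : C1b f -> C1b g -> C1b (fun s => f s * g s).
Proof.
move=> [f' [M [M0 hf]]] [g' [N [N0 hg]]].
exists (fun s => f s * g' s + g s * f' s), (M * N + N * M); split; first by rewrite addr_ge0// mulr_ge0.
move=> s hs; have [h1 h2 h3] := hf s hs; have [k1 k2 k3] := hg s hs; split.
- exact: is_deriveM.
- by rewrite normrM ler_wpDr ?mulr_ge0// ler_pM.
- by rewrite (le_trans (ler_normD _ _))// lerD// normrM ler_pM.
Qed.

Lemma C1b_cst k : C1b (cst k).
Proof.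
exists (cst 0), `|k|; split => // s _; split => //; last by rewrite normr0.
exact: is_derive_cst.
Qed.

Lemma C1b_intro f f' : {within `[0, L], continuous f} -> {within `[0, L], continuous f'} ->
  (forall t, 0 < t < L -> is_derive t (1 : R) f (f' t)) -> C1b f.
Proof.
move=> cf cf' d.
have [M hM] := cont_bounded hL cf; have [N hN] := cont_bounded hL cf'.
exists f', (`|M| + `|N|); split; first by rewrite addr_ge0.
move=> s hs; have hs' : itvoo 0 L s by rewrite itvooE.
split; first exact: d.
  by rewrite ler_wpDr// (le_trans (hM _ hs'))// ler_norm.
by rewrite ler_wpDl// (le_trans (hN _ hs'))// ler_norm.
Qed.

Lemma C1b_eq f g : (forall s, 0 < s < L -> f s = g s) -> C1b f -> C1b g.
Proof.
move=> fg [f' [M [M0 hf]]]; exists f', M; split => // s hs.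
have [h1 h2 h3] := hf s hs; split => //; last by rewrite -fg.
apply: near_eq_is_derive h1.
have : nbhs s (`]0, L[%classic : set R) by apply: open_nbhs_nbhs; split; [exact: itv_open|rewrite /= in_itv].
by apply: filterS => t; rewrite /= in_itv/=; exact: fg.
Qed.

Lemma C1b_II i j : C1b (fun t => II_mid II t i j).
Proof.
have [f [f' [cf cf' e d]]] := II_mid_C1 i j.
apply: (@C1b_eq f); last exact: C1b_intro cf cf' d.
by move=> s /andP[s0 sL]; rewrite e// !ltW.
Qed.

Lemma frame_cont i : [/\ {within `[0, L], continuous (fun t => e1 t i 0)},
  {within `[0, L], continuous (fun t => e2 t i 0)} & {within `[0, L], continuous (fun t => e3 t i 0)}].
Proof. by have [_ [h1 h2 h3] _] := hframe; split; exact: within_entry. Qed.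

Lemma frame_derive i t : 0 < t < L -> [/\
  is_derive t (1 : R) (fun t => e1 t i 0) (kappa t * e2 t i 0 + II_mid II t 0 0 * e3 t i 0),
  is_derive t (1 : R) (fun t => e2 t i 0) (- kappa t * e1 t i 0 + II_mid II t 0 1 * e3 t i 0) &
  is_derive t (1 : R) (fun t => e3 t i 0) (- II_mid II t 0 0 * e1 t i 0 - II_mid II t 0 1 * e2 t i 0)].
Proof.
have [_ _ d] := hframe => /d[d1 d2 d3].
split; [have := is_derive_entry i 0 d1|have := is_derive_entry i 0 d2|have := is_derive_entry i 0 d3];
  by rewrite !mxE.
Qed.

Lemma wcontD f g (A : set R) : {within A, continuous f} -> {within A, continuous g} ->
  {within A, continuous (fun s => f s + g s)}.
Proof. by move=> cf cg x; apply: cvgD; [exact: cf|exact: cg]. Qed.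

Lemma wcontM f g (A : set R) : {within A, continuous f} -> {within A, continuous g} ->
  {within A, continuous (fun s => f s * g s)}.
Proof. by move=> cf cg x; apply: cvgM; [exact: cf|exact: cg]. Qed.

Lemma wcontN f (A : set R) : {within A, continuous f} -> {within A, continuous (fun s => - f s)}.
Proof. by move=> cf x; apply: cvgN; exact: cf. Qed.

Lemma frame_derive_cont i : [/\
  {within `[0, L], continuous (fun t => kappa t * e2 t i 0 + II_mid II t 0 0 * e3 t i 0)},
  {within `[0, L], continuous (fun t => - kappa t * e1 t i 0 + II_mid II t 0 1 * e3 t i 0)} &
  {within `[0, L], continuous (fun t => - II_mid II t 0 0 * e1 t i 0 - II_mid II t 0 1 * e2 t i 0)}].
Proof.
have [c1 c2 c3] := frame_cont i; have ck := kappa_cont.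
have c00 : {within `[0, L], continuous (fun t => II_mid II t 0 0)} by exact: II_mid_cont.
have c01 : {within `[0, L], continuous (fun t => II_mid II t 0 1)} by exact: II_mid_cont.
split.
- by apply: wcontD; apply: wcontM.
- by apply: wcontD; apply: wcontM => //; exact: wcontN.
- apply: wcontD; first by apply: wcontM => //; exact: wcontN.
  by apply: wcontN; apply: wcontM.
Qed.

Lemma C1b_frame i : [/\ C1b (fun t => e1 t i 0), C1b (fun t => e2 t i 0) & C1b (fun t => e3 t i 0)].
Proof.
have [c1 c2 c3] := frame_cont i; have [k1 k2 k3] := frame_derive_cont i.
by split; [apply: C1b_intro c1 k1 _|apply: C1b_intro c2 k2 _|apply: C1b_intro c3 k3 _] => t /(frame_derive i)[].
Qed.

Lemma zero_derive_cst f : {within `[0, L], continuous f} ->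
  (forall t, 0 < t < L -> is_derive t (1 : R) f 0) -> forall t, 0 <= t <= L -> f t = f 0.
Proof.
move=> cf d t /andP[]; rewrite le_eqVlt => /predU1P[<-//|t0 tL].
have [||c] := @MVT R f (fun=> 0) 0 t t0.
- by move=> x; rewrite in_itv/= => /andP[x0 xt]; apply: d; rewrite x0 (lt_le_trans xt).
- apply: continuous_subspaceW cf => x; rewrite /= !in_itv/= => /andP[-> xt] /=.
  exact: le_trans tL.
by move=> _ /eqP; rewrite mul0r subr_eq0 => /eqP.
Qed.

(** With the frame as columns, [M' = M Om] for a skew [Om], so [(M M^T)' = M (Om + Om^T) M^T = 0].
    The order [M M^T] makes each entry constant directly, whereas [M^T M] would only satisfy a
    differential equation. *)
Lemma frame_orth t : 0 <= t <= L ->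
  mx3 (e1 t) (e2 t) (e3 t) *m (mx3 (e1 t) (e2 t) (e3 t))^T = 1%:M.
Proof.
move=> tL.
have E s i j : (mx3 (e1 s) (e2 s) (e3 s) *m (mx3 (e1 s) (e2 s) (e3 s))^T) i j =
   e1 s i 0 * e1 s j 0 + e2 s i 0 * e2 s j 0 + e3 s i 0 * e3 s j 0.
  rewrite mxE sum3 ![_^T _ j]mxE.
  by have [-> -> ->] := mx3E (e1 s) (e2 s) (e3 s) i; have [-> -> ->] := mx3E (e1 s) (e2 s) (e3 s) j.
have [[h0 _] _ _] := hframe; have {}h0 := mulmx1C h0.
apply/matrixP => i j; rewrite -h0 !E.
have [a1 a2 a3] := frame_cont i; have [b1 b2 b3] := frame_cont j.
apply: (@zero_derive_cst (fun s => e1 s i 0 * e1 s j 0 + e2 s i 0 * e2 s j 0 + e3 s i 0 * e3 s j 0)) => //.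
  by apply: wcontD; [apply: wcontD|]; exact: wcontM.
move=> s /[dup] /(frame_derive i)[d1 d2 d3] /(frame_derive j)[d1' d2' d3'].
apply: (is_derive_eq (is_deriveDf (is_deriveDf (is_deriveMf d1 d1') (is_deriveMf d2 d2')) (is_deriveMf d3 d3'))).
ring.
Qed.

(** The determinant is continuous, squares to 1 and equals 1 at the origin; a value -1 would force a
    zero in between. *)
Lemma frame_SO3 t : 0 <= t <= L -> SO3 (mx3 (e1 t) (e2 t) (e3 t)).
Proof.
move=> tL; have ht := frame_orth tL; split; first exact: mulmx1C.
have dd s : 0 <= s <= L -> \det (mx3 (e1 s) (e2 s) (e3 s)) ^+ 2 = 1.
  by move=> /frame_orth /(congr1 determinant); rewrite det_mulmx det_tr det1 expr2.
have [[_ d0] _ _] := hframe.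
have : \det (mx3 (e1 t) (e2 t) (e3 t)) ^+ 2 == 1 by rewrite dd.
rewrite sqrf_eq1 => /orP[/eqP//|/eqP dm].
have t0 : 0 <= t by case/andP: tL.
have cd : {within `[0, L], continuous (fun s => \det (mx3 (e1 s) (e2 s) (e3 s)))}.
  have -> : (fun s => \det (mx3 (e1 s) (e2 s) (e3 s))) =
     (fun s => (e1 s 1 0 * e2 s 2 0 + - (e1 s 2 0 * e2 s 1 0)) * e3 s 0 0 +
       (e1 s 2 0 * e2 s 0 0 + - (e1 s 0 0 * e2 s 2 0)) * e3 s 1 0 +
       (e1 s 0 0 * e2 s 1 0 + - (e1 s 1 0 * e2 s 0 0)) * e3 s 2 0).
    apply/funext => s; rewrite det_mx3 dot3.
    by have [-> -> ->] := crossE (e1 s) (e2 s).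
  have [a1 a2 a3] := frame_cont 0; have [b1 b2 b3] := frame_cont 1; have [c1 c2 c3] := frame_cont 2.
  exact: (wcontD (wcontD (wcontM (wcontD (wcontM b1 c2) (wcontN (wcontM c1 b2))) a3)
    (wcontM (wcontD (wcontM c1 a2) (wcontN (wcontM a1 c2))) b3))
    (wcontM (wcontD (wcontM a1 b2) (wcontN (wcontM b1 a2))) c3)).
have cd' : {within `[0, t], continuous (fun s => \det (mx3 (e1 s) (e2 s) (e3 s)))}.
  apply: continuous_subspaceW cd => x; rewrite /= !in_itv/= => /andP[-> xt] /=.
  by case/andP: tL => _; exact: le_trans.
have [|c] := @IVT R _ 0 t 0 t0 cd'.
  by rewrite d0 dm; rewrite ge_min le_max lerN10 ler01 orbT.
rewrite in_itv/= => /andP[c0 ct] c00.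
have := dd c; rewrite c0 (le_trans ct) ?(andP tL).2// => /(_ isT) /eqP.
by rewrite c00 expr0n eq_sym oner_eq0.
Qed.

Lemma frame_ortho t : 0 <= t <= L -> [/\ dot (e1 t) (e1 t) = 1, dot (e2 t) (e2 t) = 1,
  dot (e1 t) (e2 t) = 0 & forall i, [/\ `|e1 t i 0| <= 1, `|e2 t i 0| <= 1 & `|e3 t i 0| <= 1]].
Proof.
move=> tL; have hS := frame_SO3 tL; have [/matrixP hQ _] := hS.
have E i j : ((mx3 (e1 t) (e2 t) (e3 t))^T *m mx3 (e1 t) (e2 t) (e3 t)) i j =
   mx3 (e1 t) (e2 t) (e3 t) 0 i * mx3 (e1 t) (e2 t) (e3 t) 0 j +
   mx3 (e1 t) (e2 t) (e3 t) 1 i * mx3 (e1 t) (e2 t) (e3 t) 1 j +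
   mx3 (e1 t) (e2 t) (e3 t) 2 i * mx3 (e1 t) (e2 t) (e3 t) 2 j.
  by rewrite mxE sum3 ![_^T _ _]mxE.
have q00 := hQ 0 0; have q11 := hQ 1 1; have q01 := hQ 0 1.
rewrite E in q00; rewrite E in q11; rewrite E in q01.
have [h1 h2 h3] := mx3E (e1 t) (e2 t) (e3 t) 0; have [k1 k2 k3] := mx3E (e1 t) (e2 t) (e3 t) 1.
have [l1 l2 l3] := mx3E (e1 t) (e2 t) (e3 t) 2.
rewrite h1 k1 l1 mxE in q00; rewrite h2 k2 l2 mxE in q11; rewrite h1 h2 k1 k2 l1 l2 mxE in q01.
split; [by rewrite dot3 q00|by rewrite dot3 q11|by rewrite dot3 q01|move=> i].
have [<- <- <-] := mx3E (e1 t) (e2 t) (e3 t) i.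
by split; exact: SO3_entry.
Qed.

Lemma Phi_entry z i : Phi II e1 e2 e3 z i 0 =
  (\int[mu]_(s in `[0, z.1]) e1 s i 0) + z.2 * e2 z.1 i 0
  + z.2 ^+ 2 * (2^-1 * (II_mid II z.1 1 1 * e3 z.1 i 0))
  + z.2 ^+ 3 * (- 6^-1 * (II_mid II z.1 1 1 * (II_mid II z.1 0 1 * e1 z.1 i 0 + II_mid II z.1 1 1 * e2 z.1 i 0))).
Proof. rewrite /Phi !mxE; ring. Qed.

Lemma arc_derive i s : 0 < s < L ->
  is_derive s (1 : R) (fun t => \int[mu]_(s in `[0, t]) e1 s i 0) (e1 s i 0).
Proof.
move=> /[dup] hs /andP[s0 sL]; have [c1 _ _] := frame_cont i.
have [d1 _ _] := frame_derive i hs.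
have cs : {for s, continuous (fun t => e1 t i 0)}.
  by apply: differentiable_continuous; apply/derivable1_diffP; case: d1.
have ic : mu.-integrable `[0, L] (EFin \o (fun t => e1 t i 0)).
  by apply: continuous_compact_integrable => //; exact: segment_compact.
have [d e] := continuous_FTC1_closed sL ic s0 cs.
by apply: DeriveDef; [exact: d|rewrite -derive1E; exact: e].
Qed.

(** Differentiating a cubic polynomial in [z.2] leaves [e1] and [e2] as terms of order 0; the rest
    is divisible by [z.2], with coefficients bounded uniformly along the interval. *)
Lemma Phi_derive : exists K : R, 0 <= K /\ forall z i, 0 < z.1 < L -> `|z.2| <= 1 ->
  `|('D_(dir 0) (Phi II e1 e2 e3) z) i 0 - e1 z.1 i 0| <= K * `|z.2| /\
  `|('D_(dir 1) (Phi II e1 e2 e3) z) i 0 - e2 z.1 i 0| <= K * `|z.2|.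
Proof.
(* Derivability is carried along entry by entry because the derivative of a matrix-valued map is the
   matrix of derivatives only where it exists. *)
suff : forall i, exists2 K : R, 0 <= K & forall z, 0 < z.1 < L -> `|z.2| <= 1 ->
  [/\ derivable (fun z => Phi II e1 e2 e3 z i 0) z (wdir true),
      derivable (fun z => Phi II e1 e2 e3 z i 0) z (wdir false),
  `|('D_(wdir true) (fun z => Phi II e1 e2 e3 z i 0) z) - e1 z.1 i 0| <= K * `|z.2| &
  `|('D_(wdir false) (fun z => Phi II e1 e2 e3 z i 0) z) - e2 z.1 i 0| <= K * `|z.2| ].
  move=> h; have [K0 K00 h0] := h 0; have [K1 K10 h1] := h 1; have [K2 K20 h2] := h 2.
  exists (K0 + K1 + K2); split; first by rewrite !addr_ge0.
  move=> z i hz1 hz2.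
  have [a0 b0 c0 d0] := h0 z hz1 hz2; have [a1 b1 c1 d1] := h1 z hz1 hz2.
  have [a2 b2 c2 d2] := h2 z hz1 hz2.
  have D1 : derivable (Phi II e1 e2 e3) z (dir 0).
    by apply/derivable_mxP => k j; rewrite ord1; elim/ord3_ind: k; [exact: a0|exact: a1|exact: a2].
  have D2 : derivable (Phi II e1 e2 e3) z (dir 1).
    by apply/derivable_mxP => k j; rewrite ord1; elim/ord3_ind: k; [exact: b0|exact: b1|exact: b2].
  rewrite (derive_mx D1) (derive_mx D2) [X in `|X - _| <= _ /\ _]mxE [X in _ /\ `|X - _| <= _]mxE.
  have ab := normr_ge0 z.2.
  have le (a b c x : R) : 0 <= a -> 0 <= b -> x <= c * `|z.2| -> x <= (a + b + c) * `|z.2|.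
    by move=> a_ b_ /le_trans; apply; rewrite ler_wpM2r// lerDr addr_ge0.
  elim/ord3_ind: i; split.
  - by rewrite (_ : K0 + _ + _ = K1 + K2 + K0); [exact: le|ring].
  - by rewrite (_ : K0 + _ + _ = K1 + K2 + K0); [exact: le|ring].
  - by rewrite (_ : K0 + _ + _ = K0 + K2 + K1); [exact: le|ring].
  - by rewrite (_ : K0 + _ + _ = K0 + K2 + K1); [exact: le|ring].
  - exact: le.
  - exact: le.
move=> i; have [n1 n2 n3] := C1b_frame i.
have n11 : C1b (fun t => II_mid II t 1 1) by exact: C1b_II.
have n01 : C1b (fun t => II_mid II t 0 1) by exact: C1b_II.
pose g1 t := e2 t i 0.
pose g2 t := 2^-1 * (II_mid II t 1 1 * e3 t i 0).
pose g3 t := - 6^-1 * (II_mid II t 1 1 * (II_mid II t 0 1 * e1 t i 0 + II_mid II t 1 1 * e2 t i 0)).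
have m2 : C1b g2 by apply: C1bM; [exact: C1b_cst|exact: C1bM].
have m3 : C1b g3.
  by apply: C1bM; [exact: C1b_cst|apply: C1bM => //; apply: C1bD; exact: C1bM].
have [f1 [M1 [M10 p1]]] := n2; have [f2 [M2 [M20 p2]]] := m2; have [f3 [M3 [M30 p3]]] := m3.
exists (M1 + 2 * M2 + 3 * M3); first by rewrite !addr_ge0// mulr_ge0.
move=> [s t] /= hs ht.
have [d1 a1 b1] := p1 s hs; have [d2 a2 b2] := p2 s hs; have [d3 a3 b3] := p3 s hs.
have dP := arc_derive i hs.
have E : (fun z => Phi II e1 e2 e3 z i 0) = (fun z : R * R =>
  (\int[mu]_(s in `[0, z.1]) e1 s i 0) + z.2 * g1 z.1 + z.2 ^+ 2 * g2 z.1 + z.2 ^+ 3 * g3 z.1).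
  by apply/funext => z; exact: Phi_entry.
rewrite E.
have D1 : is_derive s (1 : R) (fun s => (\int[mu]_(s in `[0, s]) e1 s i 0) + t * g1 s + t ^+ 2 * g2 s + t ^+ 3 * g3 s)
   (e1 s i 0 + t * f1 s + t ^+ 2 * f2 s + t ^+ 3 * f3 s).
  have dc (c : R) := @is_derive_cst _ R R c s (1 : R).
  apply: (is_derive_eq (is_deriveDf (is_deriveDf (is_deriveDf dP (is_deriveMf (dc t) d1)) (is_deriveMf (dc (t ^+ 2)) d2)) (is_deriveMf (dc (t ^+ 3)) d3))).
  rewrite /=; ring.
have D2 : is_derive t (1 : R) (fun t => (\int[mu]_(s in `[0, s]) e1 s i 0) + t * g1 s + t ^+ 2 * g2 s + t ^+ 3 * g3 s)
   (g1 s + 2 * t * g2 s + 3 * t ^+ 2 * g3 s).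
  have dc (c : R) := @is_derive_cst _ R R c t (1 : R).
  have di := @is_derive_id _ R t (1 : R).
  have dX n := @is_deriveX _ R id n t (1 : R) _ di.
  apply: (is_derive_eq (is_deriveDf (is_deriveDf (is_deriveDf (dc _) (is_deriveMf di (dc (g1 s)))) (is_deriveMf (dX 2%N) (dc (g2 s)))) (is_deriveMf (dX 3%N) (dc (g3 s))))).
  rewrite /= /GRing.scale /=; ring.
have at0 := normr_ge0 t.
have t2 : `|t| ^+ 2 <= `|t| by rewrite expr2 ler_piMr.
have t3 : `|t| ^+ 3 <= `|t| by rewrite exprS (le_trans (ler_wpM2l at0 t2))// -expr2.
have q1 : derivable (fun z : R * R => (\int[mu]_(s in `[0, z.1]) e1 s i 0) + z.2 * g1 z.1 + z.2 ^+ 2 * g2 z.1 + z.2 ^+ 3 * g3 z.1) (s, t) (wdir true).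
  by apply/(derivable_sliceP true); case: D1.
have q2 : derivable (fun z : R * R => (\int[mu]_(s in `[0, z.1]) e1 s i 0) + z.2 * g1 z.1 + z.2 ^+ 2 * g2 z.1 + z.2 ^+ 3 * g3 z.1) (s, t) (wdir false).
  by apply/(derivable_sliceP false); case: D2.
split; [exact: q1|exact: q2| |].
- have := derive_slice true s t (fun z : R * R => (\int[mu]_(s in `[0, z.1]) e1 s i 0) + z.2 * g1 z.1 + z.2 ^+ 2 * g2 z.1 + z.2 ^+ 3 * g3 z.1).
  move=> /= <-; have [_ ->] := D1.
  have -> : e1 s i 0 + t * f1 s + t ^+ 2 * f2 s + t ^+ 3 * f3 s - e1 s i 0 = t * f1 s + t ^+ 2 * f2 s + t ^+ 3 * f3 s by ring.
  apply: (@le_trans _ _ (`|t| * M1 + `|t| * M2 + `|t| * M3)).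
    rewrite (le_trans (ler_normD _ _))// lerD//.
      rewrite (le_trans (ler_normD _ _))// lerD// normrM ler_pM// normrX//.
    by rewrite normrM ler_pM// normrX.
  have := mulr_ge0 at0 M20; have := mulr_ge0 at0 M30; move: (`|t|) => a; lra.
- have := derive_slice false t s (fun z : R * R => (\int[mu]_(s in `[0, z.1]) e1 s i 0) + z.2 * g1 z.1 + z.2 ^+ 2 * g2 z.1 + z.2 ^+ 3 * g3 z.1).
  move=> /= <-; have [_ ->] := D2.
  have -> : g1 s + 2 * t * g2 s + 3 * t ^+ 2 * g3 s - e2 s i 0 = 2 * t * g2 s + 3 * t ^+ 2 * g3 s by rewrite /g1; ring.
  apply: (@le_trans _ _ (2 * `|t| * M2 + 3 * `|t| * M3)).
    rewrite (le_trans (ler_normD _ _))// lerD// normrM ler_pM// normrM ger0_norm// ?normrX//.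
    by rewrite ler_wpM2l.
  have := mulr_ge0 at0 M10; move: (`|t|) => a; lra.
Qed.

End frame.

(** * Uniform coercivity for thin strips *)

Section coercive_energy.
Context {R : realType}.
Variables (L w0 : R) (kappa : R -> R) (II : R * R -> 'M[R]_2) (e1 e2 e3 : R -> 'cV[R]_3).
Variable W : 'M[R]_3 -> \bar R.
Hypotheses (hL : 0 < L) (hw0 : 0 < w0).
Hypothesis hkappa : smooth_on `[0, L] kappa.
Hypothesis hII : smooth_on (`[0, L] `*` `[- (w0 / 2), w0 / 2]) II.
Hypothesis hframe : frame L kappa II e1 e2 e3.
Hypothesis hW : energy_density W.
Local Notation mu2 := (@lebesgue2 R).
Local Notation S := (strip L).
Local Notation L2S := (L2 mu2 S).
Let mS := @measurable_strip R L.

Lemma kappa_bounded : exists2 M : R, 0 <= M & forall t, 0 <= t <= L -> `|kappa t| <= M.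
Proof.
have ck := kappa_cont hkappa.
have cn : {within `[0, L], continuous (fun x => `|kappa x|)}.
  by move=> x; apply: continuous_comp; [exact: ck|exact: norm_continuous].
have [c _ hc] := EVT_max (ltW hL) cn.
by exists `|kappa c| => // x hx; apply: hc; rewrite in_itv.
Qed.

(** The value 1/2 keeps [lambda = 1 - kappa z.2] between 1/2 and 2, the range used in every later
    estimate. *)
Lemma kappa_small : exists2 rho : R, 0 < rho & forall z : R * R, 0 <= z.1 <= L -> `|z.2| <= rho ->
  `|kappa z.1 * z.2| <= 2^-1.
Proof.
have [M M0 hM] := kappa_bounded.
have M1 : 0 < 2 * (M + 1) by rewrite mulr_gt0// ltr_wpDl.
exists (2 * (M + 1))^-1; first by rewrite invr_gt0.
move=> z hz1 hz2; rewrite normrM.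
apply: (@le_trans _ _ ((M + 1) * (2 * (M + 1))^-1)); last first.
  by rewrite invfM mulrCA mulfV ?mulr1// gt_eqF// ltr_wpDl.
by rewrite ler_pM// (le_trans (hM _ _))// lerDl.
Qed.

Lemma dot_small (a b : 'cV[R]_3) d : (forall i, `|a i 0| <= d) -> (forall i, `|b i 0| <= 1) ->
  `|dot a b| <= 3 * d.
Proof.
move=> ha hb; have d0 : 0 <= d by apply: le_trans (ha 0).
have h i : `|a i 0 * b i 0| <= d by rewrite normrM -[d]mulr1 ler_pM.
have -> : 3 * d = d + d + d by ring.
by rewrite dot3 (le_trans (ler_normD _ _))// lerD// (le_trans (ler_normD _ _))// lerD.
Qed.

(** By the Lagrange identity the product of [cross p q] with [cross e1 e2] is
    [(1 + a.e1)(1 + b.e2) - (a.e2)(b.e1)] for the errors [a = p - e1] and [b = q - e2]. Entries at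
    most 1/12 make the four products at most 1/4, so the value is at least [9/16 - 1/16]. *)
Lemma Phi_nondegenerate : exists2 rho : R, 0 < rho &
  forall z : R * R, 0 < z.1 < L -> `|z.2| <= rho ->
  let c := cross ('D_(dir 0) (Phi II e1 e2 e3) z) ('D_(dir 1) (Phi II e1 e2 e3) z) in
  dot c c != 0.
Proof.
have [K [K0 hK]] := Phi_derive hL hw0 hkappa hII hframe.
have K1 : 0 < 12 * K + 1 by rewrite ltr_wpDl// mulr_ge0.
exists (12 * K + 1)^-1; first by rewrite invr_gt0.
move=> z hz1 hz2; have z21 : `|z.2| <= 1.
  by apply: le_trans hz2 _; rewrite invf_le1// lerDr mulr_ge0.
have z1L : 0 <= z.1 <= L by case/andP: hz1 => a b; rewrite !ltW.
have [h11 h22 h12 hb] := frame_ortho hframe z1L.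
have hKz : K * `|z.2| <= 12^-1.
  have : `|z.2| * (12 * K + 1) <= 1 by rewrite -ler_pdivlMr// mul1r.
  move=> hh; rewrite -[leRHS]mul1r ler_pdivlMr//; have := normr_ge0 z.2; move: `|z.2| hh => a; lra.
have {}hK i := hK z i hz1 z21.
move: hK; set p := 'D_(dir 0) _ z; set q := 'D_(dir 1) _ z => hK /=.
pose a := p - e1 z.1; pose b := q - e2 z.1.
have pE : p = e1 z.1 + a by rewrite addrC subrK.
have qE : q = e2 z.1 + b by rewrite addrC subrK.
have ha i : `|a i 0| <= 12^-1 by rewrite !mxE (le_trans (hK i).1).
have hb' i : `|b i 0| <= 12^-1 by rewrite !mxE (le_trans (hK i).2).
clearbody a b.
have a1 : `|dot a (e1 z.1)| <= 3 * 12^-1 by apply: dot_small => // i; case: (hb i).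
have a2 : `|dot a (e2 z.1)| <= 3 * 12^-1 by apply: dot_small => // i; case: (hb i).
have b1 : `|dot b (e1 z.1)| <= 3 * 12^-1 by apply: dot_small => // i; case: (hb i).
have b2 : `|dot b (e2 z.1)| <= 3 * 12^-1 by apply: dot_small => // i; case: (hb i).
apply/eqP => h0.
have c0 : cross p q = 0.
  by apply/eqP/negPn/negP => /dot_gt0; rewrite h0 ltxx.
have := lagrange_identity p q (e1 z.1) (e2 z.1).
rewrite c0 {1}dot3 !mxE !mul0r !addr0 pE qE !dotDl h11 h22 h12 (dotC (e2 _)) h12 !add0r.
move: a1 a2 b1 b2; rewrite !ler_norml.
move: (dot _ _) (dot _ _) (dot _ _) (dot _ _) => x y u v.
have -> : 3 * 12^-1 = 4^-1 :> R by field.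
move=> /andP[v1 v2] /andP[u1 u2] /andP[y1 y2] /andP[x1 x2] e0.
have p1 : 0 <= (x + 4^-1) * (v + 4^-1) by apply: mulr_ge0; rewrite -lerBlDr sub0r.
have p2 : 0 <= (4^-1 - u) * (4^-1 + y) by apply: mulr_ge0; rewrite ?subr_ge0// addrC -lerBlDr sub0r.
have p3 : 0 <= (4^-1 + u) * (4^-1 - y) by apply: mulr_ge0; rewrite ?subr_ge0// addrC -lerBlDr sub0r.
lra.
Qed.

Lemma Qw_coercive : exists rho K : R, [/\ 0 < rho, 0 < K & forall w, 0 < w < rho ->
  forall x, S x -> forall (F : 'M[R]_2) i j,
  (F i j + F j i) ^+ 2 <= K * Q_w kappa II e1 e2 e3 W w x F].
Proof.
have [r1 r10 h1] := kappa_small; have [r2 r20 h2] := Phi_nondegenerate.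
have [C C0 hC] := Q3_coercive hW.
exists (Num.min r1 r2), (36 ^+ 2 * C); split.
- by rewrite lt_min r10.
- by apply: mulr_gt0 => //; apply: exprn_gt0; exact: ltr0Sn.
move=> w /andP[w0'] ; rewrite lt_min => /andP[w1 w2] x [/= x1 x2] F i j.
have x1' : 0 < (rescale w x).1 < L by move: x1; rewrite in_itv.
have x1'' : 0 <= (rescale w x).1 <= L by case/andP: x1' => ? ?; rewrite !ltW.
have hx2 : `|(rescale w x).2| <= w.
  rewrite /= normrM gtr0_norm// -[leRHS]mulr1 ler_wpM2l ?(ltW w0')//.
  move: x2; rewrite in_itv/= => /andP[a b]; rewrite ler_norml.
  have h : (2^-1 : R) <= 1 by rewrite invf_le1// ler1n.
  by rewrite (le_trans _ (ltW a)) ?lerN2// (le_trans (ltW b)).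
have := h1 _ x1'' (le_trans hx2 (ltW w1)); rewrite ler_norml => /andP[l1 l2].
have h22 : (2^-1 : R) < 1 by rewrite invf_lt1// ltr1n.
apply: Qw_lower => //.
- exact: h2 x1' (le_trans hx2 (ltW w2)).
- by rewrite subr_gt0 (le_lt_trans l2).
- have : (2^-1 : R) <= 1 by exact: ltW.
  move: l1; move: (_ * _) => y; lra.
Qed.

(** The integral of a nonnegative function is a supremum over simple functions below it, so
    monotonicity holds without measurability. The density [Q_w] is an infimum, and its measurability
    in [x] is never established. *)
Lemma ge0_integral_mono d (T : measurableType d) (m : {measure set T -> \bar R}) (D : set T)
    (f g : T -> \bar R) : (forall x, D x -> (0 <= f x)%E) -> (forall x, D x -> (f x <= g x)%E) ->
  (\int[m]_(x in D) f x <= \int[m]_(x in D) g x)%E.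
Proof.
move=> f0 fg; have g0 x : D x -> (0 <= g x)%E by move=> Dx; rewrite (le_trans (f0 _ Dx)) ?fg.
rewrite !ge0_integralE//; apply: le_ereal_sup => _ [h hf <-]; exists h => //.
move=> x; apply: (le_trans (hf x)); rewrite /patch; case: ifP => //; rewrite inE; exact: fg.
Qed.

Lemma energy_cvg (q_ u_ : nat -> R * R -> R) K : 0 < K -> (forall n, L2S (u_ n)) ->
  (\forall n \near \oo, forall x, S x -> u_ n x ^+ 2 <= K * q_ n x) ->
  (fun n => (12^-1 * (fine (mu2 S))^-1)%:E * \int[mu2]_(x in S) (q_ n x)%:E)%E @ \oo --> 0%E ->
  (fun n => ip mu2 S (u_ n) (u_ n)) @ \oo --> (0 : R).
Proof.
move=> K0 hu hq hE.
rewrite (_ : fine (mu2 S) = L) in hE; last by rewrite lebesgue2_strip.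
(* The normalization of the energy together with the coercivity constant: [c0] times the squared
   norm of [u_ n] is at most the energy. *)
have c0 : 0 < 12^-1 * L^-1 * K^-1 by rewrite !mulr_gt0// invr_gt0.
apply/cvgrPdist_lt => e e0.
have e1' : (0%:E < (12^-1 * L^-1 * K^-1 * e)%:E :> \bar R)%E by rewrite lte_fin mulr_gt0.
have hE' := hE _ (open_ereal_lt' e1').
near=> n.
rewrite sub0r normrN ger0_norm ?ip_ge0//.
have h1 : ((12^-1 * L^-1)%:E * \int[mu2]_(x in S) (q_ n x)%:E < (12^-1 * L^-1 * K^-1 * e)%:E)%E.
  by near: n; exact: hE'.
have h2 : forall x, S x -> u_ n x ^+ 2 <= K * q_ n x by near: n.
rewrite -(ltr_pM2l c0) -lte_fin; apply: le_lt_trans h1.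
rewrite -[_ * ip _ _ _ _]mulrA [X in (X <= _)%E]EFinM lee_pmul2l//; last by rewrite lte_fin mulr_gt0// invr_gt0.
have [_ iu] := hu n.
have -> : (K^-1 * ip mu2 S (u_ n) (u_ n))%:E = (\int[mu2]_(x in S) (K^-1 * u_ n x ^+ 2)%:E)%E.
  have := @RintZ _ _ _ mu2 S K^-1 (fun x => u_ n x ^+ 2) mS iu.
  rewrite /ip => <-; rewrite /Rintegral fineK//.
  apply: integrable_fin_num => //.
  by have := integrableZl mS K^-1 iu; exact: eq_integrable.
apply: ge0_integral_mono => x Sx; rewrite lee_fin.
  by rewrite mulr_ge0 ?sqr_ge0// invr_ge0 ltW.
by rewrite ler_pdivrMl// h2.
Unshelve. all: by end_near. Qed.

End coercive_energy.

Lemma measurable_inv_ge0 d (T : measurableType d) (R : realType) (D : set T) (u : T -> R) :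
  measurable D -> measurable_fun D u -> (forall x, D x -> 0 <= u x) ->
  measurable_fun D (fun x => (u x)^-1).
Proof.
move=> mD mu_ u0.
apply: (@eq_measurable_fun _ _ _ _ _ (fun x => u x `^ (-1))).
  by move=> x /[!inE] Dx; rewrite powR_inv1 ?u0.
exact: (measurableT_comp (measurable_powR _) mu_).
Qed.

Lemma test_fun_derive (R : realType) (A : set R) (f : R -> R) : test_fun A f ->
  test_fun A ('D_1 f : R -> R).
Proof.
move=> [sf kf cf].
have sub : closure [set x | 'D_1 f x != 0] `<=` closure [set x | f x != 0].
  have e := (closure_id (closure [set x | f x != 0])).1 (@closed_closure _ _).
  rewrite e; apply: closureS => x /= dx; apply: contrapT => nx; move/negP: dx; apply; apply/eqP.
  have oC : open (~` closure [set x | f x != 0]) by apply: closed_openC; exact: closed_closure.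
  have nb : \near x, f x = cst 0 x.
    apply: filterS (open_nbhs_nbhs (conj oC nx)) => y ny; apply/eqP/negPn/negP => h.
    by apply: ny; exact: (@subset_closure _ [set x | f x != 0] y h).
  by rewrite (near_eq_derive _ nb) derive_cst.
split; first by move=> k; have [_] := sf k.+1; exact.
- exact: (subclosed_compact (@closed_closure _ _) kf sub).
- exact: subset_trans sub cf.
Qed.

(** * Mixed weak derivatives on the strip *)

Section mixed.
Context {R : realType}.
Variable L : R.
Hypothesis hL : 0 < L.
Local Notation mu := (@lebesgue_measure R).
Local Notation mu2 := (@lebesgue2 R).
Local Notation S := (strip L).
Local Notation L2S := (L2 mu2 S).
Let mS := @measurable_strip R L.
Implicit Types (u v : R * R -> R).

Lemma sbump_test b (n : nat) (p q : rat) : (dlo b : R) < ratr p -> ratr q < dhi L b ->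
  test_fun (`]dlo b, dhi L b[ : set R) (sbump n.+1%:R (ratr p) (ratr q)).
Proof.
move=> c1 c2; apply: (@supp_test _ _ _ (ratr p) (ratr q)) => //; first exact: sbump_smooth.
by move=> x; apply: sbump_supp; rewrite ltr0n.
Qed.

(** The fundamental lemma is applied transversally for each member of a countable family of bumps,
    and then once more on almost every line. *)
Lemma tensor_fund b u : mu2.-integrable S (EFin \o u) ->
  (forall f g, test_fun (`]dlo b, dhi L b[ : set R) f ->
    test_fun (`]dlo (~~ b), dhi L (~~ b)[ : set R) g ->
    \int[mu2]_(z in S) (u z * (f (along b z) * g (along (~~ b) z))) = 0) ->
  {ae mu2, forall z, S z -> u z = 0}.
Proof.
move=> iu h.
have ca (f : R -> R) b' : smooth setT f -> continuous (fun z : R * R => f (along b' z)).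
  by move=> sf z; exact: (along_comp b' sf 0%N z I).
have H (i : nat * rat * rat) : {ae mu, forall t, dom L (~~ b) t -> (dlo b : R) < ratr i.1.2 -> ratr i.2 < dhi L b ->
    \int[mu]_(s in dom L b) (u (pt b s t) * sbump i.1.1.+1%:R (ratr i.1.2) (ratr i.2) s) = 0}.
  case: i => [[n p] q] /=.
  case: (pselect ((dlo b : R) < ratr p /\ ratr q < dhi L b)) => [[a1 a2]|na]; last first.
    by apply: aeW => t _ a1 a2; exfalso; apply: na.
  have := sbump_test n a1 a2; move: (sbump _ _ _) => F tF.
  have sF : smooth setT F by case: tF.
  have iw := bd_integrable hL iu (ca _ b sF).
  have := fundamental_lemma (dlohi hL (~~ b)) (outer_integrable b iw).
  have key : forall (n : nat) (p q : rat), (dlo (~~ b) : R) < ratr p -> ratr q < dhi L (~~ b) ->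
     \int[mu]_(t in dom L (~~ b)) ((\int[mu]_(s in dom L b) (u (pt b s t) * F (along b (pt b s t)))) * sbump n.+1%:R (ratr p) (ratr q) t) = 0.
    move=> n' p' q' c1 c2; have := sbump_test n' c1 c2; move: (sbump _ _ _) => B tB.
    have sB : smooth setT B by case: tB.
    have := fubini_along hL (~~ b) iw sB; rewrite negbK => ->.
    rewrite -[RHS](h F B tF tB); apply: eq_Rintegral => z _; ring.
  move=> /(_ key); apply: aeS => t h1 dt _ _; rewrite -[RHS](h1 dt).
  by apply: eq_Rintegral => s _; rewrite along_pt.
apply: (ae_unslice (b := b)); [exact: integrable_meas|by []|].
apply: aeS2 (ae_count H) (slice_integrable b iu) => t h1 h2 dt.
apply: (fundamental_lemma (dlohi hL b) (h2 dt)) => n p q a1 a2.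
exact: (h1 (n, p, q) dt a1 a2).
Qed.

(** Against a tensor product of [f] and [g], both mixed derivatives pair to the integral of
    [u f' g']. This is the compatibility that ties the transversal derivative of one tangent vector
    to the longitudinal derivative of the other. *)
Lemma mixed_partials u u1 u2 u12 u21 : wd L true u u1 -> wd L false u1 u12 ->
  wd L false u u2 -> wd L true u2 u21 -> {ae mu2, forall z, S z -> u12 z = u21 z}.
Proof.
move=> [hu hu1 p1] [_ hu12 p12] [_ hu2 p2] [_ hu21 p21].
have iu := L2S_int hL hu; have iu1 := L2S_int hL hu1; have iu2 := L2S_int hL hu2.
have i12 := L2S_int hL hu12; have i21 := L2S_int hL hu21.
have hB : L2S (fun z => u12 z - u21 z) by exact: L2B.
suff : {ae mu2, forall z, S z -> u12 z - u21 z = 0}.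
  by apply: aeS => z h Sz; apply/eqP; rewrite -subr_eq0 h.
apply: (tensor_fund (b := true) (L2S_int hL hB)) => f g tf tg.
have [sf _ _] := tf; have [sg _ _] := tg.
have sf' : smooth setT ('D_1 f : R -> R) by have [] := test_fun_derive tf.
have sg' : smooth setT ('D_1 g : R -> R) by have [] := test_fun_derive tg.
have df (s : R) : differentiable f s by have [h _] := sf 1%N; exact: h.
have dg (s : R) : differentiable g s by have [h _] := sg 1%N; exact: h.
have t0 := tensor_test tf tg.
have t1 := tensor_test (test_fun_derive tf) tg.
have t2 := tensor_test tf (test_fun_derive tg).
have D1 (h k : R -> R) (z : R * R) : smooth setT h -> smooth setT k ->
  'D_(wdir true) (fun z : R * R => h (along true z) * k (along false z)) z = 'D_1 h z.1 * k z.2.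
  move=> sh sk; case: z => s t.
  by rewrite (@derive_tensor _ true h k s t)//; have [d _] := sh 1%N; exact: d.
have D2 (h k : R -> R) (z : R * R) : smooth setT h -> smooth setT k ->
  'D_(wdir false) (fun z : R * R => h (along true z) * k (along false z)) z = h z.1 * 'D_1 k z.2.
  move=> sh sk; case: z => s t.
  under eq_fun do rewrite mulrC.
  rewrite (@derive_tensor _ false k h t s) ?(mulrC (h _))//.
  by have [d _] := sk 1%N; exact: d.
have e1 := pd_weak hL i12 i21.
have q1 := pd_weak hL iu1 i12 p12 t0.
have q2 := pd_weak hL iu iu1 p1 t2.
have q3 := pd_weak hL iu2 i21 p21 t0.
have q4 := pd_weak hL iu iu2 p2 t1.
have ca (h k : R -> R) : test_fun S (fun z : R * R => h (along true z) * k (along false z)) ->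
  continuous (fun z : R * R => h (along true z) * k (along false z)) by exact: test2_cont.
under eq_Rintegral do rewrite mulrBl.
rewrite RintegralB//; last 2 first.
- exact: (bd_integrable hL i12 (ca _ _ t0)).
- exact: (bd_integrable hL i21 (ca _ _ t0)).
have {}q1 : \int[mu2]_(z in S) (u1 z * (f z.1 * 'D_1 g z.2)) = - \int[mu2]_(z in S) (u12 z * (f z.1 * g z.2)).
  by rewrite -[RHS]q1; apply: eq_Rintegral => z _; congr (_ * _); exact: (esym (D2 f g z sf sg)).
have {}q2 : \int[mu2]_(z in S) (u z * ('D_1 f z.1 * 'D_1 g z.2)) = - \int[mu2]_(z in S) (u1 z * (f z.1 * 'D_1 g z.2)).
  by rewrite -[RHS]q2; apply: eq_Rintegral => z _; congr (_ * _); exact: (esym (D1 f _ z sf sg')).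
have {}q3 : \int[mu2]_(z in S) (u2 z * ('D_1 f z.1 * g z.2)) = - \int[mu2]_(z in S) (u21 z * (f z.1 * g z.2)).
  by rewrite -[RHS]q3; apply: eq_Rintegral => z _; congr (_ * _); exact: (esym (D1 f g z sf sg)).
have {}q4 : \int[mu2]_(z in S) (u z * ('D_1 f z.1 * 'D_1 g z.2)) = - \int[mu2]_(z in S) (u2 z * ('D_1 f z.1 * g z.2)).
  by rewrite -[RHS]q4; apply: eq_Rintegral => z _; congr (_ * _); exact: (esym (D2 _ g z sf' sg)).
apply/eqP; rewrite subr_eq0; apply/eqP/oppr_inj.
rewrite -[LHS]q1 -[RHS]q3; apply: oppr_inj.
by rewrite -[LHS]q2 -[RHS]q4.
Qed.

Lemma wd_C1 b h dh :
  (forall t, dom L (~~ b) t -> [/\ {within `[dlo b, dhi L b], continuous (fun s => h (pt b s t))},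
     {within `[dlo b, dhi L b], continuous (fun s => dh (pt b s t))} &
     forall s, dlo b < s < dhi L b -> is_derive s (1 : R) (fun s => h (pt b s t)) (dh (pt b s t))]) ->
  L2S h -> L2S dh -> wd L b h dh.
Proof.
move=> H hh hdh; split => //; apply: aeW => t dt; have [c1 c2 d] := H t dt.
have [i1 e] := prim_C1 (dlohi hL b) c1 c2 d.
split => //; exists (h (pt b (dlo b) t)); apply: aeW => s; rewrite itvooE => /andP[a1 a2].
by rewrite e// !ltW.
Qed.

End mixed.

(** * Moving frames of isometric immersions *)

Section SO3_columns.
Context {R : realType}.
Implicit Types a b c v : 'cV[R]_3.

Lemma SO3_mx3 a b : dot a a = 1 -> dot b b = 1 -> dot a b = 0 -> SO3 (mx3 a b (cross a b)).
Proof.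
move=> aa bb ab; have cc : dot (cross a b) (cross a b) = 1.
  by rewrite lagrange_identity aa bb ab mul0r subr0 mulr1.
split; last by rewrite det_mx3.
by apply: gram_mx3; rewrite ?trmx1// !mxE ?aa ?bb ?cc ?ab ?dot_crossl ?dot_crossr.
Qed.

Lemma mx3_orth_dot a b c : SO3 (mx3 a b c) -> [/\ dot a a = 1, dot b b = 1, dot c c = 1 &
  [/\ dot a b = 0, dot a c = 0 & dot b c = 0]].
Proof.
move=> [/matrixP hQ _].
have E i j : ((mx3 a b c)^T *m mx3 a b c) i j =
   mx3 a b c 0 i * mx3 a b c 0 j + mx3 a b c 1 i * mx3 a b c 1 j + mx3 a b c 2 i * mx3 a b c 2 j.
  by rewrite mxE sum3 ![_^T _ _]mxE.
have [h1 h2 h3] := mx3E a b c 0; have [k1 k2 k3] := mx3E a b c 1; have [l1 l2 l3] := mx3E a b c 2.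
have F i j : mx3 a b c 0 i * mx3 a b c 0 j + mx3 a b c 1 i * mx3 a b c 1 j + mx3 a b c 2 i * mx3 a b c 2 j = (i == j)%:R.
  by rewrite -E hQ mxE.
split; [have := F 0 0|have := F 1 1|have := F 2 2|split; [have := F 0 1|have := F 0 2|have := F 1 2]];
  by rewrite ?(h1, h2, h3) ?(k1, k2, k3) ?(l1, l2, l3) dot3.
Qed.

Lemma mx3_expand a b c v : SO3 (mx3 a b c) ->
  v = dot v a *: a + dot v b *: b + dot v c *: c.
Proof.
move=> [hQ _]; have {}hQ := mulmx1C hQ.
have e i j : a i 0 * a j 0 + b i 0 * b j 0 + c i 0 * c j 0 = (i == j)%:R.
  move/matrixP/(_ i j) : hQ; rewrite mxE sum3 ![_^T _ _]mxE [(1%:M) _ _]mxE => <-.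
  by have [-> -> ->] := mx3E a b c i; have [-> -> ->] := mx3E a b c j.
apply/matrixP => i j; rewrite ord1 !mxE !dot3.
have -> : (v 0 0 * a 0 0 + v 1 0 * a 1 0 + v 2 0 * a 2 0) * a i 0 +
  (v 0 0 * b 0 0 + v 1 0 * b 1 0 + v 2 0 * b 2 0) * b i 0 +
  (v 0 0 * c 0 0 + v 1 0 * c 1 0 + v 2 0 * c 2 0) * c i 0 =
  v 0 0 * (a i 0 * a 0 0 + b i 0 * b 0 0 + c i 0 * c 0 0) +
  v 1 0 * (a i 0 * a 1 0 + b i 0 * b 1 0 + c i 0 * c 1 0) +
  v 2 0 * (a i 0 * a 2 0 + b i 0 * b 2 0 + c i 0 * c 2 0) by ring.
rewrite !e; elim/ord3_ind: i => /=; ring.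
Qed.

End SO3_columns.

Section wdv.
Context {R : realType}.
Variable L : R.
Hypothesis hL : 0 < L.
Local Notation mu2 := (@lebesgue2 R).
Local Notation S := (strip L).
Let mS := @measurable_strip R L.
Let fS := strip_fin hL.
Implicit Types (U V : R * R -> 'cV[R]_3) (g : R * R -> R) (b : bool).

Definition wdv b U V := forall j, wd L b (fun z => U z j 0) (fun z => V z j 0).
Definition bdv K U := forall j, aebd mu2 S K (fun z => U z j 0).

Lemma wdv_dot b K U U' V V' : wdv b U U' -> wdv b V V' -> bdv K U -> bdv K V ->
  wd L b (fun z => dot (U z) (V z)) (fun z => dot (U' z) (V z) + dot (U z) (V' z)).
Proof.
move=> hU hV bU bV.
have := wdD (wdD (wdM hL (hU 0) (hV 0) (bU 0) (bV 0)) (wdM hL (hU 1) (hV 1) (bU 1) (bV 1)))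
  (wdM hL (hU 2) (hV 2) (bU 2) (bV 2)).
congr wd; apply/funext => z; rewrite !dot3//; ring.
Qed.

Lemma wdv_cross b K U U' V V' : wdv b U U' -> wdv b V V' -> bdv K U -> bdv K V ->
  wdv b (fun z => cross (U z) (V z)) (fun z => cross (U' z) (V z) + cross (U z) (V' z)).
Proof.
move=> hU hV bU bV j.
have P i k := wdM hL (hU i) (hV k) (bU i) (bV k).
have := wdB (P (j + 1) (j + 2)) (P (j + 2) (j + 1)).
congr wd; apply/funext => z; rewrite !mxE//; ring.
Qed.

Lemma wdvZ b K g g' U U' : wd L b g g' -> wdv b U U' -> aebd mu2 S K g -> bdv K U ->
  wdv b (fun z => g z *: U z) (fun z => g' z *: U z + g z *: U' z).
Proof.
move=> hg hU bg bU j; have := wdM hL hg (hU j) bg (bU j).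
by congr wd; apply/funext => z; rewrite !mxE.
Qed.

Lemma wd_ae_derive b g g' h h' : wd L b g g' -> wd L b h h' ->
  {ae mu2, forall z, S z -> g z = h z} -> {ae mu2, forall z, S z -> g' z = h' z}.
Proof.
move=> hg hh e; have [_ hg' _] := hg; have [h1 _ _] := hh.
have hh' : wd L b h g' by apply: (wd_ae hL hg) => //; exact: aeW.
exact: (wd_uniq hL hh' hh).
Qed.

Lemma dot_const_derive b K k U U' V V' : wdv b U U' -> wdv b V V' -> bdv K U -> bdv K V ->
  {ae mu2, forall z, S z -> dot (U z) (V z) = k} ->
  {ae mu2, forall z, S z -> dot (U' z) (V z) + dot (U z) (V' z) = 0}.
Proof.
move=> hU hV bU bV e.
exact: (wd_ae_derive (wdv_dot hU hV bU bV) (wd_cst hL b k) e).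
Qed.

Lemma bdv_unit U : {ae mu2, forall z, S z -> dot (U z) (U z) <= 1} -> bdv 1 U.
Proof.
move=> h j; apply: aeS h => z h Sz; have := h Sz; rewrite dot3 => {}h.
rewrite -(@ler_pXn2r _ 2)// ?nnegrE// real_normK ?num_real// expr1n; apply: le_trans h.
by elim/ord3_ind: j; rewrite expr2 ?lerDl ?lerDr -?addrA ?lerDl ?addr_ge0// -?expr2 ?sqr_ge0// addrCA lerDl addr_ge0 ?sqr_ge0.
Qed.

Lemma bdv_SO3 a c n : {ae mu2, forall z, S z -> SO3 (mx3 (a z) (c z) (n z))} ->
  [/\ bdv 1 a, bdv 1 c & bdv 1 n].
Proof.
by move=> h; split; apply: bdv_unit; apply: aeS h => z h Sz;
  have [q1 q2 q3 _] := mx3_orth_dot (h Sz); rewrite ?q1 ?q2 ?q3.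
Qed.

End wdv.

Lemma is_deriveVf (R : realType) (f : R -> R) (t df : R) : f t != 0 -> is_derive t (1 : R) f df ->
  is_derive t (1 : R) (fun s => (f s)^-1) (- (f t)^-1 ^+ 2 * df).
Proof.
move=> ft0 [d <-]; apply: DeriveDef; first exact: derivableV.
by rewrite (deriveV ft0 d) -exprVn.
Qed.

(** * The length of the longitudinal tangent vector *)

Section lambda.
Context {R : realType}.
Variables (L w : R) (kappa : R -> R).
Hypotheses (hL : 0 < L) (hw : 0 < w).
Hypothesis hkappa : smooth_on `[0, L] kappa.
Hypothesis hk : forall z : R * R, 0 <= z.1 <= L -> `|z.2| <= 2^-1 ->
  `|kappa z.1 * (w * z.2)| <= 2^-1.
Local Notation mu := (@lebesgue_measure R).
Local Notation mu2 := (@lebesgue2 R).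
Local Notation S := (strip L).
Local Notation L2S := (L2 mu2 S).
Let mS := @measurable_strip R L.
Let fS := strip_fin hL.

(** The length of [d_1 f] prescribed by the metric; [hk] keeps it in [[1/2, 2]]. *)
Definition lam (z : R * R) : R := 1 - kappa z.1 * (w * z.2).

Lemma strip_in (z : R * R) : S z -> 0 < z.1 < L /\ `|z.2| <= 2^-1.
Proof.
move=> [/= h1 h2]; move: h1 h2; rewrite !in_itv/= => h1 /andP[h2 h3]; split => //.
by rewrite ler_norml !ltW.
Qed.

Lemma lam_bounds_cc (z : R * R) : 0 <= z.1 <= L -> `|z.2| <= 2^-1 -> 2^-1 <= lam z <= 2.
Proof.
move=> hz z3; have := hk hz z3; rewrite /lam ler_norml => /andP[h1 h2].
have h3 : (2^-1 : R) + 2^-1 = 1 by rewrite [RHS](splitr 1) !mul1r.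
have h4 : (2^-1 : R) <= 1 by rewrite invf_le1// ler1n.
by apply/andP; split; lra.
Qed.

Lemma lam_bounds z : S z -> 2^-1 <= lam z <= 2.
Proof.
by move=> /strip_in[/andP[z1 z2] z3]; apply: lam_bounds_cc z3; rewrite !ltW.
Qed.

Lemma kappa_C1 : exists k' : R -> R, {within `[0, L], continuous k'} /\
  forall t, 0 < t < L -> is_derive t (1 : R) kappa (k' t).
Proof.
have [U [g [oU AU sg eg]]] := hkappa.
exists ('D_1 g : R -> R); split.
  apply: continuous_in_subspaceT => x /[!inE] xA.
  have [_ h] := sg 1%N; exact: (h 1 x (AU _ xA)).
move=> t /andP[t0 tL].
have tU : U t by apply: AU; rewrite /= in_itv/= !ltW.
apply: (@near_eq_is_derive _ _ _ g).
  have : nbhs t (`]0, L[%classic : set R).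
    by apply: open_nbhs_nbhs; split; [exact: itv_open|rewrite /= in_itv/= t0].
  apply: filterS => s; rewrite /= in_itv/= => /andP[s0 sL].
  by rewrite eg//= in_itv/= !ltW.
apply: DeriveDef => //; apply: diff_derivable; have [h _] := sg 1%N; exact: h.
Qed.

Lemma cont_along (g : R -> R) : {within `[0, L], continuous g} ->
  exists2 M : R, 0 <= M & L2S (fun z => g z.1) /\ forall z, S z -> `|g z.1| <= M.
Proof.
move=> cg; have cn : {within `[0, L], continuous (fun x => `|g x|)}.
  by move=> x; apply: continuous_comp; [exact: cg|exact: norm_continuous].
have [c _ hc] := EVT_max (ltW hL) cn.
have hb z : S z -> `|g z.1| <= `|g c|.
  by move=> /strip_in[/andP[z1 z2] _]; apply: hc; rewrite in_itv/= !ltW.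
exists `|g c| => //; split => //; apply: (L2_bd mS fS (K := `|g c|)); last exact: aeW.
have i1 : mu.-integrable (dom L true) (EFin \o g).
  have icc : mu.-integrable `[0, L] (EFin \o g).
    by apply: continuous_compact_integrable => //; exact: segment_compact.
  apply: integrableS icc => //; first exact: measurable_itvoo.
  by move=> x; rewrite -[dom _ _ _]/(itvoo 0 L x) itvooE /= in_itv/= => /andP[x0 xL]; rewrite !ltW.
have [i2 _] := along_integrable hL (b := true) i1.
exact: integrable_meas i2.
Qed.

Lemma cont_bd (g : R -> R) : {within `[0, L], continuous g} ->
  exists M, L2S (fun z => g z.1) /\ aebd mu2 S M (fun z => g z.1).
Proof. by move=> /cont_along[M _ [h1 h2]]; exists M; split => //; apply: aeW. Qed.

Lemma L2_snd : L2S (fun z => z.2).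
Proof.
apply: (L2_bd mS fS (K := 2^-1)); last by apply: aeW => z /strip_in[].
by apply: measurable_funTS; apply: continuous_measurable2 => z; exact: cvg_snd.
Qed.

Lemma lam_meas : measurable_fun S (lam : measurableTypeR R * measurableTypeR R -> R).
Proof.
have [M _ [hk1 _]] := cont_along (kappa_cont hkappa).
rewrite /lam; apply: measurable_funB => //.
apply: measurable_funM; first exact: L2_meas hk1.
by apply: measurable_funM => //; exact: L2_meas L2_snd.
Qed.

Lemma lam_L2 : L2S lam.
Proof.
apply: (L2_bd mS fS (K := 2)); first exact: lam_meas.
apply: aeW => z /lam_bounds/andP[h1 h2]; rewrite ger0_norm//; apply: le_trans h1.
by rewrite invr_ge0.
Qed.

Definition lami z : R := (lam z)^-1.

Lemma lami_bounds z : S z -> 0 <= lami z <= 2.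
Proof.
move=> /lam_bounds/andP[h1 h2]; rewrite /lami invr_ge0.
have l0 : 0 < lam z by apply: lt_le_trans h1; rewrite invr_gt0.
by rewrite ltW//= -(invrK 2) lef_pV2// posrE invr_gt0.
Qed.

Lemma lami_meas : measurable_fun S (lami : measurableTypeR R * measurableTypeR R -> R).
Proof.
apply: (measurable_inv_ge0 mS lam_meas) => z /lam_bounds/andP[h1 h2].
by apply: le_trans h1; rewrite invr_ge0.
Qed.

Definition dlam (k' : R -> R) b (z : R * R) : R :=
  if b then - (k' z.1 * (w * z.2)) else - (w * kappa z.1).

Lemma wd_dlam k' : {within `[0, L], continuous k'} ->
  (forall t, 0 < t < L -> is_derive t (1 : R) kappa (k' t)) ->
  forall b, wd L b lam (dlam k' b) /\ wd L b lami (fun z => - lami z ^+ 2 * dlam k' b z).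
Proof.
move=> ck' dk b; have ck := kappa_cont hkappa.
pose dl := dlam k'; rewrite -/dl.
have [M M0 [hM hMb]] := cont_along ck; have [N N0 [hN hNb]] := cont_along ck'.
have [K dlb] : exists K, forall z, S z -> `|dl b z| <= K.
  exists (w * M + N * (w * 2^-1)) => z Sz; have [_ z2] := strip_in Sz.
  have w2 : 0 <= w * 2^-1 by rewrite mulr_ge0// ltW.
  rewrite /dl /dlam; case: (b); rewrite normrN normrM.
    rewrite ler_wpDl ?mulr_ge0 ?(ltW hw)// ler_pM// ?hNb// normrM (gtr0_norm hw).
    by rewrite ler_wpM2l// ltW.
  rewrite (gtr0_norm hw); apply: ler_wpDr; first by rewrite mulr_ge0.
  by rewrite ler_wpM2l ?hMb// ltW.
have dlm : measurable_fun S (dl b : measurableTypeR R * measurableTypeR R -> R).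
  rewrite /dl /dlam; case: (b).
    have : L2S (fun z => - (k' z.1 * (w * z.2))).
      apply: (L2N mS); apply: (@L2M_bd _ _ _ mu2 S mS N (fun z => k' z.1) (fun z => w * z.2)).
      - exact: L2_meas hN.
      - exact: aeW.
      - by apply: L2Z => //; exact: L2_snd.
    exact: L2_meas.
  have : L2S (fun z => - (w * kappa z.1)) by apply: (L2N mS); exact: L2Z.
  exact: L2_meas.
have dl2 : L2S (dl b) by apply: (L2_bd mS fS dlm (K := K)); exact: aeW.
have li2 : L2S lami.
  apply: (L2_bd mS fS lami_meas (K := 2)); apply: aeW => z /lami_bounds/andP[h1 h2].
  by rewrite ger0_norm.
have dli2 : L2S (fun z => - lami z ^+ 2 * dl b z).
  apply: (L2M_bd mS (K := 4)) => //.
    by apply: measurableT_comp => //; apply: measurable_funX; exact: lami_meas.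
  apply: aeW => z /lami_bounds/andP[h1 h2].
  rewrite normrN ger0_norm ?sqr_ge0// expr2 (_ : 4 = 2 * 2); last by ring.
  by rewrite ler_pM.
have cc (k : R) (A : set R) : {within A, continuous (fun=> k)} by move=> x; exact: cvg_cst.
have cid (A : set R) : {within A, continuous (fun s : R => s)}.
  by apply: continuous_subspaceT => x; exact: cvg_id.
have P t : dom L (~~ b) t -> [/\ {within `[dlo b, dhi L b], continuous (fun s => lam (pt b s t))},
     {within `[dlo b, dhi L b], continuous (fun s => dl b (pt b s t))},
     forall s, dlo b <= s <= dhi L b -> lam (pt b s t) != 0 &
     forall s, dlo b < s < dhi L b -> is_derive s (1 : R) (fun s => lam (pt b s t)) (dl b (pt b s t))].
  have nz z : 0 <= z.1 <= L -> `|z.2| <= 2^-1 -> lam z != 0.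
    move=> h1 h2; have /andP[h3 _] := lam_bounds_cc h1 h2.
    by rewrite gt_eqF// (lt_le_trans _ h3)// invr_gt0.
  have isc (x k : R) := @is_derive_cst _ R R k x (1 : R).
  rewrite -[dom _ _ _]/(itvoo _ _ t) itvooE /lam /dl /dlam; case: (b) => /= /andP[t1 t2]; split.
  - apply: wcontD; [exact: cc|].
    by apply: wcontN; apply: wcontM; [exact: ck|exact: cc].
  - by apply: wcontN; apply: wcontM; [exact: ck'|exact: cc].
  - by move=> s hs; apply: (nz (s, t)) => //=; rewrite ler_norml !ltW.
  - move=> s hs; have dks := dk s hs.
    apply: (is_derive_eq (is_deriveDf (isc s 1) (is_deriveNf (is_deriveMf dks (isc s (w * t)))))).
    by rewrite mulr0 !add0r mulrC.
  - apply: wcontD; [exact: cc|apply: wcontN; apply: wcontM; first exact: cc].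
    by apply: wcontM; [exact: cc|exact: cid].
  - exact: cc.
  - by move=> s hs; apply: (nz (t, s)); [rewrite /= !ltW|rewrite /= ler_norml].
  - move=> s hs; have ids := @is_derive_id _ R s (1 : R).
    apply: (is_derive_eq (is_deriveDf (isc s 1) (is_deriveNf (is_deriveMf (isc s (kappa t)) (is_deriveMf (isc s w) ids))))).
    by rewrite /=; ring.
split; first by apply: wd_C1 => //; [move=> t /P[]|exact: lam_L2].
apply: wd_C1 => // t /P[c1 c2 nz d].
have ci : {within `[dlo b, dhi L b], continuous (fun s => lami (pt b s t))}.
  apply/subspace_continuousP => s sA; apply: cvgV; first by apply: nz; move: sA; rewrite /= in_itv.
  by move/subspace_continuousP : c1; exact.
split => //.
  apply: wcontM => //; apply: wcontN; have -> : (fun s => lami (pt b s t) ^+ 2) = (fun s => lami (pt b s t) * lami (pt b s t)).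
    by apply/funext => s; rewrite expr2.
  exact: wcontM.
move=> s hs; have nzs : lam (pt b s t) != 0 by apply: nz; case/andP: hs => ? ?; rewrite !ltW.
exact: (is_deriveVf (f := fun s => lam (pt b s t)) nzs (d s hs)).
Qed.

(** Only the transversal derivative [-w kappa] is given explicitly: differentiating
    [|d_1 f|^2 = lambda^2] in [x_2] is how the geodesic curvature enters the structure equations. *)
Lemma wd_lam : exists dl : bool -> R * R -> R, (forall z, dl false z = - (w * kappa z.1)) /\
  forall b, wd L b lam (dl b) /\ wd L b lami (fun z => - lami z ^+ 2 * dl b z).
Proof. by have [k' [ck' dk]] := kappa_C1; exists (dlam k'); split => // b; exact: wd_dlam. Qed.

End lambda.

(** The differentiated orthonormality relations make the matrix of the derivative in the frame skew,
    so three coefficients determine it. *)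
Lemma skew_expand (R : realType) (a b n da db dn : 'cV[R]_3) : SO3 (mx3 a b n) ->
  dot da a + dot a da = 0 -> dot db b + dot b db = 0 -> dot dn n + dot n dn = 0 ->
  dot da b + dot a db = 0 -> dot da n + dot a dn = 0 -> dot db n + dot b dn = 0 ->
  [/\ da = dot da b *: b + dot da n *: n, db = - dot da b *: a + dot db n *: n &
      dn = - dot da n *: a - dot db n *: b].
Proof.
move=> hS; rewrite (dotC a da) (dotC b db) (dotC n dn) (dotC a db) (dotC a dn) (dotC b dn).
move=> h1 h2 h3 h4 h5 h6.
have e1 : dot da a = 0 by lra.
have e2 : dot db b = 0 by lra.
have e3 : dot dn n = 0 by lra.
have e4 : dot db a = - dot da b by lra.
have e5 : dot dn a = - dot da n by lra.
have e6 : dot dn b = - dot db n by lra.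
split.
- by rewrite {1}(mx3_expand da hS) e1 scale0r add0r.
- by rewrite {1}(mx3_expand db hS) e2 e4 scale0r addr0.
- by rewrite {1}(mx3_expand dn hS) e3 e5 e6 scale0r addr0 [(- dot db n) *: b]scaleNr.
Qed.

(** * Structure equations of a rescaled isometric immersion *)

Section immersion.
Context {R : realType}.
Variables (L w : R) (kappa : R -> R) (f : R * R -> 'cV[R]_3).
Hypotheses (hL : 0 < L) (hw : 0 < w).
Hypothesis hkappa : smooth_on `[0, L] kappa.
Hypothesis hk : forall z : R * R, 0 <= z.1 <= L -> `|z.2| <= 2^-1 ->
  `|kappa z.1 * (w * z.2)| <= 2^-1.
Hypothesis hf : isometric_immersion L kappa w f.
Local Notation mu2 := (@lebesgue2 R).
Local Notation S := (strip L).
Local Notation L2S := (L2 mu2 S).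
Local Notation wps := (weak_partial_scal L).
Local Notation lam := (lam w kappa).
Local Notation lami := (lami w kappa).
Let mS := @measurable_strip R L.
Let fS := strip_fin hL.

Local Opaque weak_partial_scal.

Definition fc j (z : R * R) : R := f z j 0.
Definition bi (b : bool) : 'I_2 := if b then 0 else 1.

Lemma bi_true : bi true = 0. Proof. by []. Qed.
Lemma bi_false : bi false = 1. Proof. by []. Qed.

Lemma wds_bi b u v : wds L (bi b) u v <-> wd L b u v.
Proof. by rewrite /wds; case: b. Qed.

Lemma fc_wd b j : wd L b (fc j) (wps (bi b) (fc j)).
Proof. by apply/wds_bi; have [h _] := sobolev2_wds hL (bi b) (hf.1 j 0). Qed.

Lemma fc_wd2 b c j : wd L c (wps (bi b) (fc j)) (wps (bi c) (wps (bi b) (fc j))).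
Proof. by apply/wds_bi; have [_ h] := sobolev2_wds hL (bi b) (hf.1 j 0). Qed.

Definition b1 z : 'cV[R]_3 := weak_partial L 0 f z.
Definition b2 z : 'cV[R]_3 := w^-1 *: weak_partial L 1 f z.
Definition db1 b z : 'cV[R]_3 := \col_j wps (bi b) (wps 0 (fc j)) z.
Definition db2 b z : 'cV[R]_3 := \col_j (w^-1 * wps (bi b) (wps 1 (fc j)) z).

Lemma b1_entry j : (fun z => b1 z j 0) = wps 0 (fc j).
Proof. by apply/funext => z; rewrite /b1 /weak_partial mxE. Qed.

Lemma b2_entry j : (fun z => b2 z j 0) = (fun z => w^-1 * wps 1 (fc j) z).
Proof. by apply/funext => z; rewrite /b2 /weak_partial !mxE. Qed.

Lemma db1_entry b j : (fun z => db1 b z j 0) = wps (bi b) (wps 0 (fc j)).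
Proof. by apply/funext => z; rewrite /db1 mxE. Qed.

Lemma db2_entry b j : (fun z => db2 b z j 0) = (fun z => w^-1 * wps (bi b) (wps 1 (fc j)) z).
Proof. by apply/funext => z; rewrite /db2 mxE. Qed.

Lemma wd_b1 b : wdv L b b1 (db1 b).
Proof.
move=> j.
have h : wd L b (wps 0 (fc j)) (wps (bi b) (wps 0 (fc j))) := fc_wd2 true b j.
exact: (eq_ind_r (fun F => wd L b F (fun z => db1 b z j 0))
  (eq_ind_r (fun G => wd L b (wps 0 (fc j)) G) h (db1_entry b j)) (b1_entry j)).
Qed.

Lemma wd_b2 b : wdv L b b2 (db2 b).
Proof.
by move=> j; rewrite (b2_entry j) (db2_entry b j) -bi_false; apply: wdZ; exact: fc_wd2.
Qed.

(** Equality of mixed derivatives of [f]; the factor [w] appears because [b2] is [d_2 f] divided by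
    [w]. *)
Lemma db_mixed : {ae mu2, forall z, S z -> db1 false z = w *: db2 true z}.
Proof.
have h j : {ae mu2, forall z, S z -> wps 1 (wps 0 (fc j)) z = wps 0 (wps 1 (fc j)) z}.
  have := mixed_partials hL (fc_wd true j) (fc_wd2 true false j) (fc_wd false j) (fc_wd2 false true j).
  by rewrite bi_true bi_false.
apply: aeS3 (h 0) (h 1) (h 2) => z h0 h1 h2 Sz.
apply/matrixP => i j; rewrite ord1 [RHS]mxE.
have -> : db1 false z i 0 = wps 1 (wps 0 (fc i)) z by rewrite /db1 mxE.
have -> : db2 true z i 0 = w^-1 * wps 0 (wps 1 (fc i)) z by rewrite /db2 mxE.
have {h0 h1 h2} : wps 1 (wps 0 (fc i)) z = wps 0 (wps 1 (fc i)) z.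
  by elim/ord3_ind: i; [exact: h0|exact: h1|exact: h2].
by move: (wps 1 _ z) (wps 0 _ z) => x y ->; rewrite mulrA mulfV ?gt_eqF// mul1r.
Qed.

Lemma grad_col z : col 0 (grad_w L w f z) = b1 z /\ col 1 (grad_w L w f z) = b2 z.
Proof.
split; apply/matrixP => i j; rewrite ord1 [LHS]mxE.
  by rewrite (_ : 0 = lshift 1 (0 : 'I_1)); [exact: row_mxEl|exact/val_inj].
by rewrite (_ : 1 = rshift 1 (0 : 'I_1)); [exact: row_mxEr|exact/val_inj].
Qed.

Lemma mulmx_tr_col (p : nat) (A : 'M[R]_(3, p)) (q : nat) (B : 'M[R]_(3, q)) i j :
  (A^T *m B) i j = dot (col i A) (col j B).
Proof. by rewrite dotE mxE; apply: eq_bigr => k _; rewrite !mxE. Qed.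

Lemma b_gram : {ae mu2, forall z, S z ->
  [/\ dot (b1 z) (b1 z) = lam z ^+ 2, dot (b1 z) (b2 z) = 0 & dot (b2 z) (b2 z) = 1]}.
Proof.
apply: aeS hf.2 => z h Sz; have {h} /matrixP h := h Sz.
have [c0 c1] := grad_col z.
have h00 := h 0 0; have h01 := h 0 1; have h11 := h 1 1.
rewrite mulmx_tr_col c0 [RHS]mxE [X in _ = X *+ _]mxE /= mulr1n in h00.
rewrite mulmx_tr_col c0 c1 [RHS]mxE mulr0n in h01.
by rewrite mulmx_tr_col c1 [RHS]mxE [X in _ = X *+ _]mxE /= mulr1n in h11.
Qed.

Definition a1 z := lami z *: b1 z.
Definition nu z := cross (a1 z) (b2 z).

Lemma lam_lami z : S z -> lam z * lami z = 1.
Proof.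
move=> /(lam_bounds hk)/andP[h _]; rewrite mulfV// gt_eqF//.
by apply: lt_le_trans h; rewrite invr_gt0.
Qed.

Lemma b1E z : S z -> b1 z = lam z *: a1 z.
Proof. by move=> Sz; rewrite /a1 scalerA lam_lami// scale1r. Qed.

Lemma frame_ae : {ae mu2, forall z, S z -> SO3 (mx3 (a1 z) (b2 z) (nu z))}.
Proof.
apply: aeS b_gram => z h Sz; have [h1 h2 h3] := h Sz.
rewrite /nu; apply: SO3_mx3; last 2 first.
- exact: h3.
- by rewrite /a1 dotZl h2 mulr0.
by rewrite /a1 dotZl dotZr h1 mulrA -expr2 -exprMn mulrC lam_lami// expr1n.
Qed.

Lemma sq_entry_le (v : 'cV[R]_3) j : v j 0 ^+ 2 <= dot v v.
Proof.
rewrite dotE (bigD1 j)//= -expr2 lerDl sumr_ge0// => k _.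
by rewrite -expr2 sqr_ge0.
Qed.

Lemma bd_b1 : bdv L 2 b1.
Proof.
move=> j; apply: aeS b_gram => z h Sz; have [h1 _ _] := h Sz.
have /andP[l1 l2] := lam_bounds hk Sz.
have l0 : 0 <= lam z by apply: le_trans l1; rewrite invr_ge0.
rewrite -(@ler_pXn2r _ 2)// ?nnegrE// real_normK ?num_real//.
apply: (le_trans (sq_entry_le _ _)); rewrite h1.
by rewrite lerXn2r ?nnegrE.
Qed.

Lemma bd_frame : [/\ bdv L 1 a1, bdv L 1 b2 & bdv L 1 nu].
Proof. exact: bdv_SO3 frame_ae. Qed.

Lemma lami_bd : aebd mu2 S 2 lami.
Proof. by apply: aeW => z /(lami_bounds hk)/andP[l1 l2]; rewrite ger0_norm. Qed.

(** The metric fixes the length of the cross product as [lambda], so the normalization in [normal_w]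
    becomes multiplication by a regular function. Weak derivatives of the normal are computed on
    [nu], a product of functions that have them. *)
Lemma normal_wE : {ae mu2, forall z, S z -> normal_w L w f z = nu z}.
Proof.
apply: aeS b_gram => z h Sz; have [h1 h2 h3] := h Sz.
have [c0 c1] := grad_col z; rewrite /normal_w c0 c1 /unit_normal /nu /a1.
have /andP[l1 l2] := lam_bounds hk Sz.
have l0 : 0 <= lam z by apply: le_trans l1; rewrite invr_ge0.
have -> : frob (cross (b1 z) (b2 z)) = lam z.
  by rewrite frob_dot lagrange_identity h1 h2 h3 mulr1 mul0r subr0 sqrtr_sqr ger0_norm.
rewrite -/(lami z); move: (lami z) (b1 z) (b2 z) => m u v.
apply/matrixP => i j; rewrite ord1 mxE; have [e0 e1 e2] := crossE u v.
have [k0 k1 k2] := crossE (m *: u) v.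
by elim/ord3_ind: i; rewrite ?e0 ?e1 ?e2 ?k0 ?k1 ?k2 ![(m *: u) _ _]mxE; ring.
Qed.

(** Agreement with [nu] almost everywhere gives the bound but not measurability, which is checked on
    the definition. *)
Lemma normal_w_L2 j : L2S (fun z => normal_w L w f z j 0).
Proof.
have e : aebd mu2 S 1 (fun z => normal_w L w f z j 0).
  have [_ _ bn] := bd_frame.
  by apply: aeS2 normal_wE (bn j) => z h1 h2 Sz; rewrite h1// h2.
apply: (L2_bd mS fS _ e).
have m1 i : measurable_fun S ((fun z => b1 z i 0) : measurableTypeR R * measurableTypeR R -> R).
  by have [/L2_meas] := wd_b1 true i.
have m2 i : measurable_fun S ((fun z => b2 z i 0) : measurableTypeR R * measurableTypeR R -> R).
  by have [/L2_meas] := wd_b2 true i.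
have mc i : measurable_fun S ((fun z => cross (b1 z) (b2 z) i 0) : measurableTypeR R * measurableTypeR R -> R).
  under eq_fun do rewrite mxE.
  by apply: measurable_funB; apply: measurable_funM.
have -> : (fun z => normal_w L w f z j 0) = (fun z => (Num.sqrt (dot (cross (b1 z) (b2 z)) (cross (b1 z) (b2 z))))^-1 * cross (b1 z) (b2 z) j 0).
  apply/funext => z; have [c0 c1] := grad_col z; rewrite /normal_w c0 c1 /unit_normal.
  by rewrite mxE frob_dot.
apply: measurable_funM; last exact: mc.
apply: measurable_inv_ge0 => [||z _]; [exact: mS| |exact: sqrtr_ge0].
apply: (@measurableT_comp _ _ _ _ _ _ (Num.sqrt : R -> R)).
  by apply: continuous_measurable_fun => x; exact: sqrt_continuous.
under eq_fun do rewrite dot3.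
exact: (measurable_funD (measurable_funD (measurable_funM (mc 0) (mc 0)) (measurable_funM (mc 1) (mc 1))) (measurable_funM (mc 2) (mc 2))).
Qed.

Lemma frame_wd : exists da1 dnu : bool -> R * R -> 'cV[R]_3,
  forall b, wdv L b a1 (da1 b) /\ wdv L b nu (dnu b).
Proof.
have [dl [_ hl]] := wd_lam hL hw hkappa hk.
pose da1 b z := (- lami z ^+ 2 * dl b z) *: b1 z + lami z *: db1 b z.
have h1 b : wdv L b a1 (da1 b).
  have [_ hli] := hl b; exact: (wdvZ hL hli (wd_b1 b) lami_bd bd_b1).
exists da1, (fun b z => cross (da1 b z) (b2 z) + cross (a1 z) (db2 b z)) => b; split => //.
have [k1 k2 _] := bd_frame; exact: (wdv_cross hL (h1 b) (wd_b2 b) k1 k2).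
Qed.

Local Notation H := (II_w L w f).

Lemma weak_partial_normal b dnu : wdv L b nu dnu ->
  {ae mu2, forall z, S z -> weak_partial L (bi b) (normal_w L w f) z = dnu z}.
Proof.
move=> hn.
have h j : {ae mu2, forall z, S z -> wps (bi b) (fun z => normal_w L w f z j 0) z = dnu z j 0}.
  have [_ hd _] := hn j.
  suff /wds_bi /(weak_partialP hL)[] : wd L b (fun z => normal_w L w f z j 0) (fun z => dnu z j 0) by [].
  apply: (wd_ae hL (hn j)) => //; [exact: normal_w_L2| |exact: aeW].
  by apply: aeS normal_wE => z h Sz; rewrite h.
apply: aeS3 (h 0) (h 1) (h 2) => z h0 h1 h2 Sz.
apply/matrixP => i j; rewrite ord1 mxE.
by elim/ord3_ind: i; [exact: h0|exact: h1|exact: h2].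
Qed.

Lemma weak_partial_normal_L2 i j : L2S (fun z => weak_partial L i (normal_w L w f) z j 0).
Proof.
have [da1 [dnu h]] := frame_wd.
have [b ->] : exists b, i = bi b.
  by case: i => [[|[|//]] hi]; [exists true|exists false]; exact/val_inj.
have [_ /(_ j) hn] := h b; have [_ hd _] := hn.
have w1 : wd L b (fun z => normal_w L w f z j 0) (fun z => dnu b z j 0).
  apply: (wd_ae hL hn) => //; [exact: normal_w_L2| |exact: aeW].
  by apply: aeS normal_wE => z hz Sz; rewrite hz.
have /wds_bi /(weak_partialP hL)[[_ h2 _] _] := w1.
by under eq_fun do rewrite mxE.
Qed.

Lemma II_w_entry z : [/\ H z 0 0 = - dot (b1 z) (weak_partial L 0 (normal_w L w f) z),
  H z 0 1 = - (w^-1 * dot (b1 z) (weak_partial L 1 (normal_w L w f) z)),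
  H z 1 0 = - dot (b2 z) (weak_partial L 0 (normal_w L w f) z) &
  H z 1 1 = - (w^-1 * dot (b2 z) (weak_partial L 1 (normal_w L w f) z))].
Proof.
have [c0 c1] := grad_col z.
have d0 : col 0 (grad_w L w (normal_w L w f) z) = weak_partial L 0 (normal_w L w f) z.
  apply/matrixP => i j; rewrite ord1 [LHS]mxE.
  by rewrite (_ : 0 = lshift 1 (0 : 'I_1)); [exact: row_mxEl|exact/val_inj].
have d1 : col 1 (grad_w L w (normal_w L w f) z) = w^-1 *: weak_partial L 1 (normal_w L w f) z.
  apply/matrixP => i j; rewrite ord1 [LHS]mxE.
  by rewrite (_ : 1 = rshift 1 (0 : 'I_1)); [exact: row_mxEr|exact/val_inj].
have E i j : H z i j = - dot (col i (grad_w L w f z)) (col j (grad_w L w (normal_w L w f) z)).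
  by rewrite /II_w mxE mulmx_tr_col.
split; first by rewrite E c0 d0.
- by rewrite E c0 d1 (dotZr w^-1 (b1 z)).
- by rewrite E c1 d0.
- by rewrite E c1 d1 (dotZr w^-1 (b2 z)).
Qed.

Lemma II_w_L2 i j : L2S (fun z => H z i j).
Proof.
have P K b k : bdv L K b -> (forall j, L2S (fun z => b z j 0)) ->
    L2S (fun z => dot (b z) (weak_partial L k (normal_w L w f) z)).
  move=> bb hb.
  have Q l : L2S (fun z => b z l 0 * weak_partial L k (normal_w L w f) z l 0).
    apply: (L2M_bd mS _ (bb l)); [exact: L2_meas (hb l)|exact: weak_partial_normal_L2].
  have := L2D mS (L2D mS (Q 0) (Q 1)) (Q 2).
  by congr (L2 _ _ _); apply/funext => z; rewrite dot3.
have B1 k := P _ _ k bd_b1 (fun j => (let: And3 h _ _ := wd_b1 true j in h)).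
have [_ bb2 _] := bd_frame.
have B2 k := P _ _ k bb2 (fun j => (let: And3 h _ _ := wd_b2 true j in h)).
have h2 : forall i : 'I_2, i = 0 \/ i = 1.
  by case=> [[|[|//]] hi]; [left|right]; exact/val_inj.
have E : [/\ (fun z => H z 0 0) = (fun z => - dot (b1 z) (weak_partial L 0 (normal_w L w f) z)),
  (fun z => H z 0 1) = (fun z => - (w^-1 * dot (b1 z) (weak_partial L 1 (normal_w L w f) z))),
  (fun z => H z 1 0) = (fun z => - dot (b2 z) (weak_partial L 0 (normal_w L w f) z)) &
  (fun z => H z 1 1) = (fun z => - (w^-1 * dot (b2 z) (weak_partial L 1 (normal_w L w f) z)))].
  by split; apply/funext => z; have [h00 h01 h10 h11] := II_w_entry z.
have [E00 E01 E10 E11] := E.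
case: (h2 i) => ->; case: (h2 j) => ->; rewrite ?E00 ?E01 ?E10 ?E11; apply: (L2N mS).
- exact: B1.
- by apply: L2Z => //; exact: B1.
- exact: B2.
- by apply: L2Z => //; exact: B2.
Qed.

Lemma frame_relations b da1 dnu : wdv L b a1 da1 -> wdv L b nu dnu ->
  {ae mu2, forall z, S z -> [/\ da1 z = dot (da1 z) (b2 z) *: b2 z + dot (da1 z) (nu z) *: nu z,
    db2 b z = - dot (da1 z) (b2 z) *: a1 z + dot (db2 b z) (nu z) *: nu z &
    dnu z = - dot (da1 z) (nu z) *: a1 z - dot (db2 b z) (nu z) *: b2 z] /\
    [/\ dot (da1 z) (b2 z) + dot (a1 z) (db2 b z) = 0, dot (da1 z) (nu z) + dot (a1 z) (dnu z) = 0,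
       dot (db2 b z) (nu z) + dot (b2 z) (dnu z) = 0 & dot (db2 b z) (b2 z) = 0]}.
Proof.
move=> ha hn; have [k1 k2 k3] := bd_frame.
have F P : (forall z, SO3 (mx3 (a1 z) (b2 z) (nu z)) -> P z) -> {ae mu2, forall z, S z -> P z}.
  by move=> h; apply: aeS frame_ae => z hz Sz; exact: h (hz Sz).
have r11 := dot_const_derive hL ha ha k1 k1 (F (fun z => dot (a1 z) (a1 z) = 1) (fun z h => (let: And4 x _ _ _ := mx3_orth_dot h in x))).
have r22 := dot_const_derive hL (wd_b2 b) (wd_b2 b) k2 k2 (F (fun z => dot (b2 z) (b2 z) = 1) (fun z h => (let: And4 _ x _ _ := mx3_orth_dot h in x))).
have r33 := dot_const_derive hL hn hn k3 k3 (F (fun z => dot (nu z) (nu z) = 1) (fun z h => (let: And4 _ _ x _ := mx3_orth_dot h in x))).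
have r12 := dot_const_derive hL ha (wd_b2 b) k1 k2 (F (fun z => dot (a1 z) (b2 z) = 0) (fun z h => (let: And4 _ _ _ (And3 x _ _) := mx3_orth_dot h in x))).
have r13 := dot_const_derive hL ha hn k1 k3 (F (fun z => dot (a1 z) (nu z) = 0) (fun z h => (let: And4 _ _ _ (And3 _ x _) := mx3_orth_dot h in x))).
have r23 := dot_const_derive hL (wd_b2 b) hn k2 k3 (F (fun z => dot (b2 z) (nu z) = 0) (fun z h => (let: And4 _ _ _ (And3 _ _ x) := mx3_orth_dot h in x))).
apply: aeS3 frame_ae (aeI r11 (aeI r22 r33)) (aeI r12 (aeI r13 r23)) => z h0 [h1 [h2 h3]] [h4 [h5 h6]] Sz.
split; first exact: (skew_expand (h0 Sz) (h1 Sz) (h2 Sz) (h3 Sz) (h4 Sz) (h5 Sz) (h6 Sz)).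
split; [exact: h4|exact: h5|exact: h6|].
by have := h2 Sz; rewrite (dotC (b2 z)) -mulr2n => /eqP; rewrite mulrn_eq0 => /eqP.
Qed.

(** Orthonormality leaves three coefficients in each direction. Those against the normal are entries
    of [H] by definition. The tangential ones, and the symmetry of [H], follow by differentiating
    [|b1|^2 = lambda^2], [b1.b2 = 0] and [b1.nu = 0] in [x_2] and replacing [d_2 b1] by
    [w d_1 b2]. *)
Lemma gauss_weingarten : exists da1 dnu : bool -> R * R -> 'cV[R]_3,
  (forall b, wdv L b a1 (da1 b) /\ wdv L b nu (dnu b)) /\
  {ae mu2, forall z, S z -> [/\
    [/\ da1 true z = kappa z.1 *: b2 z + (lami z * H z 0 0) *: nu z,
        db2 true z = - kappa z.1 *: a1 z + H z 1 0 *: nu z &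
        dnu true z = - (lami z * H z 0 0) *: a1 z - H z 1 0 *: b2 z],
    [/\ da1 false z = (w * (lami z * H z 0 1)) *: nu z,
        db2 false z = (w * H z 1 1) *: nu z &
        dnu false z = - (w * (lami z * H z 0 1)) *: a1 z - (w * H z 1 1) *: b2 z] &
    H z 0 1 = H z 1 0]}.
Proof.
have [da1 [dnu hd]] := frame_wd; exists da1, dnu; split => //.
have [t1 t2] := hd true; have [f1 f2] := hd false.
have Rt := frame_relations t1 t2; have Rf := frame_relations f1 f2.
have Nt := weak_partial_normal t2; have Nf := weak_partial_normal f2.
rewrite bi_true in Nt; rewrite bi_false in Nf.
have [k1 k2 k3] := bd_frame.
(* Product rules for dot products take one common bound, and [b1] has bound 2. *)
have k2' : bdv L 2 b2 by move=> j; apply: aeS (k2 j) => z h Sz; rewrite (le_trans (h Sz))// ler1n.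
have k3' : bdv L 2 nu by move=> j; apply: aeS (k3 j) => z h Sz; rewrite (le_trans (h Sz))// ler1n.
have g12 : {ae mu2, forall z, S z -> dot (b1 z) (b2 z) = 0}.
  by apply: aeS b_gram => z h Sz; have [_ ->] := h Sz.
have g1n : {ae mu2, forall z, S z -> dot (b1 z) (nu z) = 0}.
  apply: aeS frame_ae => z h Sz; have [_ _ _ [_ hh _]] := mx3_orth_dot (h Sz).
  by rewrite b1E// dotZl hh mulr0.
have rb12 := dot_const_derive hL (wd_b1 false) (wd_b2 false) bd_b1 k2' g12.
have rb1n := dot_const_derive hL (wd_b1 false) f2 bd_b1 k3' g1n.
have rb11 : {ae mu2, forall z, S z -> dot (db1 false z) (b1 z) + dot (b1 z) (db1 false z) = - (w * kappa z.1) * lam z + lam z * - (w * kappa z.1)}.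
  have [dl [dlf hl]] := wd_lam hL hw hkappa hk.
  have [hlam _] := hl false.
  have bl : aebd mu2 S 2 lam.
    apply: aeW => z /(lam_bounds hk)/andP[l1 l2]; rewrite ger0_norm//.
    by apply: le_trans l1; rewrite invr_ge0.
  have g11 : {ae mu2, forall z, S z -> dot (b1 z) (b1 z) = lam z * lam z}.
    by apply: aeS b_gram => z h Sz; have [-> _ _] := h Sz; rewrite expr2.
  have := wd_ae_derive hL (wdv_dot hL (wd_b1 false) (wd_b1 false) bd_b1 bd_b1) (wdM hL hlam hlam bl bl) g11.
  by apply: aeS => z h Sz; rewrite h// dlf.
apply: aeS3 (aeI Rt Rf) (aeI Nt (aeI Nf db_mixed)) (aeI rb12 (aeI rb1n rb11)).
move=> z [h1 h2] [h3 [h4 h5]] [h6 [h7 h8]] Sz.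
move: (h1 Sz) (h2 Sz) (h3 Sz) (h4 Sz) (h5 Sz) (h6 Sz) (h7 Sz) (h8 Sz) => {h1 h2 h3 h4 h5 h6 h7 h8}.
have ll := lam_lami Sz; have hb := b1E Sz.
have [-> -> -> ->] := II_w_entry z.
move: (weak_partial L 0 _ z) (weak_partial L 1 _ z) => n0 n1.
move: (da1 true z) (da1 false z) (dnu true z) (dnu false z) (db2 true z) (db2 false z) (db1 false z) hb.
move: ll; move: (lam z) (lami z) (b1 z) (a1 z) (b2 z) (nu z) (kappa z.1) => l m b a c n k.
move=> ll dat daf dnt dnf dbt dbf dbb bE [[q1 q2 q3] [q4 q5 q6 q7]] [[p1 p2 p3] [p4 p5 p6 p7]] -> -> db_w.
rewrite db_w !bE !dotZl !dotZr => s1 s2 s3.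
have w0 : w != 0 by rewrite gt_eqF.
have l0 : l != 0 by apply/eqP => l0; move: ll; rewrite l0 mul0r => /esym/eqP; rewrite oner_eq0.
have m0 : m != 0 by apply/eqP => l1; move: ll; rewrite l1 mulr0 => /esym/eqP; rewrite oner_eq0.
(* From [b1.d_2 b1 = -w kappa lambda] and [d_2 b1 = w d_1 b2] one gets [a.d_1 c = -kappa]. *)
have e1 : dot dat c = k.
  have h : l * w * (dot a dbt + k) = 0.
    by move: s3; rewrite (dotC dbt a) => s3; lra.
  have : dot a dbt + k = 0 by move/eqP: h; rewrite !mulf_eq0 (negbTE l0) (negbTE w0) => /eqP.
  by move=> h'; move: q4 h'; move: (dot _ _) (dot _ _) => x y; lra.
(* Since [d_1 c] is orthogonal to [c], so is [d_2 b1]; then [b1.c = 0] differentiated in [x_2]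
   leaves [a.d_2 c = 0]. *)
have e2 : dot daf c = 0.
  have : dot a dbf = 0.
    by move/eqP : s1; rewrite q7 mulr0 add0r mulf_eq0 (negbTE l0) => /eqP.
  by move=> h; move: p4; rewrite h addr0.
have e3 : m * - (l * dot a dnt) = dot dat n.
  have -> : m * - (l * dot a dnt) = - (l * m) * dot a dnt by ring.
  by rewrite ll; move: q5; move: (dot _ _) (dot _ _) => x y; lra.
have e4 : - dot c dnt = dot dbt n by move: q6; move: (dot _ _) (dot _ _) => x y; lra.
have e5 : w * (m * - (w^-1 * (l * dot a dnf))) = dot daf n.
  have -> : w * (m * - (w^-1 * (l * dot a dnf))) = - (l * m) * dot a dnf by field.
  by rewrite ll; move: p5; move: (dot _ _) (dot _ _) => x y; lra.
have e6 : w * - (w^-1 * dot c dnf) = dot dbf n.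
  have -> : w * - (w^-1 * dot c dnf) = - dot c dnf by field.
  by move: p6; move: (dot _ _) (dot _ _) => x y; lra.
(* The symmetry of [H]: both off-diagonal entries equal [d_1 c.n], by [b1.nu = 0] differentiated in
   [x_2]. *)
have e7 : - (w^-1 * (l * dot a dnf)) = - dot c dnt.
  have h : l * dot a dnf = - (w * dot dbt n) by move: s2; move: (w * _) (l * _) => x y; lra.
  by rewrite h e4; field.
rewrite e3 e4 e5 e6 -e4 e7; split; [split|split|] => //.
- by rewrite {1}q1 e1.
- by rewrite {1}q2 e1 e4.
- by rewrite {1}q3 e4.
- by rewrite {1}p1 e2 scale0r add0r.
- by rewrite {1}p2 e2 oppr0 scale0r add0r.
Qed.

End immersion.

Section immersion_frame.
Context {R : realType}.
Variables (L w : R) (kappa : R -> R) (f : R * R -> 'cV[R]_3).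
Hypotheses (hL : 0 < L) (hw : 0 < w).
Hypothesis hkappa : smooth_on `[0, L] kappa.
Hypothesis hk : forall z : R * R, 0 <= z.1 <= L -> `|z.2| <= 2^-1 ->
  `|kappa z.1 * (w * z.2)| <= 2^-1.
Hypothesis hf : isometric_immersion L kappa w f.
Local Notation mu2 := (@lebesgue2 R).
Local Notation S := (strip L).
Local Notation L2S := (L2 mu2 S).
Local Notation lami := (lami w kappa).
Local Notation H := (II_w L w f).
Local Notation a := (a1 L w kappa f).
Local Notation c := (b2 L w f).
Local Notation n := (nu L w kappa f).
Let mS := @measurable_strip R L.

Lemma wdv_ae b U V V' : wdv L b U V -> {ae mu2, forall z, S z -> V z = V' z} ->
  (forall j, L2S (fun z => V' z j 0)) -> wdv L b U V'.
Proof.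
move=> hU e hV j; have [h1 _ _] := hU j; apply: (wd_ae hL (hU j)) => //; first exact: aeW.
by apply: aeS e => z h Sz; rewrite h.
Qed.

Lemma L2_scale_col K (g : R * R -> R) (U : R * R -> 'cV[R]_3) j : bdv L K U ->
  L2S (fun z => U z j 0) -> L2S g -> L2S (fun z => (g z *: U z) j 0).
Proof.
move=> bU hU hg; under eq_fun do rewrite mxE mulrC.
by apply: (L2M_bd mS _ (bU j) hg); exact: L2_meas hU.
Qed.

Lemma L2_lami i j : L2S (fun z => lami z * H z i j).
Proof.
apply: (L2M_bd mS _ (lami_bd hk)); first exact: lami_meas.
exact: (II_w_L2 hL hw hkappa hk hf).
Qed.

(** The relations of [gauss_weingarten] hold almost everywhere; after a change on null sets their
    right-hand sides serve as weak derivatives, a form in which every coefficient has a known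
    limit. *)
Lemma frame_wd_explicit :
  [/\ wdv L true a (fun z => kappa z.1 *: c z + (lami z * H z 0 0) *: n z),
      wdv L true c (fun z => - kappa z.1 *: a z + H z 1 0 *: n z) &
      wdv L true n (fun z => - (lami z * H z 0 0) *: a z - H z 1 0 *: c z)] /\
  [/\ wdv L false a (fun z => (w * (lami z * H z 0 1)) *: n z),
      wdv L false c (fun z => (w * H z 1 1) *: n z) &
      wdv L false n (fun z => - (w * (lami z * H z 0 1)) *: a z - (w * H z 1 1) *: c z)].
Proof.
have [da [dn [hd e]]] := gauss_weingarten hL hw hkappa hk hf.
have [at_ nt] := hd true; have [af nf] := hd false.
have [k1 k2 k3] := bd_frame hk hf.
have h1 j : L2S (fun z => a z j 0) by have [] := at_ j.
have h2 j : L2S (fun z => c z j 0) by have [] := wd_b2 hL hf true j.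
have h3 j : L2S (fun z => n z j 0) by have [] := nt j.
have hH i j := II_w_L2 hL hw hkappa hk hf i j.
have hlH i j := L2_lami i j.
have [M _ [hK _]] := cont_along hL (kappa_cont hkappa).
have hN g : L2S g -> L2S (fun z => - g z) by exact: (L2N mS).
have hZ g : L2S g -> L2S (fun z => w * g z) by exact: (L2Z mS).
have P U V g h : (forall j, L2S (fun z => (g z *: U z : 'cV[R]_3) j 0)) -> (forall j, L2S (fun z => (h z *: V z : 'cV[R]_3) j 0)) ->
    forall j, L2S (fun z => (g z *: U z + h z *: V z) j 0).
  by move=> q1 q2 j; under eq_fun do rewrite mxE; exact: L2D.
have Q U V g h : (forall j, L2S (fun z => (g z *: U z : 'cV[R]_3) j 0)) -> (forall j, L2S (fun z => (h z *: V z : 'cV[R]_3) j 0)) ->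
    forall j, L2S (fun z => (g z *: U z - h z *: V z) j 0).
  move=> q1 q2 j.
  have -> : (fun z => (g z *: U z - h z *: V z) j 0) = (fun z => (g z *: U z) j 0 - (h z *: V z) j 0).
    by apply/funext => z; rewrite mxE [X in _ + X]mxE.
  exact: L2B.
have Sa g : L2S g -> forall j, L2S (fun z => (g z *: a z) j 0) by move=> hg j; exact: L2_scale_col k1 (h1 j) hg.
have Sc g : L2S g -> forall j, L2S (fun z => (g z *: c z) j 0) by move=> hg j; exact: L2_scale_col k2 (h2 j) hg.
have Sn g : L2S g -> forall j, L2S (fun z => (g z *: n z) j 0) by move=> hg j; exact: L2_scale_col k3 (h3 j) hg.
have hct := wd_b2 hL hf true; have hcf := wd_b2 hL hf false.
split; split.
- apply: (wdv_ae at_); first by apply: aeS e => z h Sz; have [[]] := h Sz.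
  by apply: P; [exact: Sc|exact: Sn].
- apply: (wdv_ae hct); first by apply: aeS e => z h Sz; have [[]] := h Sz.
  by apply: P; [apply: Sa; exact: hN|exact: Sn].
- apply: (wdv_ae nt); first by apply: aeS e => z h Sz; have [[]] := h Sz.
  by apply: Q; [apply: Sa; exact: hN|exact: Sc].
- apply: (wdv_ae af); first by apply: aeS e => z h Sz; have [_ []] := h Sz.
  by apply: Sn; exact: hZ.
- apply: (wdv_ae hcf); first by apply: aeS e => z h Sz; have [_ []] := h Sz.
  by apply: Sn; exact: hZ.
- apply: (wdv_ae nf); first by apply: aeS e => z h Sz; have [_ []] := h Sz.
  by apply: Q; [apply: Sa; apply: hN; exact: hZ|apply: Sc; exact: hZ].
Qed.

End immersion_frame.

(** * Convergence of the frame *)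

Lemma subseq_oo (t : nat -> nat) : {homo t : m n / (m < n)%N} -> t @ \oo --> \oo.
Proof.
move=> ht; have tge n : (n <= t n)%N by elim: n => // n IH; rewrite (leq_ltn_trans IH)// ht.
by move=> A [N _ hN]; exists N => // n Nn; apply: hN => /=; rewrite (leq_trans Nn).
Qed.

Lemma cvg_subseq (T : topologicalType) (u : nat -> T) (l : T) (t : nat -> nat) :
  {homo t : m n / (m < n)%N} -> u @ \oo --> l -> (fun n => u (t n)) @ \oo --> l.
Proof. by move=> ht cu; exact: (cvg_comp t u (subseq_oo ht) cu). Qed.

Lemma bolzano_weierstrass_seq (R : realType) (I : eqType) (r : seq I) (u : I -> nat -> R) (M : R) :
  (forall i n, `|u i n| <= M) ->
  exists s : nat -> nat, {homo s : m n / (m < n)%N} /\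
    forall i, i \in r -> cvgn (fun n => u i (s n)).
Proof.
move=> hM; elim: r => [|i r [s [hs cs]]]; first by exists id; split.
have bu : bounded_fun (fun n => u i (s n)).
  by exists M; split; [exact: num_real|move=> x xM n _ /=; rewrite (le_trans (hM _ _))// ltW].
have [t ht ct] := bolzano_weierstrass bu.
have tlt : {homo t : m n / (m < n)%N}.
  move=> m n mn; have := ht n m; rewrite !leEnat => h.
  by rewrite ltnNge h -ltnNge.
exists (s \o t); split; first by move=> m n mn; apply: hs; exact: tlt.
move=> j; rewrite inE => /predU1P[->|jr]; first exact: ct.
apply/cvg_ex; have /cvg_ex[l hl] := cs _ jr; exists l.
exact: cvg_subseq tlt hl.
Qed.

Section limit.
Context {R : realType}.
Variables (L w0 : R) (kappa : R -> R) (II : R * R -> 'M[R]_2) (e1 e2 e3 : R -> 'cV[R]_3).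
Hypotheses (hL : 0 < L) (hw0 : 0 < w0).
Hypothesis hkappa : smooth_on `[0, L] kappa.
Hypothesis hII : smooth_on (`[0, L] `*` `[- (w0 / 2), w0 / 2]) II.
Hypothesis hframe : frame L kappa II e1 e2 e3.
Local Notation mu2 := (@lebesgue2 R).
Local Notation S := (strip L).
Local Notation L2S := (L2 mu2 S).
Local Notation cvS := (cv2 mu2 S).
Local Notation nsq u := (ip mu2 S u u).
Let mS := @measurable_strip R L.
Let fS := strip_fin hL.
Local Notation P := (fun z : R * R => II_mid II z.1 0 0).
Local Notation Q := (fun z : R * R => II_mid II z.1 0 1).
Local Notation D := (fun z : R * R => II_mid II z.1 1 1).

Variable w_ : nat -> R.
Variables a c n : nat -> R * R -> 'cV[R]_3.
Variables p q r s : nat -> R * R -> R.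
Hypothesis w_cvg : w_ @ \oo --> (0 : R).
Hypothesis hS : forall k, {ae mu2, forall z, S z -> SO3 (mx3 (a k z) (c k z) (n k z))}.
Hypothesis wta : forall k, wdv L true (a k) (fun z => kappa z.1 *: c k z + p k z *: n k z).
Hypothesis wtc : forall k, wdv L true (c k) (fun z => - kappa z.1 *: a k z + q k z *: n k z).
Hypothesis wtn : forall k, wdv L true (n k) (fun z => - p k z *: a k z - q k z *: c k z).
Hypothesis wfa : forall k, wdv L false (a k) (fun z => (w_ k * r k z) *: n k z).
Hypothesis wfc : forall k, wdv L false (c k) (fun z => (w_ k * s k z) *: n k z).
Hypothesis wfn : forall k, wdv L false (n k) (fun z => - (w_ k * r k z) *: a k z - (w_ k * s k z) *: c k z).
Hypothesis cp : cvS p P.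
Hypothesis cq : cvS q Q.
Hypothesis cr : cvS r Q.
Hypothesis cs : cvS s D.

Lemma strip_cc z : S z -> 0 <= z.1 <= L.
Proof. by move=> /strip_in[/andP[h1 h2] _]; rewrite !ltW. Qed.

Lemma e_wd : [/\ wdv L true (fun z => e1 z.1) (fun z => kappa z.1 *: e2 z.1 + II_mid II z.1 0 0 *: e3 z.1),
  wdv L true (fun z => e2 z.1) (fun z => - kappa z.1 *: e1 z.1 + II_mid II z.1 0 1 *: e3 z.1) &
  wdv L true (fun z => e3 z.1) (fun z => - II_mid II z.1 0 0 *: e1 z.1 - II_mid II z.1 0 1 *: e2 z.1)].
Proof.
have W (F dF : R -> 'cV[R]_3) (G : 'I_3 -> R -> R) : (forall j t, dF t j 0 = G j t) ->
    (forall j, {within `[0, L], continuous (fun t => F t j 0)}) ->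
    (forall j, {within `[0, L], continuous (G j)}) ->
    (forall j t, 0 < t < L -> is_derive t (1 : R) (fun t => F t j 0) (G j t)) ->
    wdv L true (fun z => F z.1) (fun z => dF z.1).
  move=> hG h1 h2 h3 j.
  have [_ _ [k1 _]] := cont_along hL (h1 j); have [_ _ [k2 _]] := cont_along hL (h2 j).
  have := wd_along hL (b := true) (h1 j) (h2 j) (h3 j) k1 k2.
  by congr wd; apply/funext => z; rewrite hG.
have fc j := frame_cont hframe j; have fd j t := @frame_derive _ _ _ _ _ _ _ hframe j t.
have fdc j := frame_derive_cont hw0 hkappa hII hframe j.
split.
- apply: (W e1 (fun t => kappa t *: e2 t + II_mid II t 0 0 *: e3 t) (fun j t => kappa t * e2 t j 0 + II_mid II t 0 0 * e3 t j 0)) => [j t|j|j|j t].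
  + by rewrite !mxE.
  + by have [] := fc j.
  + by have [] := fdc j.
  + by move=> /(fd j)[].
- apply: (W e2 (fun t => - kappa t *: e1 t + II_mid II t 0 1 *: e3 t) (fun j t => - kappa t * e1 t j 0 + II_mid II t 0 1 * e3 t j 0)) => [j t|j|j|j t].
  + by rewrite !mxE.
  + by have [] := fc j.
  + by have [] := fdc j.
  + by move=> /(fd j)[].
- apply: (W e3 (fun t => - II_mid II t 0 0 *: e1 t - II_mid II t 0 1 *: e2 t) (fun j t => - II_mid II t 0 0 * e1 t j 0 - II_mid II t 0 1 * e2 t j 0)) => [j t|j|j|j t].
  + by rewrite !mxE.
  + by have [] := fc j.
  + by have [] := fdc j.
  + by move=> /(fd j)[].
Qed.

Lemma e_bd : [/\ bdv L 1 (fun z => e1 z.1), bdv L 1 (fun z => e2 z.1) & bdv L 1 (fun z => e3 z.1)].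
Proof.
by split => j; apply: aeW => z /strip_cc /(frame_ortho hframe)[_ _ _ /(_ j)[]].
Qed.

Lemma e_wd0 : [/\ wdv L false (fun z => e1 z.1) (cst 0), wdv L false (fun z => e2 z.1) (cst 0) &
  wdv L false (fun z => e3 z.1) (cst 0)].
Proof.
have [h1 h2 h3] := e_wd.
have W (F : R -> 'cV[R]_3) : (forall j, L2S (fun z => F z.1 j 0)) -> wdv L false (fun z => F z.1) (cst 0).
  move=> hF j; have := wd_transv hL (b := false) (f := fun t => F t j 0) (hF j).
  by congr wd; apply/funext => z; rewrite /cst mxE.
split; apply: W => j; [by have [] := h1 j|by have [] := h2 j|by have [] := h3 j].
Qed.

Lemma acn_bd k : [/\ bdv L 1 (a k), bdv L 1 (c k) & bdv L 1 (n k)].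
Proof. exact: bdv_SO3 (hS k). Qed.

(* The matrix of [A_w E^T]; its gradient only involves the differences between the
   coefficients of the two frames. *)
Definition Rm k (i j : 'I_3) (z : R * R) : R :=
  a k z i 0 * e1 z.1 j 0 + c k z i 0 * e2 z.1 j 0 + n k z i 0 * e3 z.1 j 0.

Let U k (i j : 'I_3) z := n k z i 0 * e1 z.1 j 0 - a k z i 0 * e3 z.1 j 0.
Let V k (i j : 'I_3) z := n k z i 0 * e2 z.1 j 0 - c k z i 0 * e3 z.1 j 0.

Lemma Rm_true k i j : wd L true (Rm k i j) (fun z =>
  (p k z - II_mid II z.1 0 0) * U k i j z + (q k z - II_mid II z.1 0 1) * V k i j z).
Proof.
have [h1 h2 h3] := e_wd; have [b1 b2 b3] := e_bd; have [k1 k2 k3] := acn_bd k.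
have := wdD (wdD (wdM hL (wta k i) (h1 j) (k1 i) (b1 j)) (wdM hL (wtc k i) (h2 j) (k2 i) (b2 j)))
  (wdM hL (wtn k i) (h3 j) (k3 i) (b3 j)).
congr wd; apply/funext => z; rewrite !mxE /U /V; ring.
Qed.

(** [E] depends on [x_1] alone, so only the derivatives of [A_w] contribute and the factor [w] is
    inherited. No difference of coefficients is required for smallness here. *)
Lemma Rm_false k i j : wd L false (Rm k i j) (fun z =>
  w_ k * (r k z * U k i j z + s k z * V k i j z)).
Proof.
have [h1 h2 h3] := e_wd0; have [b1 b2 b3] := e_bd; have [k1 k2 k3] := acn_bd k.
have := wdD (wdD (wdM hL (wfa k i) (h1 j) (k1 i) (b1 j)) (wdM hL (wfc k i) (h2 j) (k2 i) (b2 j)))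
  (wdM hL (wfn k i) (h3 j) (k3 i) (b3 j)).
congr wd; apply/funext => z; rewrite !mxE /U /V; ring.
Qed.

Let UV_bd k i j : {ae mu2, forall z, S z -> U k i j z ^+ 2 <= 4 /\ V k i j z ^+ 2 <= 4}.
Proof.
have [b1 b2 b3] := e_bd; have [k1 k2 k3] := acn_bd k.
have T (x y u v : R) : `|x| <= 1 -> `|y| <= 1 -> `|u| <= 1 -> `|v| <= 1 -> (x * y - u * v) ^+ 2 <= 4.
  move=> hx hy hu hv.
  have h : `|x * y - u * v| <= 2.
    by rewrite (le_trans (ler_normB _ _))// !normrM (_ : 2 = 1 + 1)// lerD// -[leRHS]mulr1 ler_pM.
  rewrite -[leLHS]real_normK ?num_real// (_ : 4 = 2 ^+ 2); last by ring.
  by rewrite lerXn2r ?nnegrE.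
apply: aeS3 (aeI (k1 i) (k2 i)) (aeI (k3 i) (b1 j)) (aeI (b2 j) (b3 j)) => z [x1 x2] [x3 x4] [x5 x6] Sz.
by split; apply: T; [exact: x3|exact: x4|exact: x1|exact: x6|exact: x3|exact: x5|exact: x2|exact: x6].
Qed.

Let UV_meas k i j : measurable_fun S (U k i j : measurableTypeR R * measurableTypeR R -> R) /\
  measurable_fun S (V k i j : measurableTypeR R * measurableTypeR R -> R).
Proof.
have [h1 h2 h3] := e_wd.
have M (W W' : R * R -> 'cV[R]_3) l : wdv L true W W' -> measurable_fun S ((fun z => W z l 0) : measurableTypeR R * measurableTypeR R -> R).
  by move=> /(_ l)[/L2_meas].
split.
  exact: (measurable_funB (measurable_funM (M _ _ i (wtn k)) (M _ _ j h1)) (measurable_funM (M _ _ i (wta k)) (M _ _ j h3))).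
exact: (measurable_funB (measurable_funM (M _ _ i (wtn k)) (M _ _ j h2)) (measurable_funM (M _ _ i (wtc k)) (M _ _ j h3))).
Qed.

Let XY_small k i j (x y : R * R -> R) : L2S x -> L2S y ->
  L2S (fun z => x z * U k i j z + y z * V k i j z) /\
  nsq (fun z => x z * U k i j z + y z * V k i j z) <= 8 * nsq x + 8 * nsq y.
Proof.
move=> hx hy; have [mU mV] := UV_meas k i j.
have bU : aebd mu2 S 2 (U k i j).
  apply: aeS (UV_bd k i j) => z h Sz; have [hh _] := h Sz.
  by rewrite -(@ler_pXn2r _ 2)// ?nnegrE// real_normK ?num_real// (le_trans hh)// le_eqVlt; apply/orP; left; apply/eqP; ring.
have bV : aebd mu2 S 2 (V k i j).
  apply: aeS (UV_bd k i j) => z h Sz; have [_ hh] := h Sz.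
  by rewrite -(@ler_pXn2r _ 2)// ?nnegrE// real_normK ?num_real// (le_trans hh)// le_eqVlt; apply/orP; left; apply/eqP; ring.
have h1 : L2S (fun z => x z * U k i j z).
  by under eq_fun do rewrite mulrC; exact: (L2M_bd mS mU bU hx).
have h2 : L2S (fun z => y z * V k i j z).
  by under eq_fun do rewrite mulrC; exact: (L2M_bd mS mV bV hy).
split; first exact: L2D.
have q1 : nsq (fun z => x z * U k i j z) <= 4 * nsq x.
  apply: (ip_ae_le mS h1 hx); apply: aeS (UV_bd k i j) => z h Sz; have [hh _] := h Sz.
  by rewrite exprMn mulrC ler_wpM2r ?sqr_ge0.
have q2 : nsq (fun z => y z * V k i j z) <= 4 * nsq y.
  apply: (ip_ae_le mS h2 hy); apply: aeS (UV_bd k i j) => z h Sz; have [_ hh] := h Sz.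
  by rewrite exprMn mulrC ler_wpM2r ?sqr_ge0.
have := ip_sqD mS h1 h2; move: q1 q2; move: (nsq _) (nsq _) (nsq _) (nsq _) (nsq _) => *; lra.
Qed.

Let m k i j : R := L^-1 * \int[mu2]_(z in S) Rm k i j z.

(** The longitudinal part of the gradient is small because the coefficients of the two frames
    approach each other, the transversal part because of the factor [w^2] in front of bounded
    norms. *)
Lemma Rm_mean i j : (fun k => nsq (fun z => Rm k i j z - m k i j)) @ \oo --> (0 : R).
Proof.
have [hp_ hP cp0] := cp; have [hq_ hQ cq0] := cq; have [hr_ _ _] := cr; have [hs_ _ _] := cs.
have crr := cv2_ip mS cr cr; have css := cv2_ip mS cs cs.
pose g k := 8 * (w_ k ^+ 2 * (8 * nsq (r k) + 8 * nsq (s k))) +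
  8 * L ^+ 2 * (8 * nsq (fun z => p k z - II_mid II z.1 0 0) + 8 * nsq (fun z => q k z - II_mid II z.1 0 1)).
apply: (@cvg0_squeeze _ _ g 1).
- by move=> k; exact: ip_ge0.
- move=> k; rewrite mul1r.
  have := poincare2 hL (Rm_true k i j) (Rm_false k i j).
  have hpP : L2S (fun z => p k z - II_mid II z.1 0 0) by exact: L2B.
  have hqQ : L2S (fun z => q k z - II_mid II z.1 0 1) by exact: L2B.
  have [_ x1] := XY_small k i j hpP hqQ; have [y0 y1] := XY_small k i j (hr_ k) (hs_ k).
  rewrite (ip_sqZ mS (w_ k) y0) => h; apply: (le_trans h); rewrite /g; apply: lerD.
    by rewrite ler_pM2l// ler_wpM2l// sqr_ge0.
  by rewrite ler_wpM2l// mulr_ge0// sqr_ge0.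
have -> : (0 : R) = 8 * (0 ^+ 2 * (8 * nsq Q + 8 * nsq D)) + 8 * L ^+ 2 * (8 * 0 + 8 * 0).
  by move: (nsq _) (nsq _) => x y; ring.
have cM (k : R) (u : nat -> R) l : u @ \oo --> l -> (fun n => k * u n) @ \oo --> k * l.
  by move=> cu; apply: cvgM => //; exact: cvg_cst.
apply: cvgD.
  apply: (cM); apply: cvgM; first by rewrite expr2; under eq_fun do rewrite expr2; exact: cvgM.
  by apply: cvgD; apply: (cM).
by apply: (cM); apply: cvgD; apply: (cM).
Qed.

Lemma ip_cst (k : R) : nsq (cst k) = k ^+ 2 * L.
Proof.
transitivity (k ^+ 2 * fine (mu2 S)); last by rewrite (lebesgue2_strip hL).
by rewrite -(Rintegral_cst mu2 mS); apply: eq_Rintegral => z _; rewrite expr2.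
Qed.

Lemma Rm_bd k i j : aebd mu2 S 3 (Rm k i j).
Proof.
have [b1 b2 b3] := e_bd; have [k1 k2 k3] := acn_bd k.
apply: aeS3 (aeI (k1 i) (k2 i)) (aeI (k3 i) (b1 j)) (aeI (b2 j) (b3 j)) => z [x1 x2] [x3 x4] [x5 x6] Sz.
have T (x y : R) : `|x| <= 1 -> `|y| <= 1 -> `|x * y| <= 1.
  by move=> hx hy; rewrite normrM -[leRHS]mulr1 ler_pM.
rewrite /Rm (_ : 3 = 1 + 1 + 1); last by ring.
rewrite (le_trans (ler_normD _ _))// lerD//; last by apply: T; [exact: x3|exact: x6].
rewrite (le_trans (ler_normD _ _))// lerD//; apply: T; [exact: x1|exact: x4|exact: x2|exact: x5].
Qed.

Let m_bd k i j : `|m k i j| <= 3.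
Proof.
have [hR _ _] := Rm_true k i j.
have cs_ := cauchy_schwarz mS hR (L2_cst mS fS 1).
have b9 : nsq (Rm k i j) <= 9 * nsq (cst 1).
  apply: (ip_ae_le mS hR (L2_cst mS fS 1)); apply: aeS (Rm_bd k i j) => z h Sz.
  rewrite expr1n mulr1 -[leLHS]real_normK ?num_real// (_ : 9 = 3 ^+ 2); last by ring.
  by rewrite lerXn2r ?nnegrE// h.
rewrite -(@ler_pXn2r _ 2)// ?nnegrE// real_normK ?num_real//.
rewrite /m exprMn exprVn mulrC ler_pdivrMr ?exprn_gt0//.
move: cs_ b9; rewrite ip_cst expr1n mul1r /ip.
under eq_Rintegral do rewrite mulr1.
move=> h1 h2; apply: (le_trans h1).
apply: (@le_trans _ _ (9 * L * L)); first by rewrite ler_wpM2r// ltW.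
by rewrite le_eqVlt; apply/orP; left; apply/eqP; ring.
Qed.

Lemma cv2_cst_shift (u_ : nat -> R * R -> R) (x_ : nat -> R) x :
  (forall k, L2S (u_ k)) -> (fun k => nsq (fun z => u_ k z - x_ k)) @ \oo --> (0 : R) ->
  x_ @ \oo --> x -> cvS u_ (cst x).
Proof.
move=> hu h0 hx; split => //; first exact: L2_cst.
apply: (@cvg0_squeeze _ _ (fun k => 2 * nsq (fun z => u_ k z - x_ k) + 2 * ((x_ k - x) ^+ 2 * L)) 1).
- by move=> k; exact: ip_ge0.
- move=> k; rewrite mul1r -ip_cst.
  have l1 : L2S (fun z => u_ k z - x_ k) by apply: (L2B mS (hu k)); exact: (L2_cst mS fS (x_ k)).
  have := ip_sqD mS l1 (L2_cst mS fS (x_ k - x)); congr (_ <= _).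
  by rewrite /ip; apply: eq_Rintegral => z _; rewrite /cst; ring.
have -> : (0 : R) = 2 * 0 + 2 * ((x - x) ^+ 2 * L) by rewrite subrr; ring.
have cc (k : R) : (fun=> k) @ \oo --> k by exact: cvg_cst.
apply: cvgD; first by apply: cvgM; [exact: cc|exact: h0].
apply: cvgM; [exact: cc|apply: cvgM; last exact: cc].
have cx : (fun k => x_ k - x) @ \oo --> x - x by apply: cvgB.
by rewrite expr2; under eq_fun do rewrite expr2; exact: cvgM.
Qed.

Lemma cv2_uniq_cst (u_ : nat -> R * R -> R) x y : cvS u_ (cst x) ->
  (forall k, {ae mu2, forall z, S z -> u_ k z = y}) -> x = y.
Proof.
move=> [hu hx h0] hy.
have E k : nsq (fun z => u_ k z - cst x z) = (y - x) ^+ 2 * L.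
  rewrite -ip_cst; apply: (ip_ae_eq mS); try exact: L2_cst; try by apply: (L2B mS).
  - by apply: aeS (hy k) => z h Sz; rewrite h.
  - by apply: aeS (hy k) => z h Sz; rewrite h.
rewrite (funext E) in h0.
have cc : (fun k : nat => (y - x) ^+ 2 * L) @ \oo --> (y - x) ^+ 2 * L by exact: cvg_cst.
have h : (y - x) ^+ 2 * L = 0 by exact: (cvg_unique (@Rhausdorff R) cc h0).
by move/eqP : h; rewrite mulf_eq0 (gt_eqF hL) orbF sqrf_eq0 subr_eq0 => /eqP ->.
Qed.

(** Orthogonality and unit determinant are polynomial identities in uniformly bounded entries, so
    they survive [L^2] convergence, and for a constant limit they hold exactly. *)
Lemma rotation_limit : exists (t : nat -> nat) (C : 'M[R]_3), [/\ {homo t : m n / (m < n)%N},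
  SO3 C & forall i j, cvS (fun k => Rm (t k) i j) (cst (C i j))].
Proof.
have [t [ht ct]] := @bolzano_weierstrass_seq R _ (enum {: 'I_3 * 'I_3}) (fun ij k => m k ij.1 ij.2) 3 (fun ij k => m_bd k ij.1 ij.2).
pose C : 'M[R]_3 := \matrix_(i, j) limn (fun k => m (t k) i j).
have cm i j : (fun k => m (t k) i j) @ \oo --> C i j.
  by rewrite mxE; apply: (ct (i, j)); rewrite mem_enum.
have cR i j : cvS (fun k => Rm (t k) i j) (cst (C i j)).
  apply: (@cv2_cst_shift _ (fun k => m (t k) i j)) => //.
    by move=> k; have [] := Rm_true (t k) i j.
  exact: (cvg_subseq ht (Rm_mean i j)).
exists t, C; split => //.
have RS k : {ae mu2, forall z, S z -> SO3 (\matrix_(i, j) Rm k i j z)}.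
  apply: aeS (hS k) => z h Sz; have [h1 h2] := h Sz; have [k1 k2] := frame_SO3 hframe (strip_cc Sz).
  have -> : \matrix_(i, j) Rm k i j z = mx3 (a k z) (c k z) (n k z) *m (mx3 (e1 z.1) (e2 z.1) (e3 z.1))^T.
    apply/matrixP => i j; rewrite mxE [RHS]mxE sum3 ![_^T _ j]mxE.
    have [-> -> ->] := mx3E (a k z) (c k z) (n k z) i.
    by have [-> -> ->] := mx3E (e1 z.1) (e2 z.1) (e3 z.1) j.
  split; last by rewrite det_mulmx det_tr h2 k2 mulr1.
  by rewrite trmx_mul trmxK mulmxA -[_ *m _^T *m mx3 (a k z) _ _]mulmxA h1 mulmx1 (mulmx1C k1).
have RR i j i' j' : cvS (fun k z => Rm (t k) i j z * Rm (t k) i' j' z) (cst (C i j * C i' j')).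
  apply: (cv2M_bd mS (K := 3) (K' := `|C i' j'|) (cR i j) (cR i' j')); first by move=> k; exact: Rm_bd.
  by apply: aeW => z _; rewrite lexx.
have G j j' : C 0 j * C 0 j' + C 1 j * C 1 j' + C 2 j * C 2 j' = (j == j')%:R.
  apply: (@cv2_uniq_cst (fun k z => Rm (t k) 0 j z * Rm (t k) 0 j' z + Rm (t k) 1 j z * Rm (t k) 1 j' z + Rm (t k) 2 j z * Rm (t k) 2 j' z)).
    exact: (cv2D mS (cv2D mS (RR 0 j 0 j') (RR 1 j 1 j')) (RR 2 j 2 j')).
  move=> k; apply: aeS (RS (t k)) => z h Sz; have [/matrixP /(_ j j') + _] := h Sz.
  by rewrite !mxE sum3 !mxE.
have T i j i1 j1 i2 j2 i3 j3 i4 j4 : cvS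
    (fun k z => Rm (t k) i j z * (Rm (t k) i1 j1 z * Rm (t k) i2 j2 z - Rm (t k) i3 j3 z * Rm (t k) i4 j4 z))
    (cst (C i j * (C i1 j1 * C i2 j2 - C i3 j3 * C i4 j4))).
  apply: (cv2M_bd mS (K := 3) (K' := `|C i1 j1 * C i2 j2 - C i3 j3 * C i4 j4|) (cR i j)
    (* The determinant is cubic: one bounded converging entry multiplies a two-by-two minor, whose
       constant limit gives the second bound. *)
    (cv2B mS (RR i1 j1 i2 j2) (RR i3 j3 i4 j4))); first by move=> k; exact: Rm_bd.
  by apply: aeW => z _; rewrite lexx.
split.
  by apply/matrixP => j j'; rewrite mxE sum3 ![_^T _ _]mxE G mxE.
rewrite det3; apply: (@cv2_uniq_cst (fun k z => \det (\matrix_(i, j) Rm (t k) i j z))); last first.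
  by move=> k; apply: aeS (RS (t k)) => z h Sz; have [_] := h Sz.
have := cv2D mS (cv2B mS (T 0 0 1 1 2 2 1 2 2 1) (T 0 1 1 0 2 2 1 2 2 0)) (T 0 2 1 0 2 1 1 1 2 0).
congr cv2; apply/funext => k; apply/funext => z.
by rewrite det3 ![(\matrix_(_, _) _) _ _]mxE.
Qed.

Section frame_limit.
Variables (t : nat -> nat) (C : 'M[R]_3).
Hypothesis cR : forall i j, cvS (fun k => Rm (t k) i j) (cst (C i j)).

Lemma cvR_mul i (e : R -> 'cV[R]_3) : bdv L 1 (fun z => e z.1) -> (forall j, L2S (fun z => e z.1 j 0)) ->
  cvS (fun k z => Rm (t k) i 0 z * e z.1 0 0 + Rm (t k) i 1 z * e z.1 1 0 + Rm (t k) i 2 z * e z.1 2 0)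
      (fun z => (C *m e z.1) i 0).
Proof.
move=> be he.
have T j : cvS (fun k z => Rm (t k) i j z * e z.1 j 0) (fun z => C i j * e z.1 j 0).
  apply: (cv2M_bd mS (K := 3) (K' := 1) (cR i j) (cv2_cst mS (he j))); last exact: be.
  by move=> k; exact: Rm_bd.
have := cv2D mS (cv2D mS (T 0) (T 1)) (T 2).
by congr cv2; apply/funext => z; rewrite mulmx_col.
Qed.

(** The frame is recovered as [A = (A E^T) E], since [E] is orthogonal. *)
Lemma frame_limit i : [/\ cvS (fun k z => a (t k) z i 0) (fun z => (C *m e1 z.1) i 0),
  cvS (fun k z => c (t k) z i 0) (fun z => (C *m e2 z.1) i 0) &
  cvS (fun k z => n (t k) z i 0) (fun z => (C *m e3 z.1) i 0)].
Proof.
have [h1 h2 h3] := e_wd; have [b1 b2 b3] := e_bd.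
have G (g : nat -> R * R -> 'cV[R]_3) (e : R -> 'cV[R]_3) : bdv L 1 (fun z => e z.1) ->
    (forall j, L2S (fun z => e z.1 j 0)) -> (forall k, L2S (fun z => g k z i 0)) ->
    (forall k z, S z -> g k z i 0 = Rm k i 0 z * e z.1 0 0 + Rm k i 1 z * e z.1 1 0 + Rm k i 2 z * e z.1 2 0) ->
    cvS (fun k z => g (t k) z i 0) (fun z => (C *m e z.1) i 0).
  move=> be he hg E; have H := cvR_mul i be he; have [_ hl _] := H.
  by apply: (cv2_ae mS H) => // [k|]; apply: aeW => z Sz //; exact: E.
have O z (x y u : R) : S z ->
   [/\ x = (x * e1 z.1 0 0 + y * e2 z.1 0 0 + u * e3 z.1 0 0) * e1 z.1 0 0 +
     (x * e1 z.1 1 0 + y * e2 z.1 1 0 + u * e3 z.1 1 0) * e1 z.1 1 0 +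
     (x * e1 z.1 2 0 + y * e2 z.1 2 0 + u * e3 z.1 2 0) * e1 z.1 2 0,
    y = (x * e1 z.1 0 0 + y * e2 z.1 0 0 + u * e3 z.1 0 0) * e2 z.1 0 0 +
     (x * e1 z.1 1 0 + y * e2 z.1 1 0 + u * e3 z.1 1 0) * e2 z.1 1 0 +
     (x * e1 z.1 2 0 + y * e2 z.1 2 0 + u * e3 z.1 2 0) * e2 z.1 2 0 &
    u = (x * e1 z.1 0 0 + y * e2 z.1 0 0 + u * e3 z.1 0 0) * e3 z.1 0 0 +
     (x * e1 z.1 1 0 + y * e2 z.1 1 0 + u * e3 z.1 1 0) * e3 z.1 1 0 +
     (x * e1 z.1 2 0 + y * e2 z.1 2 0 + u * e3 z.1 2 0) * e3 z.1 2 0].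
  move=> Sz; have [] := mx3_orth_dot (frame_SO3 hframe (strip_cc Sz)).
  move: (e1 z.1) (e2 z.1) (e3 z.1) => v1 v2 v3 q1 q2 q3 [q4 q5 q6].
  rewrite !dot3 in q1 q2 q3 q4 q5 q6.
  split.
  (* The orthonormality relations are inserted as factors 1 and 0 on the left, after which the
     identity is polynomial. *)
  - rewrite -[LHS](addr0 x) -[X in x + X](mulr0 u) -q5 -[X in X + _]addr0 -[X in (x + X) + _](mulr0 y) -q4 -[X in X + _ + _]mulr1 -q1; ring.
  - rewrite -[LHS](addr0 y) -[X in y + X](mulr0 u) -q6 -[X in X + _]addr0 -[X in (y + X) + _](mulr0 x) -q4 -[X in X + _ + _]mulr1 -q2; ring.
  - rewrite -[LHS](addr0 u) -[X in u + X](mulr0 x) -q5 -[X in X + _]addr0 -[X in (u + X) + _](mulr0 y) -q6 -[X in X + _ + _]mulr1 -q3; ring.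
have l1 k := wta k i; have l2 k := wtc k i; have l3 k := wtn k i.
split; apply: G => [|j|k|k z Sz].
- exact: b1.
- by have [] := h1 j.
- by have [] := l1 k.
- by rewrite /Rm; have [E _ _] := O z (a k z i 0) (c k z i 0) (n k z i 0) Sz.
- exact: b2.
- by have [] := h2 j.
- by have [] := l2 k.
- by rewrite /Rm; have [_ E _] := O z (a k z i 0) (c k z i 0) (n k z i 0) Sz.
- exact: b3.
- by have [] := h3 j.
- by have [] := l3 k.
- by rewrite /Rm; have [_ _ E] := O z (a k z i 0) (c k z i 0) (n k z i 0) Sz.
Qed.
End frame_limit.

End limit.

(** * The determinant constraint *)

Section blowup.
Context {R : realType}.
Variable L : R.
Hypothesis hL : 0 < L.
Local Notation mu := (@lebesgue_measure R).
Local Notation mu2 := (@lebesgue2 R).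
Local Notation S := (strip L).
Local Notation L2S := (L2 mu2 S).
Local Notation cvS := (cv2 mu2 S).
Let mS := @measurable_strip R L.
Let fS := strip_fin hL.

(** The test function depends on one variable and so is not compactly supported in the strip; only a
    derivative along that variable occurs, hence no boundary term arises. *)
Lemma wd_test b u v (f : R -> R) : wd L b u v -> test_fun (`]dlo b, dhi L b[ : set R) f ->
  \int[mu2]_(z in S) (u z * 'D_1 f (along b z)) = - \int[mu2]_(z in S) (v z * f (along b z)).
Proof.
move=> [hu hv p] tf.
have [dF cD F0 F1] := test_C1 tf; have [sf _ _] := tf.
have sD : smooth setT ('D_1 f : R -> R) by have [] := test_fun_derive tf.
have iu := L2S_int hL hu; have iv := L2S_int hL hv.
have i1 := bd_integrable hL iu (fun z => along_comp b sD 0%N z I).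
have i2 := bd_integrable hL iv (fun z => along_comp b sf 0%N z I).
rewrite -(fubini_strip b i1) -(fubini_strip b i2) -mulN1r -RintZ; last 2 first.
- exact: measurable_itvoo.
- exact: (outer_integrable b i2).
have i3 := integrableZl (measurable_itvoo _ _) (-1) (outer_integrable b i2).
apply: (Rint_ae_eq (measurable_itvoo _ _)).
- exact: integrable_meas1 (outer_integrable b i1).
- exact: integrable_meas1 i3.
rewrite /pd in p; apply: aeS2 p (slice_L2 hL b hu) => t h2 h1 dt.
move: (h2 dt) (h1 dt) => {}h2 {}h1.
have E s : along b (pt b s t) = s by case: (b).
rewrite mulN1r; under eq_Rintegral do rewrite E.
under [in RHS]eq_Rintegral do rewrite E.
apply: (prim_test (dlohi hL b) h2 _ dF cD F0 F1).
by have [] := h1.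
Qed.

Lemma wd_snd : wd L false (fun z => z.2) (cst 1) /\ wd L true (fun z => z.2) (cst 0).
Proof.
split; last exact: (wd_transv hL (b := true) (f := id) (L2_snd hL)).
apply: (wd_along hL (b := false) (f := id) (df := cst 1)).
- by apply: continuous_subspaceT => x; exact: cvg_id.
- by apply: continuous_subspaceT => x; exact: cvg_cst.
- exact: (L2_snd hL).
- exact: L2_cst.
Qed.

Lemma prim_itv (F f : R -> R) b : (forall x, is_derive x (1 : R) F (f x)) -> continuous f ->
  \int[mu]_(s in dom L b) f s = F (dhi L b) - F (dlo b).
Proof.
move=> dF cf; have lh := dlohi hL b.
have cF : continuous F by move=> x; apply/differentiable_continuous/derivable1_diffP; case: (dF x).
have [_ h] := prim_C1 lh (continuous_subspaceT cF) (continuous_subspaceT cf) (fun x _ => dF x).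
by rewrite (h (dhi L b)) ?lexx ?(ltW lh)// addrAC subrr add0r.
Qed.

Lemma integral_id : \int[mu]_(s in dom L false) s = 0.
Proof.
have d (x : R) : is_derive x (1 : R) (fun x : R => x ^+ 2 / 2) x.
  by apply: is_derive_eq; rewrite /GRing.scale/=; field.
rewrite (prim_itv false d) /=; last by move=> x; exact: cvg_id.
by rewrite sqrrN subrr.
Qed.

Lemma integral_sqr : \int[mu]_(s in dom L false) s ^+ 2 = 12^-1.
Proof.
have d (x : R) : is_derive x (1 : R) (fun x : R => x ^+ 3 / 3) (x ^+ 2).
  by apply: is_derive_eq; rewrite /GRing.scale/=; field.
rewrite (prim_itv false d) /=; last by move=> x; exact: exprn_continuous.
by field.
Qed.

Lemma integrable_id : mu.-integrable (dom L false) (EFin \o (@id R)).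
Proof.
apply: (L2_integrable (measurable_itvoo _ _) (itvoo_fin _ _)).
apply: (L2_bd (measurable_itvoo _ _) (itvoo_fin _ _) (K := 2^-1)) => //.
by apply: aeW => x; rewrite /dom itvooE ler_norml => /andP[h1 h2]; rewrite !ltW.
Qed.

Lemma odd_integral (h : R -> R) : mu2.-integrable S (EFin \o (fun z => z.2 * h z.1)) ->
  \int[mu2]_(z in S) (z.2 * h z.1) = 0.
Proof.
move=> ih; rewrite -(fubini_strip false ih).
under eq_Rintegral => t _ do under eq_Rintegral => s _ do rewrite mulrC.
under eq_Rintegral => t _ do rewrite (RintZ (h t) (measurable_itvoo _ _) integrable_id) integral_id mulr0.
by rewrite Rintegral_cst ?mul0r//; exact: measurable_itvoo.
Qed.

Lemma sqr_integral (h : R -> R) : mu2.-integrable S (EFin \o (fun z => z.2 ^+ 2 * h z.1)) ->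
  mu.-integrable (itvoo 0 L) (EFin \o h) ->
  \int[mu2]_(z in S) (z.2 ^+ 2 * h z.1) = 12^-1 * \int[mu]_(t in itvoo 0 L) h t.
Proof.
move=> ih ihh; rewrite -(fubini_strip false ih).
have idi : mu.-integrable (dom L false) (EFin \o (fun x : R => x ^+ 2)).
  apply: (L2_integrable (measurable_itvoo _ _) (itvoo_fin _ _)).
  apply: (L2_bd (measurable_itvoo _ _) (itvoo_fin _ _) (K := 2^-1 ^+ 2)) => //.
  apply: aeW => x; rewrite /dom itvooE => /andP[h1 h2]; rewrite normrX lerXn2r ?nnegrE ?invr_ge0//.
  by rewrite ler_norml !ltW.
under eq_Rintegral => t _ do under eq_Rintegral => s _ do rewrite mulrC.
under eq_Rintegral => t _ do rewrite (RintZ (h t) (measurable_itvoo _ _) idi) integral_sqr mulrC.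
by rewrite RintZ//; exact: measurable_itvoo.
Qed.

Lemma avg_fst (g : R -> R) : avg L false (fun z => g z.1) = (fun z => g z.1).
Proof.
apply/funext => z; rewrite /avg /= Rint_dom_cst// len_false invr1 mul1r.
by rewrite mulr1.
Qed.

Lemma avg_odd (g : R -> R) z : avg L false (fun z => z.2 * g z.1) z = 0.
Proof.
rewrite /avg /=; under eq_Rintegral => s _ do rewrite mulrC.
by rewrite (RintZ (g z.1) (measurable_itvoo _ _) integrable_id) integral_id !mulr0.
Qed.

Lemma avgZ b k u : L2S u -> {ae mu2, forall z, S z -> avg L b (fun z => k * u z) z = k * avg L b u z}.
Proof.
move=> hu; have h := slice_integrable b (L2S_int hL hu).
have h' : {ae mu, forall t, dom L (~~ b) t ->
  \int[mu]_(s in dom L b) (k * u (pt b s t)) = k * \int[mu]_(s in dom L b) u (pt b s t)}.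
  by apply: aeS h => t h dt; rewrite RintZ//; [exact: measurable_itvoo|exact: h].
by apply: aeS (ae_dom h') => z hz Sz; rewrite /avg hz// mulrCA.
Qed.

Lemma avg_bd b K u : L2S u -> aebd mu2 S K u -> aebd mu2 S K (avg L b u).
Proof.
move=> hu bu; have h := slice_integrable b (L2S_int hL hu).
have h' : {ae mu, forall t, dom L (~~ b) t -> `|\int[mu]_(s in dom L b) u (pt b s t)| <= K * len L b}.
  apply: aeS2 h (ae_slice b bu) => t h1 h2 dt; move: (h1 dt) (h2 dt) => {}h1 {}h2.
  apply: (le_trans (le_normr_Rintegral (measurable_itvoo _ _) h1)).
  rewrite -(Rint_dom_cst hL b K).
  apply: (Rint_ae_le (measurable_itvoo _ _)) => //; first exact: (integrable_norm h1).
  exact: dom_cst_integrable.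
have l0 := len_gt0 hL b.
by apply: aeS (ae_dom h') => z hz Sz; rewrite /avg normrM gtr0_norm ?invr_gt0// mulrC ler_pdivrMr// hz.
Qed.

Lemma cv2_avg b (u_ : nat -> R * R -> R) u : cvS u_ u -> cvS (fun k => avg L b (u_ k)) (avg L b u).
Proof.
move=> [hu_ hu cu]; split.
- by move=> k; have [] := avg_L2 hL b (hu_ k).
- by have [] := avg_L2 hL b hu.
apply: (cvg0_squeeze (K := 1) (b := _) _ _ cu) => k; first exact: ip_ge0.
rewrite mul1r; have [h1 h2] := avg_L2 hL b (L2B mS (hu_ k) hu).
apply: le_trans h2.
have h3 : L2S (fun z => avg L b (u_ k) z - avg L b u z).
  by apply: (L2B mS); [have [] := avg_L2 hL b (hu_ k)|have [] := avg_L2 hL b hu].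
have e : {ae mu2, forall z, S z -> avg L b (u_ k) z - avg L b u z = avg L b (fun z => u_ k z - u z) z}.
  by apply: aeS (avgB hL b (hu_ k) hu) => z h Sz; rewrite h.
by rewrite le_eqVlt; apply/orP; left; apply/eqP; apply: (ip_ae_eq mS).
Qed.

(* The transversal oscillation of a map with small transversal derivative [w rho]
   is [w x2 g] to first order. *)
Lemma blowup (w_ : nat -> R) (u_ rho_ : nat -> R * R -> R) (g : R -> R) :
  (forall k, 0 < w_ k) -> (forall k, wd L false (u_ k) (fun z => w_ k * rho_ k z)) ->
  (exists M, aebd mu2 S M (fun z => g z.1)) ->
  cvS rho_ (fun z => g z.1) ->
  cvS (fun k z => (w_ k)^-1 * (u_ k z - avg L false (u_ k) z)) (fun z => z.2 * g z.1).
Proof.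
move=> hw hu [M bg] [hr hg cr].
have b2 : aebd mu2 S 2^-1 (fun z : R * R => z.2) by apply: aeW => z /strip_in[].
(* The candidate limit has transversal derivative [g] and mean zero on each vertical segment, so
   subtracting it does not affect the average and the slice inequality applies to
   [u / w - x_2 g]. *)
have wg : wd L false (fun z => z.2 * g z.1) (fun z => g z.1).
  have := wdM hL wd_snd.1 (wd_transv hL (b := false) (f := g) hg) b2 bg.
  by congr wd; apply/funext => z; rewrite /cst /= mul1r mulr0 addr0.
have [hzg _ _] := wg.
have wy k : wd L false (fun z => (w_ k)^-1 * u_ k z - z.2 * g z.1) (fun z => rho_ k z - g z.1).
  have := wdB (wdZ (w_ k)^-1 (hu k)) wg.
  by congr wd; apply/funext => z; rewrite mulKf// gt_eqF.
have hu_ k : L2S (u_ k) by have [] := hu k.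
have hv k : L2S (fun z => (w_ k)^-1 * (u_ k z - avg L false (u_ k) z)).
  by apply: (L2Z mS); apply: (L2B mS) => //; have [] := avg_L2 hL false (hu_ k).
split => //.
apply: (cvg0_squeeze (K := 4) (b := _) _ _ cr) => k; first exact: ip_ge0.
have := poincare_slice hL (wy k); rewrite len_false expr1n mulr1; apply: le_trans.
have [hy _ _] := wy k.
rewrite le_eqVlt; apply/orP; left; apply/eqP; apply: (ip_ae_eq mS).
1,2: exact: (L2B mS).
1,2: by apply: (L2B mS) => //; have [] := avg_L2 hL false hy.
all: apply: aeS2 (avgB hL false (L2Z mS (w_ k)^-1 (hu_ k)) hzg) (avgZ false (w_ k)^-1 (hu_ k)) => z e1 e2 Sz.
all: by rewrite (e1 Sz) (e2 Sz) avg_odd; ring.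
Qed.

(** Near a point where [g] is nonzero, one-sidedly at an endpoint, the exceptional set would contain
    an interval of positive length. *)
Lemma cont_ae0 (g : R -> R) : {within `[0, L], continuous g} ->
  {ae mu, forall t, itvoo 0 L t -> g t = 0} -> forall t : R, 0 <= t <= L -> g t = 0.
Proof.
move=> cg [N [mN N0 hN]] t ht; apply/eqP/negPn/negP => gt0.
have tI : `[0, L]%classic t by rewrite /= in_itv.
have e0 : 0 < `|g t| by rewrite normr_gt0.
have := (subspace_continuousP _ _).1 cg t tI.
move/cvgrPdist_lt => /(_ _ e0); rewrite /within /= => /nbhs_ballP[d /= d0 hd].
pose A := Num.max 0 (t - d); pose B := Num.min L (t + d).
have AB : A < B.
  by case/andP : ht => h1 h2; rewrite /A /B gt_max !lt_min; move: (hL) (d0) h1 h2; clear; move=> *; apply/andP; split; apply/andP; split; lra.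
have sub : itvoo A B `<=` N.
  move=> x; rewrite itvooE gt_max lt_min => /andP[/andP[x0 x1] /andP[x2 x3]].
  apply: hN => /= h; have {h}h := h _; have xI : itvoo 0 L x by rewrite itvooE x0.
  have := hd x; rewrite /ball /= ltr_norml => H.
  have : `|g t - g x| < `|g t|.
    by apply: H; [apply/andP; split; lra|rewrite in_itv/= !ltW].
  by rewrite h// subr0 ltxx.
have : (mu (itvoo A B) <= mu N)%E by apply: (le_measure mu) => //; rewrite inE; first exact: (measurable_itvoo A B).
rewrite N0 /itvoo lebesgue_measure_itv/= lte_fin AB -EFinB lee_fin subr_le0 leNgt.
by rewrite AB.
Qed.

Lemma Rint_sumB (u v x y : 'I_3 -> R * R -> R) :
  (forall i, [/\ L2S (u i), L2S (v i), L2S (x i) & L2S (y i)]) ->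
  \sum_i (ip mu2 S (u i) (v i) - ip mu2 S (x i) (y i)) =
  \int[mu2]_(z in S) \sum_i (u i z * v i z - x i z * y i z).
Proof.
move=> h; have I i : mu2.-integrable S (EFin \o (fun z => u i z * v i z - x i z * y i z)).
  have [h1 h2 h3 h4] := h i.
  by have := integrableB mS (L2M_integrable mS h1 h2) (L2M_integrable mS h3 h4); exact: eq_integrable.
have J i : ip mu2 S (u i) (v i) - ip mu2 S (x i) (y i) = \int[mu2]_(z in S) (u i z * v i z - x i z * y i z).
  have [h1 h2 h3 h4] := h i.
  by rewrite RintegralB//; apply: L2M_integrable.
under [RHS]eq_Rintegral do rewrite sum3.
rewrite sum3 RintegralD//; last first.
  by have := integrableD mS (I 0) (I 1); exact: eq_integrable.
by rewrite RintegralD// !J.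
Qed.

End blowup.

(** * Passage to the limit in the determinant constraint *)

Section det.
Context {R : realType}.
Variables (L : R) (kappa P Q D : R -> R) (d1 d2 d3 : R -> 'cV[R]_3).
Hypothesis hL : 0 < L.
Local Notation mu := (@lebesgue_measure R).
Local Notation mu2 := (@lebesgue2 R).
Local Notation S := (strip L).
Local Notation L2S := (L2 mu2 S).
Local Notation cvS := (cv2 mu2 S).
Local Notation bdS := (aebd mu2 S).
Let mS := @measurable_strip R L.
Let fS := strip_fin hL.
Hypothesis ck : {within `[0, L], continuous kappa}.
Hypothesis cP : {within `[0, L], continuous P}.
Hypothesis cQ : {within `[0, L], continuous Q}.
Hypothesis cD : {within `[0, L], continuous D}.
Hypothesis hd : forall t, 0 <= t <= L -> SO3 (mx3 (d1 t) (d2 t) (d3 t)).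
Variable w_ : nat -> R.
Variables a c n : nat -> R * R -> 'cV[R]_3.
Variables p q r s : nat -> R * R -> R.
Hypothesis w0 : forall k, 0 < w_ k.
Hypothesis hS : forall k, {ae mu2, forall z, S z -> SO3 (mx3 (a k z) (c k z) (n k z))}.
Hypothesis wta : forall k, wdv L true (a k) (fun z => kappa z.1 *: c k z + p k z *: n k z).
Hypothesis wtc : forall k, wdv L true (c k) (fun z => - kappa z.1 *: a k z + q k z *: n k z).
Hypothesis wfa : forall k, wdv L false (a k) (fun z => (w_ k * r k z) *: n k z).
Hypothesis wfc : forall k, wdv L false (c k) (fun z => (w_ k * s k z) *: n k z).
Hypothesis cp : cvS p (fun z => P z.1).
Hypothesis cq : cvS q (fun z => Q z.1).
Hypothesis cr : cvS r (fun z => Q z.1).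
Hypothesis cs : cvS s (fun z => D z.1).
Hypothesis ca : forall i, cvS (fun k z => a k z i 0) (fun z => d1 z.1 i 0).
Hypothesis cc : forall i, cvS (fun k z => c k z i 0) (fun z => d2 z.1 i 0).
Hypothesis cn : forall i, cvS (fun k z => n k z i 0) (fun z => d3 z.1 i 0).

Let d_bd : [/\ bdv L 1 (fun z => d1 z.1), bdv L 1 (fun z => d2 z.1) & bdv L 1 (fun z => d3 z.1)].
Proof. by apply: bdv_SO3; apply: aeW => z /strip_in[/andP[z0 z1] _]; apply: hd; rewrite !ltW. Qed.

Let acn k : [/\ bdv L 1 (a k), bdv L 1 (c k) & bdv L 1 (n k)].
Proof. exact: bdv_SO3 (hS k). Qed.

Let da k i z := kappa z.1 * c k z i 0 + p k z * n k z i 0.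
Let dc k i z := - kappa z.1 * a k z i 0 + q k z * n k z i 0.
(** Transversal oscillations of the first and second frame vectors, blown up to order one; their
    limits see [II^0_12] and [II^0_22]. *)
Let v k i z := (w_ k)^-1 * (a k z i 0 - avg L false (fun z => a k z i 0) z).
Let vc k i z := (w_ k)^-1 * (c k z i 0 - avg L false (fun z => c k z i 0) z).

Let wda k i : wd L true (fun z => a k z i 0) (da k i).
Proof. by have := wta k i; congr wd; apply/funext => z; rewrite !mxE. Qed.
Let wdc k i : wd L true (fun z => c k z i 0) (dc k i).
Proof. by have := wtc k i; congr wd; apply/funext => z; rewrite !mxE. Qed.

Let cda i : cvS (fun k => da k i) (fun z => kappa z.1 * d2 z.1 i 0 + P z.1 * d3 z.1 i 0).
Proof.
have [M [k1 k2]] := cont_bd hL ck; have [MP [p1 p2]] := cont_bd hL cP; have [b1 b2 b3] := d_bd.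
apply: (cv2D mS); first exact: (cv2M_bd mS (cv2_cst mS k1) (cc i) (fun=> k2) (b2 i)).
have nb k : bdS 1 (fun z => n k z i 0) by have [_ _] := acn k; exact.
have := cv2M_bd mS (cn i) cp nb p2.
by congr cv2; [apply/funext => k|]; apply/funext => z; rewrite mulrC.
Qed.

Let cdc i : cvS (fun k => dc k i) (fun z => - kappa z.1 * d1 z.1 i 0 + Q z.1 * d3 z.1 i 0).
Proof.
have [M [k1 k2]] := cont_bd hL ck; have [MP [p1 p2]] := cont_bd hL cQ; have [b1 b2 b3] := d_bd.
apply: (cv2D mS).
  have := cv2N mS (cv2M_bd mS (cv2_cst mS k1) (ca i) (fun=> k2) (b1 i)).
  by congr cv2; [apply/funext => k|]; apply/funext => z; rewrite mulNr.
have nb k : bdS 1 (fun z => n k z i 0) by have [_ _] := acn k; exact.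
have := cv2M_bd mS (cn i) cq nb p2.
by congr cv2; [apply/funext => k|]; apply/funext => z; rewrite mulrC.
Qed.

Let cv_blow (u_ rho_ : nat -> R * R -> R) (g : R -> R) i :
  {within `[0, L], continuous g} -> cvS rho_ (fun z => g z.1) ->
  (forall k, wd L false (u_ k) (fun z => (w_ k * rho_ k z) * n k z i 0)) ->
  cvS (fun k z => (w_ k)^-1 * (u_ k z - avg L false (u_ k) z)) (fun z => z.2 * (g z.1 * d3 z.1 i 0)).
Proof.
move=> cg crho hu; have [M [g1 g2]] := cont_bd hL cg; have [b1 b2 b3] := d_bd.
have nb k : bdS 1 (fun z => n k z i 0) by have [_ _] := acn k; exact.
apply: (blowup hL (rho_ := fun k z => rho_ k z * n k z i 0) (g := fun t => g t * d3 t i 0) w0).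
- by move=> k; have := hu k; congr wd; apply/funext => z; rewrite mulrA.
- by exists (M * 1); apply: aebdM => //; exact: b3.
have := cv2M_bd mS (cn i) crho nb g2.
by congr cv2; [apply/funext => k|]; apply/funext => z; rewrite mulrC.
Qed.

Let cv_v i : cvS (fun k => v k i) (fun z => z.2 * (Q z.1 * d3 z.1 i 0)).
Proof.
apply: (cv_blow cQ cr) => k.
by have := wfa k i; congr wd; apply/funext => z; rewrite !mxE.
Qed.

Let cv_vc i : cvS (fun k => vc k i) (fun z => z.2 * (D z.1 * d3 z.1 i 0)).
Proof.
apply: (cv_blow cD cs) => k.
by have := wfc k i; congr wd; apply/funext => z; rewrite !mxE.
Qed.

Section test.
Variable eta : R -> R.
Hypothesis te : test_fun (`]dlo true, dhi L true[ : set R) eta.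

(** [X] is the [x_1]-derivative of [x_2 eta c^], with [c^] the vertical average of [c]. [Z] comes
    from writing [c^ = c - (c - c^)] against [d_1 a]: the part with [c] gives [kappa], and the
    remainder absorbs the factor [1/w]. *)
Let X k i z := z.2 * 'D_1 eta z.1 * avg L false (fun z => c k z i 0) z + z.2 * eta z.1 * avg L false (dc k i) z.
Let Z k i z := z.2 * eta z.1 * vc k i z.

Let eta_bd (f : R -> R) : smooth setT f -> exists K, L2S (fun z => z.2 * f z.1) /\ bdS K (fun z => z.2 * f z.1).
Proof.
move=> sf; have cf : continuous (fun z : R * R => z.2 * f z.1).
  move=> z; apply: cvgM; first exact: cvg_snd.
  exact: (along_comp true sf 0%N z I).
have [K hK] := continuous_bounded_strip hL cf.
exists K; split; last exact: aeW.
by apply: (L2_bd mS fS (K := K)); [exact: (measurable_funTS (continuous_measurable2 cf))|exact: aeW].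
Qed.

Let se : smooth setT eta. Proof. by have [] := te. Qed.
Let sDe : smooth setT ('D_1 eta : R -> R). Proof. by have [] := test_fun_derive te. Qed.

Let cvX i : cvS (fun k => X k i) (fun z => z.2 * 'D_1 eta z.1 * d2 z.1 i 0 +
  z.2 * eta z.1 * (- kappa z.1 * d1 z.1 i 0 + Q z.1 * d3 z.1 i 0)).
Proof.
have [K [h1 h2]] := eta_bd sDe; have [K' [h1' h2']] := eta_bd se; have [b1 b2 b3] := d_bd.
have [M [k1 k2]] := cont_bd hL ck; have [MQ [q1 q2]] := cont_bd hL cQ.
have bnk : bdS M (fun z => - kappa z.1) by apply: aeS k2 => z; rewrite normrN.
have e1 := cv2_avg hL false (cc i); rewrite (avg_fst hL (fun t => d2 t i 0)) in e1.
have e2 := cv2_avg hL false (cdc i).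
rewrite (avg_fst hL (fun t => - kappa t * d1 t i 0 + Q t * d3 t i 0)) in e2.
apply: (cv2D mS); first exact: (cv2M_bd mS (cv2_cst mS h1) e1 (fun=> h2) (b2 i)).
apply: (cv2M_bd mS (cv2_cst mS h1') e2 (fun=> h2')).
by apply: aebdD; apply: aebdM; [exact: bnk|exact: b1|exact: q2|exact: b3].
Qed.

Let cvZ i : cvS (fun k => Z k i) (fun z => z.2 * eta z.1 * (z.2 * (D z.1 * d3 z.1 i 0))).
Proof.
have [K' [h1' h2']] := eta_bd se; have [b1 b2 b3] := d_bd; have [MQ [q1 q2]] := cont_bd hL cD.
apply: (cv2M_bd mS (cv2_cst mS h1') (cv_vc i) (fun=> h2')).
apply: aebdM; first by apply: aeW => z /strip_in[_]; exact.
by apply: aebdM; [exact: q2|exact: b3].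
Qed.

(* Testing [avg c . v] against [x2 eta'(x1)]: [c . da = kappa] and the averages do
   not depend on [x2], so both are orthogonal to [x2]. *)
Let parts k : \sum_i (ip mu2 S (X k i) (v k i) - ip mu2 S (Z k i) (da k i)) = 0.
Proof.
have [ba bc bn] := acn k.
have cX i : L2S (X k i) by have [] := cvX i.
have cZ i : L2S (Z k i) by have [] := cvZ i.
have cV i : L2S (v k i) by have [] := cv_v i.
have cA i : L2S (da k i) by have [] := cda i.
rewrite Rint_sumB//.
have wac i := wd_avg hL (wdc k i); have waa i := wd_avg hL (wda k i).
have wv i : wd L true (v k i) (fun z => (w_ k)^-1 * (da k i z - avg L false (da k i) z)).
  exact: (wdZ (w_ k)^-1 (wdB (wda k i) (waa i))).
have la i : L2S (fun z => a k z i 0) by have [] := wda k i.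
have lc i : L2S (fun z => c k z i 0) by have [] := wdc k i.
have bac i : bdS 1 (avg L false (fun z => c k z i 0)) by exact: (avg_bd hL false (lc i) (bc i)).
have baa i : bdS 1 (avg L false (fun z => a k z i 0)) by exact: (avg_bd hL false (la i) (ba i)).
have bv i : bdS ((w_ k)^-1 * (1 + 1)) (v k i).
  have wi : 0 <= (w_ k)^-1 by rewrite invr_ge0 ltW.
  apply: aeS2 (ba i) (baa i) => z h1 h2 Sz; rewrite normrM ger0_norm// ler_wpM2l//.
  by rewrite (le_trans (ler_normB _ _))// lerD ?h1 ?h2.
have wh i := wdM hL (wac i) (wv i) (bac i) (bv i).
have bh i := aebdM (bac i) (bv i).
have b2 : bdS 2^-1 (fun z => z.2) by apply: aeW => z /strip_in[].
pose cb i z := avg L false (fun z => c k z i 0) z.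
pose dcb i z := avg L false (dc k i) z.
pose dab i z := avg L false (da k i) z.
pose h z := z.2 * (cb 0 z * v k 0 z + cb 1 z * v k 1 z + cb 2 z * v k 2 z).
pose h' z := z.2 * ((dcb 0 z * v k 0 z + cb 0 z * ((w_ k)^-1 * (da k 0 z - dab 0 z))) +
  (dcb 1 z * v k 1 z + cb 1 z * ((w_ k)^-1 * (da k 1 z - dab 1 z))) +
  (dcb 2 z * v k 2 z + cb 2 z * ((w_ k)^-1 * (da k 2 z - dab 2 z)))).
have WH : wd L true h h'.
  have := wdM hL (wd_snd hL).2 (wdD (wdD (wh 0) (wh 1)) (wh 2)) b2 (aebdD (aebdD (bh 0) (bh 1)) (bh 2)).
  by congr wd; apply/funext => z; rewrite /cst mul0r add0r.
have T := wd_test hL WH te.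
pose Y (i : 'I_3) z := avg L false (fun z => c k z i 0) z * avg L false (da k i) z.
(* The terms with an isolated [1/w], which depend on [x_1] alone: [kappa] and the product of the
   averages. Multiplied by [x_2] they integrate to zero, whatever their size. *)
pose H t := eta t * ((w_ k)^-1 * (kappa t - (Y 0 (t, 0) + Y 1 (t, 0) + Y 2 (t, 0)))).
have [M [k1 k2]] := cont_bd hL ck.
have LY i : L2S (Y i).
  apply: (L2M_bd mS _ (bac i)); first by have [/L2_meas] := wac i.
  by have [] := waa i.
have iH : mu2.-integrable S (EFin \o (fun z => z.2 * H z.1)).
  have [K [h1 h2]] := eta_bd se.
  have h3 : L2S (fun z => (w_ k)^-1 * (kappa z.1 - (Y 0 z + Y 1 z + Y 2 z))).
    by apply: (L2Z mS); apply: (L2B mS k1); apply: (L2D mS); [apply: (L2D mS)|].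
  have := L2M_integrable mS h1 h3; apply: eq_integrable => // z _ /=.
  by rewrite /H mulrA.
have OH := odd_integral hL iH.
have [hh hh' _] := WH.
have i1 := bd_integrable hL (L2S_int hL hh) (fun z => along_comp true sDe 0%N z I).
have i2 := bd_integrable hL (L2S_int hL hh') (fun z => along_comp true se 0%N z I).
have i12 : mu2.-integrable S _ := integrableD mS i1 i2.
have key : {ae mu2, forall z, S z -> dot (c k z) (kappa z.1 *: c k z + p k z *: n k z) = kappa z.1}.
  apply: aeS (hS k) => z hz Sz; have [_ q2 _ [_ _ q6]] := mx3_orth_dot (hz Sz).
  by rewrite dotDr !dotZr q2 q6 mulr0 addr0 mulr1.
have IB : \int[mu2]_(z in S) (h z * 'D_1 eta z.1 + h' z * eta z.1 - z.2 * H z.1) = 0.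
  by rewrite RintegralB// RintegralD// OH subr0; apply/eqP; rewrite addr_eq0; exact/eqP.
apply: (etrans _ IB); apply: (Rint_ae_eq mS).
- have iz i := L2M_integrable mS (cX i) (cV i); have iz' i := L2M_integrable mS (cZ i) (cA i).
  have I i := integrableB mS (iz i) (iz' i).
  under eq_fun do rewrite sum3.
  have := integrableD mS (integrableD mS (I 0) (I 1)) (I 2).
  exact: integrable_meas.
- have := integrableB mS i12 iH; exact: integrable_meas.
apply: aeS key => z kz Sz; have {kz} := kz Sz; rewrite dot3 !mxE => kz.
have HE : H z.1 = eta z.1 * ((w_ k)^-1 * (kappa z.1 - (cb 0 z * dab 0 z + cb 1 z * dab 1 z + cb 2 z * dab 2 z))) by [].
have XE i : X k i z = z.2 * 'D_1 eta z.1 * cb i z + z.2 * eta z.1 * dcb i z by [].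
have ZE i : Z k i z = z.2 * eta z.1 * ((w_ k)^-1 * (c k z i 0 - cb i z)) by [].
have {}kz : c k z 0 0 * da k 0 z + c k z 1 0 * da k 1 z + c k z 2 0 * da k 2 z = kappa z.1 by [].
(* Once [kappa] is written as [c.d_1 a], the two integrands agree identically:
   [c^.d_1 a - kappa = -(c - c^).d_1 a]. *)
rewrite sum3 HE !XE !ZE -kz /h /h'; ring.
Qed.

(** Each pairing in [parts] joins two strongly convergent sequences, so the identity passes to the
    limit. There [X.v] contributes [Q^2] and [Z.da] contributes [P D]. *)
Let test_eq0 : \int[mu2]_(z in S) (z.2 ^+ 2 * ((Q z.1 ^+ 2 - P z.1 * D z.1) * eta z.1)) = 0.
Proof.
pose XX i (z : R * R) := z.2 * 'D_1 eta z.1 * d2 z.1 i 0 +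
  z.2 * eta z.1 * (- kappa z.1 * d1 z.1 i 0 + Q z.1 * d3 z.1 i 0).
pose VV i (z : R * R) := z.2 * (Q z.1 * d3 z.1 i 0).
pose ZZ i (z : R * R) := z.2 * eta z.1 * (z.2 * (D z.1 * d3 z.1 i 0)).
pose AA i (z : R * R) := kappa z.1 * d2 z.1 i 0 + P z.1 * d3 z.1 i 0.
have cvi i : (fun k => ip mu2 S (X k i) (v k i) - ip mu2 S (Z k i) (da k i)) @ \oo -->
    ip mu2 S (XX i) (VV i) - ip mu2 S (ZZ i) (AA i).
  apply: cvgB; first exact: (cv2_ip mS (cvX i) (cv_v i)).
  exact: (cv2_ip mS (cvZ i) (cda i)).
have lim0 : \sum_i (ip mu2 S (XX i) (VV i) - ip mu2 S (ZZ i) (AA i)) = 0.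
  rewrite sum3.
  have cs3 : (fun k : nat => 0 : R) @ \oo --> (ip mu2 S (XX 0) (VV 0) - ip mu2 S (ZZ 0) (AA 0)) +
     (ip mu2 S (XX 1) (VV 1) - ip mu2 S (ZZ 1) (AA 1)) + (ip mu2 S (XX 2) (VV 2) - ip mu2 S (ZZ 2) (AA 2)).
    rewrite -(_ : (fun k => (ip mu2 S (X k 0) (v k 0) - ip mu2 S (Z k 0) (da k 0)) +
     (ip mu2 S (X k 1) (v k 1) - ip mu2 S (Z k 1) (da k 1)) + (ip mu2 S (X k 2) (v k 2) - ip mu2 S (Z k 2) (da k 2))) = (fun=> 0)).
      by apply: cvgD; [apply: cvgD|]; exact: cvi.
    by apply/funext => k; rewrite -(parts k) sum3.
  exact: (cvg_unique (@Rhausdorff R) cs3 (cvg_cst _)).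
rewrite -lim0 Rint_sumB//; last first.
  by move=> i; split; [have [] := cvX i|have [] := cv_v i|have [] := cvZ i|have [] := cda i].
apply: eq_Rintegral => z; rewrite inE => /strip_in[/andP[z0 z1] _].
have z01 : 0 <= z.1 <= L by rewrite !ltW.
have [_ _ q3 [_ q5 q6]] := mx3_orth_dot (hd z01).
rewrite sum3 /XX /VV /ZZ /AA.
(* Orthonormality of the limit frame removes every product except that of [d3] with itself, so
   [eta'] and [kappa] disappear. *)
transitivity (z.2 ^+ 2 * (Q z.1 * 'D_1 eta z.1 * dot (d2 z.1) (d3 z.1) +
  eta z.1 * Q z.1 * (- kappa z.1 * dot (d1 z.1) (d3 z.1) + Q z.1 * dot (d3 z.1) (d3 z.1)) -
  eta z.1 * D z.1 * (kappa z.1 * dot (d2 z.1) (d3 z.1) + P z.1 * dot (d3 z.1) (d3 z.1)))).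
  by rewrite q3 q5 q6; ring.
by rewrite !dot3; ring.
Qed.

Lemma blowup_test : \int[mu]_(t in itvoo 0 L) ((Q t ^+ 2 - P t * D t) * eta t) = 0.
Proof.
have cG : {within `[0, L], continuous (fun t => Q t ^+ 2 - P t * D t)}.
  apply: wcontD; first exact: (wcontM cQ cQ).
  by apply: wcontN; exact: wcontM.
have ce : {within `[0, L], continuous eta} by apply: continuous_subspaceT => x; exact: (se 0%N x I).
have [M [h1 h2]] := cont_bd hL (wcontM cG ce).
have iG : mu.-integrable (itvoo 0 L) (EFin \o (fun t => (Q t ^+ 2 - P t * D t) * eta t)).
  apply: (integrableS _ _ _ (continuous_compact_integrable (@segment_compact _ 0 L) (wcontM cG ce))) => //.
  by move=> t; rewrite itvooE /= in_itv/= => /andP[t0 t1]; rewrite !ltW.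
have c2 : continuous (fun z : R * R => z.2 ^+ 2).
  by move=> z; apply: cvgM; exact: cvg_snd.
have iS : mu2.-integrable S (EFin \o (fun z => z.2 ^+ 2 * ((Q z.1 ^+ 2 - P z.1 * D z.1) * eta z.1))).
  by have := bd_integrable hL (L2S_int hL h1) c2; apply: eq_integrable => // z _ /=; rewrite mulrC.
have := test_eq0; rewrite (sqr_integral hL iS iG) => /eqP.
by rewrite mulf_eq0 invr_eq0 pnatr_eq0 /= => /eqP.
Qed.

End test.

(** Bumps are enough as [eta]; continuity of the coefficients turns the almost everywhere identity
    into one at every point, endpoints included. *)
Lemma blowup_det t : 0 <= t <= L -> Q t ^+ 2 = P t * D t.
Proof.
have cG : {within `[0, L], continuous (fun t => Q t ^+ 2 - P t * D t)}.
  apply: wcontD; first exact: (wcontM cQ cQ).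
  by apply: wcontN; exact: wcontM.
move=> ht; apply/eqP; rewrite -subr_eq0; apply/eqP.
apply: (cont_ae0 hL cG) ht; apply: (fundamental_lemma hL).
  apply: (integrableS _ _ _ (continuous_compact_integrable (@segment_compact _ 0 L) cG)) => //.
  by move=> x; rewrite itvooE /= in_itv/= => /andP[t0 t1]; rewrite !ltW.
by move=> k p0 q0 h1 h2; apply: blowup_test; exact: (sbump_test (L := L) (b := true) k h1 h2).
Qed.

End det.

(** * Convergence of the second fundamental form *)

Lemma ord2 (k : 'I_2) : k = 0 \/ k = 1.
Proof. by case: k => [[|[|//]] ?]; [left|right]; exact: val_inj. Qed.

Section second_form.
Context {R : realType}.
Variables (L w0 : R) (kappa : R -> R) (II : R * R -> 'M[R]_2) (e1 e2 e3 : R -> 'cV[R]_3)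
  (W : 'M[R]_3 -> \bar R).
Hypotheses (hL : 0 < L) (hw0 : 0 < w0).
Hypothesis hkappa : smooth_on `[0, L] kappa.
Hypothesis hII : smooth_on (`[0, L] `*` `[- (w0 / 2), w0 / 2]) II.
Hypothesis hIIsym : forall z, (`[0, L] `*` `[- (w0 / 2), w0 / 2]) z -> (II z)^T = II z.
Local Notation mu2 := (@lebesgue2 R).
Local Notation S := (strip L).
Local Notation L2S := (L2 mu2 S).
Local Notation cvS := (cv2 mu2 S).
Let mS := @measurable_strip R L.
Let fS := strip_fin hL.

(** Clamping the coordinates to the rectangle before applying the local smooth extension gives
    continuity on the whole plane, at the price of smoothness; measurability and convergence ask
    only for continuity. *)
Lemma smooth_on_extension i j : exists h : R * R -> R, continuous h /\
  forall z, (`[0, L] `*` `[- (w0 / 2), w0 / 2]) z -> II z i j = h z.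
Proof.
have [U [G [oU AU sG eG]]] := hII.
pose c1 (z : R * R) : R := Num.max 0 (Num.min L z.1).
pose c2 (z : R * R) : R := Num.max (- (w0 / 2)) (Num.min (w0 / 2) z.2).
have h2 : 0 <= w0 / 2 by rewrite divr_ge0// ltW.
have cA z : (`[0, L] `*` `[- (w0 / 2), w0 / 2]) (c1 z, c2 z).
  split; rewrite /= in_itv/= /c1 /c2 le_max ge_max ge_min ?lexx ?orTb ?(ltW hL)//=.
  by rewrite (le_trans _ h2) ?oppr_le0.
have cc : continuous (fun z => (c1 z, c2 z)).
  move=> z.
  have h1c : {for z, continuous c1}.
    apply: (@continuous_max _ _ (cst 0) (fun z : R * R => Num.min L z.1)); first exact: cvg_cst.
    by apply: (@continuous_min _ _ (cst L) fst); [exact: cvg_cst|exact: cvg_fst].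
  suff h2c : {for z, continuous c2} by exact: (cvg_pair h1c h2c).
  apply: (@continuous_max _ _ (cst (- (w0 / 2))) (fun z : R * R => Num.min (w0 / 2) z.2)); first exact: cvg_cst.
  by apply: (@continuous_min _ _ (cst (w0 / 2)) snd); [exact: cvg_cst|exact: cvg_snd].
exists (fun z => G (c1 z, c2 z) i j); split.
  move=> z; have cG : {for (c1 z, c2 z), continuous G} by apply: (sG 0%N); apply: AU.
  have cGc := @continuous_comp _ _ _ (fun z => (c1 z, c2 z)) G z (cc z) cG.
  exact: (@continuous_comp _ _ _ (G \o (fun z => (c1 z, c2 z))) (fun A : 'M[R]_2 => A i j) z cGc (@coord_continuous _ _ _ i j _)).
move=> z Az; rewrite eG//; case: z Az => x y [/=]; rewrite !in_itv/= => /andP[x0 x1] /andP[y0 y1].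
rewrite /c1 /c2 /=; congr (G (_, _) i j).
  by rewrite min_r// max_r.
by rewrite min_r// max_r.
Qed.

Lemma L2_eq_strip (u v : R * R -> R) : L2S u -> (forall z, S z -> u z = v z) -> L2S v.
Proof.
move=> [mu_ iu] e; split; first by apply: (eq_measurable_fun u) => // z /[!inE]; exact: e.
by have := iu; apply: eq_integrable => // z /[!inE] /e /= ->.
Qed.

Section energy.
Variables (w : nat -> R) (f_ : nat -> R * R -> 'cV[R]_3).
Hypothesis hw : forall n, 0 < w n.
Hypothesis hww : forall n, w n <= w0.
Hypothesis hw_cvg : w @ \oo --> (0 : R).
Hypothesis hk : forall n (z : R * R), 0 <= z.1 <= L -> `|z.2| <= 2^-1 ->
  `|kappa z.1 * (w n * z.2)| <= 2^-1.
Hypothesis hf : forall n, isometric_immersion L kappa (w n) (f_ n).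
Hypothesis hE : (fun n => energy_w L kappa II e1 e2 e3 W (w n) (f_ n)) @ \oo --> 0%E.

Lemma rescale_in n z : S z -> (`[0, L] `*` `[- (w0 / 2), w0 / 2]) (rescale (w n) z).
Proof.
move=> /strip_in[/andP[z0 z1] z2]; split; rewrite /= in_itv/=; first by rewrite !ltW.
by rewrite -ler_norml normrM gtr0_norm// ler_pM// ltW.
Qed.

Lemma rescale_cvg i j : cvS (fun n z => II (rescale (w n) z) i j) (fun z => II_mid II z.1 i j).
Proof.
have [h [ch eh]] := smooth_on_extension i j.
have c2 v : continuous (fun z : R * R => h (rescale v z)).
  move=> z; apply: (@continuous_comp _ _ _ (rescale v) h); last exact: ch.
  have k2 : {for z, continuous (fun z : R * R => v * z.2)} by apply: cvgM; [exact: cvg_cst|exact: cvg_snd].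
  exact: (cvg_pair cvg_fst k2).
have [M hM] := continuous_bounded_strip hL (c2 w0).
have bd n z : S z -> `|h (rescale (w n) z)| <= M.
  (* A narrower strip is part of the strip of width [w0], so one bound serves all [n] and dominated
     convergence applies. *)
  move=> Sz; have -> : rescale (w n) z = rescale w0 (z.1, (w n / w0) * z.2).
    by rewrite /rescale /= mulrA mulrCA divff ?mulr1// gt_eqF.
  apply: hM; move: Sz => [/= h1 h2]; split => //=.
  move: h2; rewrite !in_itv/= -!ltr_norml => h2; rewrite normrM (le_lt_trans _ h2)//.
  rewrite -[leRHS]mul1r ler_wpM2r// ger0_norm; last exact: (divr_ge0 (ltW (hw n)) (ltW hw0)).
  by rewrite ler_pdivrMr// mul1r.
have bd0 z : S z -> `|h (z.1, 0)| <= M.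
  move=> Sz; have -> : (z.1, 0) = rescale w0 (z.1, 0) by rewrite /rescale /= mulr0.
  apply: hM; move: Sz => [/= h1 _]; split => //=.
  by rewrite in_itv/= oppr_lt0 invr_gt0 ltr0n.
have mh v : measurable_fun S ((fun z => h (rescale v z)) : measurableTypeR R * measurableTypeR R -> R).
  exact: (measurable_funTS (continuous_measurable2 (c2 v))).
have mh0 : measurable_fun S ((fun z => h (z.1, 0)) : measurableTypeR R * measurableTypeR R -> R).
  by have := mh 0; congr measurable_fun; apply/funext => z; rewrite /rescale mul0r.
have l n : L2S (fun z => h (rescale (w n) z)).
  by apply: (L2_bd mS fS (mh _)); apply: aeW => z; exact: bd.
have l0 : L2S (fun z => h (z.1, 0)) by apply: (L2_bd mS fS mh0); apply: aeW => z; exact: bd0.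
have cvh : cvS (fun n z => h (rescale (w n) z)) (fun z => h (z.1, 0)).
  split => //.
  have r0 : \int[mu2]_(z in S) (0 : R) = 0 by rewrite Rintegral_cst// mul0r.
  suff DC : (fun n => ip mu2 S (fun z => h (rescale (w n) z) - h (z.1, 0)) (fun z => h (rescale (w n) z) - h (z.1, 0))) @ \oo --> \int[mu2]_(z in S) (0 : R).
    by rewrite r0 in DC.
  apply: (Rint_dct (h := fun=> (M + M) ^+ 2) mS).
  - by move=> n; exact: (measurable_funM (measurable_funB (mh _) mh0) (measurable_funB (mh _) mh0)).
  - exact: (L2_integrable mS fS (L2_cst mS fS _)).
  - move=> z Sz.
    have cz : (fun n => h (rescale (w n) z)) @ \oo --> h (z.1, 0).
      apply: (cvg_comp (fun n => rescale (w n) z) h _ (ch (z.1, 0))).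
      have cw : (fun n => w n * z.2) @ \oo --> 0.
        by rewrite -(mul0r z.2); apply: cvgM => //; exact: cvg_cst.
      exact: (cvg_pair (cvg_cst z.1) cw).
    have cz' : (fun n => h (rescale (w n) z) - h (z.1, 0)) @ \oo --> (0 : R).
      have := cvgB cz (@cvg_cst _ (h (z.1, 0)) _ \oo _); rewrite subrr; exact.
    have := cvgM cz' cz'; rewrite mulr0; exact.
  - move=> n z Sz; rewrite -expr2 normrX lerXn2r ?nnegrE//.
      by rewrite addr_ge0// (le_trans _ (bd0 z Sz)).
    by rewrite (le_trans (ler_normB _ _))// lerD ?bd ?bd0.
have en n z : S z -> h (rescale (w n) z) = II (rescale (w n) z) i j.
  by move=> Sz; rewrite eh//; exact: rescale_in.
have e0 z : S z -> h (z.1, 0) = II_mid II z.1 i j.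
  by move=> Sz; rewrite /II_mid eh//; apply: midpt_in => //; move: Sz => /strip_in[/andP[z0 z1] _]; rewrite !ltW.
apply: (cv2_ae mS cvh).
- by move=> n; apply: (L2_eq_strip (l n)) => z; exact: en.
- by apply: (L2_eq_strip l0) => z; exact: e0.
- by move=> n; apply: aeW => z Sz; rewrite en.
- by apply: aeW => z Sz; rewrite e0.
Qed.

Let F n z := II_w L (w n) (f_ n) z - II (rescale (w n) z).

Let lF n i j : L2S (fun z => F n z i j).
Proof.
have [h _ _] := rescale_cvg i j.
have := L2B mS (II_w_L2 hL (hw n) hkappa (hk n) (hf n) i j) (h n).
by congr L2; apply/funext => z; rewrite !mxE.
Qed.

Hypothesis hQ : exists2 K : R, 0 < K & forall n x, S x -> forall (F : 'M[R]_2) i j,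
  (F i j + F j i) ^+ 2 <= K * Q_w kappa II e1 e2 e3 W (w n) x F.

(** Coercivity bounds [F + F^T] only. The symmetry of [H] from the structure equations and that of
    [II] make this twice [F]. *)
Let F_sym n : {ae mu2, forall z, S z -> F n z 0 1 = F n z 1 0}.
Proof.
have [da [dn [_ e]]] := gauss_weingarten hL (hw n) hkappa (hk n) (hf n).
apply: aeS e => z h Sz; have {h} [_ _ e] := h Sz.
have /matrixP/(_ 0 1) := hIIsym (rescale_in n Sz); rewrite mxE => e'.
have E k l : F n z k l = II_w L (w n) (f_ n) z k l - II (rescale (w n) z) k l.
  by rewrite /F [LHS]mxE; congr (_ + _); rewrite mxE.
by rewrite !E e e'.
Qed.

Let cvF i j : cvS (fun n z => F n z i j + F n z j i) (cst 0).
Proof.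
have [K K0 hK] := hQ; split; [by move=> n; exact: L2D|exact: L2_cst|].
rewrite (_ : (fun n => _) = (fun n => ip mu2 S (fun z => F n z i j + F n z j i) (fun z => F n z i j + F n z j i))).
  apply: (energy_cvg hL (q_ := fun n x => Q_w kappa II e1 e2 e3 W (w n) x (F n x)) K0) hE.
    by move=> n; exact: L2D.
  by apply: nearW => n x Sx; exact: hK.
by apply/funext => n; rewrite /cst; under eq_fun do rewrite subr0.
Qed.

Lemma second_form_cvg i j : cvS (fun n z => II_w L (w n) (f_ n) z i j) (fun z => II_mid II z.1 i j).
Proof.
have cF : cvS (fun n z => F n z i j) (cst 0).
  have := cv2Z mS 2^-1 (cvF i j); rewrite (_ : (fun x => _ * cst 0 x) = cst 0); last by apply/funext => z; rewrite mulr0.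
  move=> /(cv2_ae mS); apply => //.
  - exact: L2_cst.
  - have T (x y : R) : x = y -> x = 2^-1 * (x + y) by move=> <-; field.
    move=> n; apply: aeS (F_sym n) => z h Sz; have {}h := h Sz.
    by have [->|->] := ord2 i; have [->|->] := ord2 j; apply: T.
  - by apply: aeW.
have := cv2D mS cF (rescale_cvg i j); congr cv2.
  by apply/funext => n; apply/funext => z; rewrite !mxE subrK.
by apply/funext => z; rewrite add0r.
Qed.

(** The frame coefficients of the first tangent vector carry [lambda^-1], which tends to 1 uniformly
    at rate [2 K w]. *)
Lemma lami_cvg i j : cvS (fun n z => lami (w n) kappa z * II_w L (w n) (f_ n) z i j) (fun z => II_mid II z.1 i j).
Proof.
have [K K0 [_ hK]] := cont_along hL (kappa_cont hkappa).
have lL n : L2S (lami (w n) kappa).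
  apply: (L2_bd mS fS (lami_meas hL hkappa (hk n)) (K := 2)); apply: aeW => z /(lami_bounds (hk n))/andP[h1 h2].
  by rewrite ger0_norm.
have cl : cvS (fun n => lami (w n) kappa) (cst 1).
  apply: (cv2_unif mS fS (e_ := fun n => 2 * K * w n) lL); first exact: L2_cst.
    by rewrite -(mulr0 (2 * K)); apply: cvgM => //; exact: cvg_cst.
  move=> n z Sz; have /andP[l1 l2] := lam_bounds (hk n) Sz.
  have l0 : 0 < lam (w n) kappa z by apply: lt_le_trans l1; rewrite invr_gt0.
  have -> : lami (w n) kappa z - cst 1 z = lami (w n) kappa z * (kappa z.1 * (w n * z.2)).
    by rewrite /lami -[X in _ - X](mulVf (lt0r_neq0 l0)) /cst /lam; ring.
  have /andP[i0 i1] := lami_bounds (hk n) Sz.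
  have [_ z2] := strip_in Sz.
  rewrite normrM (ger0_norm i0) normrM normrM (gtr0_norm (hw n)) -mulrA ler_pM ?mulr_ge0 ?(ltW (hw n))//.
  rewrite ler_pM ?mulr_ge0 ?(ltW (hw n))//; first exact: hK.
  rewrite -[leRHS]mulr1 ler_wpM2l ?(ltW (hw n))// (le_trans z2)// invf_le1//.
  by rewrite ler1n.
have cI : {within `[0, L], continuous (fun t => II_mid II t i j)} by apply: II_mid_cont; [exact: hw0|exact: hII].
have [M _ [_ hM]] := cont_along hL cI.
have bl n : aebd mu2 S 2 (lami (w n) kappa).
  by apply: aeW => z /(lami_bounds (hk n))/andP[h1 h2]; rewrite ger0_norm.
have bM : aebd mu2 S M (fun z => II_mid II z.1 i j) by exact: aeW.
have := cv2M_bd mS cl (second_form_cvg i j) bl bM.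
by congr cv2; apply/funext => z; rewrite /cst mul1r.
Qed.

End energy.
End second_form.

(** * Strong convergence *)

Section strong.
Context {R : realType}.
Variables (L w0 : R) (kappa : R -> R) (II : R * R -> 'M[R]_2) (e1 e2 e3 : R -> 'cV[R]_3).
Hypotheses (hL : 0 < L) (hw0 : 0 < w0).
Hypothesis hkappa : smooth_on `[0, L] kappa.
Hypothesis hII : smooth_on (`[0, L] `*` `[- (w0 / 2), w0 / 2]) II.
Hypothesis hframe : frame L kappa II e1 e2 e3.
Local Notation mu := (@lebesgue_measure R).
Local Notation mu2 := (@lebesgue2 R).
Local Notation S := (strip L).
Local Notation I := (itvoo 0 L).
Local Notation L2S := (L2 mu2 S).
Local Notation cvS := (cv2 mu2 S).
Local Notation bdS := (aebd mu2 S).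
Local Notation nsq u := (ip mu2 S u u).
Let mS := @measurable_strip R L.
Let fS := strip_fin hL.

Lemma cv2_scal0 (x : nat -> R) (u_ : nat -> R * R -> R) u : x @ \oo --> (0 : R) -> cvS u_ u ->
  cvS (fun n z => x n * u_ n z) (cst 0).
Proof.
move=> x0 cu; have [hu_ hu _] := cu; split; [by move=> n; exact: L2Z|exact: L2_cst|].
have E n : ip mu2 S (fun z => x n * u_ n z - cst 0 z) (fun z => x n * u_ n z - cst 0 z) = x n * x n * nsq (u_ n).
  by rewrite -expr2 -ip_sqZ//; congr (ip _ _ _ _); apply/funext => z; rewrite /cst subr0.
rewrite (funext E); have := cvgM (cvgM x0 x0) (cv2_ip mS cu cu).
by rewrite !mul0r; exact.
Qed.

Lemma cont_L2I (g : R -> R) : {within `[0, L], continuous g} -> L2 mu I g.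
Proof.
move=> cg; have [M hM] := cont_bounded hL cg.
apply: (L2_bd (measurable_itvoo _ _) (itvoo_fin _ _) (K := M)); last exact: aeW.
have sub : I `<=` `[0, L] by move=> x; rewrite itvooE /= in_itv/= => /andP[x0 x1]; rewrite !ltW.
apply: (measurable_funS _ sub) => //.
exact: subspace_continuous_measurable_fun.
Qed.

Section limit_frame.
Variable C : 'M[R]_3.
Hypothesis hC : SO3 C.
(** The limit frame is the reference frame turned by the constant rotation; left multiplication by
    [C] preserves the frame equations. *)
Definition d1 t := C *m e1 t.
Definition d2 t := C *m e2 t.
Definition d3 t := C *m e3 t.
Definition dd1 t := kappa t *: d2 t + II_mid II t 0 0 *: d3 t.
Definition dd2 t := - kappa t *: d1 t + II_mid II t 0 1 *: d3 t.

Lemma rot_mx3 (a b c : 'cV[R]_3) : mx3 (C *m a) (C *m b) (C *m c) = C *m mx3 a b c.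
Proof.
apply/matrixP => i j; have [q1 q2 q3] := mx3E (C *m a) (C *m b) (C *m c) i.
rewrite [RHS]mxE sum3; have E k := mx3E a b c k.
have [a0 b0 c0] := E 0; have [a1 b1 c1] := E 1; have [a2 b2 c2] := E 2.
by elim/ord3_ind: j; rewrite ?q1 ?q2 ?q3 mulmx_col ?a0 ?a1 ?a2 ?b0 ?b1 ?b2 ?c0 ?c1 ?c2.
Qed.

Lemma d_SO3 t : 0 <= t <= L -> SO3 (mx3 (d1 t) (d2 t) (d3 t)).
Proof.
move=> /(frame_SO3 hframe)[h1 h2]; have [c1 c2] := hC; rewrite rot_mx3; split.
  by rewrite trmx_mul mulmxA -[_ *m _^T *m C]mulmxA c1 mulmx1.
by rewrite det_mulmx c2 h2 mulr1.
Qed.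

Lemma d_cont j : [/\ {within `[0, L], continuous (fun t => d1 t j 0)},
  {within `[0, L], continuous (fun t => d2 t j 0)} & {within `[0, L], continuous (fun t => d3 t j 0)}].
Proof.
have T (e : R -> 'cV[R]_3) : (forall i, {within `[0, L], continuous (fun t => e t i 0)}) ->
    {within `[0, L], continuous (fun t => (C *m e t) j 0)}.
  move=> he.
  have K i : {within `[0, L], continuous (fun t => C j i * e t i 0)}.
    by apply: wcontM; [move=> x; exact: cvg_cst|exact: he].
  have E : (fun t => (C *m e t) j 0) = (fun t => C j 0 * e t 0 0 + C j 1 * e t 1 0 + C j 2 * e t 2 0).
    by apply/funext => t; rewrite mulmx_col.
  exact: (eq_ind_r (fun F : R -> R => {within `[0, L], continuous F}) (wcontD (wcontD (K 0) (K 1)) (K 2)) E).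
by split; apply: T => i; have [] := frame_cont hframe i.
Qed.

Lemma d_bd : [/\ bdv L 1 (fun z => d1 z.1), bdv L 1 (fun z => d2 z.1) & bdv L 1 (fun z => d3 z.1)].
Proof. by apply: bdv_SO3; apply: aeW => z /strip_in[/andP[z0 z1] _]; apply: d_SO3; rewrite !ltW. Qed.

Lemma dd_cont j : {within `[0, L], continuous (fun t => dd1 t j 0)} /\
  {within `[0, L], continuous (fun t => dd2 t j 0)}.
Proof.
have [c1 c2 c3] := d_cont j; have ck := kappa_cont hkappa.
have cI i k : {within `[0, L], continuous (fun t => II_mid II t i k)} by apply: II_mid_cont; [exact: hw0|exact: hII].
split.
  have E : (fun t => dd1 t j 0) = (fun t => kappa t * d2 t j 0 + II_mid II t 0 0 * d3 t j 0).
    by apply/funext => t; rewrite /dd1 [LHS]mxE [X in X + _]mxE [X in _ + X]mxE.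
  exact: (eq_ind_r (fun F : R -> R => {within `[0, L], continuous F}) (wcontD (wcontM ck c2) (wcontM (cI 0 0) c3)) E).
have E : (fun t => dd2 t j 0) = (fun t => - kappa t * d1 t j 0 + II_mid II t 0 1 * d3 t j 0).
  by apply/funext => t; rewrite /dd2 [LHS]mxE [X in X + _]mxE [X in _ + X]mxE.
exact: (eq_ind_r (fun F : R -> R => {within `[0, L], continuous F}) (wcontD (wcontM (wcontN ck) c1) (wcontM (cI 0 1) c3)) E).
Qed.

Lemma dd_rot t : dd1 t = C *m (kappa t *: e2 t + II_mid II t 0 0 *: e3 t) /\
  dd2 t = C *m (- kappa t *: e1 t + II_mid II t 0 1 *: e3 t).
Proof. by rewrite !mulmxDr -!scalemxAr. Qed.

Lemma d_wd : [/\ wdv L true (fun z => d1 z.1) (fun z => dd1 z.1), wdv L true (fun z => d2 z.1) (fun z => dd2 z.1),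
  wdv L false (fun z => d1 z.1) (cst 0) & wdv L false (fun z => d2 z.1) (cst 0)].
Proof.
have [h1 h2 h3] := e_wd hL hw0 hkappa hII hframe.
have T (e de : R -> 'cV[R]_3) : wdv L true (fun z => e z.1) (fun z => de z.1) ->
    wdv L true (fun z => (C *m e z.1)) (fun z => (C *m de z.1)).
  move=> h j; have := wdD (wdD (wdZ (C j 0) (h 0)) (wdZ (C j 1) (h 1))) (wdZ (C j 2) (h 2)).
  by congr wd; apply/funext => z; rewrite mulmx_col.
have E1 : (fun z : R * R => dd1 z.1) = (fun z => C *m (kappa z.1 *: e2 z.1 + II_mid II z.1 0 0 *: e3 z.1)).
  by apply/funext => z; have [-> _] := dd_rot z.1.
have E2 : (fun z : R * R => dd2 z.1) = (fun z => C *m (- kappa z.1 *: e1 z.1 + II_mid II z.1 0 1 *: e3 z.1)).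
  by apply/funext => z; have [_ ->] := dd_rot z.1.
have w1 : wdv L true (fun z => d1 z.1) (fun z => dd1 z.1) by rewrite E1; exact: (T e1 (fun t => kappa t *: e2 t + II_mid II t 0 0 *: e3 t)).
have w2 : wdv L true (fun z => d2 z.1) (fun z => dd2 z.1) by rewrite E2; exact: (T e2 (fun t => - kappa t *: e1 t + II_mid II t 0 1 *: e3 t)).
have F (e : R -> 'cV[R]_3) : (forall j, L2S (fun z => e z.1 j 0)) -> wdv L false (fun z => e z.1) (cst 0).
  move=> hF j; have := wd_transv hL (b := false) (f := fun t => e t j 0) (hF j).
  by congr wd; apply/funext => z; rewrite /cst mxE.
by split => //; apply: F => j; [have [] := w1 j|have [] := w2 j].
Qed.

(** The primitive is normalized to vanish at 0; the translations in [immersion_cvg] are adjusted to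
    this choice. *)
Definition limit_curve t : 'cV[R]_3 := \col_j Prim 0 (fun s => d1 s j 0) t.

Let d1_int j : mu.-integrable I (EFin \o (fun t => d1 t j 0)).
Proof. by have [c1 _ _] := d_cont j; apply: L2I_int; exact: cont_L2I. Qed.

Let curve_entry j : (fun t => limit_curve t j 0) = Prim 0 (fun s => d1 s j 0).
Proof. by apply/funext => t; rewrite mxE. Qed.

Let curve_cont j : {within `[0, L], continuous (fun t => limit_curve t j 0)}.
Proof. by rewrite curve_entry; apply: Prim_cont; [exact: ltW|exact: d1_int]. Qed.

Lemma curve_wd : wdv L true (fun z => limit_curve z.1) (fun z => d1 z.1) /\
  wdv L false (fun z => limit_curve z.1) (cst 0).
Proof.
have l j : L2S (fun z => limit_curve z.1 j 0) by have [M _ []] := cont_along hL (@curve_cont j).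
have [h _ _ _] := d_wd.
split=> j.
  split; [exact: l|by have [] := h j|apply: aeW => t dt /=].
  rewrite (curve_entry j); exact: Prim_prim (d1_int j).
have := wd_transv hL (b := false) (f := fun t => limit_curve t j 0) (l j).
by congr wd; apply/funext => z; rewrite /cst mxE.
Qed.

Lemma curve_wd1 j : wd1 L 0 (fun t => limit_curve t j 0) (fun t => d1 t j 0).
Proof.
have [c1 _ _] := d_cont j.
split; [exact: cont_L2I|exact: cont_L2I|rewrite curve_entry; exact: Prim_prim (d1_int j)].
Qed.

Lemma d1_wd1 j : wd1 L 0 (fun t => d1 t j 0) (fun t => dd1 t j 0).
Proof.
have [c1 _ _] := d_cont j; have [cd _] := dd_cont j.
split; [exact: cont_L2I|exact: cont_L2I|].
have P i : prim 0 L (fun t => e1 t i 0) (fun t => kappa t * e2 t i 0 + II_mid II t 0 0 * e3 t i 0).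
  have [c _ _] := frame_cont hframe i; have [c' _ _] := frame_derive_cont hw0 hkappa hII hframe i.
  have [h1 h2] := prim_C1 hL c c' (fun t ht => (let: And3 x _ _ := frame_derive hframe i ht in x)).
  by split => //; exists (e1 0 i 0); apply: aeW => x; rewrite itvooE => /andP[x0 x1]; apply: h2; rewrite !ltW.
have := primD (primD (primZ (C j 0) (P 0)) (primZ (C j 1) (P 1))) (primZ (C j 2) (P 2)).
congr prim; apply/funext => t; first by rewrite mulmx_col.
by have [-> _] := dd_rot t; rewrite mulmx_col; congr (_ + _ + _); congr (_ * _); rewrite [RHS]mxE [X in _ = X + _]mxE [X in _ = _ + X]mxE.
Qed.

Lemma limit_curve_regular : [/\ sobolev1 L 2 limit_curve,
  sobolev1 L 0 d1 /\ sobolev1 L 0 d2 /\ sobolev1 L 0 d3 &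
  {ae mu, forall t : R, 0 < t < L ->
    [/\ SO3 (mx3 (d1 t) (d2 t) (d3 t)), d1 t = weak_deriv1 L limit_curve t &
      dot (weak_deriv1 L d1 t) (d2 t) = kappa t]}].
Proof.
split.
- by move=> j; exact: (sobolev_I2 hL (curve_wd1 j) (d1_wd1 j)).
- by split; [|split]; move=> j; apply: sobolev_I0; apply: cont_L2I; have [] := d_cont j.
have A j := weak_deriv1P hL (curve_wd1 j); have B j := weak_deriv1P hL (d1_wd1 j).
apply: aeS3 (aeI (A 0) (A 1)) (aeI (A 2) (B 0)) (aeI (B 1) (B 2)) => t [x0 x1] [x2 y0] [y1 y2] ht.
have tL : 0 <= t <= L by case/andP : ht => t0 t1; rewrite !ltW.
have tI : I t by rewrite itvooE.
have S3 := d_SO3 tL; split => //.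
  apply/matrixP => i j; rewrite ord1 [RHS]mxE.
  by elim/ord3_ind: i; [rewrite x0|rewrite x1|rewrite x2].
have -> : weak_deriv1 L d1 t = dd1 t.
  apply/matrixP => i j; rewrite ord1 [LHS]mxE.
  by elim/ord3_ind: i; [exact: y0|exact: y1|exact: y2].
have [q1 q2 q3 [q4 q5 q6]] := mx3_orth_dot S3.
by rewrite /dd1 dotDl !dotZl q2 (dotC (d3 t)) q6 mulr1 mulr0 addr0.
Qed.

Section sequence.
Variables (w : nat -> R) (f_ : nat -> R * R -> 'cV[R]_3).
Hypothesis hw : forall n, 0 < w n.
Hypothesis hw_cvg : w @ \oo --> (0 : R).
Hypothesis hk : forall n (z : R * R), 0 <= z.1 <= L -> `|z.2| <= 2^-1 ->
  `|kappa z.1 * (w n * z.2)| <= 2^-1.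
Hypothesis hf : forall n, isometric_immersion L kappa (w n) (f_ n).
Local Notation a n := (a1 L (w n) kappa (f_ n)).
Local Notation c n := (b2 L (w n) (f_ n)).
Local Notation nn n := (nu L (w n) kappa (f_ n)).
Local Notation H n := (II_w L (w n) (f_ n)).
Local Notation lamin n := (lami (w n) kappa).
Hypothesis ca : forall i, cvS (fun k z => a k z i 0) (fun z => d1 z.1 i 0).
Hypothesis cc : forall i, cvS (fun k z => c k z i 0) (fun z => d2 z.1 i 0).
Hypothesis cn : forall i, cvS (fun k z => nn k z i 0) (fun z => d3 z.1 i 0).
Hypothesis cp : cvS (fun n z => lamin n z * H n z 0 0) (fun z => II_mid II z.1 0 0).
Hypothesis cq : cvS (fun n z => H n z 1 0) (fun z => II_mid II z.1 0 1).
Hypothesis cr : cvS (fun n z => lamin n z * H n z 0 1) (fun z => II_mid II z.1 0 1).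
Hypothesis cs : cvS (fun n z => H n z 1 1) (fun z => II_mid II z.1 1 1).

Let cI i k : {within `[0, L], continuous (fun t => II_mid II t i k)}.
Proof. by apply: II_mid_cont; [exact: hw0|exact: hII]. Qed.

Definition da n b z : 'cV[R]_3 := if b then kappa z.1 *: c n z + (lamin n z * H n z 0 0) *: nn n z
  else (w n * (lamin n z * H n z 0 1)) *: nn n z.
Definition dc n b z : 'cV[R]_3 := if b then - kappa z.1 *: a n z + H n z 1 0 *: nn n z
  else (w n * H n z 1 1) *: nn n z.

Let wda n b : wdv L b (a n) (da n b).
Proof. by have [[h1 _ _] [h2 _ _]] := frame_wd_explicit hL (hw n) hkappa (hk n) (hf n); case: b. Qed.

Let wdc n b : wdv L b (c n) (dc n b).
Proof. by have [[_ h1 _] [_ h2 _]] := frame_wd_explicit hL (hw n) hkappa (hk n) (hf n); case: b. Qed.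

(** The limits depend on [x_1] alone, so their transversal derivatives vanish. *)
Definition dlim (dd : R -> 'cV[R]_3) (b : bool) (t : R) : 'cV[R]_3 := if b then dd t else 0.

Let cvMn (x : nat -> R * R -> R) (g : R -> R) i : {within `[0, L], continuous g} ->
  cvS x (fun z => g z.1) -> cvS (fun n z => x n z * nn n z i 0) (fun z => g z.1 * d3 z.1 i 0).
Proof.
move=> cg cx; have [M [_ hM]] := cont_bd hL cg.
have nb k : bdS 1 (fun z => nn k z i 0) by have [_ _] := bd_frame (hk k) (hf k); exact.
have := cv2M_bd mS (cn i) cx nb hM.
by congr cv2; [apply/funext => k|]; apply/funext => z; rewrite mulrC.
Qed.

Let cvda b i : cvS (fun n z => da n b z i 0) (fun z => dlim dd1 b z.1 i 0).
Proof.
have [M [k1 k2]] := cont_bd hL (kappa_cont hkappa); have [b1_ b2_ b3_] := d_bd.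
case: b.
  have := cv2D mS (cv2M_bd mS (cv2_cst mS k1) (cc i) (fun=> k2) (b2_ i)) (cvMn i (@cI 0 0) cp).
  congr cv2; [apply/funext => n|]; apply/funext => z; rewrite /dlim /da /dd1.
    by rewrite [RHS]mxE [X in _ = X + _]mxE [X in _ = _ + X]mxE.
  by rewrite [RHS]mxE [X in _ = X + _]mxE [X in _ = _ + X]mxE.
have := cv2_scal0 hw_cvg (cvMn i (@cI 0 1) cr).
congr cv2; [apply/funext => n|]; apply/funext => z; first by rewrite [RHS]mxE mulrA.
by rewrite [RHS]mxE.
Qed.

Let cvdc b i : cvS (fun n z => dc n b z i 0) (fun z => dlim dd2 b z.1 i 0).
Proof.
have [M [k1 k2]] := cont_bd hL (kappa_cont hkappa); have [b1_ b2_ b3_] := d_bd.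
case: b.
  have := cv2D mS (cv2N mS (cv2M_bd mS (cv2_cst mS k1) (ca i) (fun=> k2) (b1_ i))) (cvMn i (@cI 0 1) cq).
  congr cv2; [apply/funext => n|]; apply/funext => z; rewrite /dlim /dc /dd2.
    by rewrite [RHS]mxE [X in _ = X + _]mxE [X in _ = _ + X]mxE mulNr.
  by rewrite [RHS]mxE [X in _ = X + _]mxE [X in _ = _ + X]mxE mulNr.
have := cv2_scal0 hw_cvg (cvMn i (@cI 1 1) cs).
congr cv2; [apply/funext => n|]; apply/funext => z; first by rewrite [RHS]mxE mulrA.
by rewrite [RHS]mxE.
Qed.

Let lam_bd n : bdS 2 (lam (w n) kappa).
Proof.
apply: aeW => z /(lam_bounds (hk n))/andP[l1 l2]; rewrite ger0_norm//.
by apply: le_trans l1; rewrite invr_ge0.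
Qed.

Let lam_cvg : cvS (fun n => lam (w n) kappa) (cst 1).
Proof.
have [K K0 [_ hK]] := cont_along hL (kappa_cont hkappa).
apply: (cv2_unif mS fS (e_ := fun n => K * w n)) => [n|||n z Sz].
- exact: (lam_L2 hL hkappa (hk n)).
- exact: L2_cst.
- by rewrite -(mulr0 K); apply: cvgM => //; exact: cvg_cst.
have [_ z2] := strip_in Sz.
rewrite /lam /cst addrAC subrr add0r normrN normrM ler_pM ?hK// normrM (gtr0_norm (hw n)).
rewrite -[leRHS]mulr1 ler_wpM2l ?(ltW (hw n))// (le_trans z2)// invf_le1//.
by rewrite ler1n.
Qed.

Let cvlam (x : nat -> R * R -> R) (g : R -> R) : {within `[0, L], continuous g} ->
  cvS x (fun z => g z.1) -> cvS (fun n z => lam (w n) kappa z * x n z) (fun z => g z.1).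
Proof.
move=> cg cx; have [M [_ hM]] := cont_bd hL cg.
have := cv2M_bd mS lam_cvg cx lam_bd hM.
by congr cv2; apply/funext => z; rewrite /cst mul1r.
Qed.

Let dlim_cont (dd : R -> 'cV[R]_3) b i : {within `[0, L], continuous (fun t => dd t i 0)} ->
  {within `[0, L], continuous (fun t => dlim dd b t i 0)}.
Proof.
case: b => // _; rewrite /dlim; have -> : (fun t : R => (0 : 'cV[R]_3) i 0) = cst (0 : R) by apply/funext => t; rewrite mxE.
by move=> x; exact: cvg_cst.
Qed.

(** Since [b1 = lambda a] and the gradient of [lambda] is [w] times a bounded function, the product
    rule leaves only [lambda] times the derivative of [a] in the limit. *)
Lemma db1_cvg : exists db : nat -> bool -> R * R -> 'cV[R]_3,
  (forall n b, wdv L b (b1 L (f_ n)) (db n b)) /\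
  forall b i, cvS (fun n z => db n b z i 0) (fun z => dlim dd1 b z.1 i 0).
Proof.
have [k' [ck' dk']] := kappa_C1 hkappa.
have [M [h1 h2]] := cont_bd hL ck'; have [K [k1 k2]] := cont_bd hL (kappa_cont hkappa).
have [b1_ b2_ b3_] := d_bd.
have l2 : bdS 2^-1 (fun z => z.2) by apply: aeW => z /strip_in[].
(* The derivative of [lambda] with its factor [w] removed, independent of [n]. *)
pose g b (z : R * R) := if b then - (k' z.1 * z.2) else - kappa z.1.
have [G [lg bg]] : exists G, (forall b, L2S (g b)) /\ forall b, bdS G (g b).
  exists (Num.max (M * 2^-1) K); split; case.
  - apply: (L2N mS); have := L2M_bd mS (L2_meas (L2_snd hL)) l2 h1.
    by congr L2; apply/funext => z; rewrite mulrC.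
  - exact: (L2N mS).
  - by apply: aeS (aebdM h2 l2) => z h Sz; rewrite /g normrN le_max h.
  - by apply: aeS k2 => z h Sz; rewrite /g normrN le_max h// orbT.
have E n b z : dlam (w n) kappa k' b z = w n * g b z by rewrite /dlam /g; case: b; ring.
exists (fun n b z => (w n * g b z) *: a n z + lam (w n) kappa z *: da n b z); split.
  move=> n b j; have [hl _] := wd_dlam hL (hw n) hkappa (hk n) ck' dk' b.
  have [ba _ _] := bd_frame (hk n) (hf n).
  have W := wdM hL hl (wda n b j) (lam_bd n) (ba j).
  have [_ W2 _] := W; have [B1 _ _] := wd_b1 hL (hf n) b j.
  apply: (wd_ae hL W B1).
  - by apply: (L2_eq_strip W2) => z Sz; rewrite E [RHS]mxE [X in _ = X + _]mxE [X in _ = _ + X]mxE.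
  - by apply: aeW => z Sz; rewrite (b1E (f_ n) (hk n) Sz) [RHS]mxE.
  - by apply: aeW => z Sz; rewrite E [RHS]mxE [X in _ = X + _]mxE [X in _ = _ + X]mxE.
move=> b i.
have := cv2D mS (cv2_scal0 hw_cvg (cv2M_bd mS (cv2_cst mS (lg b)) (ca i) (fun=> bg b) (b1_ i)))
  (cvlam (@dlim_cont dd1 b i (dd_cont i).1) (cvda b i)).
congr cv2; [apply/funext => n|]; apply/funext => z.
  by rewrite [RHS]mxE [X in _ = X + _]mxE [X in _ = _ + X]mxE mulrA.
by rewrite /cst add0r.
Qed.

Lemma b1_cvg i : cvS (fun n z => b1 L (f_ n) z i 0) (fun z => d1 z.1 i 0).
Proof.
have [c1 _ _] := d_cont i; have h := cvlam c1 (ca i); have [_ h2 _] := h.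
apply: (cv2_ae mS h) => //.
- by move=> n; have [h3 _ _] := wd_b1 hL (hf n) true i; exact: h3.
- by move=> n; apply: aeW => z Sz; rewrite (b1E (f_ n) (hk n) Sz) [LHS]mxE.
- exact: aeW.
Qed.

Lemma row_mx2 (u v : 'cV[R]_3) i : row_mx u v i 0 = u i 0 /\ row_mx u v i 1 = v i 0.
Proof.
split.
  by rewrite (_ : 0 = lshift 1 (0 : 'I_1)); [exact: row_mxEl|exact/val_inj].
by rewrite (_ : 1 = rshift 1 (0 : 'I_1)); [exact: row_mxEr|exact/val_inj].
Qed.

Lemma dlim_wd (j : 'I_3) b : wd L b (fun z => d1 z.1 j 0) (fun z => dlim dd1 b z.1 j 0) /\
  wd L b (fun z => d2 z.1 j 0) (fun z => dlim dd2 b z.1 j 0).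
Proof. by have [h1 h2 h3 h4] := d_wd; case: b; split; [exact: h1|exact: h2|exact: h3|exact: h4]. Qed.

Lemma grad_cvg : sobolev2_cvg L 1 (fun n => grad_w L (w n) (f_ n))
  (fun x => row_mx (d1 x.1) (d2 x.1)).
Proof.
have SC := sobolev_cvg1 mS (@wds_L2 _ L) (wdsE hL) (wds_uniq hL) (wds_ae hL) (@wds_B _ L).
have [db [hdb cdb]] := db1_cvg.
move=> i j; have [->|->] := ord2 j.
- have E n : (fun x => grad_w L (w n) (f_ n) x i 0) = (fun x => b1 L (f_ n) x i 0).
    by apply/funext => z; have [-> _] := row_mx2 (b1 L (f_ n) z) (b2 L (w n) (f_ n) z) i.
  have E0 : (fun x : R * R => row_mx (d1 x.1) (d2 x.1) i 0) = (fun x => d1 x.1 i 0).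
    by apply/funext => z; have [-> _] := row_mx2 (d1 z.1) (d2 z.1) i.
  rewrite E0 (_ : (fun n x => grad_w L (w n) (f_ n) x i 0) = (fun n x => b1 L (f_ n) x i 0)); last by apply/funext => n; exact: E.
  apply: (SC _ _ (fun n k z => db n (k == 0) z i 0) (fun k z => dlim dd1 (k == 0) z.1 i 0)).
  + exact: b1_cvg.
  + by move=> k; exact: cdb.
  + by move=> n k; exact: hdb.
  + move=> k; exact: (dlim_wd i (k == 0)).1.
- have E n : (fun x => grad_w L (w n) (f_ n) x i 1) = (fun x => b2 L (w n) (f_ n) x i 0).
    by apply/funext => z; have [_ ->] := row_mx2 (b1 L (f_ n) z) (b2 L (w n) (f_ n) z) i.
  have E0 : (fun x : R * R => row_mx (d1 x.1) (d2 x.1) i 1) = (fun x => d2 x.1 i 0).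
    by apply/funext => z; have [_ ->] := row_mx2 (d1 z.1) (d2 z.1) i.
  rewrite E0 (_ : (fun n x => grad_w L (w n) (f_ n) x i 1) = (fun n x => b2 L (w n) (f_ n) x i 0)); last by apply/funext => n; exact: E.
  apply: (SC _ _ (fun n k z => dc n (k == 0) z i 0) (fun k z => dlim dd2 (k == 0) z.1 i 0)).
  + exact: cc.
  + by move=> k; exact: cvdc.
  + by move=> n k; exact: wdc.
  + move=> k; exact: (dlim_wd i (k == 0)).2.
Qed.

(** Once the means agree, Poincare bounds [f_n - f] by its gradient, that is by [b1 - d1] and
    [w b2], both of which tend to zero. The derivatives of order one and two come from those of the
    frame. *)
Lemma immersion_cvg : exists v : nat -> 'cV[R]_3,
  sobolev2_cvg L 2 (fun n x => f_ n x + v n) (fun x => limit_curve x.1).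
Proof.
have SC := sobolev_cvg2 mS (@wds_L2 _ L) (wdsE hL) (wds_uniq hL) (wds_ae hL) (@wds_B _ L).
have [db [hdb cdb]] := db1_cvg.
pose mean (u : R * R -> R) := L^-1 * \int[mu2]_(z in S) u z.
(* The translation moves the mean of [f_ n] onto that of the limit curve. *)
pose F (j : 'I_3) (z : R * R) := limit_curve z.1 j 0.
exists (fun n => \col_j (mean (F j) - mean (fun z => f_ n z j 0))) => i j; rewrite ord1 {j}.
have [wF1 wF2] := curve_wd; have [wD1 _ wD2 _] := d_wd.
have g1 n : wd L true (fun z => f_ n z i 0) (fun z => b1 L (f_ n) z i 0).
  by have := fc_wd hL (hf n) true i; rewrite -(b1_entry L (f_ n) i).
have g2 n : wd L false (fun z => f_ n z i 0) (fun z => w n * b2 L (w n) (f_ n) z i 0).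
  have := fc_wd hL (hf n) false i; congr wd.
  apply/funext => z; have := congr1 (fun g => g z) (b2_entry L (w n) (f_ n) i).
  by move=> /= ->; rewrite mulrA mulfV ?gt_eqF// mul1r.
have cb := b1_cvg i.
have cw2 := cv2_scal0 hw_cvg (cc i).
have z0 : (fun z : R * R => (0 : 'cV[R]_3) i 0) = cst 0 by apply/funext => z; rewrite mxE.
have lf n : L2S (fun z => f_ n z i 0) by have [] := g1 n.
have lF : L2S (F i) by have [] := wF1 i.
have cf : cvS (fun n z => f_ n z i 0 + (mean (F i) - mean (fun z => f_ n z i 0))) (F i).
  split => //.
    by move=> n; apply: (L2D mS (lf n)); exact: (L2_cst mS fS _).
  have [_ _ c1] := cb; have [_ _ c2] := cw2.
  apply: (cvg0_squeeze (K := 1) (b := fun n => 8 * ip mu2 S (fun z => w n * b2 L (w n) (f_ n) z i 0 - cst 0 z) (fun z => w n * b2 L (w n) (f_ n) z i 0 - cst 0 z)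
    + 8 * L ^+ 2 * ip mu2 S (fun z => b1 L (f_ n) z i 0 - d1 z.1 i 0) (fun z => b1 L (f_ n) z i 0 - d1 z.1 i 0))).
  - by move=> n; exact: ip_ge0.
  - move=> n; rewrite mul1r; have v1 := wdB (g1 n) (wF1 i); have v2 : wd L false (fun z => f_ n z i 0 - limit_curve z.1 i 0) (fun z => w n * b2 L (w n) (f_ n) z i 0 - cst 0 z).
      have := wdB (g2 n) (wF2 i); congr wd; apply/funext => z; congr (_ - _); exact: mxE.
    have := poincare2 hL v1 v2.
    rewrite RintegralB//; [|exact: (L2S_int hL (lf n))|exact: (L2S_int hL lF)].
    apply: le_trans; rewrite le_eqVlt; apply/orP; left; apply/eqP.
    by congr ip; apply/funext => z; rewrite /mean /F; ring.
  have := cvgD (cvgM (cvg_cst (8 : R)) c2) (cvgM (cvg_cst (8 * L ^+ 2)) c1).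
  by rewrite !mulr0 addr0; exact.
have E n : (fun x => (f_ n x + \col_j (mean (F j) - mean (fun z => f_ n z j 0))) i 0) =
    (fun z => f_ n z i 0 + (mean (F i) - mean (fun z => f_ n z i 0))).
  by apply/funext => z; rewrite mxE [X in _ + X]mxE.
rewrite (_ : (fun n x => _) = (fun n z => f_ n z i 0 + (mean (F i) - mean (fun z => f_ n z i 0)))); last by apply/funext => n; exact: E.
(* The unscaled transversal derivative is [w b2]; it and its derivatives vanish in the limit thanks
   to the factor [w]. *)
apply: (SC _ _
  (fun n (k : 'I_2) z => if k == 0 then b1 L (f_ n) z i 0 else w n * b2 L (w n) (f_ n) z i 0)
  (fun (k : 'I_2) z => if k == 0 then d1 z.1 i 0 else 0)
  (fun n (k l : 'I_2) z => if k == 0 then db n (l == 0) z i 0 else w n * dc n (l == 0) z i 0)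
  (fun (k l : 'I_2) z => if k == 0 then dlim dd1 (l == 0) z.1 i 0 else 0)).
- exact: cf.
- by move=> k; case: (k == 0); [exact: cb|exact: cw2].
- move=> k l; case: (k == 0); first exact: cdb.
  exact: (cv2_scal0 hw_cvg (cvdc _ i)).
- move=> n k; rewrite /wds; case: (k == 0).
    by have := wdD (g1 n) (wd_cst hL true (mean (F i) - mean (fun z => f_ n z i 0))); congr wd; apply/funext => z; rewrite /cst addr0.
  by have := wdD (g2 n) (wd_cst hL false (mean (F i) - mean (fun z => f_ n z i 0))); congr wd; apply/funext => z; rewrite /cst addr0.
- move=> k; rewrite /wds; case: (k == 0); first exact: wF1.
  by have := wF2 i; congr wd.
- move=> n k l; rewrite /wds; case: (k == 0); first exact: hdb.
  exact: (wdZ (w n) (wdc n _ i)).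
- move=> k l; rewrite /wds; case: (k == 0); first exact: (dlim_wd i (l == 0)).1.
  exact: wd_cst.
Qed.

End sequence.
End limit_frame.
End strong.

Theorem proposition5p10 (R : realType) (L w0 : R)
    (kappa : R -> R) (II : R * R -> 'M[R]_2)
    (e1 e2 e3 : R -> 'cV[R]_3) (W : 'M[R]_3 -> \bar R)
    (w : nat -> R) (f_ : nat -> R * R -> 'cV[R]_3)
    (hL : 0 < L) (hw0 : 0 < w0)
    (hkappa : smooth_on `[0, L] kappa)
    (hII : smooth_on (`[0, L] `*` `[- (w0 / 2), w0 / 2]) II)
    (hIIsym : forall z, (`[0, L] `*` `[- (w0 / 2), w0 / 2]) z ->
       (II z)^T = II z)
    (hframe : frame L kappa II e1 e2 e3)
    (hW : energy_density W)
    (hw : forall n, 0 < w n) (hw_cvg : w @ \oo --> (0 : R))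
    (hf : forall n, isometric_immersion L kappa (w n) (f_ n))
    (hE : (fun n => energy_w L kappa II e1 e2 e3 W (w n) (f_ n)) @ \oo
          --> 0%E) :
  (forall t, 0 <= t <= L -> \det (II_mid II t) = 0) /\
  exists (s : nat -> nat) (c : nat -> 'cV[R]_3) (f d1 d2 d3 : R -> 'cV[R]_3),
    [/\ {homo s : m n / (m < n)%N},
        sobolev1 L 2 f,
        sobolev1 L 0 d1 /\ sobolev1 L 0 d2 /\ sobolev1 L 0 d3,
        {ae lebesgue_measure, forall t : R, 0 < t < L ->
           [/\ SO3 (mx3 (d1 t) (d2 t) (d3 t)), d1 t = weak_deriv1 L f t &
               dot (weak_deriv1 L d1 t) (d2 t) = kappa t]} &
        [/\ sobolev2_cvg L 2 (fun n x => f_ (s n) x + c n) (fun x => f x.1),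
            sobolev2_cvg L 1 (fun n => grad_w L (w (s n)) (f_ (s n)))
              (fun x => row_mx (d1 x.1) (d2 x.1)) &
            sobolev2_cvg L 0 (fun n => II_w L (w (s n)) (f_ (s n)))
              (fun x => II_mid II x.1)]].
Proof.
have [rho1 [K [r1 K0 hQ]]] := Qw_coercive hL hw0 hkappa hII hframe hW.
have [rho2 r2 hk] := kappa_small hL hkappa.
pose rho := Num.min w0 (Num.min rho1 rho2).
have rho0 : 0 < rho by rewrite !lt_min hw0 r1 r2.
have [N _ hN] : \forall n \near \oo, w n < rho.
  by apply: (cvgr_lt _ hw_cvg).
(* Finitely many terms are dropped, so that the thresholds for coercivity, for [lambda] and for the
   domain of [II] hold for every index. *)
pose t0 n := (n + N)%N.
have ht0 : {homo t0 : m n / (m < n)%N} by move=> m n; rewrite ltn_add2r.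
have wN n : [/\ w (t0 n) < w0, w (t0 n) < rho1 & w (t0 n) < rho2].
  by have /= := hN (t0 n) (leq_addl _ _); rewrite !lt_min => /and3P[].
pose w' n := w (t0 n); pose g n := f_ (t0 n).
have hw' n : 0 < w' n by exact: hw.
have hww n : w' n <= w0 by have [h _ _] := wN n; exact: ltW.
have cw' : w' @ \oo --> (0 : R) by exact: cvg_subseq ht0 hw_cvg.
have hk' n (z : R * R) : 0 <= z.1 <= L -> `|z.2| <= 2^-1 -> `|kappa z.1 * (w' n * z.2)| <= 2^-1.
  move=> z1 z2; apply: (hk (z.1, w' n * z.2)) => //=; have [_ _ h] := wN n.
  rewrite normrM (gtr0_norm (hw' n)) -[leRHS]mulr1 ler_pM ?(ltW (hw' n)) ?(ltW h)//.
  by rewrite (le_trans z2)// invf_le1// ler1n.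
have hg n : isometric_immersion L kappa (w' n) (g n) by exact: hf.
have hE' : (fun n => energy_w L kappa II e1 e2 e3 W (w' n) (g n)) @ \oo --> 0%E.
  exact: cvg_subseq ht0 hE.
have hQ' : exists2 K : R, 0 < K & forall n x, strip L x -> forall (F : 'M[R]_2) i j,
    (F i j + F j i) ^+ 2 <= K * Q_w kappa II e1 e2 e3 W (w' n) x F.
  by exists K => // n; apply: hQ; have [_ h _] := wN n; rewrite hw' h.
have mS := @measurable_strip R L.
have cH := second_form_cvg hL hw0 hkappa hII hIIsym hw' hww cw' hk' hg hE' hQ'.
have cl := lami_cvg hL hw0 hkappa hII hIIsym hw' hww cw' hk' hg hE' hQ'.
have sym t : 0 <= t <= L -> II_mid II t 1 0 = II_mid II t 0 1.
  by move=> ht; have /matrixP/(_ 0 1) := hIIsym _ (midpt_in hw0 ht); rewrite mxE.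
(* The limit of the entry [H_21] is renamed to [II^0_12], the form in which it occurs in the frame
   equations. *)
have cq : cv2 (@lebesgue2 R) (strip L) (fun n z => II_w L (w' n) (g n) z 1 0) (fun z => II_mid II z.1 0 1).
  apply: (cv2_ae mS (cH 1 0)).
  - by move=> n; have [h _ _] := cH 1 0; exact: h.
  - by have [_ h _] := cH 0 1.
  - by move=> n; exact: aeW.
  - by apply: aeW => z Sz; rewrite sym// (strip_cc Sz).
have hS n := frame_ae (hk' n) (hg n).
have W6 n := frame_wd_explicit hL (hw' n) hkappa (hk' n) (hg n).
have wt n := (W6 n).1; have wf n := (W6 n).2.
have wta n := let: And3 h _ _ := wt n in h.
have wtc n := let: And3 _ h _ := wt n in h.
have wtn n := let: And3 _ _ h := wt n in h.
have wfa n := let: And3 h _ _ := wf n in h.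
have wfc n := let: And3 _ h _ := wf n in h.
have wfn n := let: And3 _ _ h := wf n in h.
have [t [C [ht hC cR]]] := rotation_limit hL hw0 hkappa hII hframe cw' hS wta wtc wtn wfa wfc wfn (cl 0 0) cq (cl 0 1) (cH 1 1).
have cF i := frame_limit hL hw0 hkappa hII hframe hS wta wtc wtn cR i.
have ca i := let: And3 h _ _ := cF i in h.
have cc i := let: And3 _ h _ := cF i in h.
have cn i := let: And3 _ _ h := cF i in h.
have cpt := cv2_shift ht (cl 0 0); have cqt := cv2_shift ht cq.
have crt := cv2_shift ht (cl 0 1); have cst_ := cv2_shift ht (cH 1 1).
have cI i k : {within `[0, L], continuous (fun t => II_mid II t i k)}.
  by apply: II_mid_cont; [exact: hw0|exact: hII].
have cwt : (fun n => w' (t n)) @ \oo --> (0 : R) by exact: cvg_subseq ht cw'.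
split.
  move=> x hx.
  have := blowup_det hL (kappa_cont hkappa) (@cI 0 0) (@cI 0 1) (@cI 1 1)
    (@d_SO3 _ _ _ _ _ _ _ hframe _ hC) (fun n => hw' (t n)) (fun n => hS (t n)) (fun n => wta (t n)) (fun n => wtc (t n))
    (fun n => wfa (t n)) (fun n => wfc (t n)) cpt cqt crt cst_ ca cc cn hx.
  by move=> D; rewrite det2 (sym _ hx) -expr2 D subrr.
have [reg1 reg2 reg3] := limit_curve_regular hL hw0 hkappa hII hframe hC.
have G := grad_cvg hL hw0 hkappa hII hframe hC (fun n => hw' (t n)) cwt (fun n => hk' (t n)) (fun n => hg (t n)) ca cc cn cpt cqt crt cst_.
have [v F] := immersion_cvg hL hw0 hkappa hII hframe hC (fun n => hw' (t n)) cwt (fun n => hk' (t n)) (fun n => hg (t n)) ca cc cn cpt cqt crt cst_.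
(* The extraction of [t] is composed with the initial shift; the frame comes from one and the same
   rotation [C] for all three limits. *)
exists (fun n => t0 (t n)), v, (limit_curve e1 C), (d1 e1 C), (d2 e2 C), (d3 e3 C); split => //.
  by move=> m n mn; apply: ht0; exact: ht.
split => // i j; apply: (sobolev_cvg0 mS); exact: (cv2_shift ht (cH i j)).
Qed.
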